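(* Let $q\in L_2(0,\pi)$ be real-valued, let $0<a<\pi$ and $\alpha>0$ with $a(1+\alpha)>\pi\alpha$, and let $\rho(x)=1$ for $0\le x\le a$, $\rho(x)=\alpha^2$ for $a<x\le\pi$. Consider the boundary value problem $$-y''+q(x)y=\lambda^2\rho(x)y,\quad 0\le x\le\pi,\qquad y'(0)=y(\pi)=0.$$ Let $\varphi(x,\lambda)$ be the solution of the equation with $\varphi(0,\lambda)=1$, $\varphi'(0,\lambda)=0$, represented as $$\varphi(x,\lambda)=\varphi_0(x,\lambda)+\int_0^{\mu^+(x)}A(x,t)\cos\lambda t\,dt,$$ where $$\mu^{\pm}(x)=\pm x\sqrt{\rho(x)}+a\bigl(1\mp\sqrt{\rho(x)}\bigr),\qquad \varphi_0(x,\lambda)=\tfrac12\Bigl(1+\tfrac{1}{\sqrt{\rho(x)}}\Bigr)\cos\lambda\mu^+(x)+\tfrac12\Bigl(1-\tfrac{1}{\sqrt{\rho(x)}}\Bigr)\cos\lambda\mu^-(x),$$ and $A(x,\cdot)$ is the kernel of this representation (belonging to $L_{2,\rho}(0,\pi)$ for each fixed $x$). Let $\lambda_n^2$ ($\lambda_n\ge 0$, $n\ge1$) be the eigenvalues of the problem, i.e. $\lambda_n$ are the roots of $\varphi(\pi,\lambda)=0$, and $\alpha_n=\int_0^\pi\rho(x)\varphi^2(x,\lambda_n)\,dx$ the norming constants; let $(\lambda_n^0)^2$ and $\alpha_n^0$ be the eigenvalues and norming constants of the same problem with $q\equiv0$. Define $$F_0(x,t)=\sum_{n=1}^\infty\left(\frac{\varphi_0(t,\lambda_n)\cos\lambda_n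 x}{\alpha_n}-\frac{\varphi_0(t,\lambda_n^0)\cos\lambda_n^0 x}{\alpha_n^0}\right),$$ $$F(x,t)=\tfrac12\Bigl(1+\tfrac{1}{\sqrt{\rho(x)}}\Bigr)F_0(\mu^+(x),t)+\tfrac12\Bigl(1-\tfrac{1}{\sqrt{\rho(x)}}\Bigr)F_0(\mu^-(x),t).$$ Then for each fixed $x\in[0,\pi]$ the kernel $A(x,t)$ satisfies the linear functional integral equation $$\frac{2}{1+\sqrt{\rho(t)}}A\bigl(x,\mu^+(t)\bigr)+\frac{1-\sqrt{\rho(2a-t)}}{1+\sqrt{\rho(2a-t)}}A(x,2a-t)+F(x,t)+\int_0^{\mu^+(x)}A(x,\xi)F_0(\xi,t)\,d\xi=0,\qquad 0<t<x.$$
   Context: $L_{2,\rho}(0,\pi)$ denotes the space of square-integrable functions on $(0,\pi)$ with weight $\rho$, i.e. with norm $\bigl(\int_0^\pi\rho(t)|f(t)|^2dt\bigr)^{1/2}$. The kernel $A(x,t)$ in the transformation-operator representation of $\varphi$ is related to $q$ by $\frac{d}{dx}A(x,\mu^+(x))=\frac{1}{4\sqrt{\rho(x)}}\bigl(1+\frac{1}{\sqrt{\rho(x)}}\bigr)q(x)$, and $\varphi_0(x,\lambda)$ is the solution in the case $q\equiv0$. *)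

(* Defs.v *)
From HB Require Import structures.
From mathcomp Require Import all_boot all_order all_algebra.
From mathcomp Require Import all_classical all_reals all_analysis.
Set Implicit Arguments. Unset Strict Implicit. Unset Printing Implicit Defensive.
Import Order.TTheory GRing.Theory Num.Theory.
Local Open Scope classical_set_scope.
Local Open Scope ring_scope.

Section Defs.
Variable R : realType.
Implicit Types (a al x t l mu : R).

Definition rho a al x : R := if x <= a then 1 else al ^+ 2.
Definition srho a al x : R := Num.sqrt (rho a al x).

Definition mu_plus a al x : R := x * srho a al x + a * (1 - srho a al x).
Definition mu_minus a al x : R := - x * srho a al x + a * (1 + srho a al x).

Definition phi0 a al x l : R :=
  2^-1 * (1 + (srho a al x)^-1) * cos (l * mu_plus a al x)
  + 2^-1 * (1 - (srho a al x)^-1) * cos (l * mu_minus a al x).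

Definition lintegral_ab (b c : R) (f : R -> R) : R :=
  Rintegral (@lebesgue_measure R) `[b, c] f.

(* Caratheodory solution on [0,pi] of -y'' + q y = mu rho y, with y1 = y' :
   y, y' absolutely continuous, y'' = (q - mu rho) y a.e. *)
Definition is_sol (q : R -> R) a al mu (y y1 : R -> R) : Prop :=
  (@lebesgue_measure R).-integrable `[0, pi] (fun s => (y1 s)%:E) /\
  (@lebesgue_measure R).-integrable `[0, pi]
     (fun s => ((q s - mu * rho a al s) * y s)%:E) /\
  forall x, 0 <= x <= pi ->
    y x = y 0 + lintegral_ab 0 x y1 /\
    y1 x = y1 0 + lintegral_ab 0 x (fun s => (q s - mu * rho a al s) * y s).

Definition is_eigenvalue (q : R -> R) a al mu : Prop :=
  exists y y1 : R -> R, is_sol q a al mu y y1 /\ y1 0 = 0 /\ y pi = 0 /\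
    exists x, 0 <= x <= pi /\ y x != 0.

End Defs.

(* Main.v *)
(* In [L_{2,rho}] the representation of [phi] reads [phi(s,l) = phi0(s,l) + <K_s, phi0(.,l)>], where
   [K_s(t)] is the sum of the two [A]-terms of the equation and vanishes for [t > s]. Using the
   representation at [x], the left-hand side of the equation becomes the limit [R(t)] of
     [K_x(t) + sum_(n < N) (phi(x,lam_n) phi0(t,lam_n) / alpha_n - phi(x,lam0_n) phi0(t,lam0_n) / alpha0_n)].
   Let [V h (s) = <K_s, h>]. The operator [1 + V] turns [phi0(t,.)] into [phi(t,.)] in both sums. Test the
   result against a smooth [f] supported in [(0,x)]: by the eigenfunction expansion of the perturbed
   problem the first sum tends to [f(x) = 0]; by Parseval's identity of the unperturbed problem the
   second one cancels [K_x + V K_x], up to series that vanish because [f(x) = 0] and [V] is triangular.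
   Hence [R + V R = 0] almost everywhere on [(0,x)], and Gronwall's inequality for the triangular [V]
   gives [R = 0].

   The convergence of the series, almost everywhere and in [L2] of every affine image of the variable,
   rests on [lam_n - lam0_n = O(1/n)] and [1/alpha_n - 1/alpha0_n = O(1/n)], on a Bessel inequality for
   the separated frequencies [lam0_n], and on passing to the subsequence of cubes. That the [n]-th
   eigenvalues correspond to each other follows from the completeness of the two orthogonal systems:
   their elements are close in the square-summable sense, which excludes an index shift. *)
Require Import Defs.
From HB Require Import structures.
From mathcomp Require Import all_boot all_order all_algebra.
From mathcomp Require Import all_classical all_reals all_analysis.
From mathcomp Require Import measurable_realfun.
From mathcomp Require Import ring lra zify.
Set Implicit Arguments. Unset Strict Implicit. Unset Printing Implicit Defensive.
Import Order.TTheory GRing.Theory Num.Theory numFieldNormedType.Exports.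
Local Open Scope classical_set_scope.
Local Open Scope ring_scope.

(** * Integrals over compact intervals *)

(** The kernel is square integrable for each fixed [x], and no joint measurability in [x] and [t] is
    given, so Fubini's theorem cannot be applied to [V]. All facts about [V] are therefore read off
    the functions [phi0(., lam0_n)], on which it acts explicitly: uniform bounds, measurability of
    [V h] and the transpose of [V] come from the unperturbed expansion. Completeness is proved
    without compact operators: a lower bound of the operator on the domain vectors orthogonal to all
    eigenfunctions can always be raised by means of its bounded resolvent, and the best such bound
    would be attained. Cubes are the right subsequence because a series with coefficients of size
    [1/n] has L2 norm [O(j^-2)] on the block from [j^3] to [(j+1)^3], which is summable, while the
    absolute values of the terms in that block add up to [O(1/j)]. The condition on [a] and [al]
    says [mu_minus pi > 0]: the reflection [u -> 2 a - u] sends the part of the kernel beyond [a]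
    into [[0, a]], where the second [A]-term compensates the reflected wave of [phi0]. *)

Section Integral.
Context {R : realType}.
Implicit Types (b c d x : R) (f g h : R -> R).
Notation mu := (@lebesgue_measure R).
Notation I := (@lintegral_ab R).

Definition Mf b c f := measurable_fun `[b, c] f.
Definition L1 b c f := mu.-integrable `[b, c] (fun x => (f x)%:E).
(** Measurability is a separate conjunct because it does not follow from that of the square. *)
Definition L2 b c f := Mf b c f /\ L1 b c (fun x => f x ^+ 2).
(** Boundedness holds at every point, not only almost everywhere. This class is closed under
    products and multiplies [L1] and [L2] into themselves. *)
Definition BM b c f :=
  Mf b c f /\ exists M, forall x, b <= x <= c -> `|f x| <= M.

Lemma in_ccE b c x : (x \in `[b, c]%classic) = (b <= x <= c).
Proof. by apply/idP/idP => [/set_mem /=|h]; rewrite ?in_itv // inE /= in_itv. Qed.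

Lemma ccE b c x : `[b, c]%classic x = (b <= x <= c) :> Prop.
Proof. by rewrite /= in_itv. Qed.

Lemma L1_Mf b c f : L1 b c f -> Mf b c f.
Proof. by move=> /integrableP[/measurable_EFinP]. Qed.

Lemma Mf_sub b c b' c' f : b <= b' -> c' <= c -> Mf b c f -> Mf b' c' f.
Proof.
move=> bb cc; apply: measurable_funS => // x; rewrite !ccE => /andP[h1 h2].
by rewrite (le_trans bb) // (le_trans h2).
Qed.

Lemma L1_sub b c b' c' f : b <= b' -> c' <= c -> L1 b c f -> L1 b' c' f.
Proof.
move=> bb cc; apply: integrableS => // x; rewrite !ccE => /andP[h1 h2].
by rewrite (le_trans bb) // (le_trans h2).
Qed.

Lemma BM_sub b c b' c' f : b <= b' -> c' <= c -> BM b c f -> BM b' c' f.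
Proof.
move=> bb cc [mf [M hM]]; split; first exact: Mf_sub mf.
by exists M => x /andP[h1 h2]; apply: hM; rewrite (le_trans bb) // (le_trans h2).
Qed.

Lemma L2_sub b c b' c' f : b <= b' -> c' <= c -> L2 b c f -> L2 b' c' f.
Proof. by move=> bb cc [mf h]; split; [exact: Mf_sub mf | exact: L1_sub h]. Qed.

Lemma Mf_ext b c f g : (forall x, b <= x <= c -> f x = g x) -> Mf b c f -> Mf b c g.
Proof.
move=> fg; apply: eq_measurable_fun => x; rewrite in_ccE; exact: fg.
Qed.

Lemma L1_ext b c f g : (forall x, b <= x <= c -> f x = g x) -> L1 b c f -> L1 b c g.
Proof.
by move=> fg; apply: eq_integrable => // x; rewrite in_ccE => /fg ->.
Qed.

Lemma L2_ext b c f g : (forall x, b <= x <= c -> f x = g x) -> L2 b c f -> L2 b c g.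
Proof.
move=> fg [mf h]; split; first exact: Mf_ext mf.
by apply: L1_ext h => x /fg ->.
Qed.

Lemma BM_ext b c f g : (forall x, b <= x <= c -> f x = g x) -> BM b c f -> BM b c g.
Proof.
move=> fg [mf [M hM]]; split; first exact: Mf_ext mf.
by exists M => x h; rewrite -fg // hM.
Qed.

Lemma L1D b c f g : L1 b c f -> L1 b c g -> L1 b c (fun x => f x + g x).
Proof. by move=> h1 h2; exact: (integrableD _ h1 h2). Qed.

Lemma L1B b c f g : L1 b c f -> L1 b c g -> L1 b c (fun x => f x - g x).
Proof. by move=> h1 h2; exact: (integrableB _ h1 h2). Qed.

Lemma L1Z b c k f : L1 b c f -> L1 b c (fun x => k * f x).
Proof. by move=> h; exact: (integrableZl _ k h). Qed.

Lemma L1N b c f : L1 b c f -> L1 b c (fun x => - f x).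
Proof. by move=> h; exact: (integrableN h). Qed.

Lemma L1_abs b c f : L1 b c f -> L1 b c (fun x => `|f x|).
Proof. by move=> h; exact: (integrable_abse h). Qed.

Lemma mu_cc b c : (mu `[b, c] < +oo)%E.
Proof. by rewrite lebesgue_measure_itv /=; case: ifP => // _; rewrite -EFinB ltry. Qed.

Lemma BM_L1 b c f : BM b c f -> L1 b c f.
Proof.
move=> [mf [M hM]]; apply: measurable_bounded_integrable => //; first exact: mu_cc.
exists M; split; first exact: num_real.
move=> z Mz x; rewrite ccE => h; exact: (le_trans (hM _ h) (ltW Mz)).
Qed.

Lemma L1_le b c f g : Mf b c f -> L1 b c g ->
  (forall x, b <= x <= c -> `|f x| <= g x) -> L1 b c f.
Proof.
move=> mf ig fg; apply: (le_integrable _ _ _ ig) => //; first exact/measurable_EFinP.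
move=> x; rewrite ccE => h /=; rewrite lee_fin.
by rewrite (le_trans (fg _ h)) // ler_norm.
Qed.

Lemma MfM b c f g : Mf b c f -> Mf b c g -> Mf b c (fun x => f x * g x).
Proof. exact: measurable_funM. Qed.
Lemma MfD b c f g : Mf b c f -> Mf b c g -> Mf b c (fun x => f x + g x).
Proof. exact: measurable_funD. Qed.
Lemma MfB b c f g : Mf b c f -> Mf b c g -> Mf b c (fun x => f x - g x).
Proof. exact: measurable_funB. Qed.
Lemma MfZ b c k f : Mf b c f -> Mf b c (fun x => k * f x).
Proof. by move=> mf; apply: MfM => //; exact: measurable_cst. Qed.
Lemma MfX b c f n : Mf b c f -> Mf b c (fun x => f x ^+ n).
Proof. exact: measurable_funX. Qed.
Lemma Mf_abs b c f : Mf b c f -> Mf b c (fun x => `|f x|).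
Proof. by move=> mf; apply: measurableT_comp => //; exact: normr_measurable. Qed.

Lemma BMM b c f g : BM b c f -> BM b c g -> BM b c (fun x => f x * g x).
Proof.
move=> [mf [M hM]] [mg [N hN]]; split; first exact: MfM.
exists (M * N) => x h; rewrite normrM ler_pM //; [exact: hM|exact: hN].
Qed.
Lemma BMD b c f g : BM b c f -> BM b c g -> BM b c (fun x => f x + g x).
Proof.
move=> [mf [M hM]] [mg [N hN]]; split; first exact: MfD.
exists (M + N) => x h; rewrite (le_trans (ler_normD _ _)) // lerD //; [exact: hM|exact: hN].
Qed.
Lemma BM_cst b c k : BM b c (fun _ => k).
Proof. by split; [exact: measurable_cst | exists `|k|]. Qed.
Lemma BMZ b c k f : BM b c f -> BM b c (fun x => k * f x).
Proof. by move=> h; apply: BMM => //; exact: BM_cst. Qed.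
Lemma BMB b c f g : BM b c f -> BM b c g -> BM b c (fun x => f x - g x).
Proof.
move=> hf /(BMZ (-1)) hg; apply: BM_ext (BMD hf hg) => x _ /=; ring.
Qed.
Lemma BMX b c f n : BM b c f -> BM b c (fun x => f x ^+ n).
Proof.
move=> hf; elim: n => [|n IH]; first exact: BM_cst.
by apply: BM_ext (BMM hf IH) => x _; rewrite exprS.
Qed.

Lemma BM_L2 b c f : BM b c f -> L2 b c f.
Proof. by move=> hf; split; [case: hf | exact/BM_L1/BMX]. Qed.

Lemma L1_BM b c f g : L1 b c f -> BM b c g -> L1 b c (fun x => f x * g x).
Proof.
move=> hf [mg [M hM]].
have M0 x : b <= x <= c -> 0 <= M by move=> h; exact: le_trans (hM _ h).
apply: (@L1_le _ _ _ (fun x => M * `|f x|)).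
- exact: MfM (L1_Mf hf) mg.
- exact/L1Z/L1_abs.
- by move=> x h; rewrite normrM mulrC ler_wpM2r // hM.
Qed.

Lemma BM_L1M b c f g : BM b c f -> L1 b c g -> L1 b c (fun x => f x * g x).
Proof. by move=> h1 h2; apply: L1_ext (L1_BM h2 h1) => x _; rewrite mulrC. Qed.

Lemma L2M b c f g : L2 b c f -> L2 b c g -> L1 b c (fun x => f x * g x).
Proof.
move=> [mf hf] [mg hg].
apply: (@L1_le _ _ _ (fun x => f x ^+ 2 + g x ^+ 2)); [exact: MfM| exact: L1D|].
move=> x _; rewrite ler_norml; apply/andP; split; nra.
Qed.

Lemma L2_L1 b c f : L2 b c f -> L1 b c f.
Proof.
move=> hf; apply: L1_ext (L2M hf (BM_L2 (BM_cst b c 1))) => x _.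
by rewrite mulr1.
Qed.

Lemma L2Z b c k f : L2 b c f -> L2 b c (fun x => k * f x).
Proof.
move=> [mf hf]; split; first exact: MfZ.
by apply: L1_ext (L1Z (k ^+ 2) hf) => x _; rewrite exprMn.
Qed.
Lemma L2D b c f g : L2 b c f -> L2 b c g -> L2 b c (fun x => f x + g x).
Proof.
move=> hf hg; split; first exact: MfD hf.1 hg.1.
apply: L1_ext (L1D (L1D hf.2 hg.2) (L1Z 2 (L2M hf hg))).
by move=> x _; ring.
Qed.
Lemma L2B b c f g : L2 b c f -> L2 b c g -> L2 b c (fun x => f x - g x).
Proof.
move=> hf /(L2Z (-1)) hg; apply: L2_ext (L2D hf hg) => x _; ring.
Qed.
Lemma L2_BM b c f g : L2 b c f -> BM b c g -> L2 b c (fun x => f x * g x).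
Proof.
move=> hf hg; split; first exact: MfM hf.1 hg.1.
apply: L1_ext (L1_BM hf.2 (BMX 2 hg)) => x _; by rewrite exprMn.
Qed.
Lemma L2_sum b c (F : nat -> R -> R) m n : (forall i, L2 b c (F i)) ->
  L2 b c (fun x => \sum_(m <= i < n) F i x).
Proof.
move=> hF; elim: n => [|n IH].
  by apply: L2_ext (BM_L2 (BM_cst b c 0)) => x _; rewrite big_geq.
have [mn|nm] := leqP m n.
  by apply: L2_ext (L2D IH (hF n)) => x _; rewrite big_nat_recr.
by apply: L2_ext (BM_L2 (BM_cst b c 0)) => x _; rewrite big_geq.
Qed.

Lemma I_ext b c f g : (forall x, b <= x <= c -> f x = g x) -> I b c f = I b c g.
Proof. by move=> fg; apply: eq_Rintegral => x; rewrite in_ccE; exact: fg. Qed.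
Lemma ID b c f g : L1 b c f -> L1 b c g -> I b c (fun x => f x + g x) = I b c f + I b c g.
Proof. by move=> hf hg; rewrite /lintegral_ab RintegralD. Qed.
Lemma IB b c f g : L1 b c f -> L1 b c g -> I b c (fun x => f x - g x) = I b c f - I b c g.
Proof. by move=> hf hg; rewrite /lintegral_ab RintegralB. Qed.
Lemma IZ b c k f : L1 b c f -> I b c (fun x => k * f x) = k * I b c f.
Proof. by move=> hf; rewrite /lintegral_ab RintegralZl. Qed.
Lemma I_le b c f g : L1 b c f -> L1 b c g ->
  (forall x, b <= x <= c -> f x <= g x) -> I b c f <= I b c g.
Proof.
by move=> hf hg fg; apply: le_Rintegral => // x; rewrite ccE; exact: fg.
Qed.
Lemma I_ge0 b c f : (forall x, b <= x <= c -> 0 <= f x) -> 0 <= I b c f.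
Proof. by move=> h; apply: Rintegral_ge0 => x; rewrite ccE; exact: h. Qed.
Lemma I_cst b c k : b <= c -> I b c (fun _ => k) = k * (c - b).
Proof.
move=> bc; rewrite /lintegral_ab Rintegral_cst //; congr (_ * _).
have := lebesgue_measure_itv `[b, c]; rewrite /= lte_fin => ->.
case: ltP => [|cb] //=.
by have -> : c = b; [apply/le_anti; rewrite bc cb|rewrite subrr].
Qed.
Lemma I_abs b c f : L1 b c f -> `|I b c f| <= I b c (fun x => `|f x|).
Proof. by move=> hf; apply: le_normr_Rintegral. Qed.
Lemma I_same b f : I b b f = 0.
Proof. by rewrite /lintegral_ab set_itv1 Rintegral_set1. Qed.

Lemma I_split b c d f : b <= c -> c <= d -> L1 b d f -> I b d f = I b c f + I c d f.
Proof.
move=> bc cd hf; apply/eqP; rewrite addrC -subr_eq; apply/eqP.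
rewrite /lintegral_ab Rintegral_itvB ?bnd_simp //.
rewrite Rintegral_itv_obnd_cbnd //.
apply: integrableS hf => // x /=; rewrite !in_itv /= => /andP[h1 h2].
by rewrite h2 andbT (le_trans bc) // ltW.
Qed.

Lemma I_absM b c f M : b <= c -> L1 b c f -> (forall x, b <= x <= c -> `|f x| <= M) ->
  `|I b c f| <= M * (c - b).
Proof.
move=> bc hf hM; rewrite (le_trans (I_abs hf)) // -I_cst //.
by apply: I_le => //; [exact: L1_abs | exact/BM_L1/BM_cst].
Qed.

Lemma I_mono b c d f : b <= c -> c <= d -> L1 b d f ->
  (forall x, b <= x <= d -> 0 <= f x) -> I b c f <= I b d f.
Proof.
move=> bc cd hf f0; rewrite (I_split bc cd hf) lerDl; apply: I_ge0 => x /andP[h1 h2].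
by apply: f0; rewrite h2 andbT (le_trans bc).
Qed.

Lemma I_sum b c (F : nat -> R -> R) m n : (forall i, L1 b c (F i)) ->
  L1 b c (fun x => \sum_(m <= i < n) F i x) /\
  I b c (fun x => \sum_(m <= i < n) F i x) = \sum_(m <= i < n) I b c (F i).
Proof.
move=> hF; have h0 : L1 b c (fun _ => 0) by exact/BM_L1/BM_cst.
have i0 : I b c (fun _ => 0) = 0 by rewrite /lintegral_ab Rintegral_cst // mul0r.
elim: n => [|n [IH1 IH2]].
  by split; [apply: L1_ext h0 => x _|rewrite [RHS]big_geq // -[RHS]i0; apply: I_ext => x _];
     rewrite big_geq.
have [mn|nm] := leqP m n; last first.
  by split; [apply: L1_ext h0 => x _|rewrite [RHS]big_geq // -[RHS]i0; apply: I_ext => x _];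
     rewrite big_geq.
split; first by apply: L1_ext (L1D IH1 (hF n)) => x _; rewrite big_nat_recr.
rewrite [RHS]big_nat_recr //= -IH2 -ID //; apply: I_ext => x _; by rewrite big_nat_recr.
Qed.

End Integral.

(** * Absolutely continuous functions *)

Section AbsCont.
Context {R : realType}.
Implicit Types (b c d x y : R) (f g h : R -> R).
Notation I := (@lintegral_ab R).

(** Absolute continuity is carried by the pair of a function and an integrable density. The density
    is not a pointwise derivative and may be changed on a null set. *)
Definition AC b c f f' := L1 b c f' /\ forall x, b <= x <= c -> f x = f b + I b x f'.

Lemma AC_ext b c f f' g g' : (forall x, b <= x <= c -> f x = g x) ->
  (forall x, b <= x <= c -> f' x = g' x) -> AC b c f f' -> AC b c g g'.
Proof.
move=> fg fg' [h1 h2]; split; first exact: L1_ext h1.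
move=> x xbc; have bc : b <= b <= c by case/andP: xbc => xb xc; rewrite lexx (le_trans xb).
rewrite -fg // -fg // h2 //; congr (_ + _); apply: I_ext => t /andP[bt tx]; apply: fg'.
by rewrite bt (le_trans tx) //; case/andP: xbc.
Qed.

Lemma AC_incr b c f f' x y : AC b c f f' -> b <= x -> x <= y -> y <= c ->
  f y - f x = I x y f'.
Proof.
move=> [h1 h2] bx xy yc; rewrite (h2 y) ?(le_trans bx) // (h2 x) ?bx ?(le_trans xy) //.
rewrite (I_split bx xy); last exact: L1_sub h1.
ring.
Qed.

Lemma AC_sub b c b' c' f f' : b <= b' -> c' <= c -> AC b c f f' -> AC b' c' f f'.
Proof.
move=> bb cc h; split; first exact: L1_sub h.1.
move=> x /andP[bx xc]; apply/eqP; rewrite addrC -subr_eq; apply/eqP.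
by apply: AC_incr h _ _ _ => //; apply: le_trans cc.
Qed.

Lemma AC_cont b c f f' : b <= c -> AC b c f f' -> {within `[b, c], continuous f}.
Proof.
move=> bc [h1 h2].
have : {within `[b, c], continuous (fun x => f b + I b x f')}.
  move=> x; apply: cvgD; first exact: cvg_cst.
  exact: (parameterized_integral_continuous bc h1).
by apply: subspace_eq_continuous => x; rewrite in_ccE => /h2.
Qed.

Lemma cont_Mf b c f : {within `[b, c], continuous f} -> Mf b c f.
Proof. by move=> h; apply: subspace_continuous_measurable_fun. Qed.

Lemma AC_BM b c f f' : b <= c -> AC b c f f' -> BM b c f.
Proof.
move=> bc h; split; first exact: (cont_Mf (AC_cont bc h)).
exists (`|f b| + I b c (fun x => `|f' x|)) => x /andP[bx xc].
rewrite h.2 ?bx // (le_trans (ler_normD _ _)) // lerD2l.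
have hs : L1 b x f' by apply: L1_sub h.1.
rewrite (le_trans (I_abs hs)) // I_mono //; exact: L1_abs h.1.
Qed.

Lemma AC_D b c f f' g g' : AC b c f f' -> AC b c g g' ->
  AC b c (fun x => f x + g x) (fun x => f' x + g' x).
Proof.
move=> hf hg; split; first exact: L1D hf.1 hg.1.
move=> x xbc; case/andP: (xbc) => bx xc.
by rewrite ID ?(hf.2 x) ?(hg.2 x) //; [ring| apply: L1_sub hf.1|apply: L1_sub hg.1].
Qed.

Lemma AC_Z b c k f f' : AC b c f f' -> AC b c (fun x => k * f x) (fun x => k * f' x).
Proof.
move=> hf; split; first exact: L1Z hf.1.
move=> x xbc; case/andP: (xbc) => bx xc.
by rewrite IZ ?(hf.2 x) //; [ring| apply: L1_sub hf.1].
Qed.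

Lemma AC_B b c f f' g g' : AC b c f f' -> AC b c g g' ->
  AC b c (fun x => f x - g x) (fun x => f' x - g' x).
Proof.
move=> hf /(AC_Z (-1)) hg; apply: AC_ext (AC_D hf hg) => x _ /=; ring.
Qed.

Lemma AC_cst b c k : AC b c (fun _ => k) (fun _ => 0).
Proof.
split; first exact/BM_L1/BM_cst.
by move=> x /andP[bx _]; rewrite I_cst // mul0r addr0.
Qed.

Lemma AC_sum b c (F F' : nat -> R -> R) m n : (forall i, AC b c (F i) (F' i)) ->
  AC b c (fun x => \sum_(m <= i < n) F i x) (fun x => \sum_(m <= i < n) F' i x).
Proof.
move=> hF; elim: n => [|n IH].
  by apply: AC_ext (AC_cst b c 0) => x _; rewrite big_geq.
have [mn|nm] := leqP m n.
  by apply: AC_ext (AC_D IH (hF n)) => x _; rewrite big_nat_recr.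
by apply: AC_ext (AC_cst b c 0) => x _; rewrite big_geq.
Qed.

Lemma le_pow2_le0 (x C : R) : (forall k : nat, x <= C / 2 ^+ k) -> x <= 0.
Proof.
move=> h; rewrite leNgt; apply/negP => x0.
have C0 : 0 < C by have := h 0%N; rewrite expr0 divr1; exact: lt_le_trans.
have Cx : 0 <= C / x by rewrite divr_ge0 // ltW.
have := archi_boundP Cx; set n := Num.bound _ => hn.
have := h n; rewrite ler_pdivlMr ?exprn_gt0 // leNgt => /negP; apply.
rewrite mulrC -ltr_pdivrMr // (lt_le_trans hn) // -natrX ler_nat.
exact/ltnW/ltn_expl.
Qed.

(* Increments of [H] are quadratically small with respect to [Phi]; halving [Phi]
   repeatedly shows that they vanish. *)
Lemma quadratic_increments_const b c (H Phi : R -> R) : b <= c ->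
  {within `[b, c], continuous Phi} ->
  (forall x y, b <= x -> x <= y -> y <= c -> Phi x <= Phi y) ->
  (forall x y, b <= x -> x <= y -> y <= c -> `|H y - H x| <= (Phi y - Phi x) ^+ 2) ->
  H c = H b.
Proof.
move=> bc cP mP hH.
have key k x y : b <= x -> x <= y -> y <= c ->
    `|H y - H x| <= (Phi y - Phi x) ^+ 2 / 2 ^+ k.
  elim: k x y => [|k IH] x y bx xy yc; first by rewrite expr0 divr1 hH.
  have cP' : {within `[x, y], continuous Phi}.
    by apply: continuous_subspaceW cP => z /=; rewrite !in_itv /= => /andP[h1 h2]; rewrite (le_trans bx) // (le_trans h2).
  have Pxy := mP _ _ bx xy yc.
  (* The point [m] halves the increment of [Phi], so the two squares add up to half of the original
     square. *)
  have [|m] := @IVT _ Phi x y ((Phi x + Phi y) / 2) xy cP'.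
    by rewrite min_l // max_r //; apply/andP; split; lra.
  rewrite in_itv /= => /andP[xm my] Pm.
  have h1 := IH x m bx xm (le_trans my yc).
  have h2 := IH m y (le_trans bx xm) my yc.
  have -> : H y - H x = (H m - H x) + (H y - H m) by ring.
  apply: le_trans (ler_normD _ _) _; apply: le_trans (lerD h1 h2) _.
  rewrite Pm -mulrDl (exprS 2) le_eqVlt; apply/orP; left; apply/eqP.
  have : (2 : R) ^+ k != 0 by rewrite expf_neq0.
  by move: (2 ^+ k) => p p0; field.
suff : `|H c - H b| <= 0 by rewrite normr_le0 subr_eq0 => /eqP.
by apply: (@le_pow2_le0 _ ((Phi c - Phi b) ^+ 2)) => k; exact: key.
Qed.

(** Product rule without Fubini's theorem or smoothing. The increment over [[u, v]] of [f * g] minus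
    the integral of the candidate density is the integral of [f' * (g u - g) + (f v - f) * g']. It
    is at most the square of the increment of [Phi], the integral of [|f'| + |g'|], so the
    difference is constant. *)
Lemma AC_mul b c f f' g g' : AC b c f f' -> AC b c g g' ->
  AC b c (fun x => f x * g x) (fun x => f' x * g x + f x * g' x).
Proof.
move=> hf hg.
have hL : b <= c -> L1 b c (fun x => f' x * g x + f x * g' x).
  move=> bc; apply: L1D; [exact: L1_BM hf.1 (AC_BM bc hg)|exact: BM_L1M (AC_BM bc hf) hg.1].
split.
  have [bc|cb] := leP b c; first exact: hL.
  rewrite /L1 set_itv_ge ?bnd_simp -?ltNge //; exact: integrable_set0.
move=> x /andP[bx xc]; have bc := le_trans bx xc.
pose p t := `|f' t| + `|g' t|; pose Phi t := I b t p.
have hp : L1 b c p by apply: L1D; apply: L1_abs; [exact: hf.1|exact: hg.1].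
have hP : AC b c Phi p by split => // t _; rewrite /Phi I_same add0r.
pose H t := f t * g t - I b t (fun x => f' x * g x + f x * g' x).
suff : H x = H b by rewrite /H I_same subr0 => <-; rewrite subrK.
apply: (@quadratic_increments_const b x H Phi bx).
- exact: AC_cont (AC_sub (lexx b) xc hP).
- move=> u v bu uv vx; rewrite -subr_ge0 (AC_incr hP) ?(le_trans vx) //.
  by apply: I_ge0 => t _; rewrite addr_ge0.
move=> u v bu uv vx; have vc := le_trans vx xc.
have sub h : L1 b c h -> L1 u v h by exact: L1_sub.
have hfu := sub _ hf.1; have hgu := sub _ hg.1.
have bf := BM_sub bu vc (AC_BM bc hf); have bg := BM_sub bu vc (AC_BM bc hg).
have -> : H v - H u = I u v (fun s => f' s * (g u - g s) + (f v - f s) * g' s).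
  have -> : H v - H u = f v * (g v - g u) + (f v - f u) * g u
     - (I b v (fun x => f' x * g x + f x * g' x) - I b u (fun x => f' x * g x + f x * g' x)).
    by rewrite /H; ring.
  rewrite (AC_incr hg) // (AC_incr hf) //.
  rewrite (@I_split _ b u v) //; last by apply: L1_sub (hL bc).
  rewrite (addrC (I b u _)) addrK -IZ // mulrC -IZ // -ID; [|exact: L1Z|exact: L1Z].
  rewrite -IB; last 2 first; [by apply: L1D; exact: L1Z|by apply: L1_sub (hL bc)|].
  by apply: I_ext => t _; ring.
have hi : L1 u v (fun s => f' s * (g u - g s) + (f v - f s) * g' s).
  apply: L1D; [apply: L1_BM => //|apply: BM_L1M => //];
  by apply: BMB => //; exact: BM_cst.
have pf : forall s t, u <= s -> s <= t -> t <= v -> `|f t - f s| <= Phi v - Phi u.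
  move=> s t us st tv; rewrite (AC_incr hf) ?(le_trans bu) ?(le_trans tv) //.
  rewrite (AC_incr hP) //.
  have h1 : L1 s t f' by apply: L1_sub hfu.
  apply: (le_trans (I_abs h1)).
  have h2 : L1 u v p by apply: sub.
  rewrite (I_split us (le_trans st tv) h2) -[leLHS]add0r lerD //.
    by apply: I_ge0 => z _; rewrite addr_ge0.
  have h3 : L1 s v p by apply: L1_sub h2.
  rewrite (I_split st tv h3) -[leLHS]addr0 lerD //.
    apply: I_le => [||z _]; [exact: L1_abs|exact: L1_sub h2|].
    by rewrite lerDl.
  by apply: I_ge0 => z _; rewrite addr_ge0.
have pg : forall s t, u <= s -> s <= t -> t <= v -> `|g t - g s| <= Phi v - Phi u.
  move=> s t us st tv; rewrite (AC_incr hg) ?(le_trans bu) ?(le_trans tv) //.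
  rewrite (AC_incr hP) //.
  have h1 : L1 s t g' by apply: L1_sub hgu.
  apply: (le_trans (I_abs h1)).
  have h2 : L1 u v p by apply: sub.
  rewrite (I_split us (le_trans st tv) h2) -[leLHS]add0r lerD //.
    by apply: I_ge0 => z _; rewrite addr_ge0.
  have h3 : L1 s v p by apply: L1_sub h2.
  rewrite (I_split st tv h3) -[leLHS]addr0 lerD //.
    apply: I_le => [||z _]; [exact: L1_abs|exact: L1_sub h2|].
    by rewrite lerDr.
  by apply: I_ge0 => z _; rewrite addr_ge0.
have h2 : L1 u v p by apply: sub.
apply: (le_trans (I_abs hi)).
rewrite expr2 [in X in _ <= _ * X](AC_incr hP) // -IZ //.
apply: I_le => [||s /andP[us sv]]; [exact: L1_abs|exact: L1Z|].
rewrite (le_trans (ler_normD _ _)) // !normrM [p s]/p mulrDr; apply: lerD.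
  by rewrite mulrC ler_wpM2r // distrC; apply: pg.
by rewrite ler_wpM2r //; apply: pf.
Qed.

Lemma AC_C1 b c f f' : (forall x, is_derive x 1 f (f' x)) -> continuous f' -> AC b c f f'.
Proof.
move=> df cf.
have df1 x : derivable f x 1 by exact: (@ex_derive _ _ _ _ _ _ _ (df x)).
have cf1 : continuous f by move=> x; exact/differentiable_continuous/derivable1_diffP.
have hf x y : {within `[x, y], continuous f'} by exact: continuous_subspaceT.
split; first by apply: continuous_compact_integrable => //; exact: segment_compact.
move=> x /andP[bx _]; move: bx; rewrite le_eqVlt => /predU1P[<-|bx].
  by rewrite I_same addr0.
rewrite /lintegral_ab /Rintegral (@continuous_FTC2 _ f' f) //=; first by ring.
  by split => //; [apply: cvg_at_right_filter|apply: cvg_at_left_filter]; exact: cf1.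
by move=> z _; rewrite derive1E; exact: derive_val.
Qed.

End AbsCont.

(** * Volterra equations and Gronwall's inequality *)

Section Volterra.
Context {R : realType}.
Implicit Types (b c d x y : R) (f g h : R -> R).
Notation I := (@lintegral_ab R).

Lemma quad_discr (A B C : R) : 0 <= C -> (forall t, 0 <= A - 2 * t * B + t ^+ 2 * C) ->
  B ^+ 2 <= A * C.
Proof.
move=> C0 h; have [C00|C1] := eqVneq C 0.
  rewrite C00 mulr0; have [->|B0] := eqVneq B 0; first by rewrite expr0n.
  (* For [C = 0] the form is affine in [t], and this value of [t] makes it equal to [-1]. *)
  have := h ((A + 1) / (2 * B)); rewrite C00 mulr0 addr0.
  have -> : 2 * ((A + 1) / (2 * B)) * B = A + 1 by field.
  by rewrite opprD addrA subrr add0r oppr_ge0 ler10.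
have C2 : 0 < C by rewrite lt_def C1.
have := h (B / C); have -> : A - 2 * (B / C) * B + (B / C) ^+ 2 * C = (A * C - B ^+ 2) / C.
  by field.
by rewrite pmulr_lge0 ?invr_gt0 // subr_ge0.
Qed.

Lemma CauchySchwarz b c (w f g : R -> R) : BM b c w -> (forall x, b <= x <= c -> 0 <= w x) ->
  L2 b c f -> L2 b c g ->
  (I b c (fun x => w x * f x * g x)) ^+ 2
    <= I b c (fun x => w x * f x ^+ 2) * I b c (fun x => w x * g x ^+ 2).
Proof.
move=> bw w0 hf hg; apply: quad_discr.
  by apply: I_ge0 => x /w0 h; rewrite mulr_ge0 // sqr_ge0.
move=> t.
have h1 : L1 b c (fun x => w x * f x ^+ 2) by exact: BM_L1M bw hf.2.
have h2 : L1 b c (fun x => w x * g x ^+ 2) by exact: BM_L1M bw hg.2.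
have h3 : L1 b c (fun x => w x * f x * g x).
  by apply: L1_ext (BM_L1M bw (L2M hf hg)) => x _; rewrite mulrA.
rewrite -IZ // -IZ // -IB //; last exact: L1Z.
rewrite -ID; [|by apply: L1B => //; exact: L1Z|exact: L1Z].
apply: I_ge0 => x /w0 wx; suff -> : w x * f x ^+ 2 - 2 * t * (w x * f x * g x) +
  t ^+ 2 * (w x * g x ^+ 2) = w x * (f x - t * g x) ^+ 2 by rewrite mulr_ge0 // sqr_ge0.
ring.
Qed.

Lemma CauchySchwarz1 b c f g : L2 b c f -> L2 b c g ->
  (I b c (fun x => f x * g x)) ^+ 2
    <= I b c (fun x => f x ^+ 2) * I b c (fun x => g x ^+ 2).
Proof.
move=> hf hg; have := @CauchySchwarz b c (fun _ => 1) f g (BM_cst _ _ _) (fun _ _ => ler01) hf hg.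
congr (_ ^+ 2 <= _ * _); apply: I_ext => x _; by rewrite mul1r.
Qed.

Lemma is_derive_affine (F F' : R -> R) (k d x : R) :
  (forall x, is_derive x 1 F (F' x)) ->
  is_derive x 1 (fun t => F (k * t + d)) (k * F' (k * x + d)).
Proof.
move=> dF; have h : is_derive x 1 (fun t => k * t + d) k.
  have -> : (fun t => k * t + d) = (k \*: id) + cst d by [].
  by apply: is_derive_eq; rewrite addr0 /GRing.scale /= mulr1.
have := @is_derive1_comp _ F (fun t => k * t + d) x (F' (k * x + d)) k (dF _) h.
move=> h'; apply: is_derive_eq h' _; by rewrite mulrC.
Qed.

Lemma I_exp b k x : 0 < k -> b <= x ->
  L1 b x (fun t => expR (k * (t - b))) /\
  I b x (fun t => expR (k * (t - b))) = (expR (k * (x - b)) - 1) / k.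
Proof.
move=> k0 bx.
have h : AC b x (fun t => k^-1 * expR (k * (t - b))) (fun t => expR (k * (t - b))).
  apply: AC_C1 => [t|].
    have H := @is_derive_affine expR expR k (- k * b) t (@is_derive_expR R).
    have -> : (fun t => k^-1 * expR (k * (t - b))) = (k^-1 \*: (fun t => expR (k * t + - k * b))).
      apply/funext => s; rewrite /GRing.scale /=; congr (_ * expR _); ring.
    apply: is_derive_eq; rewrite /GRing.scale /= mulrA mulVf ?gt_eqF // mul1r; congr expR; ring.
  move=> t; apply: continuous_comp; last exact: continuous_expR.
  by apply: cvgM; [exact: cvg_cst|apply: cvgB; [exact: cvg_id|exact: cvg_cst]].
split; first exact: h.1.
have := h.2 x; rewrite bx lexx => /(_ isT) /esym /eqP; rewrite addrC eq_sym -subr_eq => /eqP <-.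
by rewrite subrr mulr0 expR0; field; rewrite gt_eqF.
Qed.

(** Any bound of the form [S * expR (k * (x - b))] reproduces itself under the inequality with [S]
    replaced by [A + S / 2], since [B / k <= 1 / 2] for [k = 2 * B + 1]. Iterating from the trivial
    bound [M] leads to [2 * A]. Continuity of [u] is not involved. *)
Lemma Gronwall b c (u : R -> R) A B : 0 <= B -> 0 <= A -> BM b c u ->
  (forall x, b <= x <= c -> u x <= A + B * I b x u) ->
  forall x, b <= x <= c -> u x <= 2 * A * expR ((2 * B + 1) * (x - b)).
Proof.
move=> B0 A0 hu hI; pose k := 2 * B + 1; have k0 : 0 < k by rewrite /k; lra.
have [M [M0 hM]] : exists M, 0 <= M /\ forall x, b <= x <= c -> u x <= M.
  case: hu => _ [M hM]; exists `|M|; split => // x /hM h.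
  by rewrite (le_trans (ler_norm _)) // (le_trans h) // ler_norm.
have E1 x : b <= x -> 1 <= expR (k * (x - b)).
  by move=> bx; rewrite -expR0 ler_expR mulr_ge0 ?subr_ge0 // ltW.
have key (n : nat) x : b <= x <= c -> u x <= (2 * A + M / 2 ^+ n) * expR (k * (x - b)).
  elim: n x => [|n IH] x xbc; case/andP: (xbc) => bx xc.
    rewrite expr0 divr1 (le_trans (hM _ xbc)) // -[leLHS]mulr1 ler_pM //; last exact: E1.
    by lra.
  set S := 2 * A + M / 2 ^+ n in IH *.
  have S0 : 0 <= S by rewrite /S addr_ge0 ?mulr_ge0 ?invr_ge0 ?exprn_ge0.
  have [e1 e2] := I_exp k0 bx.
  have h1 : I b x u <= S * ((expR (k * (x - b)) - 1) / k).
    rewrite -e2 -IZ //; apply: I_le => [||t /andP[bt tx]].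
    - by apply: (@L1_sub _ b c) => //; exact: BM_L1.
    - exact: L1Z.
    - by apply: IH; rewrite bt (le_trans tx).
  apply: le_trans (hI _ xbc) _.
  have e := E1 _ bx; set E := expR _ in e h1 *.
  have -> : 2 * A + M / 2 ^+ n.+1 = A + S / 2.
    by rewrite /S exprS; field; rewrite expf_neq0.
  have Bk : B / k <= 1 / 2 by rewrite ler_pdivrMr // /k; lra.
  have Bk0 : 0 <= B / k by rewrite divr_ge0 // ltW.
  have : B * I b x u <= (B / k) * (S * (E - 1)).
    by rewrite (le_trans (ler_wpM2l B0 h1)) // le_eqVlt; apply/orP; left; apply/eqP; ring.
  have : (B / k) * (S * (E - 1)) <= 1 / 2 * (S * (E - 1)).
    by rewrite ler_wpM2r // mulr_ge0 // subr_ge0.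
  have : 0 <= A * (E - 1) by rewrite mulr_ge0 // subr_ge0.
  nra.
move=> x xbc; rewrite -subr_le0; apply: (@le_pow2_le0 _ _ (M * expR (k * (x - b)))) => n.
have := key n x xbc; rewrite -/k mulrDl lerBlDl => /le_trans; apply.
by rewrite lerD2l le_eqVlt; apply/orP; left; apply/eqP; ring.
Qed.

Lemma geo_cvg (u : nat -> R) C : (forall n, `|u n.+1 - u n| <= C / 2 ^+ n) ->
  cvgn u /\ forall n, `|limn u - u n| <= 2 * C / 2 ^+ n.
Proof.
move=> h; have C0 : 0 <= C by have := h 0%N; rewrite expr0 divr1; exact: le_trans.
have hnm n m : `|u (n + m)%N - u n| <= 2 * C / 2 ^+ n - 2 * C / 2 ^+ (n + m).
  elim: m => [|m IH]; first by rewrite addn0 !subrr normr0.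
  have -> : u (n + m.+1)%N - u n = (u (n + m)%N - u n) + (u (n + m).+1 - u (n + m)%N).
    by rewrite addnS; ring.
  rewrite (le_trans (ler_normD _ _)) // (le_trans (lerD IH (h _))) //.
  rewrite addnS (exprS 2 (n + m)) le_eqVlt; apply/orP; left; apply/eqP.
  have h1 : (2 : R) ^+ n != 0 by rewrite expf_neq0.
  have h2 : (2 : R) ^+ (n + m) != 0 by rewrite expf_neq0.
  by move: (2 ^+ n) (2 ^+ (n + m)) h1 h2 => p q p0 q0; field; rewrite p0 q0.
have hnm' n m : (n <= m)%N -> `|u m - u n| <= 2 * C / 2 ^+ n.
  move=> nm; rewrite -(subnKC nm) (le_trans (hnm _ _)) // gerBl.
  by rewrite !mulr_ge0 // invr_ge0 exprn_ge0.
have cu : cvgn u.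
  have -> : u = (fun n => u 0%N + series (telescope u) n) by apply/funext => n; exact: eq_sum_telescope.
  apply: is_cvgD; first exact: is_cvg_cst.
  apply: normed_cvg; apply: (@series_le_cvg _ _ (geometric C 2^-1)) => //= n.
  - by rewrite mulr_ge0 // exprn_ge0 // invr_ge0.
  - by rewrite exprVn; exact: h.
  - by apply: is_cvg_geometric_series; rewrite ger0_norm ?invr_ge0 // invf_lt1 // ltr1n.
split => // n; rewrite distrC.
have cc : (fun m => `|u n - u m|) @ \oo --> `|u n - limn u|.
  by apply: cvg_norm; apply: cvgB; [exact: cvg_cst|].
apply: (cvgr_to_le cc); exists n => // m /= nm; rewrite distrC; exact: hnm'.
Qed.

Lemma I_sqr_sub b c s (p : R -> R) : L2 b c p -> b <= s -> s <= c ->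
  I b s (fun t => p t ^+ 2) <= I b c (fun t => p t ^+ 2).
Proof. by move=> hp bs sc; apply: I_mono => //; [exact: hp.2|move=> *; exact: sqr_ge0]. Qed.

(** The iteration contracts by one half in the supremum norm weighted with [expR (- k * (x - b))].
    The coefficient [p] is only in [L2], so the inner integral is estimated by the Cauchy-Schwarz
    inequality. *)
Lemma Picard b c (p r : R -> R) c0 c1 : b <= c -> L2 b c p -> L1 b c r ->
  exists z z1, [/\ AC b c z z1, AC b c z1 (fun s => p s * z s + r s), z b = c0 & z1 b = c1].
Proof.
move=> bc hp hr; pose P := I b c (fun t => p t ^+ 2); pose L := c - b + 1.
have P0 : 0 <= P by apply: I_ge0 => *; exact: sqr_ge0.
have L1' : 1 <= L by rewrite /L; lra.
(* This size of [k] gives [P / (2 * k) <= 1 / (4 * L ^ 2)], which is the contraction condition after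
   squaring. The summand 1 in [L] keeps it positive on a degenerate interval. *)
pose k := 2 * P * L ^+ 2 + 1.
have k0 : 0 < k.
  have : 0 <= 2 * P * L ^+ 2 by apply: mulr_ge0; [exact: mulr_ge0|exact: sqr_ge0].
  rewrite /k; lra.
pose T z s := c1 + I b s (fun t => p t * z t + r t).
pose U z x := c0 + I b x (T z).
have hint z : BM b c z -> L1 b c (fun t => p t * z t + r t).
  by move=> hz; apply: L1D => //; apply: L1_BM => //; exact: L2_L1.
have ACT z : BM b c z -> AC b c (T z) (fun t => p t * z t + r t).
  by move=> hz; split; [exact: hint|move=> x _; rewrite /T I_same addr0].
have ACU z : BM b c z -> AC b c (U z) (T z).
  move=> hz; split; first exact: BM_L1 (AC_BM bc (ACT _ hz)).
  by move=> x _; rewrite /U I_same addr0.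
pose zn n := iter n U (fun _ => 0).
have bz n : BM b c (zn n).
  by elim: n => [|n IH]; [exact: BM_cst|exact: AC_BM bc (ACU _ IH)].
pose E x := expR (k * (x - b)).
have E1 x : b <= x -> 1 <= E x.
  by move=> bx; rewrite -expR0 ler_expR mulr_ge0 ?subr_ge0 // ltW.
have Em x y : x <= y -> E x <= E y.
  by move=> xy; rewrite ler_expR ler_wpM2l ?(ltW k0) // lerD2r.
have [D [D0 hD]] : exists D, 0 <= D /\ forall x, b <= x <= c -> `|zn 1%N x - zn 0%N x| <= D.
  case: (BMB (bz 1%N) (bz 0%N)) => _ [M hM]; exists `|M|; split => // x h.
  by rewrite (le_trans (hM _ h)) // ler_norm.
have hd n x : b <= x <= c -> `|zn n.+1 x - zn n x| <= D / 2 ^+ n * E x.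
  elim: n x => [|n IH] x xbc; case/andP: (xbc) => bx xc.
    rewrite expr0 divr1 (le_trans (hD _ xbc)) // -[leLHS]mulr1 ler_wpM2l //; exact: E1.
  set d := fun x => zn n.+1 x - zn n x; set Dn := D / 2 ^+ n in IH.
  have Dn0 : 0 <= Dn by rewrite divr_ge0 // exprn_ge0.
  have bd : BM b c d by exact: BMB.
  have hs s : b <= s -> s <= x -> `|I b s (fun t => p t * d t)| <= Dn * E x / (2 * L).
    move=> bs sx; have sc := le_trans sx xc.
    have sq : I b s (fun t => p t * d t) ^+ 2 <= (Dn * E x / (2 * L)) ^+ 2.
      apply: le_trans (CauchySchwarz1 (L2_sub (lexx b) sc hp) (L2_sub (lexx b) sc (BM_L2 bd))) _.
      have k20 : 0 < 2 * k by rewrite mulr_gt0.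
      have [e1 e2] := I_exp k20 bs.
      have dd : I b s (fun t => d t ^+ 2) <= Dn ^+ 2 * (E x ^+ 2 / (2 * k)).
        apply: (@le_trans _ _ (Dn ^+ 2 * I b s (fun t => expR (2 * k * (t - b))))).
          rewrite -IZ //; apply: I_le => [||t /andP[bt ts]].
          - by apply: (@L1_sub _ b c) => //; exact: (BM_L2 bd).2.
          - exact: L1Z.
          - have -> : expR (2 * k * (t - b)) = E t ^+ 2 by rewrite /E -expRM_natl; congr expR; ring.
            rewrite -exprMn -real_normK ?num_real // lerXn2r ?nnegrE ?mulr_ge0 ?expR_ge0 //.
            by apply: IH; rewrite bt (le_trans ts).
        rewrite e2 ler_wpM2l ?sqr_ge0 // ler_pM2r ?invr_gt0 //.
        have -> : expR (2 * k * (s - b)) = E s ^+ 2 by rewrite /E -expRM_natl; congr expR; ring.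
        rewrite lerBlDr -[leLHS]addr0 lerD // lerXn2r ?nnegrE ?expR_ge0 //; exact: Em.
      apply: le_trans (ler_pM _ _ (I_sqr_sub hp bs sc) dd) _.
      + by apply: I_ge0 => *; exact: sqr_ge0.
      + by apply: I_ge0 => *; exact: sqr_ge0.
      rewrite -/P.
      have -> : P * (Dn ^+ 2 * (E x ^+ 2 / (2 * k))) = (Dn ^+ 2 * E x ^+ 2) * (P / (2 * k)).
        by field; rewrite gt_eqF.
      have -> : (Dn * E x / (2 * L)) ^+ 2 = (Dn ^+ 2 * E x ^+ 2) * (1 / (4 * L ^+ 2)).
        by field; rewrite gt_eqF // (lt_le_trans _ L1').
      have DE0 : 0 <= Dn ^+ 2 * E x ^+ 2 by rewrite -exprMn sqr_ge0.
      rewrite ler_wpM2l //.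
      have L20 : 0 < 4 * L ^+ 2 by rewrite mulr_gt0 // exprn_gt0 // (lt_le_trans _ L1').
      rewrite ler_pdivrMr // mulrAC ler_pdivlMr //.
      have -> : 1 * (2 * k) = P * (4 * L ^+ 2) + 2 by rewrite /k; ring.
      by rewrite lerDl.
    have hh : 0 <= Dn * E x / (2 * L).
      by rewrite divr_ge0 ?mulr_ge0 ?expR_ge0 // (le_trans _ L1').
    by rewrite -(ler_pXn2r (n:=2)) ?nnegrE // real_normK ?num_real.
  have -> : zn n.+2 x - zn n.+1 x = I b x (fun s => I b s (fun t => p t * d t)).
    have znS m : zn m.+1 x = U (zn m) x by [].
    rewrite (znS n.+1) (znS n); rewrite /U opprD addrACA subrr add0r -IB; last 2 first.
    - by apply: (@L1_sub _ b c) => //; exact: (ACU _ (bz n.+1)).1.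
    - by apply: (@L1_sub _ b c) => //; exact: (ACU _ (bz n)).1.
    apply: I_ext => s /andP[bs sx]; have sc := le_trans sx xc.
    rewrite /T opprD addrACA subrr add0r -IB; last 2 first.
    - by apply: (@L1_sub _ b c) => //; exact: hint.
    - by apply: (@L1_sub _ b c) => //; exact: hint.
    by apply: I_ext => t _; rewrite /d; ring.
  have hL : L1 b x (fun s => I b s (fun t => p t * d t)).
    have : AC b c (fun s => I b s (fun t => p t * d t)) (fun t => p t * d t).
      split; first by apply: L1_BM => //; exact: L2_L1.
      by move=> y _; rewrite I_same add0r.
    by move/(AC_BM bc)/BM_L1; exact: L1_sub.
  apply: le_trans (I_absM bx hL (M := Dn * E x / (2 * L)) _) _.
    by move=> s /andP[]; exact: hs.
  have -> : D / 2 ^+ n.+1 * E x = Dn * E x / 2.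
    by rewrite /Dn exprS; field; rewrite expf_neq0.
  have -> : Dn * E x / (2 * L) * (x - b) = Dn * E x / 2 * ((x - b) / L).
    by field; rewrite gt_eqF // (lt_le_trans _ L1').
  rewrite ler_piMr ?mulr_ge0 ?expR_ge0 // ler_pdivrMr ?(lt_le_trans _ L1') // /L; lra.
pose K := D * E c.
have hd' n x : b <= x <= c -> `|zn n.+1 x - zn n x| <= K / 2 ^+ n.
  move=> xbc; apply: le_trans (hd n x xbc) _; rewrite /K.
  have -> : D * E c / 2 ^+ n = D / 2 ^+ n * E c by ring.
  by rewrite ler_wpM2l ?divr_ge0 ?exprn_ge0 //; apply: Em; case/andP: xbc.
pose z x := limn (fun n => zn n x).
have cz x : b <= x <= c -> cvgn (fun n => zn n x) /\ forall n, `|z x - zn n x| <= 2 * K / 2 ^+ n.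
  by move=> xbc; apply: geo_cvg => n; exact: hd'.
have bzz : BM b c z.
  split.
    apply: (@measurable_fun_cvg _ _ _ _ zn) => [m|x]; first exact: (bz m).1.
    by rewrite ccE => /cz[].
  exists (2 * K) => x /cz[_ /(_ 0%N)]; rewrite /zn /= subr0 expr0 divr1; exact.
have hz x : b <= x <= c -> z x = U z x.
  move=> xbc; case/andP: (xbc) => bx xc.
  suff : `|z x - U z x| <= 0 by rewrite normr_le0 subr_eq0 => /eqP.
  pose Q := I b c (fun t => `|p t|).
  have Q0 : 0 <= Q by exact: I_ge0.
  apply: (@le_pow2_le0 _ _ (K + (c - b) * Q * 2 * K)) => n.
  have -> : z x - U z x = (z x - zn n.+1 x) + (U (zn n) x - U z x).
    have -> : zn n.+1 x = U (zn n) x by [].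
    by rewrite addrA subrK.
  apply: le_trans (ler_normD _ _) _; rewrite mulrDl; apply: lerD.
    have [_ /(_ n.+1)] := cz _ xbc; rewrite exprS.
    by have -> : 2 * K / (2 * 2 ^+ n) = K / 2 ^+ n by field; rewrite expf_neq0.
  have h1 s : b <= s -> s <= c -> `|T (zn n) s - T z s| <= Q * (2 * K / 2 ^+ n).
    move=> bs sc; rewrite /T opprD addrACA subrr add0r -IB; last 2 first.
    - by apply: (@L1_sub _ b c) => //; exact: hint.
    - by apply: (@L1_sub _ b c) => //; exact: hint.
    have hp1 := L2_L1 hp.
    have hl : L1 b s (fun t => p t * zn n t + r t - (p t * z t + r t)).
      by apply: L1B; apply: (@L1_sub _ b c) => //; exact: hint.
    apply: le_trans (I_abs hl) _.
    apply: (@le_trans _ _ (I b s (fun t => (2 * K / 2 ^+ n) * `|p t|))).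
      apply: I_le => [||t /andP[bt ts]]; first exact: L1_abs.
      - by apply: L1Z; apply: (@L1_sub _ b c) => //; exact: L1_abs.
      - have -> : p t * zn n t + r t - (p t * z t + r t) = - (z t - zn n t) * p t by ring.
        rewrite normrM normrN ler_wpM2r //.
        have tbc : b <= t <= c by rewrite bt (le_trans ts).
        by have [_] := cz _ tbc.
    rewrite IZ; last by apply: (@L1_sub _ b c) => //; exact: L1_abs.
    rewrite mulrC ler_wpM2r //.
      by rewrite divr_ge0 ?mulr_ge0 ?exprn_ge0 // expR_ge0.
    by apply: I_mono => //; exact: L1_abs.
  have hL : L1 b x (fun s => T (zn n) s - T z s).
    by apply: (@L1_sub _ b c) => //; apply: L1B; [exact: (ACU _ (bz n)).1|exact: (ACU _ bzz).1].
  rewrite /U opprD addrACA subrr add0r -IB; last 2 first.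
  - by apply: (@L1_sub _ b c) => //; exact: (ACU _ (bz n)).1.
  - by apply: (@L1_sub _ b c) => //; exact: (ACU _ bzz).1.
  apply: le_trans (I_absM bx hL (M := Q * (2 * K / 2 ^+ n)) _) _.
    by move=> s /andP[bs sx]; apply: h1 => //; exact: le_trans sx xc.
  have KK : 0 <= Q * (2 * K / 2 ^+ n).
    by rewrite !mulr_ge0 // ?expR_ge0 // invr_ge0 exprn_ge0.
  have -> : (c - b) * Q * 2 * K / 2 ^+ n = Q * (2 * K / 2 ^+ n) * (c - b) by ring.
  by rewrite ler_wpM2l // lerD2r.
have ebb : b <= b <= c by rewrite lexx.
exists z, (T z); split.
- by apply: AC_ext (ACU _ bzz) => // x /hz.
- exact: ACT.
- by rewrite hz // /U I_same addr0.
- by rewrite /T I_same addr0.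
Qed.

(** The constant depends on [p] and on the interval, not on the source [r]. Integrating twice and
    squaring bounds [z ^ 2] by the source and the integral of [z ^ 2], to which Gronwall's
    inequality applies. *)
Lemma Volterra_bound b c (p : R -> R) : b <= c -> L2 b c p ->
  exists C, 0 <= C /\ forall z z1 r, L1 b c r -> AC b c z z1 ->
    AC b c z1 (fun s => p s * z s + r s) -> z b = 0 -> z1 b = 0 ->
    forall x, b <= x <= c -> z x ^+ 2 <= C * (I b c (fun t => `|r t|)) ^+ 2.
Proof.
move=> bc hp; pose P := I b c (fun t => p t ^+ 2); pose L := c - b.
have P0 : 0 <= P by apply: I_ge0 => *; exact: sqr_ge0.
have L0 : 0 <= L by rewrite /L subr_ge0.
pose B := 2 * L ^+ 2 * P.
have B0 : 0 <= B by rewrite !mulr_ge0 // sqr_ge0.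
exists (2 * (2 * L ^+ 2) * expR ((2 * B + 1) * (c - b))); split.
  by rewrite !mulr_ge0 ?sqr_ge0 ?expR_ge0.
move=> z z1 r hr hz hz1 z0 z10 x xbc; case/andP: (xbc) => bx xc.
set rr := I b c _; have rr0 : 0 <= rr by apply: I_ge0.
have bz := AC_BM bc hz.
have key y : b <= y <= c -> z y ^+ 2 <= 2 * L ^+ 2 * rr ^+ 2 + B * I b y (fun t => z t ^+ 2).
  move=> /andP[yb yc].
  set W := I b y (fun t => z t ^+ 2); have W0 : 0 <= W by apply: I_ge0 => *; exact: sqr_ge0.
  have hs s : b <= s -> s <= y -> z1 s ^+ 2 <= 2 * (P * W) + 2 * rr ^+ 2.
    move=> bs sy; have sc := le_trans sy yc.
    rewrite hz1.2 ?bs // z10 add0r ID; last 2 first.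
    - by apply: (@L1_sub _ b c) => //; apply: L1_BM => //; exact: L2_L1.
    - exact: L1_sub hr.
    set X := I b s _; set Y := I b s _.
    have hX : X ^+ 2 <= P * W.
      apply: le_trans (CauchySchwarz1 (L2_sub (lexx b) sc hp) (L2_sub (lexx b) sc (BM_L2 bz))) _.
      apply: ler_pM; [by apply: I_ge0 => *; exact: sqr_ge0|by apply: I_ge0 => *; exact: sqr_ge0|exact: I_sqr_sub|].
      by apply: (@I_sqr_sub _ y) => //; exact: L2_sub (BM_L2 bz).
    have hY : Y ^+ 2 <= rr ^+ 2.
      have hrs : L1 b s r by exact: L1_sub hr.
      rewrite -real_normK ?num_real // lerXn2r ?nnegrE //; apply: le_trans (I_abs hrs) _.
      by apply: I_mono => //; exact: L1_abs.
    have : 0 <= (X - Y) ^+ 2 by exact: sqr_ge0.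
    nra.
  have hy : L1 b y z1 by apply: L1_sub hz.1.
  have bz1 : BM b y z1 by apply: BM_sub (AC_BM bc hz1).
  rewrite hz.2 ?yb // z0 add0r.
  have := CauchySchwarz1 (BM_L2 (BM_cst b y 1)) (BM_L2 bz1).
  rewrite (I_ext (g := z1)); last by move=> t _; rewrite mul1r.
  move/le_trans; apply; rewrite [X in X * _](I_ext (g := fun _ => 1)); last by move=> t _; rewrite expr1n.
  rewrite I_cst // mul1r.
  have h2 : I b y (fun x => z1 x ^+ 2) <= (2 * (P * W) + 2 * rr ^+ 2) * (y - b).
    rewrite -I_cst //; apply: I_le => [||t /andP[bt ty]]; [exact: (BM_L2 bz1).2|exact/BM_L1/BM_cst|exact: hs].
  have yL : y - b <= L by rewrite /L lerD2r.
  have yb0 : 0 <= y - b by rewrite subr_ge0.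
  have G0 : 0 <= 2 * (P * W) + 2 * rr ^+ 2 by rewrite addr_ge0 // ?mulr_ge0 // sqr_ge0.
  apply: le_trans (ler_wpM2l yb0 h2) _.
  have -> : 2 * L ^+ 2 * rr ^+ 2 + B * W = L * (L * (2 * (P * W) + 2 * rr ^+ 2)) by rewrite /B; ring.
  rewrite ler_pM // ?mulr_ge0 // mulrC ler_pM //.
have := @Gronwall b c (fun t => z t ^+ 2) (2 * L ^+ 2 * rr ^+ 2) B B0 _ _ key x xbc.
have A0 : 0 <= 2 * L ^+ 2 * rr ^+ 2 by rewrite !mulr_ge0 ?sqr_ge0.
move/(_ A0 (BMX 2 bz))/le_trans; apply.
have -> : 2 * (2 * L ^+ 2) * expR ((2 * B + 1) * (c - b)) * rr ^+ 2 =
  2 * (2 * L ^+ 2 * rr ^+ 2) * expR ((2 * B + 1) * (c - b)) by ring.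
rewrite ler_wpM2l ?mulr_ge0 // ler_expR ler_wpM2l ?lerD2r //.
by rewrite addr_ge0 // mulr_ge0.
Qed.

Lemma Volterra_unique b c (p r z z1 y y1 : R -> R) : b <= c -> L2 b c p -> L1 b c r ->
  AC b c z z1 -> AC b c z1 (fun s => p s * z s + r s) ->
  AC b c y y1 -> AC b c y1 (fun s => p s * y s + r s) -> z b = y b -> z1 b = y1 b ->
  forall x, b <= x <= c -> z x = y x /\ z1 x = y1 x.
Proof.
move=> bc hp hr hz hz1 hy hy1 e e1.
have [C [C0 hC]] := Volterra_bound bc hp.
have h1 : AC b c (fun s => z1 s - y1 s) (fun s => p s * (z s - y s) + 0).
  by apply: AC_ext (AC_B hz1 hy1) => // t _; ring.
have zy x : b <= x <= c -> z x - y x = 0.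
  move=> xbc; have := hC _ _ _ (BM_L1 (BM_cst b c 0)) (AC_B hz hy) h1 _ _ _ xbc.
  rewrite e e1 !subrr => /(_ erefl erefl) /=.
  rewrite (I_ext (g := fun _ => 0)); last by move=> t _; rewrite normr0.
  rewrite I_cst // mul0r expr0n mulr0 => h.
  by apply/eqP; rewrite -sqrf_eq0 eq_le h sqr_ge0.
move=> x xbc; split; first by apply/eqP; rewrite -subr_eq0 zy.
apply/eqP; rewrite -subr_eq0 h1.2 // e1 subrr add0r; case/andP: (xbc) => bx xc.
rewrite (I_ext (g := fun _ => 0)) ?I_cst ?mul0r // => t /andP[bt tx].
by rewrite zy ?mulr0 ?addr0 // bt (le_trans tx).
Qed.

End Volterra.

(** * Almost everywhere convergence and affine substitution *)

Section AlmostEverywhere.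
Context {R : realType}.
Implicit Types (b c d x y : R) (f g h : R -> R).
Notation mu := (@lebesgue_measure R).
Notation I := (@lintegral_ab R).

Lemma ae_mp (P Q : R -> Prop) : (forall x, P x -> Q x) ->
  {ae mu, forall x, P x} -> {ae mu, forall x, Q x}.
Proof. by move=> PQ; apply: filterS; first exact: (ae_filter_ringOfSetsType mu). Qed.

Lemma ae_and (P Q : R -> Prop) : {ae mu, forall x, P x} -> {ae mu, forall x, Q x} ->
  {ae mu, forall x, P x /\ Q x}.
Proof. by move=> hP hQ; apply: filterI; first exact: (ae_filter_ringOfSetsType mu). Qed.

Lemma I_EFin b c f : L1 b c f -> (\int[mu]_(x in `[b, c]) (f x)%:E)%E = (I b c f)%:E.
Proof.
by move=> hf; rewrite /lintegral_ab /Rintegral fineK //; exact: integrable_fin_num.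
Qed.

Lemma ge0_I_fin b c f K : Mf b c f -> (forall x, b <= x <= c -> 0 <= f x) ->
  (\int[mu]_(x in `[b, c]) (f x)%:E <= K%:E)%E -> L1 b c f /\ I b c f <= K.
Proof.
move=> mf f0 h.
have hf : L1 b c f.
  apply/integrableP; split; first exact/measurable_EFinP.
  rewrite (_ : (\int[mu]_(x in `[b, c]) `|(f x)%:E|)%E = (\int[mu]_(x in `[b, c]) (f x)%:E)%E).
    exact: le_lt_trans h (ltry _).
  by apply: eq_integral => x; rewrite in_ccE => /f0 fx; rewrite /= ger0_norm.
by split => //; rewrite -lee_fin -I_EFin.
Qed.

(** By monotone convergence the sum of the absolute values is integrable, hence finite almost
    everywhere. *)
Lemma ae_cvg_series b c (D : nat -> R -> R) K : (forall j, L1 b c (D j)) ->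
  (forall n, \sum_(0 <= j < n) I b c (fun x => `|D j x|) <= K) ->
  {ae mu, forall x, b <= x <= c -> cvgn (series (fun j => D j x))}.
Proof.
move=> hD hK.
pose g x := (\sum_(j <oo) (`|D j x|)%:E)%E.
have mg : measurable_fun `[b, c] g.
  apply: ge0_emeasurable_sum => // k.
  by move=> _; apply/measurable_EFinP; exact: (Mf_abs (L1_Mf (hD k))).
have ig : (\int[mu]_(x in `[b, c]) g x <= K%:E)%E.
  rewrite integral_nneseries //; last first.
    by move=> j; apply/measurable_EFinP; exact: (Mf_abs (L1_Mf (hD j))).
  apply: lime_le; first by apply: is_cvg_nneseries => n _ _; exact: integral_ge0.
  apply: nearW => n; rewrite (eq_bigr (fun j => (I b c (fun x => `|D j x|))%:E)).
    by rewrite sumEFin lee_fin hK.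
  by move=> j _; rewrite I_EFin //; exact: L1_abs.
have g0 x : (0 <= g x)%E by apply: nneseries_ge0 => n _ _; rewrite lee_fin.
have hg : mu.-integrable `[b, c] g.
  apply/integrableP; split => //.
  rewrite (_ : (\int[mu]_(x in `[b, c]) `|g x|)%E = (\int[mu]_(x in `[b, c]) g x)%E).
    exact: le_lt_trans ig (ltry _).
  by apply: eq_integral => x _; rewrite gee0_abs.
have hae : {ae mu, forall x, `[b, c]%classic x -> g x \is a fin_num} by exact: integrable_ae.
apply: ae_mp hae => x /= hx xbc.
have {}hx : g x \is a fin_num by apply: hx; rewrite in_itv.
apply: normed_cvg.
have ub n : series (fun j => `|D j x|) n <= fine (g x).
  rewrite -lee_fin fineK // /series /= -sumEFin.
  by apply: nneseries_lim_ge => k _; rewrite lee_fin.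
apply: nondecreasing_is_cvgn.
  by apply: nondecreasing_series => n _ _ /=.
by exists (fine (g x)) => _ [n _ <-]; exact: ub.
Qed.

(** A measurable stand-in for the limit: the upper limit is always measurable, and it equals the
    limit wherever the sequence converges. *)
Definition esuplim (v : nat -> R -> R) x := fine (limn_esup (fun n => (v n x)%:E)).

Lemma esuplim_Mf b c (v : nat -> R -> R) : (forall n, Mf b c (v n)) -> Mf b c (esuplim v).
Proof.
move=> hv; apply: (measurableT_comp (fine_measurable measurableT)).
by apply: measurable_fun_limn_esup => n; apply/measurable_EFinP; exact: hv.
Qed.

Lemma esuplimE (v : nat -> R -> R) x l : (fun n => v n x) @ \oo --> l -> esuplim v x = l.
Proof.
move=> h; rewrite /esuplim.
have h' : (fun n => (v n x)%:E) @ \oo --> l%:E by apply/fine_cvgP => //; split => //; exact: nearW.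
by have [_ ->] := cvg_limn_einf_sup h'.
Qed.

(** The Cauchy criterion with tolerances [1/(k+1)] writes the set through countable unions and
    intersections. *)
Lemma cvgn_set_measurable b c (v : nat -> R -> R) : (forall n, Mf b c (v n)) ->
  measurable (`[b, c] `&` [set x | cvgn (fun n => v n x)]).
Proof.
move=> hv.
have -> : `[b, c] `&` [set x | cvgn (fun n => v n x)] =
  \bigcap_(k : nat) \bigcup_(N : nat) \bigcap_(n in [set n | (N <= n)%N])
    \bigcap_(m in [set m | (N <= m)%N]) (`[b, c] `&` [set x | `|v n x - v m x| <= k.+1%:R^-1]).
  apply/seteqP; split => x /=.
    move=> [xbc cx] k _.
    move/cvg_cauchy/cauchy_ballP: (cx) => /(_ k.+1%:R^-1).
    rewrite invr_gt0 ltr0n => /(_ isT)[[A B] [/= [N1 _ hA] [N2 _ hB]] hAB].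
    exists (maxn N1 N2) => // n /= hn m /= hm; split => //.
    have := hAB (v n x, v m x) _; rewrite /ball /= => h; apply: ltW; apply: h; split => /=.
      by apply: hA => /=; exact: leq_trans (leq_maxl _ _) hn.
    by apply: hB => /=; exact: leq_trans (leq_maxr _ _) hm.
  move=> h; have xbc : `[b, c]%classic x.
    by have [N _ /(_ N)] := h 0%N Logic.I; move=> /(_ (leqnn _) N (leqnn _)) [].
  split => //; apply/cauchy_cvgP/cauchy_ballP => e e0.
  have [k _ hk] := near_infty_natSinv_lt (PosNum e0).
  have [N _ hN] := h k Logic.I.
  exists ([set y | exists2 n, (N <= n)%N & y = v n x], [set y | exists2 n, (N <= n)%N & y = v n x]).
    by split; exists N => // n /= Nn; exists n.
  move=> [y z] /= [[n Nn ->] [m Nm ->]]; rewrite /ball /=.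
  have [_ /= hnm] := hN n Nn m Nm; apply: (le_lt_trans hnm); apply: (hk k) => /=; exact: leqnn.
apply: bigcapT_measurable => k; apply: bigcupT_measurable => N.
apply: bigcap_measurable => //; first by exists N => /=; exact: leqnn.
move=> n _; apply: bigcap_measurable => //; first by exists N => /=; exact: leqnn.
move=> m _.
have := (measurable_fun_ler (Mf_abs (MfB (hv n) (hv m))) (measurable_cst (k.+1%:R^-1 : R))).
move=> /(_ (measurable_itv _) [set true] Logic.I) /=.
by congr measurable; apply/seteqP; split.
Qed.

(** At points of divergence [limn] takes the default value [point]. The function is thus glued from
    the upper limit on the convergence set and a constant off it. This matters because [F0] is
    defined by [limn]. *)
Lemma limn_Mf b c (v : nat -> R -> R) : (forall n, Mf b c (v n)) ->
  Mf b c (fun x => limn (fun n => v n x)).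
Proof.
move=> hv; have mC := cvgn_set_measurable hv; set C := _ `&` _ in mC.
have hE x : b <= x <= c -> limn (fun n => v n x) =
    if x \in C then esuplim v x else (point : R).
  move=> xbc; case: ifPn => [/set_mem[_ /= cx]|xC].
    by rewrite (esuplimE cx).
  apply: dvgP => cx; move/negP: xC; apply; rewrite inE; split => //=; rewrite ?in_itv.
apply: (@Mf_ext _ _ _ (fun x => if x \in C then esuplim v x else point)).
  by move=> x h; rewrite hE.
apply: measurable_fun_if => //; first last.
- by apply: measurable_funS (esuplim_Mf hv).
apply: (measurable_fun_bool true).
have -> : `[b, c] `&` (fun x => x \in C) @^-1` [set true] = C.
  apply/seteqP; split => x /=; first by move=> [_ /set_mem].
  by move=> h; split; [case: h|apply/mem_set].
by [].
Qed.

(** Fatou's lemma for squares. Applied to tails of a series, it turns uniform bounds on finite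
    blocks into a rate of L2 convergence to the almost everywhere limit. *)
Lemma fatou_L2 b c (v : nat -> R -> R) w (e : R) N : (forall n, L2 b c (v n)) -> Mf b c w ->
  {ae mu, forall x, b <= x <= c -> (fun n => v n x) @ \oo --> w x} ->
  (forall n, (N <= n)%N -> I b c (fun x => v n x ^+ 2) <= e) ->
  L2 b c w /\ I b c (fun x => w x ^+ 2) <= e.
Proof.
move=> hv mw hcv he.
suff : (\int[mu]_(x in `[b, c]) (w x ^+ 2)%:E <= e%:E)%E.
  move/ge0_I_fin => /(_ (MfX 2 mw) (fun x _ => sqr_ge0 _)) [h1 h2].
  by split.
pose f n x := ((v n x ^+ 2)%:E : \bar R).
have mf n : measurable_fun `[b, c] (f n) by apply/measurable_EFinP; exact: (MfX 2 (hv n).1).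
have -> : (\int[mu]_(x in `[b, c]) (w x ^+ 2)%:E = \int[mu]_(x in `[b, c]) limn_einf (f^~ x))%E.
  apply: ae_eq_integral => //.
  - by apply/measurable_EFinP; exact: (MfX 2 mw).
  - have -> : (fun x => limn_einf (f^~ x)) = (fun x => - limn_esup (fun n => - f n x))%E.
      apply/funext => x; rewrite -limn_einfN; congr limn_einf.
      by apply/funext => n; rewrite /comp oppeK.
    apply: measurableT_comp => //; apply: measurable_fun_limn_esup => n.
    exact: (measurableT_comp (@oppe_measurable R setT) (mf n)).
  - apply: ae_mp hcv => x h /= xbc; have {}h : (fun n => v n x) @ \oo --> w x by apply: h; rewrite -ccE.
    have h2 : (fun n => v n x ^+ 2) @ \oo --> w x ^+ 2 by rewrite expr2; under eq_fun do rewrite expr2; exact: cvgM.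
    have h3 : (f^~ x) @ \oo --> (w x ^+ 2)%:E by apply/fine_cvgP; split => //; exact: nearW.
    by have [-> _] := cvg_limn_einf_sup h3.
apply: le_trans (fatou _ _ _ _) _ => //.
  by move=> n x _; rewrite lee_fin sqr_ge0.
rewrite limn_einf_lim; apply: lime_le; first exact: is_cvg_einfs.
exists N => // n /= Nn; apply: (@le_trans _ _ (\int[mu]_(x in `[b, c]) f n x)%E).
  by apply: ereal_inf_lbound; exists n => /=.
by rewrite /f I_EFin ?lee_fin ?he //; exact: (hv n).2.
Qed.

(** Along a subsequence with squared distances at most [4^-j], the bound [|D| <= 2^j * D^2 + 2^-j]
    makes the L1 norms of the differences summable, which gives an almost everywhere limit. *)
Lemma Riesz_Fischer b c (v : nat -> R -> R) :
  (forall n, L2 b c (v n)) ->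
  (forall e, 0 < e -> exists N, forall n m, (N <= n)%N -> (N <= m)%N ->
     I b c (fun x => (v n x - v m x) ^+ 2) <= e) ->
  exists w, L2 b c w /\ forall e, 0 < e -> exists N, forall n, (N <= n)%N ->
     I b c (fun x => (v n x - w x) ^+ 2) <= e.
Proof.
move=> hv hC; have [bc|cb] := leP b c; last first.
  exists (fun _ => 0); split; first exact/BM_L2/BM_cst.
  move=> e e0; exists 0%N => n _; apply: le_trans (ltW e0).
  rewrite (_ : I b c _ = 0) // /lintegral_ab.
  by rewrite set_itv_ge ?bnd_simp -?ltNge // Rintegral_set0.
have [N0 hN0] : {N0 : nat -> nat & forall j n m, (N0 j <= n)%N -> (N0 j <= m)%N ->
     I b c (fun x => (v n x - v m x) ^+ 2) <= (4 ^+ j)^-1}.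
  apply: (@choice _ _ (fun j N => forall n m, (N <= n)%N -> (N <= m)%N ->
     I b c (fun x => (v n x - v m x) ^+ 2) <= (4 ^+ j)^-1)) => j.
  by apply: hC; rewrite invr_gt0 exprn_gt0.
(* Taking maxima makes the thresholds nondecreasing, so that later members of the subsequence
   satisfy all earlier estimates. *)
pose N j := \max_(i < j.+1) N0 i.
have NN0 j : (N0 j <= N j)%N by exact: (@leq_bigmax _ (fun i : 'I_j.+1 => N0 i) ord_max).
have N0S j k : (j <= k)%N -> (N0 j <= N k)%N.
  move=> jk; exact: (@leq_bigmax _ (fun i : 'I_k.+1 => N0 i) (Ordinal (jk : (j < k.+1)%N))).
pose D j x := v (N j.+1) x - v (N j) x.
have hD j : L2 b c (D j) by exact: L2B.
have geo n : \sum_(0 <= j < n) (2 ^+ j)^-1 <= 2 :> R.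
  have -> : \sum_(0 <= j < n) (2 ^+ j)^-1 = 2 - 2 * (2 ^+ n)^-1 :> R.
    elim: n => [|n IH]; first by rewrite big_geq // expr0 invr1 mulr1 subrr.
    rewrite big_nat_recr //= IH exprS invfM.
    by have h : (2 : R) * 2^-1 = 1 by [rewrite divff]; rewrite mulrA h; ring.
  by rewrite gerBl mulr_ge0 // invr_ge0 exprn_ge0.
have hID j : I b c (fun x => `|D j x|) <= (1 + (c - b)) * (2 ^+ j)^-1.
  have p0 : 0 < 2 ^+ j :> R by rewrite exprn_gt0.
  apply: (@le_trans _ _ (I b c (fun x => 2 ^+ j * D j x ^+ 2 + (2 ^+ j)^-1))).
    apply: I_le => [||x _].
    - exact/L1_abs/L2_L1.
    - by apply: L1D; [apply: L1Z; exact: (hD j).2|exact/BM_L1/BM_cst].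
    have h2 := real_normK (num_real (D j x)); rewrite -h2; set d := `|D j x|.
    have d0 : 0 <= d by exact: normr_ge0.
    have q0 : 0 < (2 ^+ j)^-1 :> R by rewrite invr_gt0.
    have pq : 2 ^+ j * (2 ^+ j)^-1 = 1 :> R by rewrite divff ?gt_eqF.
    move: (2 ^+ j) ((2 ^+ j)^-1) p0 q0 pq => p q p0 q0 pq.
    have h : 0 <= p * (d - q) ^+ 2 by rewrite mulr_ge0 ?sqr_ge0 // ltW.
    have e : p * (d - q) ^+ 2 = p * d ^+ 2 - 2 * d + q.
      by transitivity (p * d ^+ 2 - 2 * d * (p * q) + q * (p * q)); [ring|rewrite pq; ring].
    lra.
  have hD2 : L1 b c (fun x => D j x ^+ 2) by exact: (hD j).2.
  rewrite ID ?IZ //; [|exact: L1Z|exact/BM_L1/BM_cst].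
    rewrite I_cst // mulrDl mul1r [(c - b) * _]mulrC lerD2r.
    have := hN0 j (N j.+1) (N j) (N0S _ _ (leqnSn j)) (NN0 j).
    have -> : (4 ^+ j)^-1 = (2 ^+ j)^-1 * (2 ^+ j)^-1 :> R by rewrite -invfM -exprMn; congr (_ ^+ _)^-1; ring.
    move=> h; apply: le_trans (ler_wpM2l (ltW p0) h) _.
    by rewrite mulrA divff ?gt_eqF // mul1r.
have hcv : {ae mu, forall x, b <= x <= c -> cvgn (series (fun j => D j x))}.
  apply: (@ae_cvg_series _ _ D ((1 + (c - b)) * 2)) => [j|n]; first exact: L2_L1.
  apply: (@le_trans _ _ (\sum_(0 <= j < n) (1 + (c - b)) * (2 ^+ j)^-1)).
    by apply: ler_sum => j _.
  by rewrite -mulr_sumr ler_wpM2l // addr_ge0 // subr_ge0.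
pose w := esuplim (fun j => v (N j)).
have mw : Mf b c w by apply: esuplim_Mf => n; exact: (hv _).1.
have hw : {ae mu, forall x, b <= x <= c -> (fun j => v (N j) x) @ \oo --> w x}.
  apply: ae_mp hcv => x h xbc; have {}h := h xbc.
  suff cv : cvgn (fun j => v (N j) x) by rewrite /w (esuplimE cv).
  have -> : (fun j => v (N j) x) = (fun j => v (N 0%N) x + series (fun j => D j x) j).
    apply/funext => j; rewrite /series /=; elim: j => [|j IH]; first by rewrite big_geq // addr0.
    by rewrite big_nat_recr //= addrA -IH /D addrC subrK.
  by apply: is_cvgD => //; exact: is_cvg_cst.
(* Fatou's lemma along the subsequence bounds the distance from every [v n] to [w], so the whole
   sequence converges. *)
have key n e M : (forall m, (M <= m)%N -> I b c (fun x => (v n x - v (N m) x) ^+ 2) <= e) ->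
    L2 b c (fun x => v n x - w x) /\ I b c (fun x => (v n x - w x) ^+ 2) <= e.
  move=> h; apply: (@fatou_L2 _ _ (fun m x => v n x - v (N m) x) _ _ M) => //.
  - by move=> m; exact: L2B.
  - by apply: MfB => //; exact: (hv n).1.
  - by apply: ae_mp hw => x h1 xbc; apply: cvgB; [exact: cvg_cst|exact: h1].
exists w; split.
  have [h1 _] := @key (N 0%N) 1 0%N (fun m _ => le_trans (hN0 0%N _ _ (NN0 0%N) (N0S _ _ (leq0n m))) ltac:(by rewrite expr0 invr1)).
  by apply: L2_ext (L2B (hv (N 0%N)) h1) => x _; rewrite subKr.
move=> e e0; have ie0 : 0 <= e^-1 by rewrite invr_ge0 ltW.
pose J := Num.bound e^-1; exists (N0 J) => n Jn.
apply: (key n e J _).2 => m Jm; apply: le_trans (hN0 J _ _ Jn (N0S _ _ Jm)) _.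
rewrite -[leRHS]invrK lef_pV2 ?posrE ?invr_gt0 ?exprn_gt0 //.
rewrite (le_trans (ltW (archi_boundP ie0))) // -natrX ler_nat.
exact/ltnW/ltn_expl.
Qed.

Lemma measurable_affine (k d : R) : measurable_fun [set: R] (fun t => k * t + d).
Proof.
by apply: measurable_funD => //; apply: measurable_funM => //; exact: measurable_cst.
Qed.

Lemma preimage_affine_cc (k d b c : R) : 0 < k ->
  (fun t => k * t + d) @^-1` `[k * b + d, k * c + d] = `[b, c]%classic.
Proof.
move=> k0; apply/seteqP; split => t /=; rewrite !in_itv /= !lerD2r !ler_pM2l //.
Qed.

Lemma preimage_affineN_cc (k d b c : R) : k < 0 ->
  (fun t => k * t + d) @^-1` `[k * c + d, k * b + d] = `[b, c]%classic.
Proof.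
by move=> k0; apply/seteqP; split => t /=; rewrite !in_itv /= !lerD2r !ler_nM2l // andbC.
Qed.

(** The rescaled image measure agrees with Lebesgue measure on the half-open intervals, and
    uniqueness does the rest. A negative [k] exchanges the closed and the open end. *)
Lemma lebesgue_affine (k d : R) (A : set R) : k != 0 -> measurable A ->
  mu A = (`|k|%:E * mu ((fun t => k * t + d)%R @^-1` A))%E.
Proof.
move=> k0 mA.
pose nu : {measure set (measurableTypeR R) -> \bar R} :=
  @measure_function_pushforward__canonical__measure_function_Measure _ _
  (measurableTypeR R) (measurableTypeR R) R mu _ (measurable_affine k d).
have -> : (`|k|%:E * mu ((fun t => k * t + d)%R @^-1` A))%E = mscale (NngNum (normr_ge0 k)) nu A by [].
apply: lebesgue_measure_unique => // X [[u v] _ <-] /=.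
rewrite /mscale /= /pushforward.
case: (ltgtP k 0) k0 => // k0 _.
- rewrite (_ : _ @^-1` _ = `[(v - d) / k, (u - d) / k[%classic); last first.
    apply/seteqP; split => t /=; rewrite !in_itv /= ler_ndivrMr // ltr_ndivlMr //;
    by move=> /andP[h1 h2]; apply/andP; split; lra.
  have := lebesgue_measure_itv `](u : R), v]; rewrite /= => ->.
  have := lebesgue_measure_itv `[(v - d) / k, (u - d) / k[; rewrite /= => ->.
  rewrite !lte_fin ltr_ndivrMr // divfK ?lt_eqF // ltrD2r.
  case: ifPn => _; last by rewrite mule0.
  by rewrite -!EFinB -EFinM ltr0_norm //; congr (_%:E); field; rewrite lt_eqF.
- rewrite (_ : _ @^-1` _ = `](u - d) / k, (v - d) / k]%classic); last first.
    apply/seteqP; split => t /=; rewrite !in_itv /= ler_pdivlMr // ltr_pdivrMr //;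
    by move=> /andP[h1 h2]; apply/andP; split; lra.
  have := lebesgue_measure_itv `](u : R), v]; rewrite /= => ->.
  have := lebesgue_measure_itv `](u - d) / k, (v - d) / k]; rewrite /= => ->.
  rewrite !lte_fin ltr_pdivrMr // divfK ?gt_eqF // ltrD2r.
  case: ifPn => _; last by rewrite mule0.
  by rewrite -!EFinB -EFinM gtr0_norm //; congr (_%:E); field; rewrite gt_eqF.
Qed.

Lemma ge0_integral_affine (k d : R) (D : set R) (f : R -> \bar R) : k != 0 ->
  measurable D -> measurable_fun D f -> (forall x, D x -> 0 <= f x)%E ->
  (\int[mu]_(x in D) f x =
   `|k|%:E * \int[mu]_(x in (fun t => k * t + d)%R @^-1` D) f (k * x + d)%R)%E.
Proof.
move=> k0 mD mf f0.
pose nu : {measure set (measurableTypeR R) -> \bar R} :=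
  @measure_function_pushforward__canonical__measure_function_Measure _ _
  (measurableTypeR R) (measurableTypeR R) R mu _ (measurable_affine k d).
transitivity (\int[mscale (NngNum (normr_ge0 k)) nu]_(x in D) f x)%E.
  by apply: eq_measure_integral => A mA _; exact: lebesgue_affine.
rewrite ge0_integral_mscale //; congr (_ * _)%E.
apply: (@ge0_integral_pushforward _ _ (measurableTypeR R) (measurableTypeR R) R _
  (measurable_affine k d) mu D f mD mf).
by move=> x /set_mem; exact: f0.
Qed.

Lemma Rintegral_affine (k d b c b' c' : R) f : k != 0 ->
  (fun t => k * t + d) @^-1` `[b', c'] = `[b, c]%classic -> L1 b' c' f ->
  L1 b c (fun t => f (k * t + d)) /\ I b' c' f = `|k| * I b c (fun t => f (k * t + d)).
Proof.
move=> k0 hpre hf.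
have mc g : Mf b' c' g -> Mf b c (fun t => g (k * t + d)).
  move=> mg; rewrite /Mf -hpre; apply: (measurable_comp (measurable_itv `[b', c'])) => //.
    by move=> _ [t ht <-].
  by apply: measurable_funTS; exact: measurable_affine.
have kk : 0 < `|k| by rewrite normr_gt0.
have ge0 g : L1 b' c' g -> (forall x, b' <= x <= c' -> 0 <= g x) ->
    L1 b c (fun t => g (k * t + d)) /\ I b' c' g = `|k| * I b c (fun t => g (k * t + d)).
  move=> hg g0.
  have h := @ge0_integral_affine k d `[b', c']%classic (fun x => (g x)%:E) k0 (measurable_itv _) _ _.
  have {h} : (\int[mu]_(x in `[b', c']) (g x)%:E = `|k|%:E * \int[mu]_(x in `[b, c]) (g (k * x + d))%:E)%E.
    rewrite -hpre; apply: h; first by apply/measurable_EFinP; exact: L1_Mf.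
    by move=> x; rewrite ccE => /g0; rewrite lee_fin.
  rewrite I_EFin // => h.
  have g0' x : b <= x <= c -> 0 <= g (k * x + d).
    move=> hx; apply: g0; have : ((fun t => k * t + d) @^-1` `[b', c']) x by rewrite hpre ccE.
    by rewrite /= in_itv.
  have e : (\int[mu]_(x in `[b, c]) (g (k * x + d))%:E = (`|k|^-1 * I b' c' g)%:E)%E.
    by rewrite EFinM h muleA -EFinM mulVf ?gt_eqF // mul1e.
  have [h1 _] := ge0_I_fin (mc _ (L1_Mf hg)) g0' (eq_ind _ (fun z => (z <= _)%E) (lexx _) _ (esym e)).
  split => //; move: e; rewrite I_EFin // => -[->].
  by rewrite mulrA divff ?gt_eqF // mul1r.
(* The signed case follows from [f = (|f| + f) - |f|], a difference of nonnegative integrable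
   functions. *)
have ha := L1_abs hf; have hs := L1D ha hf.
have [a1 a2] := ge0 _ ha (fun x _ => normr_ge0 (f x)).
have [s1 s2] := ge0 _ hs (fun x _ => ltac:(have := ler_norm (- f x); rewrite normrN; lra)).
have hff : L1 b c (fun t => f (k * t + d)).
  by apply: L1_ext (L1B s1 a1) => x _; ring.
split => //.
have -> : I b' c' f = I b' c' (fun x => `|f x| + f x) - I b' c' (fun x => `|f x|).
  by rewrite -IB //; apply: I_ext => x _; ring.
by rewrite a2 s2 -mulrBr -IB //; congr (_ * _); apply: I_ext => x _; ring.
Qed.

Lemma I_affine (k d b c : R) f : 0 < k -> L1 (k * b + d) (k * c + d) f ->
  L1 b c (fun t => f (k * t + d)) /\
  I (k * b + d) (k * c + d) f = k * I b c (fun t => f (k * t + d)).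
Proof.
move=> k0 hf; have := Rintegral_affine _ (preimage_affine_cc d b c k0) hf.
by rewrite gt_eqF // gtr0_norm // => /(_ isT).
Qed.

Lemma I_affineN (k d b c : R) f : k < 0 -> L1 (k * c + d) (k * b + d) f ->
  L1 b c (fun t => f (k * t + d)) /\
  I (k * c + d) (k * b + d) f = - k * I b c (fun t => f (k * t + d)).
Proof.
move=> k0 hf; have := Rintegral_affine _ (preimage_affineN_cc d b c k0) hf.
by rewrite lt_eqF // ltr0_norm // => /(_ isT).
Qed.

Lemma ae_affine (k d : R) (P : R -> Prop) : k != 0 -> {ae mu, forall x, P x} ->
  {ae mu, forall t, P (k * t + d)}.
Proof.
move=> k0 [A [mA A0 hA]]; exists ((fun t => k * t + d) @^-1` A); split.
- by rewrite -[X in measurable X]setTI; exact: measurable_affine.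
- have := lebesgue_affine d k0 mA; rewrite A0 => /esym /eqP.
  by rewrite mule_eq0 eqe normr_eq0 (negbTE k0) /= => /eqP.
- by move=> t /= ht; apply: hA.
Qed.

End AlmostEverywhere.

(** * Test functions *)

Section TestFunctions.
Context {R : realType}.
Implicit Types (b c d x y h : R) (f g : R -> R).
Notation mu := (@lebesgue_measure R).
Notation I := (@lintegral_ab R).

(** The triple stands for a function with its first two derivatives. Vanishing holds on the whole
    half-lines, so that the function satisfies the boundary conditions on [[0, pi]] when its support
    lies in a smaller interval. *)
Definition test_fun b c f f1 f2 := exists2 e, 0 < e &
  [/\ forall u v, u <= v -> [/\ AC u v f f1, AC u v f1 f2 & BM u v f2],
      forall x, x <= b + e -> f x = 0 /\ f1 x = 0 &
      forall x, c - e <= x -> f x = 0 /\ f1 x = 0].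

(** The truncated power of spline theory. *)
Definition tpow n s x : R := Num.max (x - s) 0 ^+ n.

Lemma tpow_le n s x : x <= s -> tpow n.+1 s x = 0.
Proof. by move=> xs; rewrite /tpow max_r ?subr_le0 // expr0n. Qed.

Lemma tpow_ge n s x : s <= x -> tpow n s x = (x - s) ^+ n.
Proof. by move=> xs; rewrite /tpow max_l ?subr_ge0. Qed.

Lemma BM_tpow n s u v : BM u v (tpow n s).
Proof.
apply: BMX; split.
  by apply: measurable_maxr; [apply: measurable_funB => //; exact: measurable_cst|exact: measurable_cst].
exists (`|v - s| + `|u - s|) => x /andP[ux xv].
have h1 := ler_norm (v - s); have h0 := ler_norm (u - s); have h2 := normr_ge0 (u - s); have h3 := normr_ge0 (v - s).
by rewrite ger0_norm ?le_max ?lexx ?orbT // ge_max; apply/andP; split; lra.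
Qed.

Lemma AC_tpow n s u v : u <= v ->
  AC u v (tpow n.+2 s) (fun x => n.+2%:R * tpow n.+1 s x).
Proof.
move=> uv; have hL p q : L1 p q (fun x => n.+2%:R * tpow n.+1 s x) by apply/L1Z/BM_L1/BM_tpow.
have A x : s <= x -> I s x (fun x => n.+2%:R * tpow n.+1 s x) = tpow n.+2 s x.
  move=> sx.
  have : AC s x (fun x => (x - s) ^+ n.+2) (fun x => n.+2%:R * (x - s) ^+ n.+1).
    apply: AC_C1 => [t|].
      have h : is_derive t 1 (fun t : R => t - s) (1 : R).
        have -> : (fun t : R => t - s) = (id - cst s) by [].
        by apply: is_derive_eq; rewrite subr0.
      have -> : (fun x => (x - s) ^+ n.+2) = (fun x => x - s) ^+ n.+2.
        by apply/funext => z; rewrite exprfctE.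
      by apply: is_derive_eq; rewrite /GRing.scale /= mulr1.
    move=> t; apply: cvgM; first exact: cvg_cst.
    have : continuous (fun y : R => y - s) by move=> z; apply: cvgB; [exact: cvg_id|exact: cvg_cst].
    move=> hc; have := @continuous_comp _ _ _ (fun y : R => y - s) (fun y => y ^+ n.+1) t (hc t) (@exprn_continuous _ _ _).
    exact.
  move=> [_ /(_ x)]; rewrite sx lexx => /(_ isT); rewrite subrr expr0n add0r tpow_ge // => ->.
  by apply: I_ext => t /andP[st _]; rewrite tpow_ge.
have B p x : p <= x -> x <= s -> I p x (fun x => n.+2%:R * tpow n.+1 s x) = 0.
  move=> px xs; rewrite (I_ext (g := fun _ => 0)) ?I_cst ?mul0r // => t /andP[_ tx].
  by rewrite tpow_le ?mulr0 // (le_trans tx).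
split => // x /andP[ux xv].
have [xs|sx] := leP x s.
  by rewrite B // !tpow_le ?addr0 // (le_trans ux).
have [us|su] := leP u s.
  by rewrite (@I_split _ u s x) ?(ltW sx) // B // A ?(ltW sx) // (tpow_le _ us) !add0r.
by rewrite -(A u) ?(ltW su) // -(A x) ?(ltW sx) // (@I_split _ s u x) ?(ltW su).
Qed.

(* Cubic B-spline ramp: third difference of the truncated cubic. *)
Definition ramp (n : nat) (p h x : R) : R :=
  (tpow n p x - 3 * tpow n (p + h) x + 3 * tpow n (p + 2 * h) x - tpow n (p + 3 * h) x)
  / (n`!%:R * h ^+ 3).

Lemma AC_ramp n p h u v : 0 < h -> u <= v -> AC u v (ramp n.+2 p h) (ramp n.+1 p h).
Proof.
move=> h0 uv; pose k := (n.+2`!%:R * h ^+ 3)^-1 : R.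
have H := AC_Z k (AC_B (AC_D (AC_B (AC_tpow n p uv) (AC_Z 3 (AC_tpow n (p + h) uv)))
  (AC_Z 3 (AC_tpow n (p + 2 * h) uv))) (AC_tpow n (p + 3 * h) uv)).
apply: AC_ext H => x _; first by rewrite /ramp mulrC.
rewrite /ramp /k factS natrM.
have f0 : n.+1`!%:R != 0 :> R by rewrite pnatr_eq0 -lt0n fact_gt0.
have n0 : n.+2%:R != 0 :> R by rewrite pnatr_eq0.
have hn : h != 0 by rewrite gt_eqF.
by move: (n.+1`!%:R) (n.+2%:R) f0 n0 => F N F0 N0; field; rewrite F0 N0 hn.
Qed.

Lemma BM_ramp n p h u v : BM u v (ramp n p h).
Proof.
have hb s := BM_tpow n s u v.
by apply: BM_ext (BMZ (n`!%:R * h ^+ 3)^-1 (BMB (BMD (BMB (hb p) (BMZ 3 (hb (p + h)))) (BMZ 3 (hb (p + 2 * h)))) (hb (p + 3 * h)))) => x _; rewrite /ramp mulrC.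
Qed.

Lemma ramp_le n p h x : 0 < h -> x <= p -> ramp n.+1 p h x = 0.
Proof.
by move=> h0 xp; rewrite /ramp !tpow_le //; [ring|lra|lra|lra].
Qed.

Lemma ramp3_ge p h x : 0 < h -> p + 3 * h <= x -> ramp 3 p h x = 1.
Proof.
move=> h0 hx; rewrite /ramp !tpow_ge //; [|lra|lra|lra].
have -> : (3`!%:R : R) = 6 by rewrite !factS fact0.
by field; rewrite gt_eqF.
Qed.

Lemma ramp2_ge p h x : 0 < h -> p + 3 * h <= x -> ramp 2 p h x = 0.
Proof.
move=> h0 hx; rewrite /ramp !tpow_ge //; [|lra|lra|lra].
have -> : (2`!%:R : R) = 2 by rewrite !factS fact0.
by field; rewrite gt_eqF.
Qed.

(** On the transition interval each truncated cube is at most [27 * h ^ 3]; the coefficients add up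
    to 8 in absolute value, and [8 * 27 / 6 = 36]. *)
Lemma ramp3_bound p h x : 0 < h -> `|ramp 3 p h x| <= 36.
Proof.
move=> h0; have [px|xp] := leP x p; first by rewrite ramp_le // normr0.
have [hx|hx] := leP (p + 3 * h) x; first by rewrite ramp3_ge // normr1 ler1n.
have h30 : 0 < h ^+ 3 by rewrite exprn_gt0.
have tb s : p <= s -> 0 <= tpow 3 s x /\ tpow 3 s x <= 27 * h ^+ 3.
  move=> ps; have m0 : 0 <= Num.max (x - s) 0 by rewrite le_max lexx orbT.
  split; first by rewrite exprn_ge0.
  have -> : 27 * h ^+ 3 = (3 * h) ^+ 3 by ring.
  rewrite lerXn2r ?nnegrE //; first by rewrite mulr_ge0 // ltW.
  by rewrite ge_max; apply/andP; split; lra.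
have [a1 a2] := tb p (lexx _).
have [b1 b2] : 0 <= tpow 3 (p + h) x /\ tpow 3 (p + h) x <= 27 * h ^+ 3 by apply: tb; lra.
have [c1 c2] : 0 <= tpow 3 (p + 2 * h) x /\ tpow 3 (p + 2 * h) x <= 27 * h ^+ 3 by apply: tb; lra.
have [d1 d2] : 0 <= tpow 3 (p + 3 * h) x /\ tpow 3 (p + 3 * h) x <= 27 * h ^+ 3 by apply: tb; lra.
rewrite /ramp normrM.
have -> : (3`!%:R : R) = 6 by rewrite !factS fact0.
rewrite normfV [X in _ / X]gtr0_norm ?mulr_gt0 // ler_pdivrMr ?mulr_gt0 //.
by rewrite ler_norml; apply/andP; split; lra.
Qed.

(** The difference of two ramps is a smoothed indicator function of [[p, q]]. *)
Lemma test_ramp b c p q h : 0 < h -> b < p -> p <= q -> q + 3 * h < c ->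
  test_fun b c (fun x => ramp 3 p h x - ramp 3 q h x) (fun x => ramp 2 p h x - ramp 2 q h x)
    (fun x => ramp 1 p h x - ramp 1 q h x).
Proof.
move=> h0 bp pq qc; exists (Num.min (p - b) (c - (q + 3 * h))).
  by rewrite lt_min !subr_gt0 bp.
set e := Num.min _ _.
have e1 : e <= p - b by rewrite ge_min lexx.
have e2 : e <= c - (q + 3 * h) by rewrite ge_min lexx orbT.
split.
- move=> u v uv; split.
  + by apply: AC_B; exact: AC_ramp.
  + by apply: AC_B; exact: AC_ramp.
  + by apply: BMB; exact: BM_ramp.
- move=> x hx; rewrite !ramp_le ?subrr //; lra.
- move=> x hx; rewrite !ramp3_ge ?ramp2_ge ?subrr //; lra.
Qed.

(** Smoothed indicator functions with shrinking ramps show that [w] has integral zero over every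
    interior interval. Lebesgue's differentiation theorem then gives [w = 0] almost everywhere. *)
Lemma ae_zero_of_test b c (w : R -> R) : b < c -> L1 b c w ->
  (forall f f1 f2, test_fun b c f f1 f2 -> I b c (fun x => w x * f x) = 0) ->
  {ae mu, forall x, b < x < c -> w x = 0}.
Proof.
move=> bc hw hf; have hwa := L1_abs hw.
pose Q x := I b x (fun t => `|w t|).
have ACQ : AC b c Q (fun t => `|w t|) by split => // x _; rewrite /Q I_same add0r.
have cQ := AC_cont (ltW bc) ACQ.
have key p q : b < p -> p <= q -> q < c -> I p q w = 0.
  move=> bp pq qc; have bq := lt_le_trans bp pq; have pc := le_lt_trans pq qc.
  suff : `|I p q w| <= 0 by rewrite normr_le0 => /eqP.
  apply/ler_addgt0Pl => e e0; rewrite addr0.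
  (* The constant 37 is [36 + 1], a bound for the distance of a ramp to the sharp step. Continuity
     of the integral of [|w|] makes the resulting error small. *)
  have hcont y : b < y -> y < c -> exists d, 0 < d /\ forall z, y <= z -> z <= y + d -> z <= c -> 37 * (Q z - Q y) <= e / 2.
    move=> by_ yc.
    have cy : {for y, continuous Q}.
      move/(continuous_within_itvP _ bc): (cQ) => [H _ _]; apply: H.
      by rewrite in_itv /= by_.
    have e20 : 0 < e / 2 / 37 by rewrite !divr_gt0.
    move/cvgrPdist_le: cy => /(_ _ e20)[d /= d0 hd].
    exists (d / 2); split; first by rewrite divr_gt0.
    move=> z yz zy zc; rewrite mulrC -ler_pdivlMr //; have := hd z; rewrite /= ltr_norml.
    move=> H; have := H _; rewrite distrC => H2; apply: le_trans (ler_norm _) _; apply: H2.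
    by apply/andP; split; lra.
  have [d1 [d10 hd1]] := hcont p bp pc; have [d2 [d20 hd2]] := hcont q bq qc.
  pose h := Num.min (Num.min d1 d2) (c - q) / 6.
  have m0 : 0 < Num.min (Num.min d1 d2) (c - q) by rewrite !lt_min d10 d20 subr_gt0.
  have h0 : 0 < h by rewrite divr_gt0.
  have m1 : 6 * h <= d1 by rewrite /h mulrC divfK // !ge_min lexx.
  have m2 : 6 * h <= d2 by rewrite /h mulrC divfK // !ge_min lexx orbT.
  have m3 : 6 * h <= c - q by rewrite /h mulrC divfK // !ge_min lexx orbT.
  have qhc : q + 3 * h < c by lra.
  have := hf _ _ _ (test_ramp h0 bp pq qhc).
  have hint s : L1 b c (fun x => w x * ramp 3 s h x) by apply: L1_BM => //; exact: BM_ramp.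
  have est s : b < s -> s + 3 * h < c -> `|I b c (fun x => w x * ramp 3 s h x) - I s c w| <= 37 * (Q (s + 3 * h) - Q s).
    move=> bs sc; have s1 : s <= s + 3 * h by lra.
    have s2 : s <= c by lra.
    rewrite (@I_split _ b s c) ?(ltW bs) //.
    have -> : I b s (fun x => w x * ramp 3 s h x) = 0.
      rewrite (I_ext (g := fun _ => 0)) ?I_cst ?mul0r ?(ltW bs) // => t /andP[_ ts].
      by rewrite ramp_le // mulr0.
    have hs : L1 s c (fun x => w x * ramp 3 s h x) by apply: L1_sub (hint s) => //; exact: ltW.
    have hws : L1 s c w by apply: L1_sub hw => //; exact: ltW.
    rewrite add0r -IB // (@I_split _ s (s + 3 * h) c) ?(ltW sc) //; last exact: L1B.
    have -> : I (s + 3 * h) c (fun x => w x * ramp 3 s h x - w x) = 0.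
      rewrite (I_ext (g := fun _ => 0)) ?I_cst ?mul0r ?(ltW sc) // => t /andP[ts _].
      by rewrite ramp3_ge // mulr1 subrr.
    rewrite addr0.
    have hL : L1 s (s + 3 * h) (fun x => w x * ramp 3 s h x - w x).
      by apply: (@L1_sub _ s c) => //; [exact: ltW|exact: L1B].
    apply: le_trans (I_abs hL) _.
    rewrite (AC_incr ACQ) ?(ltW bs) ?(ltW sc) // -IZ; last by apply: (@L1_sub _ b c) => //; exact: ltW.
    apply: I_le => [||t _]; [exact: L1_abs|by apply: L1Z; apply: (@L1_sub _ b c) => //; exact: ltW|].
    have -> : w t * ramp 3 s h t - w t = (ramp 3 s h t - 1) * w t by ring.
    rewrite normrM ler_wpM2r // (le_trans (ler_normB _ _)) // normr1.
    by have := ramp3_bound s t h0; lra.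
  rewrite (I_ext (g := fun x => w x * ramp 3 p h x - w x * ramp 3 q h x)); last by move=> t _; ring.
  rewrite IB // => hpq.
  have hph : p + 3 * h < c by lra.
  have ep := est p bp hph; have eq := est q bq qhc.
  have qp : 37 * (Q (p + 3 * h) - Q p) <= e / 2 by apply: hd1 => //; [clear - h0; lra|clear - h0 m1; lra|exact: ltW].
  have qq : 37 * (Q (q + 3 * h) - Q q) <= e / 2 by apply: hd2 => //; [clear - h0; lra|clear - h0 m2; lra|exact: ltW].
  have hwp : L1 p c w by apply: L1_sub hw => //; exact: ltW.
  have := I_split pq (ltW qc) hwp => hs.
  have {}ep := le_trans ep qp; have {}eq := le_trans eq qq.
  move: ep eq hpq; move: (I b c _) (I b c _) => X Y.
  rewrite ler_norml => /andP[x1 x2]; rewrite ler_norml => /andP[y1 y2] XY.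
  by rewrite ler_norml; apply/andP; split; clear - x1 x2 y1 y2 XY hs; lra.
pose W x := I b x w.
have ACW : AC b c W w by split => // x _; rewrite /W I_same add0r.
have W0 x : b < x -> x < c -> W x = 0.
  move=> bx xc; suff : `|W x| <= 0 by rewrite normr_le0 => /eqP.
  apply/ler_addgt0Pl => e e0; rewrite addr0.
  have cb : W @ b^'+ --> W b.
    by move/(continuous_within_itvP _ bc): (AC_cont (ltW bc) ACW) => [_ h _]; exact: h.
  have W00 : W b = 0 by rewrite /W I_same.
  move: cb; rewrite W00 => /cvgrPdist_le /(_ _ e0) hn.
  have [z [bz zx hz]] : exists z, [/\ b < z, z < x & `|0 - W z| <= e].
    have : \forall z \near b^'+, [/\ b < z, z < x & `|0 - W z| <= e].
      near=> z; split.
      - by near: z; exact: nbhs_right_gt.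
      - by near: z; exact: nbhs_right_lt.
      - by near: z; exact: hn.
    by move/filter_ex.
  have hwx : L1 b x w by apply: L1_sub hw => //; exact: ltW.
  by rewrite /W (I_split (ltW bz) (ltW zx) hwx) (key z x bz (ltW zx) xc) addr0; move: hz; rewrite sub0r normrN.
(* Extension by zero, since the differentiation theorem is applied to a function that is integrable
   on the whole line. *)
pose wr := w \_ `[b, c].
have iw : mu.-integrable setT (EFin \o wr).
  rewrite /wr -restrict_EFin; apply/integrable_restrict => //=.
  by rewrite ?setIT ?setTI; exact: hw.
have h1 : forall y, mu.-integrable [set` Interval (BLeft b) (BRight y)] (EFin \o wr).
  by move=> y; apply: integrableS iw.
have h2 : locally_integrable [set: R] wr.
  by apply: open_integrable_locally => //; exact: openT.
have := FTC1 h1 h2; apply: ae_mp => x hx /andP[bx xc].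
have hbx : (BLeft b < BRight x)%E by rewrite /= lte_fin.
have [_] := hx hbx.
have e0 : wr x = w x by rewrite /wr patchE ifT // inE /= in_itv /= !ltW.
rewrite e0 => <-.
rewrite derive1E -(@derive_cst R R R (0 : R) x 1).
apply: near_eq_derive.
near=> y.
have : y \in `]b, c[ by near: y; apply: near_in_itvoo; rewrite in_itv /= bx.
rewrite in_itv /= => /andP[b_y yc].
rewrite /cst -(W0 y b_y yc); apply: I_ext => t /andP[bt ty]; rewrite /wr patchE ifT // inE /= in_itv /= bt.
by rewrite (le_trans ty) // ltW.
Unshelve. all: by end_near. Qed.

End TestFunctions.

(** * Sturm-Liouville problems *)

Section WeightedSpace.
Context {R : realType}.
Variables (a al : R).
Hypotheses (al0 : 0 < al) (a0 : 0 < a) (api : a < pi).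
Implicit Types (b c d x y : R) (f g h u v z : R -> R).
Notation I := (@lintegral_ab R).
Notation w := (rho a al).

Definition wip f g := I 0 pi (fun s => w s * f s * g s).
Notation ip := wip.
Definition rho_min : R := Num.min 1 (al ^+ 2).

Lemma rho_min_gt0 : 0 < rho_min.
Proof. by rewrite /rho_min lt_min ltr01 exprn_gt0. Qed.

Lemma rho_ge x : rho_min <= w x.
Proof. by rewrite /rho_min /rho; case: ifP => _; rewrite ge_min lexx ?orbT. Qed.

Lemma rho_gt0 x : 0 < w x.
Proof. exact: lt_le_trans rho_min_gt0 (rho_ge x). Qed.

Lemma rho_le x : w x <= 1 + al ^+ 2.
Proof. by rewrite /rho; case: ifP => _; rewrite ?lerDl ?lerDr ?sqr_ge0. Qed.

Lemma BM_rho b c : BM b c w.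
Proof.
split; last by exists (1 + al ^+ 2) => x _; rewrite gtr0_norm ?rho_gt0 // rho_le.
apply: measurable_fun_if => //.
exact: (measurable_fun_ler (@measurable_id _ _ _) (measurable_cst a)).
Qed.

Notation L2p := (L2 0 pi).

Lemma ip_L1 f g : L2p f -> L2p g -> L1 0 pi (fun s => w s * f s * g s).
Proof.
move=> hf hg; apply: L1_ext (BM_L1M (BM_rho 0 pi) (L2M hf hg)) => x _.
by rewrite mulrA.
Qed.

Lemma ipC f g : ip f g = ip g f.
Proof. by apply: I_ext => x _; ring. Qed.

Lemma ipDl f g h : L2p f -> L2p g -> L2p h -> ip (fun x => f x + g x) h = ip f h + ip g h.
Proof.
move=> hf hg hh; rewrite /wip -ID; [|exact: ip_L1|exact: ip_L1].
by apply: I_ext => x _; ring.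
Qed.

Lemma ipZl k f h : L2p f -> L2p h -> ip (fun x => k * f x) h = k * ip f h.
Proof.
move=> hf hh; rewrite /wip -IZ; [|exact: ip_L1].
by apply: I_ext => x _; ring.
Qed.

Lemma ipBl f g h : L2p f -> L2p g -> L2p h -> ip (fun x => f x - g x) h = ip f h - ip g h.
Proof.
move=> hf hg hh; rewrite /wip -IB; [|exact: ip_L1|exact: ip_L1].
by apply: I_ext => x _; ring.
Qed.

Lemma ipDr f g h : L2p f -> L2p g -> L2p h -> ip h (fun x => f x + g x) = ip h f + ip h g.
Proof. by move=> hf hg hh; rewrite ipC ipDl // ![ip _ h]ipC. Qed.
Lemma ipZr k f h : L2p f -> L2p h -> ip h (fun x => k * f x) = k * ip h f.
Proof. by move=> hf hh; rewrite ipC ipZl // [ip _ h]ipC. Qed.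
Lemma ipBr f g h : L2p f -> L2p g -> L2p h -> ip h (fun x => f x - g x) = ip h f - ip h g.
Proof. by move=> hf hg hh; rewrite ipC ipBl // ![ip _ h]ipC. Qed.

Lemma ip_suml (F : nat -> R -> R) m n h : (forall i, L2p (F i)) -> L2p h ->
  ip (fun x => \sum_(m <= i < n) F i x) h = \sum_(m <= i < n) ip (F i) h.
Proof.
move=> hF hh; rewrite /wip.
have [_ <-] := @I_sum _ 0 pi (fun i x => w x * F i x * h x) m n (fun i => ip_L1 (hF i) hh).
by apply: I_ext => x _; rewrite mulr_sumr mulr_suml.
Qed.

Lemma ip_ext f g f' g' : (forall x, 0 <= x <= pi -> f x = f' x) ->
  (forall x, 0 <= x <= pi -> g x = g' x) -> ip f g = ip f' g'.
Proof. by move=> ff gg; apply: I_ext => x h; rewrite ff // gg. Qed.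

Lemma ip_ge0 f : 0 <= ip f f.
Proof.
by apply: I_ge0 => x _; rewrite -mulrA mulr_ge0 ?(ltW (rho_gt0 _)) // -expr2 sqr_ge0.
Qed.

Lemma ip_CS f g : L2p f -> L2p g -> ip f g ^+ 2 <= ip f f * ip g g.
Proof.
move=> hf hg.
have := CauchySchwarz (BM_rho 0 pi) (fun x _ => ltW (rho_gt0 x)) hf hg.
by congr (_ <= _ * _); apply: I_ext => x _; ring.
Qed.

Lemma ip_amgm f g : L2p f -> L2p g -> 2 * `|ip f g| <= ip f f + ip g g.
Proof.
move=> hf hg; have h := ip_CS hf hg; have f0 := ip_ge0 f; have g0 := ip_ge0 g.
rewrite -(ler_pXn2r (n:=2)) ?nnegrE ?addr_ge0 ?mulr_ge0 //.
rewrite exprMn real_normK ?num_real //.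
have : 0 <= (ip f f - ip g g) ^+ 2 by exact: sqr_ge0.
nra.
Qed.

Lemma I_le_ip f : L2p f -> I 0 pi (fun x => f x ^+ 2) <= rho_min^-1 * ip f f.
Proof.
move=> hf; rewrite mulrC ler_pdivlMr ?rho_min_gt0 // mulrC -IZ; last exact: hf.2.
apply: I_le => [||x _]; [by apply: L1Z; exact: hf.2|exact: ip_L1|].
by rewrite -mulrA -expr2 ler_wpM2r ?sqr_ge0 ?rho_ge.
Qed.

Lemma ip_le_I f : L2p f -> ip f f <= (1 + al ^+ 2) * I 0 pi (fun x => f x ^+ 2).
Proof.
move=> hf; rewrite -IZ; last exact: hf.2.
apply: I_le => [||x _]; [exact: ip_L1|by apply: L1Z; exact: hf.2|].
by rewrite -mulrA -expr2 ler_wpM2r ?sqr_ge0 ?rho_le.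
Qed.

Lemma ip0_orth f g : L2p f -> L2p g -> ip f f = 0 -> ip f g = 0.
Proof.
move=> hf hg f0; have := ip_CS hf hg; rewrite f0 mul0r => h.
by apply/eqP; rewrite -sqrf_eq0 eq_le h sqr_ge0.
Qed.

End WeightedSpace.

Section Auxiliary.
Context {R : realType}.
Notation mu := (@lebesgue_measure R).
Notation I := (@lintegral_ab R).

Lemma ae_neq (c : R) : {ae mu, forall x, x != c}.
Proof.
exists [set c]; split => //; first exact: lebesgue_measure_set1.
by move=> x /= /negP; rewrite negbK => /eqP.
Qed.

(** Equality is asked on the open interval only; the two endpoints form a null set. *)
Lemma I_ae (b c : R) (f g : R -> R) : Mf b c f -> Mf b c g ->
  {ae mu, forall x, b < x < c -> f x = g x} -> I b c f = I b c g.
Proof.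
move=> mf mg h; rewrite /lintegral_ab /Rintegral; congr fine.
apply: ae_eq_integral => //; [exact/measurable_EFinP|exact/measurable_EFinP|].
apply: ae_mp (ae_and h (ae_and (ae_neq b) (ae_neq c))) => x [hx [xb xc]].
rewrite ccE => /andP[bx cx]; congr (_%:E); apply: hx.
by rewrite !lt_neqAle bx cx xc eq_sym xb.
Qed.

Lemma bounded_tail (b : nat -> R) K : (forall n, 0 <= b n) ->
  (forall n, \sum_(0 <= i < n) b i <= K) ->
  forall e, 0 < e -> exists N, forall m n, (N <= m)%N -> \sum_(m <= i < n) b i <= e.
Proof.
move=> b0 hK e e0.
have cv : cvgn (series b).
  apply: nondecreasing_is_cvgn; first by apply: nondecreasing_series => n _ _.
  by exists K => _ [n _ <-]; exact: hK.
have ub n : series b n <= limn (series b).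
  by apply: nondecreasing_cvgn_le => //; apply: nondecreasing_series => k _ _.
move/cvgrPdist_le: (cv) => /(_ _ e0)[N _ hN]; exists N => m n Nm.
have [mn|nm] := leqP m n; last by rewrite big_geq ?ltW // ltnW.
have := hN m Nm; rewrite /= => /(le_trans (ler_norm _)) h.
have e1 : series b n = series b m + \sum_(m <= i < n) b i.
  by rewrite /series /= (@big_cat_nat _ _ _ m 0 n).
have := ub n; rewrite e1; lra.
Qed.

End Auxiliary.

(** * The boundary value problem as an operator: identities and a priori bounds *)

Section SturmLiouville.
Context {R : realType}.
Variables (q : R -> R) (a al : R).
Hypotheses (al0 : 0 < al) (a0 : 0 < a) (api : a < pi) (hq : L2 0 pi q).
Implicit Types (d x : R) (f g h u v z y : R -> R).
Notation mu := (@lebesgue_measure R).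
Notation I := (@lintegral_ab R).
Notation w := (rho a al).
Notation ip := (wip a al).
Notation L2p := (L2 0 pi).
Let pi0 : 0 <= pi :> R := pi_ge0 R.

(* [z' = z1] and [- z'' + q z = rho g] *)
Definition Equation z z1 g :=
  AC 0 pi z z1 /\ AC 0 pi z1 (fun s => q s * z s - w s * g s).

(** The graph of the operator [L z = (- z'' + q z) / rho] with both boundary conditions: [z] lies in
    its domain and [L z = g]. *)
Definition Dom z z1 g :=
  [/\ Equation z z1 g, z1 0 = 0, z pi = 0 & L2p g].

Lemma is_solE nu z z1 : is_sol q a al nu z z1 <-> Equation z z1 (fun x => nu * z x).
Proof.
split=> [[h1 [h2 h3]]|[[h1 h2] [h3 h4]]].
  split; first by split => // x /h3[].
  have e x : (q x - nu * w x) * z x = q x * z x - w x * (nu * z x) by ring.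
  split; first by apply: L1_ext h2 => x _; rewrite e.
  by move=> x /h3[_ ->]; congr (_ + _); apply: I_ext => t _; rewrite e.
have e x : (q x - nu * w x) * z x = q x * z x - w x * (nu * z x) by ring.
split=> //; split; first by apply: L1_ext h3 => x _; rewrite e.
move=> x xp; split; first exact: h2.
by rewrite h4 //; congr (_ + _); apply: I_ext => t _; rewrite e.
Qed.

Lemma Equation_BM z z1 g : Equation z z1 g -> BM 0 pi z /\ BM 0 pi z1.
Proof. by move=> [h1 h2]; split; [exact: AC_BM h1|exact: AC_BM h2]. Qed.

Lemma Equation_L2 z z1 g : Equation z z1 g -> L2p z /\ L2p z1.
Proof. by move/Equation_BM => [h1 h2]; split; exact: BM_L2. Qed.

Lemma Equation_lin z z1 g y y1 h k : Equation z z1 g -> Equation y y1 h ->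
  Equation (fun x => z x + k * y x) (fun x => z1 x + k * y1 x) (fun x => g x + k * h x).
Proof.
move=> [h1 h2] [h3 h4]; split; first exact: AC_D h1 (AC_Z k h3).
by apply: AC_ext (AC_D h2 (AC_Z k h4)) => // x _ /=; ring.
Qed.

Lemma Equation_ext z z1 g g' : (forall x, 0 <= x <= pi -> g x = g' x) ->
  Equation z z1 g -> Equation z z1 g'.
Proof.
move=> gg [h1 h2]; split => //.
by apply: AC_ext h2 => // x xp; rewrite gg.
Qed.

Lemma Dom_lin z z1 g y y1 h k : Dom z z1 g -> Dom y y1 h ->
  Dom (fun x => z x + k * y x) (fun x => z1 x + k * y1 x) (fun x => g x + k * h x).
Proof.
move=> [h1 h2 h3 h4] [h5 h6 h7 h8]; split.
- exact: Equation_lin.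
- by rewrite h2 h6 mulr0 addr0.
- by rewrite h3 h7 mulr0 addr0.
- exact: L2D h4 (L2Z k h8).
Qed.

Lemma Dom_L2 z z1 g : Dom z z1 g -> L2p z.
Proof. by move=> [/Equation_L2[]]. Qed.

(** The Wronskian [z * y1 - z1 * y] has the density [w * (g * y - z * h)]. *)
Lemma Lagrange z z1 g y y1 h : Equation z z1 g -> Equation y y1 h -> L2p g -> L2p h ->
  ip g y - ip z h = (z pi * y1 pi - z1 pi * y pi) - (z 0 * y1 0 - z1 0 * y 0).
Proof.
move=> hz hy hg hh.
have [z2 z12] := Equation_L2 hz; have [y2 y12] := Equation_L2 hy.
have h1 := AC_B (AC_mul hz.1 hy.2) (AC_mul hz.2 hy.1).
have := h1.2 pi; rewrite pi0 lexx => /(_ isT) ->.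
rewrite [RHS]addrAC subrr add0r /wip -IB; [|exact: ip_L1|exact: ip_L1].
by apply: I_ext => x _; ring.
Qed.

Lemma Dom_sym z z1 g y y1 h : Dom z z1 g -> Dom y y1 h -> ip g y = ip z h.
Proof.
move=> [h1 h2 h3 h4] [h5 h6 h7 h8]; apply/eqP; rewrite -subr_eq0 (Lagrange h1 h5) //.
by rewrite h2 h3 h6 h7; apply/eqP; ring.
Qed.

(** Because [z pi = 0], the square [z x ^ 2] is the integral of [- 2 * z * z1] over [[x, pi]]. The
    weighted inequality between the means leaves [d] free, so that the derivative term can be made
    small. *)
Lemma Dom_sup z z1 g d x : Dom z z1 g -> 0 < d -> 0 <= x <= pi ->
  z x ^+ 2 <= d * I 0 pi (fun t => z1 t ^+ 2) + d^-1 * I 0 pi (fun t => z t ^+ 2).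
Proof.
move=> [hz z10 zpi _] d0 /andP[x0 xpi].
have [bz bz1] := Equation_BM hz.
have h := AC_mul hz.1 hz.1.
have := AC_incr h x0 xpi (lexx _); rewrite zpi mul0r sub0r.
have hs : L1 x pi (fun t => z1 t * z t + z t * z1 t) by apply: L1_sub h.1.
move=> e; have -> : z x ^+ 2 = `|I x pi (fun t => z1 t * z t + z t * z1 t)|.
  by rewrite -e normrN -expr2 ger0_norm ?sqr_ge0.
apply: le_trans (I_abs hs) _.
have hs1 : L1 0 pi (fun t => d * z1 t ^+ 2) by apply: L1Z; exact: (BM_L2 bz1).2.
have hs2 : L1 0 pi (fun t => d^-1 * z t ^+ 2) by apply: L1Z; exact: (BM_L2 bz).2.
rewrite -IZ; [|exact: (BM_L2 bz1).2]; rewrite -IZ; [|exact: (BM_L2 bz).2]; rewrite -ID //.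
have hs3 := L1D hs1 hs2.
have di : 0 < d^-1 by rewrite invr_gt0.
have dd : d * d^-1 = 1 by rewrite divff ?gt_eqF.
have key t : `|z1 t * z t + z t * z1 t| <= d * z1 t ^+ 2 + d^-1 * z t ^+ 2.
  move: d0 di dd (z1 t) (z t); move: (d^-1) => e' d0 e0 dd p s.
  have k1 : 0 <= d * (p - e' * s) ^+ 2 by rewrite mulr_ge0 ?sqr_ge0 ?(ltW d0).
  have k2 : 0 <= d * (p + e' * s) ^+ 2 by rewrite mulr_ge0 ?sqr_ge0 ?(ltW d0).
  have e1 : d * (p - e' * s) ^+ 2 = d * p ^+ 2 - 2 * p * s + e' * s ^+ 2.
    by transitivity (d * p ^+ 2 - 2 * (d * e') * p * s + (d * e') * e' * s ^+ 2); [ring|rewrite dd; ring].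
  have e2 : d * (p + e' * s) ^+ 2 = d * p ^+ 2 + 2 * p * s + e' * s ^+ 2.
    by transitivity (d * p ^+ 2 + 2 * (d * e') * p * s + (d * e') * e' * s ^+ 2); [ring|rewrite dd; ring].
  by rewrite ler_norml; apply/andP; split; clear - k1 k2 e1 e2; lra.
rewrite [leRHS](I_split x0 xpi hs3).
have ge0 t : 0 <= d * z1 t ^+ 2 + d^-1 * z t ^+ 2 by apply: le_trans (key t).
rewrite -[leLHS]add0r lerD //; first by apply: I_ge0 => t _.
by apply: I_le => [||t _]; [exact: L1_abs|exact: L1_sub hs3|].
Qed.

Definition qnorm := I 0 pi (fun t => `|q t|).
(** A number below the spectrum. With [k = 2 * qnorm + 1] the potential costs at most half of the
    derivative term plus [qnorm * k / rho_min] times [ip z z]; the final [- 1] leaves a full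
    [ip z z] in the coercivity estimate. *)
Definition nu0 : R := - (qnorm * (2 * qnorm + 1)) / rho_min al - 1.

Lemma qnorm_ge0 : 0 <= qnorm.
Proof. exact: I_ge0. Qed.

Lemma nu0_lt0 : nu0 < 0.
Proof.
have Q0 := qnorm_ge0; have m0 := rho_min_gt0 al0.
have : 0 <= (qnorm * (2 * qnorm + 1)) / rho_min al.
  by rewrite divr_ge0 ?mulr_ge0 ?addr_ge0 ?mulr_ge0 // ltW.
rewrite /nu0 mulNr; lra.
Qed.

Lemma energy z z1 g : Dom z z1 g ->
  ip g z = I 0 pi (fun t => z1 t ^+ 2) + I 0 pi (fun t => q t * z t ^+ 2).
Proof.
move=> [hz z10 zpi hg].
have [bz bz1] := Equation_BM hz.
have h := AC_mul hz.1 hz.2.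
have := h.2 pi; rewrite pi0 lexx zpi z10 mulr0 mul0r add0r => /(_ isT) e.
have hq2 : L1 0 pi (fun t => q t * z t ^+ 2) by apply: L1_BM; [exact: L2_L1|exact: BMX].
have hz1 := (BM_L2 bz1).2.
have hi := ip_L1 a al0 hg (BM_L2 bz).
rewrite -ID //; apply/eqP; rewrite -subr_eq0 -opprB oppr_eq0 -IB //; last exact: L1D.
by rewrite [X in _ == X]e; apply/eqP; apply: I_ext => x _; ring.
Qed.

(** The pointwise bound with [d = k^-1], integrated against [|q|], absorbs the potential into half
    of the derivative term. *)
Lemma coercive z z1 g : Dom z z1 g ->
  2^-1 * I 0 pi (fun t => z1 t ^+ 2) + ip z z <= ip (fun x => g x - nu0 * z x) z.
Proof.
move=> hD; have [hz z10 zpi hg] := hD.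
have [bz bz1] := Equation_BM hz.
rewrite ipBl //; [|exact: L2Z (BM_L2 bz)|exact: BM_L2]; rewrite ipZl //; [|exact: BM_L2|exact: BM_L2].
rewrite (energy hD).
set A := I 0 pi (fun t => z1 t ^+ 2); set B := I 0 pi (fun t => z t ^+ 2).
have A0 : 0 <= A by apply: I_ge0 => *; exact: sqr_ge0.
have B0 : 0 <= B by apply: I_ge0 => *; exact: sqr_ge0.
have Q0 := qnorm_ge0.
pose k := 2 * qnorm + 1; have k0 : 0 < k by rewrite /k; lra.
have hq2 : L1 0 pi (fun t => q t * z t ^+ 2) by apply: L1_BM; [exact: L2_L1|exact: BMX].
have h1 : `|I 0 pi (fun t => q t * z t ^+ 2)| <= qnorm * (k^-1 * A + k * B).
  apply: le_trans (I_abs hq2) _; rewrite mulrC /qnorm -IZ; last exact/L1_abs/L2_L1.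
  apply: I_le => [||t tp]; [exact: L1_abs|exact/L1Z/L1_abs/L2_L1|].
  rewrite normrM mulrC ler_wpM2r // ger0_norm ?sqr_ge0 //.
  have ki : 0 < k^-1 by rewrite invr_gt0.
  by have := Dom_sup hD ki tp; rewrite invrK.
have h2 : qnorm * (k^-1 * A) <= 2^-1 * A.
  by rewrite mulrA ler_wpM2r // ler_pdivrMr // /k; lra.
have h3 : qnorm * (k * B) <= (qnorm * k / rho_min al) * ip z z.
  by rewrite mulrA -[qnorm * k / _ * _]mulrA ler_wpM2l ?mulr_ge0 ?(ltW k0) //; apply: I_le_ip => //; exact: BM_L2.
have -> : nu0 = - (qnorm * k / rho_min al) - 1 by rewrite /nu0 mulNr.
move: h1; rewrite ler_norml mulrDr => /andP[h1 _].
move: h1 h2 h3; move: (I 0 pi _) (qnorm * (k^-1 * A)) (qnorm * (k * B)) (ip z z) (qnorm * k / _) => X Y Z W V h1 h2 h3.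
by lra.
Qed.

Lemma Dom_bound z z1 g : Dom z z1 g ->
  let G := ip (fun x => g x - nu0 * z x) (fun x => g x - nu0 * z x) in
  ip z z <= G /\ I 0 pi (fun t => z1 t ^+ 2) <= 2 * G.
Proof.
move=> hD /=; have [hz z10 zpi hg] := hD; have [z2 _] := Equation_L2 hz.
have h := coercive hD; have g2 : L2p (fun x => g x - nu0 * z x) by exact: L2B hg (L2Z _ z2).
have := ip_amgm a al0 g2 z2; have := ler_norm (ip (fun x => g x - nu0 * z x) z).
have Z0 := ip_ge0 a al0 z.
have A0 : 0 <= I 0 pi (fun t => z1 t ^+ 2) by apply: I_ge0 => *; exact: sqr_ge0.
move: h A0 Z0; set G := ip _ (fun x => g x - _); set X := ip _ z; set Z := ip z z; set W := I 0 pi _.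
by move=> h A0 Z0 h1 h2; split; lra.
Qed.

Definition sup_const : R := 2 + (rho_min al)^-1.

(** A Sobolev bound by the norm of [(L - nu0) z]. It turns L2 convergence of the images into uniform
    convergence in the domain. *)
Lemma Dom_sup_bound z z1 g x : Dom z z1 g -> 0 <= x <= pi ->
  z x ^+ 2 <= sup_const * ip (fun x => g x - nu0 * z x) (fun x => g x - nu0 * z x).
Proof.
move=> hD xp; have [h1 h2] := Dom_bound hD.
have := Dom_sup hD ltr01 xp; rewrite invr1 !mul1r => /le_trans; apply.
rewrite /sup_const mulrDl lerD //.
apply: le_trans (I_le_ip a al0 (Dom_L2 hD)) _.
by rewrite ler_wpM2l // invr_ge0 ltW // rho_min_gt0.
Qed.

Lemma Picard_Equation nu f c0 c1 : L2p f -> exists z z1,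
  [/\ Equation z z1 (fun x => f x + nu * z x), z 0 = c0 & z1 0 = c1].
Proof.
move=> hf; have hp : L2p (fun s => q s - nu * w s) by apply: L2B => //; exact/L2Z/BM_L2/BM_rho.
have hr : L1 0 pi (fun s => - (w s * f s)) by apply/L1N/BM_L1M; [exact: BM_rho|exact: L2_L1].
have [z [z1 [h1 h2 h3 h4]]] := Picard c0 c1 pi0 hp hr.
exists z, z1; split => //; split => //.
by apply: AC_ext h2 => // x _; ring.
Qed.

Lemma Equation_bound nu : exists2 C, 0 <= C & forall z z1 f, L2p f ->
  Equation z z1 (fun x => f x + nu * z x) -> z 0 = 0 -> z1 0 = 0 ->
  forall x, 0 <= x <= pi -> z x ^+ 2 <= C * ip f f.
Proof.
have hp : L2p (fun s => q s - nu * w s) by apply: L2B => //; exact/L2Z/BM_L2/BM_rho.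
have [C [C0 hC]] := Volterra_bound pi0 hp.
pose W := I 0 pi (fun t => w t * 1 ^+ 2).
have W0 : 0 <= W by apply: I_ge0 => t _; rewrite mulr_ge0 ?sqr_ge0 // ltW // rho_gt0.
exists (C * W); first by rewrite mulr_ge0.
move=> z z1 f hf [h1 h2] z0 z10 x xp.
have hwf : L1 0 pi (fun s => w s * f s) by apply: BM_L1M; [exact: BM_rho|exact: L2_L1].
have h2' : AC 0 pi z1 (fun s => (q s - nu * w s) * z s + - (w s * f s)).
  by apply: AC_ext h2 => // t _; ring.
apply: le_trans (hC _ _ _ (L1N hwf) h1 h2' z0 z10 x xp) _.
rewrite -mulrA ler_wpM2l //.
have one2 : L2p (fun _ => 1 : R) by exact/BM_L2/BM_cst.
have fa2 : L2p (fun t => `|f t|).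
  by split; [exact: Mf_abs hf.1|apply: L1_ext hf.2 => t _; rewrite real_normK ?num_real].
have := CauchySchwarz (BM_rho a al0 0 pi) (fun t _ => ltW (rho_gt0 a al0 t)) one2 fa2.
rewrite -/W; congr (_ ^+ 2 <= _ * _); apply: I_ext => t _.
  by rewrite normrN normrM gtr0_norm ?rho_gt0 // mulr1.
by rewrite real_normK ?num_real //; ring.
Qed.

Lemma Equation_unique nu z z1 y y1 : Equation z z1 (fun x => nu * z x) ->
  Equation y y1 (fun x => nu * y x) -> z 0 = y 0 -> z1 0 = y1 0 ->
  forall x, 0 <= x <= pi -> z x = y x /\ z1 x = y1 x.
Proof.
have hp : L2p (fun s => q s - nu * w s) by apply: L2B => //; exact/L2Z/BM_L2/BM_rho.
move=> [h1 h2] [h3 h4]; apply: (Volterra_unique pi0 hp (BM_L1 (BM_cst 0 pi 0))) => //.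
  by apply: AC_ext h2 => // t _; ring.
by apply: AC_ext h4 => // t _; ring.
Qed.

(** * Eigenfunctions: completeness and expansion *)

Section Spectrum.
Variables (phi phi1 : R -> R -> R) (lam : nat -> R).
Hypothesis hphi : forall l, is_sol q a al (l ^+ 2) (fun x => phi x l) (fun x => phi1 x l) /\
  phi 0 l = 1 /\ phi1 0 l = 0.
Hypothesis lam_ge0 : forall n, 0 <= lam n.
Hypothesis lamS : forall n, lam n < lam n.+1.
Hypothesis eigP : forall nu, is_eigenvalue q a al nu <-> exists n, nu = lam n ^+ 2.

Definition eigenfun n x := phi x (lam n).
Definition norming n := ip (eigenfun n) (eigenfun n).
Notation ef := eigenfun.
Notation alpha := norming.

Lemma phi_Equation l : Equation (fun x => phi x l) (fun x => phi1 x l) (fun x => l ^+ 2 * phi x l).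
Proof. by have [/is_solE] := hphi l. Qed.

Lemma phi_BM l : BM 0 pi (fun x => phi x l).
Proof. by have [] := Equation_BM (phi_Equation l). Qed.

Lemma phi_L2 l : L2p (fun x => phi x l).
Proof. exact/BM_L2/phi_BM. Qed.

Lemma ef_L2 n : L2p (ef n). Proof. exact: phi_L2. Qed.

Lemma lam_lt m n : (m < n)%N -> lam m < lam n.
Proof.
elim: n => // n IH; rewrite ltnS leq_eqVlt => /predU1P[->//|/IH h].
exact: lt_trans h (lamS n).
Qed.

Lemma lam_sq_inj m n : lam m ^+ 2 = lam n ^+ 2 -> m = n.
Proof.
move=> /eqP; rewrite eqrXn2 // => /eqP h.
by case: (ltngtP m n) => // /lam_lt; rewrite h ltxx.
Qed.

(** Eigenvalues are simple: the condition at 0 fixes a solution up to a factor, so [z] is a multiple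
    of an eigenfunction. *)
Lemma eigen_unique nu z z1 : is_eigenvalue q a al nu ->
  Equation z z1 (fun x => nu * z x) -> z1 0 = 0 -> z pi = 0.
Proof.
move=> [y [y1 [/is_solE hy [y10 [ypi [x [xp yx]]]]]]] hz z10.
(* Zero initial data would make the eigenfunction [y] vanish; the zero solution is written [0 * z]
   for comparison. *)
have [y0|y0] := eqVneq (y 0) 0.
  have h0 : Equation (fun x => 0 * z x) (fun x => 0 * z1 x) (fun x => nu * (0 * z x)).
    split; first exact: AC_Z hz.1.
    by apply: AC_ext (AC_Z 0 hz.2) => // t _; ring.
  have [e _] := Equation_unique hy h0 (etrans y0 (esym (mul0r _))) (etrans y10 (esym (mul0r _))) xp.
  by rewrite e mul0r eqxx in yx.
have h1 : Equation (fun x => z 0 / y 0 * y x) (fun x => z 0 / y 0 * y1 x) (fun x => nu * (z 0 / y 0 * y x)).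
  split; first exact: AC_Z hy.1.
  by apply: AC_ext (AC_Z (z 0 / y 0) hy.2) => // t _; ring.
have ppi : 0 <= (pi : R) <= pi by rewrite pi0 lexx.
have e0 : z 0 = z 0 / y 0 * y 0 by rewrite divfK.
have e1 : z1 0 = z 0 / y 0 * y1 0 by rewrite y10 z10 mulr0.
by have [-> _] := Equation_unique hz h1 e0 e1 ppi; rewrite ypi mulr0.
Qed.

Lemma ef_pi n : phi pi (lam n) = 0.
Proof.
have [_ [_ h]] := hphi (lam n).
by apply: (eigen_unique _ (phi_Equation (lam n)) h); apply/eigP; exists n.
Qed.

Lemma ef_Dom n : Dom (ef n) (fun x => phi1 x (lam n)) (fun x => lam n ^+ 2 * ef n x).
Proof.
have [_ [_ h]] := hphi (lam n); split => //; [exact: phi_Equation|exact: ef_pi|exact/L2Z/ef_L2].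
Qed.

Lemma Dom_coef z z1 g n : Dom z z1 g -> ip g (ef n) = lam n ^+ 2 * ip z (ef n).
Proof.
move=> hz; rewrite (Dom_sym hz (ef_Dom n)) ipZr //; [exact: ef_L2|exact: Dom_L2 hz].
Qed.

Lemma ef_orth m n : m != n -> ip (ef m) (ef n) = 0.
Proof.
move=> mn; have := Dom_coef n (ef_Dom m); rewrite ipZl; [|exact: al0|exact: ef_L2|exact: ef_L2].
move/eqP; rewrite -subr_eq0 -mulrBl mulf_eq0 subr_eq0 => /orP[/eqP/lam_sq_inj h|/eqP //].
by rewrite h eqxx in mn.
Qed.

(** The Sobolev bound at [x = 0], where the eigenfunction equals 1, excludes a vanishing norm. *)
Lemma alpha_gt0 n : 0 < alpha n.
Proof.
rewrite lt_def ip_ge0 // andbT; apply/eqP => h.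
have h0 : 0 <= (0 : R) <= pi by rewrite lexx.
have := Dom_sup_bound (ef_Dom n) h0.
have e : ip (fun x => lam n ^+ 2 * ef n x - nu0 * ef n x) (fun x => lam n ^+ 2 * ef n x - nu0 * ef n x)
   = (lam n ^+ 2 - nu0) ^+ 2 * alpha n.
  rewrite -(@ip_ext _ a al (fun x => (lam n ^+ 2 - nu0) * ef n x) (fun x => (lam n ^+ 2 - nu0) * ef n x));
    [|by move=> x _; ring|by move=> x _; ring].
  rewrite ipZl ?ipZr //; [|exact: ef_L2|exact: ef_L2|exact: ef_L2|exact/L2Z/ef_L2].
  by rewrite mulrA -expr2.
have [_ [e0 _]] := hphi (lam n).
by rewrite e h !mulr0 /eigenfun e0 expr1n ler10.
Qed.

(** Fredholm alternative for sources orthogonal to every eigenfunction, with a bound uniform in [f]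
    at every real [nu]. The solution [Y] with zero initial data is corrected by a multiple of a
    homogeneous solution. *)
Lemma solvable nu : exists2 C, 1 <= C & forall f, L2p f -> (forall n, ip f (ef n) = 0) ->
  exists z z1, [/\ Dom z z1 (fun x => f x + nu * z x), forall n, ip z (ef n) = 0
    & ip z z <= C * ip f f].
Proof.
have [C0 C00 hC0] := Equation_bound nu.
have L20 : L2p (fun _ => 0 : R) by exact/BM_L2/BM_cst.
have [p [p1 [hp' p0 p10]]] := Picard_Equation nu 1 0 L20.
have hp : Equation p p1 (fun x => nu * p x) by apply: Equation_ext hp' => x _; rewrite add0r.
have [s [s1 [hs' s0 s10]]] := Picard_Equation nu 0 1 L20.
have hs : Equation s s1 (fun x => nu * s x) by apply: Equation_ext hs' => x _; rewrite add0r.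
have [p2 _] := Equation_L2 hp; have [s2 _] := Equation_L2 hs.
pose W := I 0 pi (fun t => w t); have W0 : 0 <= W by apply: I_ge0 => t _; rewrite ltW // rho_gt0.
pose D := p pi.
(* For [D = 0] the quotient is 0 by convention, so that one constant covers both cases. *)
pose C := 1 + 2 * (W * C0) + 2 * (C0 / D ^+ 2) * ip p p.
have pp0 := ip_ge0 a al0 p.
have C1 : 1 <= C.
  rewrite /C -addrA lerDl addr_ge0 ?mulr_ge0 //.
  by rewrite invr_ge0 sqr_ge0.
exists C => // f hf hfo.
have [Y [Y1 [hY Y0 Y10]]] := Picard_Equation nu 0 0 hf.
have [Y2 _] := Equation_L2 hY.
have ff0 := ip_ge0 a al0 f.
have YY : ip Y Y <= W * C0 * ip f f.
  rewrite -mulrA mulrC /W -IZ; last exact/BM_L1/BM_rho.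
  apply: I_le => [||x xp]; [exact: ip_L1|exact/L1Z/BM_L1/BM_rho|].
  by rewrite -mulrA mulrC -expr2 ler_wpM2r ?(ltW (rho_gt0 _ _ _)) //; exact: hC0 hY Y0 Y10 x xp.
have main z z1 : Dom z z1 (fun x => f x + nu * z x) ->
    forall n, (lam n ^+ 2 - nu) * ip z (ef n) = 0.
  move=> hz n; have := Dom_coef n hz; have z2 := Dom_L2 hz.
  rewrite ipDl //; [|exact/L2Z|exact: ef_L2].
  by rewrite hfo add0r ipZl //; [move=> h; rewrite mulrBl -h subrr|exact: ef_L2].
have [D0|D0] := eqVneq D 0.
  have [m hm] : exists m, nu = lam m ^+ 2.
    apply/eigP; exists p, p1; split; first exact/is_solE.
    split => //; split => //; exists 0; split; first by rewrite lexx.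
    by rewrite p0 oner_neq0.
  have pm x : 0 <= x <= pi -> p x = ef m x.
    move=> xp; have [_ [f0 f10]] := hphi (lam m).
    have hm' := phi_Equation (lam m); rewrite -hm in hm'.
    by have [] := Equation_unique hp hm' (etrans p0 (esym f0)) (etrans p10 (esym f10)) xp.
  (* The Wronskian of the fundamental solutions [p] and [s] is constant and equals 1 at 0; with
     [p pi = 0] it reduces to [- p1 pi * s pi] at [pi]. *)
  have p1pi : p1 pi != 0.
    apply/eqP => h; have := Lagrange hp hs (L2Z nu p2) (L2Z nu s2).
    rewrite -/D D0 h p0 p10 s0 s10 ipZl // ipZr // subrr !mul0r !subr0 mulr1.
    by move/eqP; rewrite sub0r eq_sym oppr_eq0 oner_eq0.
  (* At an eigenvalue, Lagrange's identity with [p] expresses [Y pi * p1 pi] through [ip f p], which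
     vanishes since [p] is the eigenfunction [ef m]. *)
  have Ypi : Y pi = 0.
    have := Lagrange hY hp (L2D hf (L2Z nu Y2)) (L2Z nu p2).
    rewrite -/D D0 Y0 Y10 !mul0r mulr0 !subr0 ipDl //; last exact: L2Z.
    rewrite ipZl // ipZr // addrK.
    rewrite (@ip_ext _ a al f p f (ef m)) // hfo => /esym/eqP.
    by rewrite mulf_eq0 (negbTE p1pi) orbF => /eqP.
  have am := alpha_gt0 m.
  (* Only the component along [ef m] has to be removed; orthogonality to the other eigenfunctions
     follows from the equation. *)
  pose k := ip Y (ef m) / alpha m.
  have [_ [_ f10]] := hphi (lam m).
  have hz : Dom (fun x => Y x + (- k) * ef m x) (fun x => Y1 x + (- k) * phi1 x (lam m))
     (fun x => f x + nu * (Y x + (- k) * ef m x)).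
    split.
    - apply: Equation_ext (Equation_lin (- k) hY (phi_Equation (lam m))) => x _.
      by rewrite -hm /eigenfun; ring.
    - by rewrite Y10 f10 mulr0 addr0.
    - by rewrite Ypi /eigenfun ef_pi mulr0 addr0.
    - exact: L2D hf (L2Z nu (L2D Y2 (L2Z _ (ef_L2 m)))).
  have fm2 := L2Z (- k) (ef_L2 m).
  have zm : ip (fun x => Y x + (- k) * ef m x) (ef m) = 0.
    rewrite ipDl //; last exact: ef_L2.
    rewrite ipZl //; [|exact: ef_L2|exact: ef_L2].
    by rewrite /k mulNr divfK ?subrr // gt_eqF.
  exists (fun x => Y x + (- k) * ef m x), (fun x => Y1 x + (- k) * phi1 x (lam m)); split => //.
    move=> n; have [->//|nm] := eqVneq n m.
    have /eqP := main _ _ hz n; rewrite mulf_eq0 hm subr_eq0 => /orP[/eqP/lam_sq_inj h|/eqP //].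
    by rewrite h eqxx in nm.
  have z2 := Dom_L2 hz.
  have -> : ip (fun x => Y x + - k * ef m x) (fun x => Y x + - k * ef m x) = ip Y Y - k ^+ 2 * alpha m.
    rewrite [LHS]ipDr // (ipZr _ al0) //; last exact: ef_L2.
    rewrite zm mulr0 addr0 ipDl // ipZl //; last exact: ef_L2.
    rewrite [ip (ef m) Y]ipC; congr (_ + _).
    have -> : ip Y (ef m) = k * alpha m by rewrite /k divfK // gt_eqF.
    ring.
  apply: (@le_trans _ _ (ip Y Y)).
    by rewrite gerBl mulr_ge0 ?sqr_ge0 ?ltW.
  apply: le_trans YY _; rewrite ler_wpM2r // /C.
  have : 0 <= W * C0 by rewrite mulr_ge0.
  have : 0 <= 2 * (C0 / D ^+ 2) * ip p p by rewrite !mulr_ge0 // invr_ge0 sqr_ge0.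
  lra.
(* Away from the spectrum this multiple of [p] restores the boundary condition at [pi]. *)
pose k := Y pi / D.
have hz : Dom (fun x => Y x + (- k) * p x) (fun x => Y1 x + (- k) * p1 x)
   (fun x => f x + nu * (Y x + (- k) * p x)).
  split.
  - apply: Equation_ext (Equation_lin (- k) hY hp) => x _; ring.
  - by rewrite Y10 p10 mulr0 addr0.
  - by rewrite -/D /k mulNr divfK ?subrr.
  - exact: L2D hf (L2Z nu (L2D Y2 (L2Z _ p2))).
exists (fun x => Y x + (- k) * p x), (fun x => Y1 x + (- k) * p1 x); split => //.
  move=> n; have /eqP := main _ _ hz n; rewrite mulf_eq0 => /orP[|/eqP //].
  rewrite subr_eq0 => /eqP hn; exfalso; move/eqP: D0; apply.
  by apply: (eigen_unique _ hp p10); apply/eigP; exists n.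
have kp2 := L2Z (- k) p2.
have kk : k ^+ 2 <= C0 / D ^+ 2 * ip f f.
  rewrite /k expr_div_n [leRHS]mulrAC ler_wpM2r ?invr_ge0 ?sqr_ge0 //.
  by apply: (hC0 _ _ _ hf hY Y0 Y10); rewrite pi0 lexx.
rewrite [leLHS]ipDr //; last exact: L2D.
rewrite !ipDl // [ip (fun x => - k * p x) Y]ipC.
have h1 := ip_amgm a al0 Y2 kp2; have h2 := ler_norm (ip Y (fun x => - k * p x)).
have h3 : ip (fun x => - k * p x) (fun x => - k * p x) = k ^+ 2 * ip p p.
  rewrite ipZl // ipZr // mulrA; congr (_ * _); ring.
have h4 : k ^+ 2 * ip p p <= C0 / D ^+ 2 * ip f f * ip p p by rewrite ler_wpM2r.
rewrite h3 in h1 *.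
have -> : C * ip f f = ip f f + 2 * (W * C0 * ip f f) + 2 * (C0 / D ^+ 2 * ip f f * ip p p) by rewrite /C; ring.
lra.
Qed.

(** The property [P nu] says that the operator is at least [nu] on the domain vectors orthogonal to
    all eigenfunctions. It holds at [nu0], it can always be raised, and it passes to suprema; hence
    it holds for all [nu], which forces [y = 0]. *)
Lemma Dom_orth_zero y y1 g : Dom y y1 g -> (forall n, ip y (ef n) = 0) -> ip y y = 0.
Proof.
move=> hy hyo.
pose P nu := forall z z1 h, Dom z z1 h -> (forall n, ip z (ef n) = 0) -> nu * ip z z <= ip h z.
have Pdown nu nu' : nu' <= nu -> P nu -> P nu'.
  move=> nn hP z z1 h hz zo; apply: le_trans (hP _ _ _ hz zo).
  by rewrite ler_wpM2r // ip_ge0.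
have P0 : P nu0.
  move=> z z1 h hz zo; have := coercive hz; have z2 := Dom_L2 hz; have [_ _ _ h2] := hz.
  rewrite ipBl //; [|exact: L2Z]; rewrite ipZl //.
  have : 0 <= I 0 pi (fun t => z1 t ^+ 2) by apply: I_ge0 => *; exact: sqr_ge0.
  have := ip_ge0 a al0 z; lra.
(* Let [(L - nu) z = u] with resolvent constant [C]. Testing [P nu] with [u - z / C] gives [ip ((L -
   nu) u) u >= (2 / C) * ip u u - ip u z / C ^ 2], and [ip u z <= C * ip u u] leaves a gain of
   [1 / C]. *)
have step nu : P nu -> exists2 d, 0 < d & P (nu + d).
  move=> hP; have [C C1 hC] := solvable nu; have C0 : 0 < C by exact: lt_le_trans C1.
  exists C^-1; first by rewrite invr_gt0.
  move=> u u1 h hu uo; have u2 := Dom_L2 hu.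
  have [z [z1 [hz zo zz]]] := hC u u2 uo; have z2 := Dom_L2 hz; have [_ _ _ h2] := hu.
  have hD := Dom_lin (- C^-1) hu hz.
  have uzo n : ip (fun x => u x + - C^-1 * z x) (ef n) = 0.
    by rewrite ipDl ?ipZl //; [rewrite uo zo mulr0 addr0|exact: ef_L2|exact: L2Z|exact: ef_L2].
  have := hP _ _ _ hD uzo.
  have sym := Dom_sym hu hz; rewrite ipDr // in sym; last exact: L2Z.
  rewrite ipZr // in sym.
  have uz2 := L2D u2 (L2Z (- C^-1) z2); have guz2 := L2D u2 (L2Z nu z2).
  have nz2 := L2Z nu z2; have cz2 := L2Z (- C^-1) z2; have cg2 := L2Z (- C^-1) guz2.
  rewrite !(ipDl _ al0) // !(ipDr _ al0) // !(ipZl _ al0) // !(ipZr _ al0) // !(ipDl _ al0) // !(ipZl _ al0) //.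
  rewrite sym [ip z u]ipC => hh.
  have uz : ip u z <= C * ip u u.
    have uu0 := ip_ge0 a al0 u.
    apply: le_trans (ler_norm _) _; rewrite -(ler_pXn2r (n:=2)) ?nnegrE ?mulr_ge0 ?(ltW C0) //.
    rewrite real_normK ?num_real //; apply: le_trans (ip_CS a al0 u2 z2) _.
    apply: (@le_trans _ _ (ip u u * (C * ip u u))); first by rewrite ler_wpM2l.
    have -> : (C * ip u u) ^+ 2 = C * (ip u u * (C * ip u u)) by ring.
    by rewrite ler_peMl // mulr_ge0 // mulr_ge0 // ltW.
  have ci0 : 0 < C^-1 by rewrite invr_gt0.
  have cc : C^-1 * C = 1 by rewrite mulVf // gt_eqF.
  have h3 : C^-1 * (C^-1 * ip u z) <= C^-1 * ip u u.
    rewrite ler_wpM2l ?(ltW ci0) //; apply: le_trans (ler_wpM2l (ltW ci0) uz) _.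
    by rewrite mulrA cc mul1r.
  move: hh h3; move: (ip u u) (ip u z) (ip z z) (ip h u) (ip h z) (C^-1) => UU UZ ZZ HU HZ c hh h3.
  lra.
have Pall nu : P nu.
  apply: contrapT => nP.
  have ubP : ubound [set x | P x] nu.
    move=> x /= Px; rewrite leNgt; apply/negP => /ltW h; apply: nP; exact: Pdown h Px.
  have hs : has_sup [set x | P x] by split; [exists nu0|exists nu].
  (* If the supremum failed for some [z], its Rayleigh quotient would lie strictly below some
     admissible bound. *)
  have Ps : P (sup [set x | P x]).
    move=> z z1 h hz zo; rewrite leNgt; apply/negP => hlt.
    have zz0 := ip_ge0 a al0 z.
    have zz : 0 < ip z z.
      rewrite lt_def zz0 andbT; apply/eqP => e; move: hlt.
      have [_ _ _ h2] := hz; have z2 := Dom_L2 hz.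
      by rewrite e mulr0 ipC (ip0_orth al0) // ltxx.
    have e0 : 0 < sup [set x | P x] - ip h z / ip z z by rewrite subr_gt0 ltr_pdivrMr.
    have [x /= Px hx] := sup_adherent e0 hs.
    rewrite subKr ltr_pdivrMr // in hx.
    by have := Px _ _ _ hz zo; rewrite leNgt hx.
  have [d d0 hd] := step _ Ps.
  have := ub_le_sup hs.2 hd; rewrite leNgt => /negP; apply.
  by rewrite ltrDl.
have yy0 := ip_ge0 a al0 y.
apply/eqP; rewrite eq_le yy0 andbT leNgt; apply/negP => yy.
have := Pall ((ip g y + 1) / ip y y) _ _ _ hy hyo.
by rewrite divfK ?gt_eqF // leNgt ltrDl ltr01.
Qed.

Lemma test_Dom b c f f1 f2 : 0 <= b -> c <= pi -> b <= c -> test_fun b c f f1 f2 ->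
  Dom f f1 (fun x => (q x * f x - f2 x) / w x).
Proof.
move=> b0 cp bc [e e0 [h1 h2 h3]]; have [k1 k2 k3] := h1 0 pi pi0.
have wi : BM 0 pi (fun x => (w x)^-1).
  have ai : 0 < al^-1 by rewrite invr_gt0.
  apply: BM_ext (BM_rho a ai 0 pi) => x _.
  by rewrite /rho; case: ifP => _; rewrite ?invr1 // exprVn.
have f0 x : x <= 0 -> f x = 0 /\ f1 x = 0 by move=> hx; apply: h2; lra.
have fp x : pi <= x -> f x = 0 /\ f1 x = 0 by move=> hx; apply: h3; lra.
split.
- split => //; apply: AC_ext k2 => // x _.
  by rewrite [w x * _]mulrC divfK ?gt_eqF ?rho_gt0 //; ring.
- by have [] := f0 0 (lexx _).
- by have [] := fp pi (lexx _).
- apply: L2_BM wi; apply: L2B; last exact: BM_L2.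
  by apply: L2_BM => //; exact: AC_BM k1.
Qed.

Lemma ip_zero_of_test b c v : 0 <= b -> c <= pi -> b < c -> L2p v ->
  (forall f f1 f2, test_fun b c f f1 f2 -> ip v f = 0) ->
  {ae mu, forall x, b < x < c -> v x = 0}.
Proof.
move=> b0 cp bc hv h.
have hw : L1 0 pi (fun x => w x * v x) by apply: BM_L1M; [exact: BM_rho|exact: L2_L1].
have hw' : L1 b c (fun x => w x * v x) by apply: L1_sub hw.
suff H : {ae mu, forall x, b < x < c -> w x * v x = 0}.
  apply: ae_mp H => x hx /hx /eqP.
  by rewrite mulf_eq0 (gt_eqF (rho_gt0 a al0 x)) /= => /eqP.
apply: (ae_zero_of_test bc hw').
move=> f f1 f2 ht; rewrite -(h _ _ _ ht) /wip.
have [fD _ _ _] := test_Dom b0 cp (ltW bc) ht; have [fb _] := Equation_BM fD.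
case: ht => e e0 [_ h2 h3].
have hi : L1 0 pi (fun s => w s * v s * f s) by exact: ip_L1 (BM_L2 fb).
rewrite [RHS](@I_split _ 0 b pi) //; last exact: le_trans (ltW bc) cp.
have hib : L1 b pi (fun s => w s * v s * f s) by apply: L1_sub hi.
rewrite [X in _ = _ + X](@I_split _ b c pi) // ?(ltW bc) //.
rewrite [I 0 b _](I_ext (g := fun _ => 0)); last first.
  by move=> x /andP[_ xb]; have [|-> _] := h2 x; [lra|rewrite mulr0].
rewrite [I c pi _](I_ext (g := fun _ => 0)); last first.
  by move=> x /andP[xc _]; have [|-> _] := h3 x; [lra|rewrite mulr0].
by rewrite !I_cst // !mul0r add0r addr0.
Qed.

(** A general [v] need not lie in the domain, so the previous result is applied to the solution of
    [(L - nu0) z = v]. That [z] has norm zero, and moving the operator onto a test function shows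
    that [v] annihilates all of them. *)
Lemma complete0 v : L2p v -> (forall n, ip v (ef n) = 0) -> ip v v = 0.
Proof.
move=> hv vo; have [C C1 hC] := solvable nu0; have [z [z1 [hz zo _]]] := hC v hv vo.
have zz := Dom_orth_zero hz zo; have z2 := Dom_L2 hz.
have pi_0 : 0 < (pi : R) by exact: pi_gt0.
have h : {ae mu, forall x, 0 < x < pi -> v x = 0}.
  apply: ip_zero_of_test => // f f1 f2 ht.
  have hf := test_Dom (lexx 0) (lexx _) pi0 ht; have [_ _ _ g2] := hf; have f2' := Dom_L2 hf.
  have := Dom_sym hz hf; rewrite (ip0_orth al0 z2 g2 zz) ipDl //; last exact: L2Z.
  by rewrite ipZl // (ip0_orth al0 z2 f2' zz) mulr0 addr0.
rewrite /wip (@I_ae _ 0 pi _ (fun _ => 0)) ?I_cst ?mul0r //.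
- exact: L1_Mf (ip_L1 a al0 hv hv).
- exact: measurable_cst.
- by apply: ae_mp h => x hx /hx ->; rewrite mulr0.
Qed.

Definition coef v i := ip v (ef i) / alpha i.
Definition fsum (c : nat -> R) m n x := \sum_(m <= i < n) c i * ef i x.

Lemma fsum_L2 c m n : L2p (fsum c m n).
Proof. by apply: L2_sum => i; exact/L2Z/ef_L2. Qed.

Lemma ip_fsum c m n u : L2p u -> ip (fsum c m n) u = \sum_(m <= i < n) c i * ip (ef i) u.
Proof.
move=> hu; rewrite ip_suml //; last by move=> i; exact/L2Z/ef_L2.
by apply: eq_bigr => i _; rewrite ipZl //; exact: ef_L2.
Qed.

Lemma fsum_ef c m n k : ip (fsum c m n) (ef k) = if (m <= k < n)%N then c k * alpha k else 0.
Proof.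
rewrite ip_fsum; last exact: ef_L2.
case: ifP => [kn|nk].
  rewrite (bigD1_seq k) ?mem_index_iota ?iota_uniq //= big1 ?addr0 // => i ik.
  by rewrite ef_orth // mulr0.
rewrite big_nat big1 // => i imn; rewrite ef_orth ?mulr0 //.
by apply/eqP => e; move: imn; rewrite e nk.
Qed.

Lemma fsum_norm c m n : ip (fsum c m n) (fsum c m n) = \sum_(m <= i < n) c i ^+ 2 * alpha i.
Proof.
rewrite ip_fsum; last exact: fsum_L2.
rewrite !big_nat; apply: eq_bigr => i imn; rewrite ipC fsum_ef imn; ring.
Qed.

Lemma coef_norm v m n : \sum_(m <= i < n) coef v i ^+ 2 * alpha i
  = \sum_(m <= i < n) ip v (ef i) ^+ 2 / alpha i.
Proof.
apply: eq_bigr => i _; rewrite /coef; have := alpha_gt0 i; move: (alpha i) => A A0.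
by field; rewrite gt_eqF.
Qed.

Lemma Bessel v n : L2p v -> \sum_(0 <= i < n) ip v (ef i) ^+ 2 / alpha i <= ip v v.
Proof.
move=> hv; have S2 := fsum_L2 (coef v) 0 n.
have := ip_ge0 a al0 (fun x => v x - fsum (coef v) 0 n x).
rewrite ipBl //; last exact: L2B.
rewrite !ipBr // fsum_norm [ip v (fsum _ _ _)]ipC ip_fsum //.
have -> : \sum_(0 <= i < n) coef v i * ip (ef i) v = \sum_(0 <= i < n) coef v i ^+ 2 * alpha i.
  apply: eq_bigr => i _; rewrite ipC /coef; have := alpha_gt0 i; move: (alpha i) => A A0.
  by field; rewrite gt_eqF.
by rewrite coef_norm; lra.
Qed.

Lemma fsum_cat c m n x : (m <= n)%N -> fsum c 0 n x = fsum c 0 m x + fsum c m n x.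
Proof. by move=> mn; rewrite /fsum (@big_cat_nat _ _ _ m 0 n). Qed.

(** The partial sums are Cauchy by Bessel's inequality. Their limit has the coefficients of [v], so
    the remainder is orthogonal to all eigenfunctions. *)
Lemma complete v : L2p v -> forall e, 0 < e -> exists N, forall n, (N <= n)%N ->
  ip (fun x => v x - fsum (coef v) 0 n x) (fun x => v x - fsum (coef v) 0 n x) <= e.
Proof.
move=> hv; pose S n := fsum (coef v) 0 n; have S2 n : L2p (S n) by exact: fsum_L2.
have m0 := rho_min_gt0 al0.
have bt := bounded_tail _ (fun n => Bessel n hv).
have b0 n : 0 <= ip v (ef n) ^+ 2 / alpha n by rewrite divr_ge0 ?sqr_ge0 // ltW // alpha_gt0.
have {}bt := bt b0.
have hdiff m n : (m <= n)%N -> ip (fun x => S n x - S m x) (fun x => S n x - S m x) =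
    \sum_(m <= i < n) ip v (ef i) ^+ 2 / alpha i.
  move=> mn; rewrite -coef_norm -fsum_norm; apply: ip_ext => x _;
  by rewrite /S (fsum_cat _ _ mn) [X in X - _]addrC addrK.
have [|u [u2 hu]] := @Riesz_Fischer _ 0 pi S S2.
  move=> e e0; have me0 : 0 < rho_min al * e by rewrite mulr_gt0.
  have [N hN] := bt _ me0; exists N => n m Nn Nm.
  have key p r : (N <= p)%N -> (p <= r)%N -> I 0 pi (fun x => (S r x - S p x) ^+ 2) <= e.
    move=> Np pr; apply: le_trans (I_le_ip a al0 (L2B (S2 r) (S2 p))) _.
    by rewrite hdiff // mulrC ler_pdivrMr // mulrC hN.
  have [nm|/ltnW mn] := leqP n m; last exact: key.
  by rewrite (I_ext (g := fun x => (S m x - S n x) ^+ 2)) ?key // => x _; ring.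
have hu' e : 0 < e -> exists N, forall n, (N <= n)%N -> ip (fun x => u x - S n x) (fun x => u x - S n x) <= e.
  move=> e0; have k0 : 0 < 1 + al ^+ 2 by rewrite ltr_pwDl // sqr_ge0.
  have e1 : 0 < e / (1 + al ^+ 2) by rewrite divr_gt0.
  have [N hN] := hu _ e1; exists N => n Nn.
  apply: le_trans (ip_le_I a al0 (L2B u2 (S2 n))) _; rewrite mulrC -ler_pdivlMr //.
  rewrite (I_ext (g := fun x => (S n x - u x) ^+ 2)) ?hN // => x _; ring.
pose r x := v x - u x; have r2 : L2p r by exact: L2B.
have ro k : ip r (ef k) = 0.
  have ek := ef_L2 k; have ak := alpha_gt0 k.
  suff : ip r (ef k) ^+ 2 <= 0 by move=> h; apply/eqP; rewrite -sqrf_eq0 eq_le h sqr_ge0.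
  apply/ler_addgt0Pl => e e0; rewrite addr0.
  have e1 : 0 < e / alpha k by rewrite divr_gt0.
  have [N hN] := hu' _ e1.
  have := hN (maxn N k.+1) (leq_maxl _ _); set n := maxn _ _ => hn.
  have -> : ip r (ef k) = - ip (fun x => u x - S n x) (ef k).
    have hk : (0 <= k < n)%N by rewrite leq0n leq_maxr.
    by rewrite /r !ipBl // fsum_ef hk /coef divfK ?gt_eqF //; ring.
  rewrite sqrrN; apply: le_trans (ip_CS a al0 (L2B u2 (S2 n)) ek) _.
  by rewrite -ler_pdivlMr.
have rr := complete0 r2 ro.
move=> e e0; have [N hN] := hu' e e0; exists N => n Nn.
have d2 : L2p (fun x => u x - S n x) by exact: L2B.
rewrite (@ip_ext _ a al _ _ (fun x => r x + (u x - S n x)) (fun x => r x + (u x - S n x)));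
  [|by move=> x _; rewrite /r /S; ring|by move=> x _; rewrite /r /S; ring].
have rd2 := L2D r2 d2; have rd := ip0_orth al0 r2 d2 rr.
rewrite (ipDl a al0 r2 d2 rd2) (ipDr a al0 r2 d2 r2) (ipDr a al0 r2 d2 d2) rr rd.
by rewrite [ip (fun x => u x - S n x) r]ipC rd !add0r; exact: hN.
Qed.

Lemma Parseval v : L2p v -> forall e, 0 < e -> exists N, forall n u, (N <= n)%N -> L2p u ->
  (ip v u - \sum_(0 <= i < n) ip v (ef i) * ip u (ef i) / alpha i) ^+ 2 <= e * ip u u.
Proof.
move=> hv e e0; have [N hN] := complete hv e0; exists N => n u Nn hu.
have S2 := fsum_L2 (coef v) 0 n.
have -> : \sum_(0 <= i < n) ip v (ef i) * ip u (ef i) / alpha i = ip (fsum (coef v) 0 n) u.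
  by rewrite ip_fsum //; apply: eq_bigr => i _; rewrite /coef [ip (ef i) u]ipC; ring.
rewrite -ipBl //; apply: le_trans (ip_CS a al0 (L2B hv S2) hu) _.
by rewrite ler_wpM2r ?hN // ip_ge0.
Qed.

Lemma fsum_Dom c m n : exists f1, Dom (fsum c m n) f1 (fsum (fun i => c i * lam i ^+ 2) m n).
Proof.
have h00 : 0 <= (pi : R) <= pi by rewrite pi0 lexx.
have zero : Dom (fun _ => 0) (fun _ => 0) (fun _ => 0).
  split => //; last exact/BM_L2/BM_cst.
  split; first exact: AC_cst.
  by apply: AC_ext (AC_cst 0 pi 0) => // x _; ring.
have Dom_ext z z1 g z' g' : (forall x, z x = z' x) -> (forall x, g x = g' x) -> Dom z z1 g -> Dom z' z1 g'.
  by move=> /funext -> /funext ->.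
elim: n => [|n [f1 IH]].
  by exists (fun _ => 0); apply: Dom_ext zero => x; rewrite /fsum big_geq.
have [mn|nm] := leqP m n; last first.
  by exists (fun _ => 0); apply: Dom_ext zero => x; rewrite /fsum big_geq.
exists (fun x => f1 x + c n * phi1 x (lam n)).
apply: Dom_ext (Dom_lin (c n) IH (ef_Dom n)) => x; rewrite /fsum big_nat_recr //=.
by rewrite mulrA.
Qed.

(* [L - nu0] is bounded below in norm, so it suffices to expand [(L - nu0) f]. *)
Lemma expansion f f1 g : Dom f f1 g -> forall e, 0 < e -> exists N, forall n x, (N <= n)%N ->
  0 <= x <= pi -> `|f x - fsum (coef f) 0 n x| <= e.
Proof.
move=> hf e e0; have f2 := Dom_L2 hf; have [_ _ _ g2] := hf.
pose h x := g x - nu0 * f x; have h2 : L2p h by exact: L2B g2 (L2Z _ f2).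
have sc0 : 0 < sup_const by rewrite /sup_const ltr_pwDl // invr_ge0 ltW // rho_min_gt0.
have e1 : 0 < e ^+ 2 / sup_const by rewrite divr_gt0 // exprn_gt0.
have [N hN] := complete h2 e1; exists N => n x Nn xp.
have [s1 hs] := fsum_Dom (coef f) 0 n.
have hD := Dom_lin (-1) hf hs.
have := Dom_sup_bound hD xp.
have -> : f x + -1 * fsum (coef f) 0 n x = f x - fsum (coef f) 0 n x by rewrite mulN1r.
set G := ip _ _; have -> : G = ip (fun x => h x - fsum (coef h) 0 n x) (fun x => h x - fsum (coef h) 0 n x).
  suff ee t : g t + -1 * fsum (fun i => coef f i * lam i ^+ 2) 0 n t - nu0 * (f t + -1 * fsum (coef f) 0 n t)
      = h t - fsum (coef h) 0 n t by apply: ip_ext => t _; exact: ee.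
  have -> : fsum (coef h) 0 n t = fsum (fun i => coef f i * lam i ^+ 2) 0 n t - nu0 * fsum (coef f) 0 n t.
    rewrite /fsum mulr_sumr -sumrB; apply: eq_bigr => i _.
    rewrite /coef /h ipBl //; [|exact: L2Z|exact: ef_L2].
    rewrite ipZl //; last exact: ef_L2.
    rewrite (Dom_coef i hf); ring.
  rewrite /h; ring.
move=> hb; have := le_trans hb (ler_wpM2l (ltW sc0) (hN n Nn)).
rewrite mulrC divfK ?gt_eqF // => hh.
by rewrite -(ler_pXn2r (n:=2)) ?nnegrE ?(ltW e0) // real_normK ?num_real.
Qed.

(** A Hilbert-Schmidt bound: the Sobolev estimate controls the Green function of [L - nu0] in one
    variable, uniformly in the other, and integration over the latter gives the trace. *)
Lemma eigenvalue_growth : exists K : R, forall n, \sum_(0 <= i < n) ((lam i ^+ 2 - nu0) ^+ 2)^-1 <= K.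
Proof.
have sc0 : 0 < sup_const by rewrite /sup_const ltr_pwDl // invr_ge0 ltW // rho_min_gt0.
have n0 := nu0_lt0.
have d0 i : 0 < lam i ^+ 2 - nu0 by rewrite subr_gt0 (lt_le_trans n0) // sqr_ge0.
exists (sup_const * I 0 pi (fun t => w t)) => n.
have hx x : 0 <= x <= pi -> \sum_(0 <= i < n) ef i x ^+ 2 / (alpha i * (lam i ^+ 2 - nu0) ^+ 2) <= sup_const.
  move=> xp; set s := \sum_(0 <= i < n) _.
  (* With these coefficients both the value at [x] and the squared norm of the image under [L - nu0]
     equal [s], whence [s ^ 2 <= sup_const * s]. *)
  pose c i := ef i x / (alpha i * (lam i ^+ 2 - nu0) ^+ 2).
  have [s1 hs] := fsum_Dom c 0 n.
  have := Dom_sup_bound hs xp.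
  have -> : fsum c 0 n x = s by apply: eq_bigr => i _; rewrite /c; ring.
  pose c' i := ef i x / (alpha i * (lam i ^+ 2 - nu0)).
  have e t : fsum (fun i => c i * lam i ^+ 2) 0 n t - nu0 * fsum c 0 n t = fsum c' 0 n t.
    rewrite /fsum mulr_sumr -sumrB; apply: eq_bigr => i _; rewrite /c /c'.
    have := d0 i; have := alpha_gt0 i; move: (alpha i) (lam i ^+ 2) => A L A0 L0.
    by field; rewrite !gt_eqF.
  rewrite (@ip_ext _ a al _ _ (fsum c' 0 n) (fsum c' 0 n)); [|by move=> t _; exact: e|by move=> t _; exact: e].
  have -> : ip (fsum c' 0 n) (fsum c' 0 n) = s.
    rewrite fsum_norm; apply: eq_bigr => i _; rewrite /c'.
    have := d0 i; have := alpha_gt0 i; move: (alpha i) (lam i ^+ 2) => A L A0 L0.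
    by field; rewrite !gt_eqF.
  have s0 : 0 <= s.
    by apply: sumr_ge0 => i _; rewrite divr_ge0 ?sqr_ge0 // mulr_ge0 ?sqr_ge0 // ltW // alpha_gt0.
  have [->|sn0] := eqVneq s 0; first by move=> _; rewrite ltW.
  by rewrite expr2 ler_pM2r // lt_def sn0.
have hL i : L1 0 pi (fun x => w x * ef i x ^+ 2 / (alpha i * (lam i ^+ 2 - nu0) ^+ 2)).
  by apply: L1_BM; [exact: BM_L1M (BM_rho _ al0 _ _) (ef_L2 i).2|exact: BM_cst].
have [h1 h2] := @I_sum _ 0 pi (fun i x => w x * ef i x ^+ 2 / (alpha i * (lam i ^+ 2 - nu0) ^+ 2)) 0 n hL.
have -> : \sum_(0 <= i < n) ((lam i ^+ 2 - nu0) ^+ 2)^-1 =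
    I 0 pi (fun x => \sum_(0 <= i < n) w x * ef i x ^+ 2 / (alpha i * (lam i ^+ 2 - nu0) ^+ 2)).
  rewrite h2; apply: eq_bigr => i _.
  rewrite (I_ext (g := fun x => (alpha i * (lam i ^+ 2 - nu0) ^+ 2)^-1 * (w x * ef i x * ef i x))).
    rewrite IZ; last exact: ip_L1 (ef_L2 i) (ef_L2 i).
    have -> : I 0 pi (fun x => w x * ef i x * ef i x) = alpha i by [].
    have := d0 i; have := alpha_gt0 i; move: (alpha i) (lam i ^+ 2) => A L A0 L0.
    by field; rewrite !gt_eqF.
  by move=> x _; ring.
rewrite -IZ; last exact/BM_L1/BM_rho.
apply: I_le => [||x xp]; [exact: h1|exact/L1Z/BM_L1/BM_rho|].
apply: (@le_trans _ _ (w x * \sum_(0 <= i < n) ef i x ^+ 2 / (alpha i * (lam i ^+ 2 - nu0) ^+ 2))).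
  by rewrite mulr_sumr le_eqVlt; apply/orP; left; apply/eqP; apply: eq_bigr => i _; rewrite mulrA.
by rewrite mulrC ler_wpM2r ?hx // ltW // rho_gt0.
Qed.

End Spectrum.
End SturmLiouville.

(** * Asymptotics of the solutions *)

Section Unperturbed.
Context {R : realType}.
Variables (a al : R).
Hypotheses (al0 : 0 < al) (a0 : 0 < a) (api : a < pi).
Implicit Types (x l : R).
Notation I := (@lintegral_ab R).

Lemma AC_glue b c d (f f' : R -> R) : b <= c -> c <= d -> AC b c f f' -> AC c d f f' ->
  L1 b d f' -> AC b d f f'.
Proof.
move=> bc cd h1 h2 hL; split => // x /andP[bx xd].
have [xc|/ltW cx] := leP x c; first by apply: h1.2; rewrite bx.
rewrite (h2.2 x) ?cx // (h1.2 c) ?bc ?lexx // (@I_split _ b c x) ?addrA //.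
exact: L1_sub hL.
Qed.

(** The densities may differ at [b]. At [a] the function [rho] has its left value, so on [[a, pi]]
    it equals [al ^ 2] only beyond the left end. *)
Lemma AC_ext_oc b c (f f' g g' : R -> R) : (forall x, b <= x <= c -> f x = g x) ->
  (forall x, b < x <= c -> f' x = g' x) -> L1 b c g' -> AC b c f f' -> AC b c g g'.
Proof.
move=> fg fg' hL h; split => // x /andP[bx xc].
rewrite -fg ?bx // -fg ?lexx ?(le_trans bx) // h.2 ?bx //; congr (_ + _).
apply: I_ae; [exact: (L1_Mf (L1_sub (lexx _) xc h.1))|exact: (L1_Mf (L1_sub (lexx _) xc hL))|].
by apply: aeW => t /andP[bt tx]; apply: fg'; rewrite bt (le_trans (ltW tx)).
Qed.

Lemma srhoE x : srho a al x = if x <= a then 1 else al.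
Proof.
by rewrite /srho /rho; case: ifP => _; rewrite ?sqrtr1 // sqrtr_sqr gtr0_norm.
Qed.

Lemma srho_gt0 x : 0 < srho a al x.
Proof. by rewrite srhoE; case: ifP. Qed.

(** The derivative of [phi0] in [x]; the slopes of [mu_plus] and [mu_minus] are plus and minus
    [srho]. *)
Definition phi0' x l : R :=
  - (2^-1 * (1 + (srho a al x)^-1) * (l * srho a al x) * sin (l * mu_plus a al x))
  + 2^-1 * (1 - (srho a al x)^-1) * (l * srho a al x) * sin (l * mu_minus a al x).

Lemma phi0_left x l : x <= a -> phi0 a al x l = cos (l * x) /\ phi0' x l = - (l * sin (l * x)).
Proof.
move=> xa; rewrite /phi0 /phi0' /mu_plus /mu_minus srhoE xa invr1.
rewrite (_ : x * 1 + a * (1 - 1) = x); last by ring.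
by split; field.
Qed.

(** The formula of [phi0] beyond [a] in affine form. It also gives the right value at [a], which
    lets the two pieces share that endpoint. *)
Definition right0 x l : R := 2^-1 * (1 + al^-1) * cos (l * al * x + l * (a * (1 - al)))
  + 2^-1 * (1 - al^-1) * cos (- (l * al) * x + l * (a * (1 + al))).
Definition right1 x l : R := - (2^-1 * (1 + al^-1) * (l * al) * sin (l * al * x + l * (a * (1 - al))))
  + 2^-1 * (1 - al^-1) * (l * al) * sin (- (l * al) * x + l * (a * (1 + al))).

Lemma phi0_right x l : a <= x -> phi0 a al x l = right0 x l /\ phi0' x l = right1 x l.
Proof.
move=> ax; have [xa|xa] := leP x a.
  have -> : x = a by apply/le_anti; rewrite xa ax.
  have [-> ->] := phi0_left l (lexx a); rewrite /right0 /right1.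
  rewrite (_ : l * al * a + l * (a * (1 - al)) = l * a); last by ring.
  rewrite (_ : - (l * al) * a + l * (a * (1 + al)) = l * a); last by ring.
  by split; field; rewrite gt_eqF.
rewrite /phi0 /phi0' /mu_plus /mu_minus srhoE leNgt xa /= /right0 /right1.
rewrite (_ : l * (x * al + a * (1 - al)) = l * al * x + l * (a * (1 - al))); last by ring.
by rewrite (_ : l * (- x * al + a * (1 + al)) = - (l * al) * x + l * (a * (1 + al))) //; ring.
Qed.

Lemma continuous_affine_comp (F : R -> R) k d : continuous F -> continuous (fun x => F (k * x + d)).
Proof.
move=> cF x.
apply: (@continuous_comp _ _ _ (fun x => k * x + d) F); last exact: cF.
by apply: cvgD; [apply: cvgM; [exact: cvg_cst|exact: cvg_id]|exact: cvg_cst].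
Qed.

Lemma is_derive_lin2 (F G : R -> R) df dg p r x :
  is_derive x 1 F df -> is_derive x 1 G dg ->
  is_derive x 1 (fun x => p * F x + r * G x) (p * df + r * dg).
Proof.
move=> hF hG; have -> : (fun x => p * F x + r * G x) = (p \*: F) + (r \*: G) by [].
exact: is_deriveD.
Qed.

Lemma continuous_lin2 (F G : R -> R) p r : continuous F -> continuous G ->
  continuous (fun x => p * F x + r * G x).
Proof.
move=> cF cG x; apply: cvgD; apply: cvgM; [exact: cvg_cst|exact: cF|exact: cvg_cst|exact: cG].
Qed.

Lemma cont_cos_aff k d : continuous (fun x => cos (k * x + d) : R).
Proof. exact/continuous_affine_comp/continuous_cos. Qed.

Lemma cont_sin_aff k d : continuous (fun x => sin (k * x + d) : R).
Proof. exact/continuous_affine_comp/continuous_sin. Qed.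

Lemma derive_cos_aff k d x : is_derive x 1 (fun x => cos (k * x + d) : R) (k * - sin (k * x + d)).
Proof. exact: (is_derive_affine k d x (fun x => is_derive_cos x)). Qed.

Lemma derive_sin_aff k d x : is_derive x 1 (fun x => sin (k * x + d) : R) (k * cos (k * x + d)).
Proof. exact: (is_derive_affine k d x (fun x => is_derive_sin x)). Qed.

Lemma BM_cos_aff b c k d : BM b c (fun x => cos (k * x + d) : R).
Proof.
split; first by apply: cont_Mf; apply: continuous_subspaceT; exact: cont_cos_aff.
by exists 1 => x _; rewrite ler_norml cos_geN1 cos_le1.
Qed.

Lemma BM_cos b c k : BM b c (fun x => cos (k * x) : R).
Proof. by apply: BM_ext (@BM_cos_aff b c k 0) => x _; rewrite addr0. Qed.

Lemma BM_sin b c k : BM b c (fun x => sin (k * x) : R).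
Proof.
apply: (@BM_ext _ _ _ (fun x => sin (k * x + 0))) => [x _|]; first by rewrite addr0.
split; first by apply: cont_Mf; apply: continuous_subspaceT; exact: cont_sin_aff.
by exists 1 => x _; rewrite ler_norml sin_geN1 sin_le1.
Qed.

Lemma AC_left b c l : AC b c (fun x => cos (l * x)) (fun x => - (l * sin (l * x))) /\
  AC b c (fun x => - (l * sin (l * x))) (fun x => - (l ^+ 2 * cos (l * x))).
Proof.
split.
  apply: (@AC_ext _ _ _ (fun x => 1 * cos (l * x + 0) + 0 * cos (l * x + 0))
    (fun x => 1 * (l * - sin (l * x + 0)) + 0 * (l * - sin (l * x + 0)))).
  - by move=> x _; rewrite addr0; ring.
  - by move=> x _; rewrite addr0; ring.
  apply: AC_C1 => [x|]; first by apply: is_derive_lin2; exact: derive_cos_aff.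
  move=> x; have := @continuous_lin2 _ _ (- l) 0 (@cont_sin_aff l 0) (@cont_sin_aff l 0) x.
  by congr (continuous_at x _); apply/funext => t; ring.
apply: (@AC_ext _ _ _ (fun x => - l * sin (l * x + 0) + 0 * sin (l * x + 0))
    (fun x => - l * (l * cos (l * x + 0)) + 0 * (l * cos (l * x + 0)))).
- by move=> x _; rewrite addr0; ring.
- by move=> x _; rewrite addr0; ring.
apply: AC_C1 => [x|]; first by apply: is_derive_lin2; exact: derive_sin_aff.
move=> x; have := @continuous_lin2 _ _ (- l ^+ 2) 0 (@cont_cos_aff l 0) (@cont_cos_aff l 0) x.
by congr (continuous_at x _); apply/funext => t; ring.
Qed.

Lemma AC_right b c l : AC b c (fun x => right0 x l) (fun x => right1 x l) /\
  AC b c (fun x => right1 x l) (fun x => - (al ^+ 2 * l ^+ 2 * right0 x l)).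
Proof.
pose p := 2^-1 * (1 + al^-1); pose r := 2^-1 * (1 - al^-1).
pose k := l * al; pose d := l * (a * (1 - al)); pose d' := l * (a * (1 + al)).
split.
  apply: (@AC_ext _ _ _ (fun x => p * cos (k * x + d) + r * cos (- k * x + d'))
    (fun x => p * (k * - sin (k * x + d)) + r * (- k * - sin (- k * x + d')))) => [//|x _|].
    by rewrite /right1 /p /r /k /d /d'; ring.
  apply: AC_C1 => [x|]; first by apply: is_derive_lin2; exact: derive_cos_aff.
  move=> x; have := @continuous_lin2 _ _ (- (p * k)) (r * k) (@cont_sin_aff k d) (@cont_sin_aff (- k) d') x.
  by congr (continuous_at x _); apply/funext => t; ring.
apply: (@AC_ext _ _ _ (fun x => (- (p * k)) * sin (k * x + d) + (r * k) * sin (- k * x + d'))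
    (fun x => (- (p * k)) * (k * cos (k * x + d)) + (r * k) * (- k * cos (- k * x + d')))) => [x _|x _|].
- by rewrite /right1 /p /r /k /d /d'; ring.
- by rewrite /right0 /p /r /k /d /d'; ring.
apply: AC_C1 => [x|]; first by apply: is_derive_lin2; exact: derive_sin_aff.
move=> x; have := @continuous_lin2 _ _ (- (p * k ^+ 2)) (- (r * k ^+ 2)) (@cont_cos_aff k d) (@cont_cos_aff (- k) d') x.
by congr (continuous_at x _); apply/funext => t; ring.
Qed.

(** The factors [(1 + 1/al) / 2] and [(1 - 1/al) / 2] are transmission and reflection coefficients:
    they make value and derivative match at [a], so the two smooth pieces glue. *)
Lemma phi0_AC l : AC 0 pi (fun x => phi0 a al x l) (fun x => phi0' x l) /\
  AC 0 pi (fun x => phi0' x l) (fun x => - (rho a al x * l ^+ 2 * phi0 a al x l)).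
Proof.
have [L0 L1'] := AC_left 0 a l; have [R0 R1] := AC_right a pi l.
have pi0 : 0 <= pi :> R := pi_ge0 R.
have hL0 : AC 0 a (fun x => phi0 a al x l) (fun x => phi0' x l).
  by apply: AC_ext L0 => x /andP[_ xa]; have [h1 h2] := phi0_left l xa; rewrite ?h1 ?h2.
have hR0 : AC a pi (fun x => phi0 a al x l) (fun x => phi0' x l).
  by apply: AC_ext R0 => x /andP[ax _]; have [h1 h2] := phi0_right l ax; rewrite ?h1 ?h2.
have BMglue (f : R -> R) : BM 0 a f -> BM a pi f -> BM 0 pi f.
  move=> [m1 [M1 h1]] [m2 [M2 h2]]; split.
    rewrite /Mf (_ : `[0, pi]%classic = `[0, a]%classic `|` `[a, pi]%classic).
      by apply/measurable_funU.
    apply/seteqP; split => x /=; rewrite !in_itv /=.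
      move=> /andP[x0 xp]; have [xa|/ltW ax] := leP x a; [left|right]; first by rewrite x0.
      by rewrite ax.
    by move=> [|] /andP[h3 h4]; rewrite ?h3 ?h4 ?(le_trans _ h3) ?(ltW a0) ?(le_trans h4) ?(ltW api).
  exists (`|M1| + `|M2|) => x /andP[x0 xp]; have [xa|/ltW ax] := leP x a.
    by rewrite (le_trans (h1 x _)) ?x0 // (le_trans (ler_norm _)) // lerDl.
  by rewrite (le_trans (h2 x _)) ?ax // (le_trans (ler_norm _)) // lerDr.
have hL1 : AC 0 a (fun x => phi0' x l) (fun x => - (rho a al x * l ^+ 2 * phi0 a al x l)).
  apply: AC_ext L1' => x /andP[_ xa]; have [h1 h2] := phi0_left l xa; rewrite ?h1 ?h2 //.
  by rewrite /rho xa mul1r.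
have B0 : BM 0 pi (fun x => phi0 a al x l).
  by apply: BMglue; [exact: AC_BM (ltW a0) hL0|exact: AC_BM (ltW api) hR0].
have B2 : BM 0 pi (fun x => - (rho a al x * l ^+ 2 * phi0 a al x l)).
  by apply: BM_ext (BMM (BMZ (- l ^+ 2) (BM_rho a al0 0 pi)) B0) => x _; ring.
have hR1 : AC a pi (fun x => phi0' x l) (fun x => - (rho a al x * l ^+ 2 * phi0 a al x l)).
  apply: AC_ext_oc R1.
  - by move=> x /andP[ax _]; have [_ ->] := phi0_right l ax.
  - move=> x /andP[ax _]; have [-> _] := phi0_right l (ltW ax).
    by rewrite /rho leNgt ax.
  - exact: L1_sub (ltW a0) (lexx _) (BM_L1 B2).
have B1 : BM 0 pi (fun x => phi0' x l).
  by apply: BMglue; [exact: AC_BM (ltW a0) hL1|exact: AC_BM (ltW api) hR1].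
split; apply: (@AC_glue 0 a pi); rewrite ?(ltW a0) ?(ltW api) //; exact: BM_L1.
Qed.

Lemma phi0_init l : phi0 a al 0 l = 1 /\ phi0' 0 l = 0.
Proof.
by have [-> ->] := phi0_left l (ltW a0); rewrite mulr0 cos0 sin0 mulr0 oppr0.
Qed.

Lemma phi0_is_sol l : is_sol (fun _ => 0) a al (l ^+ 2) (fun x => phi0 a al x l) (fun x => phi0' x l).
Proof.
apply/is_solE; have [h1 h2] := phi0_AC l; split => //.
by apply: AC_ext h2 => // x _; ring.
Qed.

End Unperturbed.

(** * Energy estimates for oscillating solutions *)

Section EnergyEstimates.
Context {R : realType}.
Implicit Types (b c x k : R) (y r p : R -> R).
Notation I := (@lintegral_ab R).

(** The oscillating terms cancel in the density of [y1 ^ 2 + k ^ 2 * y ^ 2], which is [2 * y1 * r].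
    Evaluating at a maximum point yields bounds without Gronwall's inequality and hence without
    exponential factors. *)
Lemma energy_max b c y y1 r k : b <= c -> L1 b c r -> AC b c y y1 ->
  AC b c y1 (fun s => r s - k ^+ 2 * y s) ->
  exists x0, [/\ b <= x0 <= c, forall x, b <= x <= c ->
      y1 x ^+ 2 + k ^+ 2 * y x ^+ 2 <= y1 x0 ^+ 2 + k ^+ 2 * y x0 ^+ 2 &
    y1 x0 ^+ 2 + k ^+ 2 * y x0 ^+ 2 = y1 b ^+ 2 + k ^+ 2 * y b ^+ 2 + I b x0 (fun s => 2 * y1 s * r s)].
Proof.
move=> bc hr hy hy1.
have h : AC b c (fun x => y1 x ^+ 2 + k ^+ 2 * y x ^+ 2) (fun s => 2 * y1 s * r s).
  apply: AC_ext (AC_D (AC_mul hy1 hy1) (AC_Z (k ^+ 2) (AC_mul hy hy))) => x _; first by rewrite !expr2.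
  ring.
have [x0 x0bc hx0] := EVT_max bc (AC_cont bc h).
rewrite in_itv /= in x0bc.
exists x0; split => //; last exact: h.2.
Qed.

(** If [S ^ 2] is the maximal energy and [N] the integral of [|r|], then
    [S ^ 2 <= S0 ^ 2 + 2 * S * N], which forces [S <= S0 + 2 * N]. *)
Lemma energy_bound b c y y1 r k S0 : b <= c -> L1 b c r -> AC b c y y1 ->
  AC b c y1 (fun s => r s - k ^+ 2 * y s) -> 0 <= S0 ->
  y1 b ^+ 2 + k ^+ 2 * y b ^+ 2 <= S0 ^+ 2 -> forall x, b <= x <= c ->
  y1 x ^+ 2 + k ^+ 2 * y x ^+ 2 <= (S0 + 2 * I b c (fun s => `|r s|)) ^+ 2.
Proof.
move=> bc hr hy hy1 S00 hb x xbc.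
have [x0 [x0bc hmax he]] := energy_max bc hr hy hy1.
have E0 z : 0 <= y1 z ^+ 2 + k ^+ 2 * y z ^+ 2 by apply: addr_ge0; [exact: sqr_ge0|apply: mulr_ge0; exact: sqr_ge0].
set N := I b c _; have N0 : 0 <= N by exact: I_ge0.
apply: le_trans (hmax x xbc) _.
set E := _ + _ in he *; pose S := Num.sqrt E.
have S1 : 0 <= S by exact: sqrtr_ge0.
have SE : S ^+ 2 = E by rewrite sqr_sqrtr ?E0.
rewrite -SE lerXn2r ?nnegrE ?addr_ge0 ?mulr_ge0 //.
case/andP: (x0bc) => bx0 x0c.
have hi : L1 b x0 (fun s => 2 * y1 s * r s).
  apply: (@L1_sub _ b c) => //; apply: BM_L1M => //; exact/BMZ/(AC_BM bc hy1).
have hN : I b x0 (fun s => 2 * y1 s * r s) <= 2 * S * N.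
  apply: le_trans (ler_norm _) _; apply: le_trans (I_abs hi) _.
  apply: (@le_trans _ _ (I b x0 (fun s => 2 * S * `|r s|))).
    apply: I_le => [||s /andP[bs sx]]; [exact: L1_abs|apply/L1Z/L1_abs|].
      exact: L1_sub hr.
    rewrite !normrM normr_nat ler_wpM2r // ler_wpM2l //.
    rewrite -(ler_pXn2r (n:=2)) ?nnegrE // real_normK ?num_real // SE.
    apply: le_trans (hmax s _); last by rewrite bs (le_trans sx).
    by rewrite lerDl mulr_ge0 ?sqr_ge0.
  rewrite IZ; last by apply/L1_abs; exact: L1_sub hr.
  rewrite ler_wpM2l ?mulr_ge0 //; apply: I_mono => //; exact: L1_abs.
rewrite leNgt; apply/negP => hS.
have h1 : S ^+ 2 <= S0 ^+ 2 + 2 * S * N by rewrite SE he lerD.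
nra.
Qed.

(** For the source [p * y] the energy itself controls [2 * k * |y1 * y|]. At a frequency beyond
    twice the integral of [|p|] at most half of the maximal energy comes from the source. *)
Lemma energy_bound_q b c y y1 p k : b <= c -> 0 < k -> L1 b c p -> AC b c y y1 ->
  AC b c y1 (fun s => p s * y s - k ^+ 2 * y s) -> 2 * I b c (fun s => `|p s|) <= k ->
  forall x, b <= x <= c ->
  y1 x ^+ 2 + k ^+ 2 * y x ^+ 2 <= 2 * (y1 b ^+ 2 + k ^+ 2 * y b ^+ 2).
Proof.
move=> bc k0 hp hy hy1 hk x xbc.
have hr : L1 b c (fun s => p s * y s) by apply: L1_BM => //; exact: AC_BM hy.
have [x0 [x0bc hmax he]] := energy_max bc hr hy hy1.
apply: le_trans (hmax x xbc) _.
set E := y1 x0 ^+ 2 + _ in he *; set E0 := y1 b ^+ 2 + _ in he *.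
have EE0 : 0 <= E by apply: addr_ge0; [exact: sqr_ge0|apply: mulr_ge0; exact: sqr_ge0].
case/andP: (x0bc) => bx0 x0c; set N := I b c _ in hk.
have hi : L1 b x0 (fun s => 2 * y1 s * (p s * y s)).
  apply: (@L1_sub _ b c) => //; apply: BM_L1M => //; exact/BMZ/(AC_BM bc hy1).
have hN : I b x0 (fun s => 2 * y1 s * (p s * y s)) <= E / k * N.
  apply: le_trans (ler_norm _) _; apply: le_trans (I_abs hi) _.
  apply: (@le_trans _ _ (I b x0 (fun s => E / k * `|p s|))).
    apply: I_le => [||s /andP[bs sx]]; [exact: L1_abs|apply/L1Z/L1_abs|].
      exact: L1_sub hp.
    have -> : 2 * y1 s * (p s * y s) = 2 * y1 s * y s * p s by ring.
    rewrite normrM ler_wpM2r // ler_pdivlMr //.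
    apply: le_trans (hmax s _); last by rewrite bs (le_trans sx).
    rewrite !normrM normr_nat -(real_normK (num_real (y1 s))) -(real_normK (num_real (y s))).
    have := sqr_ge0 (`|y1 s| - k * `|y s|); nra.
  rewrite IZ; last by apply/L1_abs; exact: L1_sub hp.
  rewrite ler_wpM2l ?divr_ge0 ?(ltW k0) //; apply: I_mono => //; exact: L1_abs.
have : E / k * N <= E / 2.
  rewrite -mulrA ler_wpM2l // mulrC ler_pdivrMr //; lra.
move: he hN; lra.
Qed.

End EnergyEstimates.

(** * High-frequency asymptotics of the perturbed solution *)

Section Asymptotics.
Context {R : realType}.
Variables (q : R -> R) (a al : R).
Hypotheses (al0 : 0 < al) (a0 : 0 < a) (api : a < pi) (hq : L2 0 pi q).
Notation I := (@lintegral_ab R).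
Variables (phi phi1 : R -> R -> R).
Hypothesis hphi : forall l, is_sol q a al (l ^+ 2) (fun x => phi x l) (fun x => phi1 x l) /\
  phi 0 l = 1 /\ phi1 0 l = 0.
Let pi0 : 0 <= pi :> R := pi_ge0 R.

(** The equation has frequency [l] before [a] and [l * al] after it, so energies are estimated on
    each side and compared at [a]. A bound for [phi] comes first; it controls the source [q * phi]
    of the equation for [phi - phi0]. *)
Lemma phi_asymptotics : exists C l0, [/\ 0 < C, 1 <= l0 & forall l x, l0 <= l -> 0 <= x <= pi ->
  `|phi x l| <= C /\ `|phi x l - phi0 a al x l| <= C / l].
Proof.
have q1 := L2_L1 hq; pose Q := I 0 pi (fun s => `|q s|).
have Q0 : 0 <= Q by exact: I_ge0.
have Qsub b c : 0 <= b -> b <= c -> c <= pi -> I b c (fun s => `|q s|) <= Q.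
  move=> b0 bc cp; rewrite /Q (@I_split _ 0 b pi) ?(le_trans bc) //; last exact: L1_abs.
  apply: ler_wpDl; first exact: I_ge0.
  by apply: I_mono => //; apply: (L1_sub b0 (lexx _)); exact: L1_abs.
(* The last two summands put both frequencies [l] and [l * al] above twice the integral of [|q|]. *)
pose l0 := 1 + 2 * Q + 2 * Q / al.
have l01 : 1 <= l0 by rewrite /l0 -addrA lerDl addr_ge0 ?mulr_ge0 // invr_ge0 ltW.
pose B := 2 + 4 * (1 + al ^+ 2) / al ^+ 2.
have al2 : 0 < al ^+ 2 by rewrite exprn_gt0.
have B1 : 2 <= B by rewrite lerDl divr_ge0 ?(ltW al2) // mulr_ge0 // addr_ge0 // ltW.
have B2 : 4 * (1 + al ^+ 2) / al ^+ 2 <= B by rewrite lerDr.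
pose T := 2 * (Q * B).
have T0 : 0 <= T by rewrite !mulr_ge0 // (le_trans _ B1).
pose C := B + T + ((1 + al) * T + T) / al.
have ai : 0 < al^-1 by rewrite invr_gt0.
have T2 : 0 <= ((1 + al) * T + T) / al.
  by rewrite mulr_ge0 ?(ltW ai) // addr_ge0 // mulr_ge0 // addr_ge0 // ltW.
exists C, l0; split => //; first by rewrite /C; lra.
move=> l x ll xp.
have l1 : 1 <= l by exact: le_trans ll.
have lpos : 0 < l by exact: lt_le_trans l1.
have Qa0 : 0 <= 2 * Q / al by rewrite mulr_ge0 ?(ltW ai) // mulr_ge0.
have Q20 : 0 <= 2 * Q by rewrite mulr_ge0.
have Ql : 2 * Q <= l.
  by apply: le_trans ll; rewrite /l0 addrAC -[leLHS]add0r lerD2r addr_ge0.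
have Qal : 2 * Q <= l * al.
  by rewrite -ler_pdivrMr //; apply: le_trans ll; rewrite /l0 lerDr addr_ge0.
have [hs [p0 p10]] := hphi l; have {hs}[h1 h2] := (is_solE _ _ _ _ _ _).1 hs.
have aa0 := ltW a0; have aap := ltW api.
have hl : AC 0 a (fun x => phi x l) (fun x => phi1 x l) by apply: AC_sub h1.
have hr : AC a pi (fun x => phi x l) (fun x => phi1 x l) by apply: AC_sub h1.
have hl1 : AC 0 a (fun x => phi1 x l) (fun s => q s * phi s l - l ^+ 2 * phi s l).
  by apply: AC_ext (AC_sub (lexx _) aap h2) => // t /andP[_ ta]; rewrite /rho ta mul1r.
have bphi : BM 0 pi (fun x => phi x l) by exact: AC_BM h1.
have hr1 : AC a pi (fun x => phi1 x l) (fun s => q s * phi s l - (l * al) ^+ 2 * phi s l).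
  apply: AC_ext_oc (AC_sub aa0 (lexx _) h2) => //.
    by move=> t /andP[at_ _]; rewrite /rho leNgt at_ /=; ring.
  apply: (L1_sub aa0 (lexx _)); apply: L1B; first exact: L1_BM.
  exact/L1Z/BM_L1.
have lal : 0 < l * al by rewrite mulr_gt0.
have el := energy_bound_q aa0 lpos (L1_sub (lexx _) aap q1) hl hl1
  (le_trans (ler_wpM2l (ler0n R 2) (Qsub 0 a (lexx _) aa0 aap)) Ql).
have er := energy_bound_q aap lal (L1_sub aa0 (lexx _) q1) hr hr1
  (le_trans (ler_wpM2l (ler0n R 2) (Qsub a pi aa0 aap (lexx _))) Qal).
have l2 : 0 < l ^+ 2 by rewrite exprn_gt0.
have el' t : 0 <= t <= a -> phi1 t l ^+ 2 + l ^+ 2 * phi t l ^+ 2 <= 2 * l ^+ 2.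
  by move=> /el; rewrite p0 p10 expr0n add0r expr1n mulr1.
have bl t : 0 <= t <= a -> phi t l ^+ 2 <= B.
  move=> /el' h; apply: le_trans B1; rewrite -(ler_pM2l l2) [leRHS]mulrC.
  by apply: le_trans h; rewrite lerDr sqr_ge0.
have br t : a <= t <= pi -> phi t l ^+ 2 <= B.
  move=> /er h; apply: le_trans B2; rewrite ler_pdivlMr // -(ler_pM2l l2).
  have haa : 0 <= a <= a by rewrite aa0 lexx.
  have := el' a haa; have := sqr_ge0 (phi1 t l); have := sqr_ge0 (phi1 a l).
  have := sqr_ge0 (phi a l).
  move: h; rewrite exprMn; move: (phi1 t l ^+ 2) (phi t l ^+ 2) (phi1 a l ^+ 2) (phi a l ^+ 2) => X Y Z W.
  move: (l ^+ 2) (al ^+ 2) l2 al2 => L A L0 A0 h W0 Z0 X0 h'.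
  have k1 : A * (Z + L * W) <= A * (2 * L) by rewrite ler_wpM2l // ltW.
  have k2 : 0 <= A * Z by rewrite mulr_ge0 // ltW.
  have k3 : 0 <= L * W by rewrite mulr_ge0 // ltW.
  nra.
have bB t : 0 <= t <= pi -> phi t l ^+ 2 <= B.
  by move=> /andP[t0 tp]; have [ta|/ltW at_] := leP t a; [apply: bl; rewrite t0|apply: br; rewrite at_].
have bB' t : 0 <= t <= pi -> `|phi t l| <= B.
  move=> /bB h; rewrite -(ler_pXn2r (n:=2)) ?nnegrE ?(le_trans _ B1) // real_normK ?num_real //.
  by apply: le_trans h _; rewrite ler_eXnr // (le_trans _ B1) // ler1n.
(* The difference [phi - phi0] has zero initial data, so its energy is generated by the source
   alone, which is bounded independently of [l]. *)
have [f1 f2] := phi0_AC al0 a0 api l; have [f0 f10] := phi0_init al0 a0 l.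
have d1 := AC_B h1 f1; have d2 := AC_B h2 f2.
have qphi : L1 0 pi (fun s => q s * phi s l) by apply: L1_BM.
have bd := AC_BM pi0 d1.
have Nq b c : 0 <= b -> b <= c -> c <= pi -> 2 * I b c (fun s => `|q s * phi s l|) <= T.
  move=> b0 bc cp; rewrite /T ler_wpM2l //.
  apply: (@le_trans _ _ (I b c (fun s => B * `|q s|))).
    apply: I_le => [||s /andP[bs sc]].
    - by apply: (L1_sub b0 cp); exact: L1_abs.
    - by apply: (L1_sub b0 cp); exact/L1Z/L1_abs.
    by rewrite normrM mulrC ler_wpM2r // bB' // (le_trans b0) // (le_trans sc).
  rewrite IZ; last by apply: (L1_sub b0 cp); exact: L1_abs.
  by rewrite mulrC ler_wpM2r ?(le_trans _ B1) // Qsub.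
have d2l : AC 0 a (fun s => phi1 s l - phi0' a al s l)
    (fun s => q s * phi s l - l ^+ 2 * (phi s l - phi0 a al s l)).
  by apply: AC_ext (AC_sub (lexx _) aap d2) => // t /andP[_ ta]; rewrite /rho ta; ring.
have d2r : AC a pi (fun s => phi1 s l - phi0' a al s l)
    (fun s => q s * phi s l - (l * al) ^+ 2 * (phi s l - phi0 a al s l)).
  apply: AC_ext_oc (AC_sub aa0 (lexx _) d2) => //.
    by move=> t /andP[at_ _]; rewrite /rho leNgt at_ /=; ring.
  by apply: (L1_sub aa0 (lexx _)); apply: L1B => //; exact/L1Z/BM_L1.
have gl t : 0 <= t <= a -> (phi1 t l - phi0' a al t l) ^+ 2 + l ^+ 2 * (phi t l - phi0 a al t l) ^+ 2 <= T ^+ 2.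
  move=> ta; have init : (phi1 0 l - phi0' a al 0 l) ^+ 2 + l ^+ 2 * (phi 0 l - phi0 a al 0 l) ^+ 2 <= 0 ^+ 2.
    by rewrite p0 p10 f0 f10 !subrr expr0n mulr0 addr0.
  have := energy_bound aa0 (L1_sub (lexx _) aap qphi) (AC_sub (lexx _) aap d1) d2l (lexx 0) init ta.
  move/le_trans; apply; rewrite add0r lerXn2r ?nnegrE ?T0 //; last exact: Nq.
  by rewrite mulr_ge0 // I_ge0.
(* Changing the frequency at [a] enlarges the root of the energy by at most the factor [1 + al]. *)
have gr t : a <= t <= pi -> (phi1 t l - phi0' a al t l) ^+ 2 + (l * al) ^+ 2 * (phi t l - phi0 a al t l) ^+ 2
    <= ((1 + al) * T + T) ^+ 2.
  move=> ta; have S0 : 0 <= (1 + al) * T by rewrite mulr_ge0 // addr_ge0 // ltW.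
  have init : (phi1 a l - phi0' a al a l) ^+ 2 + (l * al) ^+ 2 * (phi a l - phi0 a al a l) ^+ 2 <= ((1 + al) * T) ^+ 2.
    have haa : 0 <= a <= a by rewrite aa0 lexx.
    have := gl a haa; rewrite (exprMn _ l al) (exprMn _ _ T).
    have := sqr_ge0 (phi1 a l - phi0' a al a l); have := sqr_ge0 (phi a l - phi0 a al a l).
    move: (_ ^+ 2) ((phi1 a l - _) ^+ 2) => Y X Y0 X0 h.
    have LY : 0 <= l ^+ 2 * Y by rewrite mulr_ge0 // ltW.
    have k1 : (1 + al ^+ 2) * (X + l ^+ 2 * Y) <= (1 + al ^+ 2) * T ^+ 2.
      by rewrite ler_wpM2l // addr_ge0 // ltW.
    have k2 : 0 <= al ^+ 2 * X by rewrite mulr_ge0 // ltW.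
    have k3 : 0 <= al * T ^+ 2 by rewrite mulr_ge0 ?sqr_ge0 // ltW.
    nra.
  have := energy_bound aap (L1_sub aa0 (lexx _) qphi) (AC_sub aa0 (lexx _) d1) d2r S0 init ta.
  move/le_trans; apply; rewrite lerXn2r ?nnegrE //.
  - by apply: addr_ge0 => //; rewrite mulr_ge0 // I_ge0.
  - by apply: addr_ge0.
  - by rewrite lerD2l; exact: Nq.
have CB : B <= C by rewrite /C; lra.
split; first exact: le_trans (bB' x xp) CB.
rewrite ler_pdivlMr // mulrC -[l in l * _]gtr0_norm // -normrM.
case/andP: (xp) => x0 xpi.
have [xa|/ltW ax] := leP x a.
  apply: (@le_trans _ _ T); last by rewrite /C; lra.
  rewrite -(ler_pXn2r (n:=2)) ?nnegrE // real_normK ?num_real // exprMn.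
  have xx : 0 <= x <= a by rewrite x0.
  by apply: le_trans (gl x xx); rewrite lerDr sqr_ge0.
apply: (@le_trans _ _ (((1 + al) * T + T) / al)); last by rewrite /C; lra.
rewrite ler_pdivlMr // -[al in _ * al](gtr0_norm al0) -normrM.
have TT : 0 <= (1 + al) * T + T by rewrite addr_ge0 // mulr_ge0 // addr_ge0 // ltW.
rewrite -(ler_pXn2r (n:=2)) ?nnegrE // real_normK ?num_real //.
have xx : a <= x <= pi by rewrite ax.
apply: le_trans (gr x xx).
have -> : (l * (phi x l - phi0 a al x l) * al) ^+ 2 = (l * al) ^+ 2 * (phi x l - phi0 a al x l) ^+ 2 by ring.
by rewrite lerDr sqr_ge0.
Qed.

End Asymptotics.

(** * Roots of functions that are never small together with their derivative *)

Section RealRoots.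
Context {R : realType}.
Implicit Types (x y l c H K : R) (g h : R -> R).

Lemma is_derive_cont g h : (forall x, is_derive x 1 g (h x)) -> continuous g.
Proof.
move=> dg x; apply/differentiable_continuous/derivable1_diffP.
exact: (@ex_derive _ _ _ _ _ _ _ (dg x)).
Qed.

Lemma mean_value g h x y : (forall x, is_derive x 1 g (h x)) -> x < y ->
  exists2 z, x < z < y & g y - g x = h z * (y - x).
Proof.
move=> dg xy.
have [|z] := @MVT _ g h x y xy (fun t _ => dg t).
  by apply: continuous_subspaceT => t; exact: is_derive_cont dg t.
by rewrite in_itv /=; exists z.
Qed.

Lemma Lipschitz_derive g h K : (forall x, is_derive x 1 g (h x)) -> (forall x, `|h x| <= K) ->
  forall x y, `|g x - g y| <= K * `|x - y|.
Proof.
move=> dg hK; suff hlt x y : x < y -> `|g x - g y| <= K * `|x - y|.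
  move=> x y; case: (ltgtP x y) => [|yx|->]; first exact: hlt.
    by rewrite distrC [`|x - y|]distrC; exact: hlt.
  by rewrite !subrr normr0 mulr0.
move=> xy; have [z _ e] := mean_value dg xy.
by rewrite distrC e normrM [`|y - x|]distrC ler_wpM2r.
Qed.

Lemma cos_Lipschitz x y : `|cos x - cos y| <= `|x - y|.
Proof.
rewrite -[leRHS]mul1r; apply: (@Lipschitz_derive _ (fun x => - sin x)) => t.
by rewrite normrN ler_norml sin_geN1 sin_le1.
Qed.

Lemma sin_Lipschitz x y : `|sin x - sin y| <= `|x - y|.
Proof.
rewrite -[leRHS]mul1r; apply: (@Lipschitz_derive _ cos) => t.
by rewrite ler_norml cos_geN1 cos_le1.
Qed.

(** By Rolle's theorem the derivative vanishes between two roots, while it has modulus at least [c]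
    at a root. The Lipschitz constant [H] converts this into a distance. *)
Lemma root_gap g h c H x y : 0 < c -> 0 < H -> (forall x, is_derive x 1 g (h x)) ->
  (forall x, c ^+ 2 <= g x ^+ 2 + h x ^+ 2) -> (forall x y, `|h x - h y| <= H * `|x - y|) ->
  g x = 0 -> g y = 0 -> x < y -> c / H <= y - x.
Proof.
move=> c0 H0 dg hc hH gx gy xy; have [z /andP[xz zy]] := mean_value dg xy.
rewrite gx gy subrr => /esym/eqP; rewrite mulf_eq0 (gt_eqF (_ : 0 < y - x)) ?subr_gt0 // orbF => /eqP hz.
rewrite ler_pdivrMr //.
have h1 : c <= `|h x|.
  rewrite -(ler_pXn2r (n:=2)) ?nnegrE ?(ltW c0) // real_normK ?num_real //.
  by have := hc x; rewrite gx expr0n add0r.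
apply: le_trans h1 _; have := hH x z; rewrite hz subr0 => /le_trans; apply.
rewrite mulrC ler_wpM2r ?(ltW H0) // ltr0_norm ?subr_lt0 // opprB; lra.
Qed.

(** The smallness of [g l] keeps the derivative above [c / 4] at distance up to [t = 4 * |g l| / c],
    and this slope is just enough for [g] to change sign there. *)
Lemma near_root_pos g h c H l : 0 < c -> 0 < H -> (forall x, is_derive x 1 g (h x)) ->
  (forall x y, `|h x - h y| <= H * `|x - y|) -> c / 2 <= h l ->
  `|g l| <= c ^+ 2 / (16 * H) -> exists2 l', `|l' - l| <= 4 * `|g l| / c & g l' = 0.
Proof.
move=> c0 H0 dg hH hl gl; have [g0|g0] := eqVneq (g l) 0.
  by exists l => //; rewrite subrr normr0 g0 normr0 mulr0 mul0r.
pose t := 4 * `|g l| / c.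
have t0 : 0 < t by rewrite divr_gt0 // mulr_gt0 // normr_gt0.
have tc : t * (c / 4) = `|g l| by rewrite /t; field; rewrite gt_eqF.
have Ht : H * t <= c / 4.
  have : `|g l| * (16 * H) <= c ^+ 2 by rewrite -ler_pdivlMr // mulr_gt0.
  move=> h1; rewrite -(ler_pM2r c0).
  have -> : H * t * c = `|g l| * (16 * H) / 4 by rewrite /t; field; rewrite gt_eqF.
  by move: h1; rewrite expr2; lra.
have h4 z : `|z - l| <= t -> c / 4 <= h z.
  move=> hz; have := hH z l; have : H * `|z - l| <= H * t by rewrite ler_wpM2l // ltW.
  by move=> h1 h2; have := le_trans h2 (le_trans h1 Ht); rewrite ler_norml => /andP[]; lra.
have h4' : 0 <= c / 4 by rewrite divr_ge0 // ltW.
have [z1 /andP[lz zl] e1] : exists2 z, l < z < l + t & g (l + t) - g l = h z * (l + t - l).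
  by apply: mean_value => //; rewrite ltrDl.
have [z2 /andP[lz2 zl2] e2] : exists2 z, l - t < z < l & g l - g (l - t) = h z * (l - (l - t)).
  by apply: mean_value => //; rewrite gtrBl.
have k1 : c / 4 <= h z1 by apply: h4; rewrite ler_norml; apply/andP; split; lra.
have k2 : c / 4 <= h z2 by apply: h4; rewrite ler_norml; apply/andP; split; lra.
have k3 : t * (c / 4) <= t * h z1 by rewrite ler_wpM2l // ltW.
have k4 : t * (c / 4) <= t * h z2 by rewrite ler_wpM2l // ltW.
have gp : 0 <= g (l + t).
  have := ler_norm (- g l); rewrite normrN.
  have : g (l + t) - g l = t * h z1 by rewrite e1 addrAC subrr add0r mulrC.
  by move: tc k3; lra.
have gn : g (l - t) <= 0.
  have := ler_norm (g l).
  have : g l - g (l - t) = t * h z2 by rewrite e2 opprB addrC subrK mulrC.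
  by move: tc k4; lra.
have [| | |l'] := @IVT _ g (l - t) (l + t) 0; first by lra.
- by apply: continuous_subspaceT => x; exact: is_derive_cont dg x.
- by rewrite ge_min gn /= le_max gp orbT.
rewrite in_itv /= => /andP[h1 h2] h3; exists l' => //.
by rewrite ler_norml -/t; apply/andP; split; lra.
Qed.

(** A small value of [g] forces a large derivative by nondegeneracy; replacing [g] by its negative
    reduces to a positive derivative. *)
Lemma near_root g h c H l : 0 < c -> 0 < H -> (forall x, is_derive x 1 g (h x)) ->
  (forall x, c ^+ 2 <= g x ^+ 2 + h x ^+ 2) -> (forall x y, `|h x - h y| <= H * `|x - y|) ->
  `|g l| <= c ^+ 2 / (16 * H) -> `|g l| <= c / 2 ->
  exists2 l', `|l' - l| <= 4 * `|g l| / c & g l' = 0.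
Proof.
move=> c0 H0 dg hc hH gl gl2.
have hl : c / 2 <= `|h l|.
  rewrite -(ler_pXn2r (n:=2)) ?nnegrE ?divr_ge0 ?(ltW c0) // real_normK ?num_real //.
  have : g l ^+ 2 <= (c / 2) ^+ 2.
    by rewrite -[g l ^+ 2]real_normK ?num_real // ler_pXn2r ?nnegrE // divr_ge0 // ltW.
  have : (c / 2) ^+ 2 = c ^+ 2 / 4 by field.
  by have := hc l; have := sqr_ge0 c; lra.
have [hn|hp] := ltP (h l) 0.
  have [| | |l'] := @near_root_pos (fun x => - g x) (fun x => - h x) c H l c0 H0.
  - by move=> x y; rewrite -opprD normrN; exact: hH.
  - by rewrite -(ltr0_norm hn).
  - by rewrite normrN.
  by rewrite normrN => ? /eqP; rewrite oppr_eq0 => /eqP ?; exists l'.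
by apply: near_root_pos dg hH _ gl => //; rewrite -(ger0_norm hp).
Qed.

End RealRoots.

(** * The characteristic function of the unperturbed problem *)

Section Characteristic.
Context {R : realType}.
Variables (a al : R).
Hypotheses (al0 : 0 < al) (a0 : 0 < a) (api : a < pi).
Implicit Types (x l : R).
Let pi0 : 0 <= pi :> R := pi_ge0 R.

Definition muB : R := pi * (1 + al) + a * (2 + al).
Definition srhoB : R := 1 + al^-1.

Lemma mu_bound x : 0 <= x <= pi -> `|mu_plus a al x| <= muB /\ `|mu_minus a al x| <= muB.
Proof.
move=> /andP[x0 xp].
have s0 : 0 < srho a al x by exact: srho_gt0.
have s1 : srho a al x <= 1 + al by rewrite srhoE //; case: ifP => _; rewrite ?lerDl ?lerDr // ltW.
rewrite /mu_plus /mu_minus /muB; set s := srho _ _ _ in s0 s1 *.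
have h1 : x * s <= pi * (1 + al) by rewrite ler_pM // ltW.
have h2 : a * s <= a * (1 + al) by rewrite ler_wpM2l // ltW.
have h3 : 0 <= x * s by rewrite mulr_ge0 // ltW.
have h4 : 0 <= a * s by rewrite mulr_ge0 // ltW.
have h5 : 0 <= a * al by rewrite mulr_ge0 // ltW.
have h6 : 0 <= pi * al by rewrite mulr_ge0 // ltW.
have e1 : x * s + a * (1 - s) = x * s + a - a * s by ring.
have e2 : - x * s + a * (1 + s) = a + a * s - x * s by ring.
move: h1 h2 h3 h4 h5 h6 (pi_ge0 R) (ltW a0); rewrite e1 e2 !mulrDr mulr1.
move: (x * s) (a * s) (a * al) (pi * al) pi => X A Y Z P *.
by rewrite !ler_norml; split; apply/andP; split; lra.
Qed.

Lemma srhoV_bound x : 0 < (srho a al x)^-1 <= srhoB.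
Proof.
rewrite /srhoB srhoE //; case: ifP => _; rewrite ?invr1 ?ltr01 ?lerDl ?invr_gt0 ?al0 ?lerDr //=.
by rewrite invr_ge0 ltW.
Qed.

Lemma phi0_coef_bound x : `|2^-1 * (1 + (srho a al x)^-1)| <= 1 + srhoB /\
  `|2^-1 * (1 - (srho a al x)^-1)| <= 1 + srhoB.
Proof.
by have := srhoV_bound x; move: (_^-1) => k /andP[k0 kB]; rewrite !ler_norml; split; apply/andP; split; lra.
Qed.

Lemma phi0_bound x l : `|phi0 a al x l| <= 2 * (1 + srhoB).
Proof.
have [h1 h2] := phi0_coef_bound x.
rewrite /phi0; apply: le_trans (ler_normD _ _) _; rewrite !normrM.
have c1 z : `|cos z| <= 1 :> R by rewrite ler_norml cos_geN1 cos_le1.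
have aux (k z : R) : `|k| <= 1 + srhoB -> `|k| * `|cos z| <= 1 + srhoB.
  by move=> h; rewrite -[leRHS]mulr1 ler_pM.
rewrite -!normrM; have := aux _ (l * mu_plus a al x) h1; have := aux _ (l * mu_minus a al x) h2.
rewrite -!normrM; lra.
Qed.

Lemma phi0_Lipschitz : exists2 C, 0 < C & forall x l l', 0 <= x <= pi ->
  `|phi0 a al x l - phi0 a al x l'| <= C * `|l - l'|.
Proof.
have B0 : 0 < muB.
  by rewrite /muB addr_gt0 ?mulr_gt0 ?pi_gt0 ?addr_gt0.
have S0 : 0 < 1 + srhoB by rewrite /srhoB !addr_gt0 ?invr_gt0.
exists (2 * ((1 + srhoB) * muB)) => [|x l l' xp]; first by rewrite !mulr_gt0.
have [h1 h2] := phi0_coef_bound x; have [m1 m2] := mu_bound xp.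
rewrite /phi0; set P := 2^-1 * _ in h1 *; set Q := 2^-1 * _ in h2 *.
have -> : P * cos (l * mu_plus a al x) + Q * cos (l * mu_minus a al x)
   - (P * cos (l' * mu_plus a al x) + Q * cos (l' * mu_minus a al x)) =
  P * (cos (l * mu_plus a al x) - cos (l' * mu_plus a al x))
  + Q * (cos (l * mu_minus a al x) - cos (l' * mu_minus a al x)) by ring.
have aux p k : `|p| <= 1 + srhoB -> `|k| <= muB ->
    `|p * (cos (l * k) - cos (l' * k))| <= (1 + srhoB) * muB * `|l - l'|.
  move=> hp hk; rewrite normrM -mulrA ler_pM //.
  by apply: le_trans (cos_Lipschitz _ _) _; rewrite -mulrBl normrM mulrC ler_wpM2r.
apply: le_trans (ler_normD _ _) _; have := aux P _ h1 m1; have := aux Q _ h2 m2; lra.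
Qed.

(** The travel time through the right piece; [M] and [m] below are [mu_plus] and [mu_minus] at
    [pi]. *)
Let b := al * (pi - a).
Let M := a + b.
Let m := a - b.
Let p : R := 2^-1 * (1 + al^-1).
Let r : R := 2^-1 * (1 - al^-1).

Definition chi' l := p * (M * - sin (M * l + 0)) + r * (m * - sin (m * l + 0)).

Lemma chiE l : phi0 a al pi l = p * cos (M * l + 0) + r * cos (m * l + 0).
Proof.
rewrite /phi0 /mu_plus /mu_minus srhoE // leNgt api /= !addr0 /M /m /b /p /r.
by congr (_ * cos _ + _ * cos _); ring.
Qed.

Lemma chi_derive l : is_derive l 1 (phi0 a al pi) (chi' l).
Proof.
rewrite (_ : phi0 a al pi = fun l => p * cos (M * l + 0) + r * cos (m * l + 0)).
  by apply: is_derive_lin2; exact: derive_cos_aff.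
by apply/funext => x; exact: chiE.
Qed.

Lemma chi'_Lipschitz : exists2 H, 0 < H & forall x y, `|chi' x - chi' y| <= H * `|x - y|.
Proof.
pose K := `|p * M * M| + `|r * m * m|.
exists (K + 1) => [|x y]; first by rewrite ltr_pwDr // addr_ge0.
apply: (@Lipschitz_derive _ _ (fun l => p * M * - (M * cos (M * l + 0)) + r * m * - (m * cos (m * l + 0)))).
  move=> l; rewrite (_ : chi' = fun l => (p * M) * - sin (M * l + 0) + (r * m) * - sin (m * l + 0)).
    by apply: is_derive_lin2; apply: is_deriveN; exact: derive_sin_aff.
  by apply/funext => z; rewrite /chi'; ring.
move=> l; apply: (@le_trans _ _ K); last by rewrite lerDl.
have c1 z : `|cos z| <= 1 :> R by rewrite ler_norml cos_geN1 cos_le1.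
apply: le_trans (ler_normD _ _) _; rewrite !mulrN !normrN !mulrA lerD // normrM; by rewrite -[leRHS]mulr1 ler_wpM2l.
Qed.

(** In terms of [cos (a * l)] and [sin (a * l)], the function and its derivative form a linear
    system with determinant [D = A * C2 ^ 2 + k * B * S2 ^ 2]. It stays above [d > 0], and the
    unknown vector has length 1, so the two values cannot both be small. *)
Lemma chi_nondegenerate : exists2 c, 0 < c & forall l, c ^+ 2 <= phi0 a al pi l ^+ 2 + chi' l ^+ 2.
Proof.
have k0 : 0 < al^-1 by rewrite invr_gt0.
have b0 : 0 < b by rewrite mulr_gt0 // subr_gt0.
pose k := al^-1; pose A := a + k * b; pose B := b + k * a.
have A0 : 0 < A by rewrite addr_gt0 // mulr_gt0.
have B0 : 0 < k * B by rewrite mulr_gt0 // addr_gt0 // mulr_gt0.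
pose d := Num.min A (k * B); have d0 : 0 < d by rewrite lt_min A0 B0.
pose S := A ^+ 2 + k ^+ 2 + B ^+ 2 + 1.
have S0 : 0 < S by rewrite ltr_pwDr // !addr_ge0 // sqr_ge0.
exists (d / Num.sqrt S) => [|l]; first by rewrite divr_gt0 // sqrtr_gt0.
rewrite expr_div_n sqr_sqrtr ?(ltW S0) // ler_pdivrMr //.
set g := phi0 _ _ _ _; set g' := chi' l.
pose C1 := cos (a * l); pose S1 := sin (a * l); pose C2 := cos (b * l); pose S2 := sin (b * l).
have hg : g = C1 * C2 - k * (S1 * S2).
  rewrite /g chiE !addr0 /M /m mulrDl mulrBl cosD cosB -/C1 -/C2 -/S1 -/S2 /p /r -/k; by field.
have hg' : g' = - (A * (S1 * C2) + B * (C1 * S2)).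
  rewrite /g' /chi' !addr0 /M /m (mulrDl a b l) (mulrBl l a b) sinD sinB -/C1 -/C2 -/S1 -/S2 /p /r -/k /A /B; by field.
pose D := A * C2 ^+ 2 + k * B * S2 ^+ 2.
have e1 : C1 ^+ 2 + S1 ^+ 2 = 1 by exact: cos2Dsin2.
have e2 : C2 ^+ 2 + S2 ^+ 2 = 1 by exact: cos2Dsin2.
have hX : C1 * D = g * (A * C2) + (- g') * (k * S2) by rewrite hg hg' /D; ring.
have hY : S1 * D = - g * (B * S2) + (- g') * C2 by rewrite hg hg' /D; ring.
have hD : D ^+ 2 = (g * (A * C2) + (- g') * (k * S2)) ^+ 2 + (- g * (B * S2) + (- g') * C2) ^+ 2.
  by rewrite -hX -hY !exprMn -mulrDl e1 mul1r.
have dD : d <= D.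
  have -> : d = d * C2 ^+ 2 + d * S2 ^+ 2 by rewrite -mulrDr e2 mulr1.
  by rewrite lerD // ler_wpM2r ?sqr_ge0 // ge_min lexx ?orbT.
have dD2 : d ^+ 2 <= D ^+ 2 by rewrite ler_pXn2r ?nnegrE ?(ltW d0) ?(le_trans _ dD) ?(ltW d0).
apply: le_trans dD2 _; rewrite hD.
have cs (x y u v : R) : (x * u + y * v) ^+ 2 <= (x ^+ 2 + y ^+ 2) * (u ^+ 2 + v ^+ 2).
  by rewrite -subr_ge0 (_ : _ - _ = (x * v - y * u) ^+ 2) ?sqr_ge0 //; ring.
apply: (@le_trans _ _ ((g ^+ 2 + g' ^+ 2) * ((A * C2) ^+ 2 + (k * S2) ^+ 2 + ((B * S2) ^+ 2 + C2 ^+ 2)))).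
  by rewrite mulrDr lerD // (le_trans (cs _ _ _ _)) // ?sqrrN.
rewrite ler_wpM2l ?addr_ge0 ?sqr_ge0 //.
have c21 : C2 ^+ 2 <= 1 by have := sqr_ge0 S2; lra.
have s21 : S2 ^+ 2 <= 1 by have := sqr_ge0 C2; lra.
have aux (z u : R) : u ^+ 2 <= 1 -> (z * u) ^+ 2 <= z ^+ 2.
  by move=> h; rewrite exprMn -[leRHS]mulr1 ler_wpM2l ?sqr_ge0.
have := aux A _ c21; have := aux k _ s21; have := aux B _ s21; rewrite /S; lra.
Qed.

End Characteristic.

(** * Matching the two spectra *)

Section NoShift.
Context {R : realType}.
Variables (a al : R).
Hypothesis al0 : 0 < al.
Notation L2p := (@L2 R 0 pi).
Notation ip := (wip a al).

Lemma tail_bound (Q : nat -> R -> Prop) : (forall n C C', C <= C' -> Q n C -> Q n C') ->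
  (forall n, exists C, Q n C) -> (exists N C, forall n, (N <= n)%N -> Q n C) ->
  exists2 C, 0 < C & forall n, Q n C.
Proof.
move=> hm hall [N [C hN]]; suff [C' hC'] : exists C', forall n, Q n C'.
  by exists (`|C'| + 1) => [|n]; [rewrite ltr_pwDr|apply: hm (hC' n); rewrite (le_trans (ler_norm _)) // lerDl].
elim: N C hN => [C h|N IH C h]; first by exists C => n; exact: h.
have [C1 h1] := hall N; apply: (IH (Num.max C C1)) => n; rewrite leq_eqVlt => /predU1P[<-|Nn].
  by apply: hm h1; rewrite le_max lexx orbT.
by apply: hm (h n Nn); rewrite le_max lexx.
Qed.

Lemma wide_kernel D (F : nat -> nat -> R) : exists2 c : nat -> R,
  (exists2 i, (i < D.+1)%N & c i != 0) & forall j, (j < D)%N -> \sum_(0 <= i < D.+1) c i * F i j = 0.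
Proof.
pose A : 'M[R]_(D.+1, D) := \matrix_(i, j) F i j.
have : kermx A != 0.
  by rewrite -mxrank_eq0 mxrank_ker -lt0n subn_gt0 ltnS rank_leq_col.
move=> /rowV0Pn[v /sub_kermxP vA v0]; exists (fun i => v 0 (inord i)).
  have [i hi] := rV0Pn _ v0.
  by exists i => //; rewrite inord_val.
move=> j jD; move/matrixP: vA => /(_ 0 (Ordinal jD)); rewrite !mxE => {2}<-.
by rewrite big_mkord; apply: eq_bigr => i _; rewrite mxE inord_val.
Qed.

(* If the orthogonal family G were shifted against the complete family E from index D on, a
   nonzero combination of the D+1 functions G_0, .., G_D could be made orthogonal to
   E_0, .., E_(D-1), and almost orthogonal to all the other E_n. *)
Lemma no_shift (E G : nat -> R -> R) (w : nat -> R) D (kap : nat -> nat) :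
  (forall n, L2p (E n)) -> (forall n, L2p (G n)) ->
  (forall m n, m != n -> ip (G m) (G n) = 0) -> (forall n, 0 < ip (G n) (G n)) ->
  (forall n, 0 < w n) ->
  (forall v, L2p v -> forall e, 0 < e -> exists N, forall n u, (N <= n)%N -> L2p u ->
    (ip v u - \sum_(0 <= i < n) ip v (E i) * ip u (E i) / w i) ^+ 2 <= e * ip u u) ->
  (forall n, (D <= n)%N -> (D < kap n)%N) ->
  (forall n, \sum_(D <= i < n) ip (fun x => E i x - G (kap i) x) (fun x => E i x - G (kap i) x) / w i
    <= 2^-1) -> False.
Proof.
move=> hE hG Go Gp wp Pars hk hs.
have [c [i0 i0D ci0] cE] := wide_kernel D (fun i j => ip (G i) (E j)).
pose f x := \sum_(0 <= i < D.+1) c i * G i x.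
have hf : L2p f by apply: L2_sum => i; exact/L2Z.
have ipf u : L2p u -> ip f u = \sum_(0 <= i < D.+1) c i * ip (G i) u.
  move=> hu; rewrite ip_suml //; last by move=> i; exact/L2Z.
  by apply: eq_bigr => i _; rewrite ipZl.
have fE j : (j < D)%N -> ip f (E j) = 0 by move=> jD; rewrite ipf // cE.
have fG k : (D < k)%N -> ip f (G k) = 0.
  move=> Dk; rewrite ipf // big_nat big1 // => i /andP[_ iD]; rewrite Go ?mulr0 //.
  by rewrite neq_ltn (leq_trans iD Dk).
have fGi k : (k <= D)%N -> ip f (G k) = c k * ip (G k) (G k).
  move=> Dk; rewrite ipf // (bigD1_seq k) ?mem_index_iota ?iota_uniq //= ?ltnS // big1 ?addr0 // => i ik.
  by rewrite Go // mulr0.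
have ff : ip f f = \sum_(0 <= i < D.+1) c i ^+ 2 * ip (G i) (G i).
  rewrite ipf //; apply: eq_big_nat => i /andP[_ iD]; rewrite ipC fGi // ; ring.
have fp : 0 < ip f f.
  rewrite ff (bigD1_seq i0) ?mem_index_iota ?iota_uniq //= ltr_pwDl //.
    by rewrite mulr_gt0 // lt_def sqrf_eq0 ci0 sqr_ge0.
  by rewrite sumr_ge0 // => i _; rewrite mulr_ge0 ?sqr_ge0 // ltW.
(* The factor 16 contradicts what follows: at least half of [ip f f] is missing from the Parseval
   sum, and [1/4 > 1/16]. *)
have [N hN] := Pars f hf (ip f f / 16) (divr_gt0 fp (ltr0n R 16)).
pose n := maxn N D.
have Dn : (D <= n)%N by exact: leq_maxr.
have := hN n f (leq_maxl _ _) hf.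
have hS : \sum_(0 <= i < n) ip f (E i) * ip f (E i) / w i <= ip f f * 2^-1.
  rewrite (@big_cat_nat _ _ _ D) //= [X in X + _]big_nat [X in X + _]big1 ?add0r; last first.
    by move=> i /andP[_ iD]; rewrite fE // !mul0r.
  apply: le_trans (ler_wpM2l (ltW fp) (hs n)); rewrite mulr_sumr !big_nat.
  apply: ler_sum => i /andP[Di _]; rewrite mulrA ler_wpM2r ?invr_ge0 ?(ltW (wp i)) //.
  have -> : ip f (E i) = ip f (fun x => E i x - G (kap i) x) by rewrite ipBr // fG ?subr0 ?hk.
  by rewrite -expr2; apply: ip_CS => //; exact: L2B.
move: hS; set S := \sum_(_ <= _ < _) _ => hS; rewrite leNgt => /negP; apply.
have h1 : ip f f / 2 <= ip f f - S by move: hS; lra.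
have h2 : (ip f f / 2) ^+ 2 <= (ip f f - S) ^+ 2.
  by rewrite ler_pXn2r ?nnegrE ?(le_trans _ h1) ?divr_ge0 ?(ltW fp).
apply: lt_le_trans h2; move: fp; move: (ip f f) => F F0; have := mulr_gt0 F0 F0.
by rewrite expr2; lra.
Qed.

End NoShift.

(** * Growth of the eigenvalues and positivity of the norming constants *)

Section SpectrumLimits.
Context {R : realType}.
Variables (q : R -> R) (a al : R).
Hypotheses (al0 : 0 < al) (a0 : 0 < a) (api : a < pi) (hq : L2 0 pi q).
Variables (phi phi1 : R -> R -> R) (lam : nat -> R).
Hypothesis hphi : forall l, is_sol q a al (l ^+ 2) (fun x => phi x l) (fun x => phi1 x l) /\
  phi 0 l = 1 /\ phi1 0 l = 0.
Hypothesis lam_ge0 : forall n, 0 <= lam n.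
Hypothesis lamS : forall n, lam n < lam n.+1.
Hypothesis eigP : forall nu, is_eigenvalue q a al nu <-> exists n, nu = lam n ^+ 2.
Notation I := (@lintegral_ab R).
Notation w := (rho a al).
Notation L2p := (@L2 R 0 pi).
Notation ef := (eigenfun phi lam).
Notation alpha := (norming a al phi lam).
Let pi0 : 0 <= pi :> R := pi_ge0 R.

(** If the first [n] eigenvalues stay below a bound, their contribution to the trace grows like [n],
    against [eigenvalue_growth]. *)
Lemma lam_infty L : exists N, forall n, (N <= n)%N -> L <= lam n.
Proof.
have [K hK] := eigenvalue_growth al0 hq hphi lam_ge0 lamS eigP.
have n0 := nu0_lt0 q al0; set nu := nu0 _ _ in hK n0.
pose B := (`|L| ^+ 2 - nu) ^+ 2.
have b0 : 0 < `|L| ^+ 2 - nu by rewrite subr_gt0 (lt_le_trans n0) // sqr_ge0.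
have B0 : 0 < B by rewrite exprn_gt0.
pose N := (Num.truncn `|K * B|).+1.
exists N => n Nn; rewrite leNgt; apply/negP => hn.
have lt i : (i < n)%N -> B^-1 <= ((lam i ^+ 2 - nu) ^+ 2)^-1.
  move=> i_n; have hi : lam i <= `|L|.
    apply: le_trans (ler_norm _); apply: le_trans (ltW hn); exact/ltW/(lam_lt lamS).
  have d0 : 0 < lam i ^+ 2 - nu by rewrite subr_gt0 (lt_le_trans n0) // sqr_ge0.
  rewrite lef_pV2 ?posrE ?exprn_gt0 // ler_pXn2r ?nnegrE ?(ltW d0) ?(ltW b0) //.
  by rewrite lerD2r ler_pXn2r ?nnegrE.
have h : n%:R * B^-1 <= K.
  apply: le_trans (hK n); rewrite mulr_natl -[X in _ *+ X]subn0 -sumr_const_nat.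
  rewrite !big_nat; apply: ler_sum => i /andP[_]; exact: lt.
move: h; rewrite ler_pdivrMr // leNgt => /negP; apply.
apply: le_lt_trans (ler_norm _) _; apply: lt_le_trans (truncnS_gt _) _.
by rewrite ler_nat.
Qed.

Lemma I_cos_sqr l : 0 < l -> a / 2 - (4 * l)^-1 <= I 0 a (fun x => cos (l * x) ^+ 2).
Proof.
move=> l0; have h : AC 0 a (fun x => (4 * l)^-1 * sin (2 * l * x + 0) + 2^-1 * (x : R)) 
    (fun x => (4 * l)^-1 * (2 * l * cos (2 * l * x + 0)) + 2^-1 * 1).
  apply: AC_C1 => [x|]; first exact: (is_derive_lin2 _ _ (derive_sin_aff _ _ _) (is_derive_id _ _)).
  have -> : (fun x : R => (4 * l)^-1 * (2 * l * cos (2 * l * x + 0)) + 2^-1 * 1) =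
     (fun x => (4 * l)^-1 * (2 * l) * cos (2 * l * x + 0) + (2^-1 * 1) * cos (0 * x + 0)).
    by apply/funext => x; rewrite (_ : 0 * x + 0 = 0) ?cos0; ring.
  by apply: continuous_lin2; exact: cont_cos_aff.
have e : I 0 a (fun x => (4 * l)^-1 * (2 * l * cos (2 * l * x + 0)) + 2^-1 * 1) = I 0 a (fun x => cos (l * x) ^+ 2).
  apply: I_ext => x _; rewrite addr0 (_ : 2 * l * x = l * x + l * x) ?cosD; last by ring.
  have := cos2Dsin2 (l * x); rewrite -!expr2 => h1.
  have -> : sin (l * x) ^+ 2 = 1 - cos (l * x) ^+ 2 by rewrite -h1 addrAC subrr add0r.
  by field; rewrite gt_eqF.
have := h.2 a; rewrite lexx (ltW a0) e => /(_ isT).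
rewrite !mulr0 !addr0 sin0 mulr0 !add0r => <-.
have : - (4 * l)^-1 <= (4 * l)^-1 * sin (2 * l * a).
  by rewrite -[leLHS]mulr1 mulNr -mulrN ler_wpM2l ?sin_geN1 // invr_ge0 mulr_ge0 // ltW.
by lra.
Qed.

(** On [[0, a]] the eigenfunction is close to [cos (lam n * x)], whose square has mean near one
    half. The finitely many small indices are handled by positivity. *)
Lemma norming_ge : exists2 c, 0 < c & forall n, c <= alpha n.
Proof.
have [C [l0 [C0 l01 hC]]] := phi_asymptotics al0 a0 api hq hphi.
suff [C1 C10 hC1] : exists2 C1, 0 < C1 & forall n, 1 <= C1 * alpha n.
  exists C1^-1 => [|n]; first by rewrite invr_gt0.
  by rewrite -[C1^-1]mul1r ler_pdivrMr // mulrC.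
have ap n : 0 < alpha n by exact: alpha_gt0 hphi eigP n.
apply: tail_bound => [n C1 C2 h h'|n|].
- by apply: le_trans h' _; rewrite ler_wpM2r // ltW.
- by exists (alpha n)^-1; rewrite mulVf // gt_eqF.
pose L := Num.max l0 (Num.max (4 / a) (4 * C)).
have [N hN] := lam_infty L; exists N, (8 * 2 / a) => n /hN.
rewrite !ge_max => /and3P[h1 h2 h3].
have l1 : 1 <= lam n by exact: le_trans h1.
have lp : 0 < lam n by exact: lt_le_trans l1.
have ha : a / 16 <= alpha n; last first.
  by rewrite mulrAC ler_pdivlMr // mul1r; move: ha; lra.
have e2 : L2p (ef n) by exact: ef_L2 hphi n.
have e2a : L2 0 a (ef n) by apply: L2_sub (ltW api) e2.
have bc : BM 0 a (fun x => cos (lam n * x)) by exact: AC_BM (ltW a0) (AC_left 0 a (lam n)).1.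
apply: (@le_trans _ _ (I 0 a (fun x => ef n x ^+ 2))); last first.
  rewrite /norming /wip (@I_split _ 0 a pi) ?(ltW a0) ?(ltW api) //; last exact: ip_L1.
  rewrite -[leLHS]addr0 lerD //.
    have -> // : I 0 a (fun x => ef n x ^+ 2) = I 0 a (fun x => w x * ef n x * ef n x).
    by apply: I_ext => x /andP[_ xa]; rewrite /rho xa mul1r expr2.
  by apply: I_ge0 => x _; rewrite -mulrA -expr2 mulr_ge0 ?sqr_ge0 // ltW // rho_gt0.
apply: (@le_trans _ _ (I 0 a (fun x => 2^-1 * cos (lam n * x) ^+ 2 - (C / lam n) ^+ 2))); last first.
  apply: I_le => [||x /andP[x0 xa]]; [|exact: e2a.2|].
    by apply: L1B; [exact/L1Z/BM_L1/BMX|exact/BM_L1/BM_cst].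
  have xp : 0 <= x <= pi by rewrite x0 (le_trans xa) // ltW.
  have [_] := hC (lam n) x h1 xp; rewrite (phi0_left al0 (lam n) xa).1.
  rewrite /eigenfun; move: (phi x _) (cos _) => u v huv.
  have h5 : (u - v) ^+ 2 <= (C / lam n) ^+ 2.
    by rewrite -[leLHS]real_normK ?num_real // ler_pXn2r ?nnegrE ?divr_ge0 ?(ltW C0).
  (* The inequality in use is [v ^ 2 / 2 - (u - v) ^ 2 <= u ^ 2]; its defect is half of this
     square. *)
  have := sqr_ge0 (2 * u - v); move: h5; rewrite !expr2; lra.
rewrite IB; [|exact/L1Z/BM_L1/BMX|exact/BM_L1/BM_cst].
rewrite I_cst ?(ltW a0) // IZ; last exact/BM_L1/BMX.
have := I_cos_sqr lp.
have k1 : (4 * lam n)^-1 <= a / 16.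
  rewrite -[leLHS]mul1r ler_pdivrMr ?mulr_gt0 //; move: h2; rewrite ler_pdivrMr //.
  by move: (lam n) => l; lra.
have k2 : (C / lam n) ^+ 2 * (a - 0) <= a / 16.
  have : C / lam n <= 4^-1 by rewrite ler_pdivrMr // -ler_pdivrMl //; move: h3; rewrite invrK; lra.
  have : 0 <= C / lam n by rewrite divr_ge0 ?(ltW C0).
  move: (C / _) a0 => t a_0 t0 t1; rewrite subr0 mulrC ler_wpM2l ?(ltW a_0) //.
  by rewrite expr2; nra.
move: k1 k2 (ltW a0); move: (I _ _ _) ((C / _) ^+ 2 * _) ((4 * _)^-1) => X Y Z k1 k2 k3 k4; lra.
Qed.

End SpectrumLimits.

(** * Pairing of the two spectra with equal indices *)

Section Alignment.
Context {R : realType}.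
Variables (q : R -> R) (a al : R).
Hypotheses (al0 : 0 < al) (a0 : 0 < a) (api : a < pi) (hq : L2 0 pi q).
Variables (phi phi1 : R -> R -> R) (lam lam0 : nat -> R).
Hypothesis hphi : forall l, is_sol q a al (l ^+ 2) (fun x => phi x l) (fun x => phi1 x l) /\
  phi 0 l = 1 /\ phi1 0 l = 0.
Hypothesis lam_ge0 : forall n, 0 <= lam n.
Hypothesis lamS : forall n, lam n < lam n.+1.
Hypothesis eigP : forall nu, is_eigenvalue q a al nu <-> exists n, nu = lam n ^+ 2.
Hypothesis lam0_ge0 : forall n, 0 <= lam0 n.
Hypothesis lam0S : forall n, lam0 n < lam0 n.+1.
Hypothesis eigP0 : forall nu, is_eigenvalue (fun _ => 0) a al nu <-> exists n, nu = lam0 n ^+ 2.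
Notation I := (@lintegral_ab R).
Notation w := (rho a al).
Notation ip := (wip a al).
Notation L2p := (@L2 R 0 pi).
Notation ef := (eigenfun phi lam).
Notation ef0 := (eigenfun (phi0 a al) lam0).
Notation alpha := (norming a al phi lam).
Notation alpha0 := (norming a al (phi0 a al) lam0).
Let pi0 : 0 <= pi :> R := pi_ge0 R.

Lemma L2_zero : L2p (fun _ => 0).
Proof. exact/BM_L2/BM_cst. Qed.

Lemma phi0_spec l : is_sol (fun _ => 0) a al (l ^+ 2) (fun x => phi0 a al x l) (fun x => phi0' a al x l) /\
  phi0 a al 0 l = 1 /\ phi0' a al 0 l = 0.
Proof. by split; [exact: phi0_is_sol|exact: phi0_init]. Qed.

Let ap n : 0 < alpha n.
Proof. exact (alpha_gt0 al0 hq hphi eigP n). Qed.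
Let ap0 n : 0 < alpha0 n.
Proof. exact (alpha_gt0 al0 L2_zero phi0_spec eigP0 n). Qed.
Let e2 n : L2p (ef n).
Proof. exact: ef_L2 hphi n. Qed.
Let e20 n : L2p (ef0 n).
Proof. exact: ef_L2 phi0_spec n. Qed.

Lemma lam0_root n : phi0 a al pi (lam0 n) = 0.
Proof. exact (ef_pi al0 L2_zero phi0_spec eigP0 n). Qed.

Lemma root_lam0 l : 0 <= l -> phi0 a al pi l = 0 -> exists k, l = lam0 k.
Proof.
move=> l0 h; have [h1 [h2 h3]] := phi0_spec l.
have [|k /eqP e] := (eigP0 (l ^+ 2)).1.
  exists (fun x => phi0 a al x l), (fun x => phi0' a al x l); split => //; split => //; split => //.
  by exists 0; rewrite h2 lexx pi0 oner_eq0.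
by exists k; apply/eqP; rewrite eqrXn2 // in e.
Qed.

(** Consecutive roots of the nondegenerate characteristic function are at least [c / H] apart; the
    gaps add up. *)
Lemma lam0_gap : exists2 d, 0 < d & forall m n, (m <= n)%N -> d * (n - m)%:R <= lam0 n - lam0 m.
Proof.
have [c c0 hc] := chi_nondegenerate al0 a0 api.
have [H H0 hH] := chi'_Lipschitz a al.
exists (c / H) => [|m n]; first by rewrite divr_gt0.
elim: n => [|n IH]; first by rewrite leqn0 => /eqP ->; rewrite !subrr mulr0.
rewrite leq_eqVlt => /predU1P[->|]; first by rewrite subnn subrr mulr0.
rewrite ltnS => mn; rewrite subSn // -addn1 natrD mulrDr mulr1.
have := root_gap c0 H0 (chi_derive al0 api) hc hH (lam0_root n) (lam0_root n.+1) (lam0S n).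
by have := IH mn; lra.
Qed.

Lemma ip_sup f B : L2p f -> (forall x, 0 <= x <= pi -> `|f x| <= B) ->
  ip f f <= (1 + al ^+ 2) * pi * B ^+ 2.
Proof.
move=> hf hB; apply: le_trans (ip_le_I _ _ hf) _ => //.
rewrite -mulrA ler_wpM2l ?addr_ge0 ?sqr_ge0 //.
apply: (@le_trans _ _ (I 0 pi (fun=> B ^+ 2))); last by rewrite I_cst // subr0 mulrC.
apply: I_le => [||x /hB h]; [exact: hf.2|exact/BM_L1/BM_cst|].
by rewrite -[leLHS]real_normK ?num_real // ler_pXn2r ?nnegrE // (le_trans _ h).
Qed.

(** Since [phi(pi, lam n) = 0], the asymptotics make [phi0(pi, lam n)] of size [1 / lam n], and
    nondegeneracy supplies a root nearby. Nothing is known about the index map [k] at this stage. *)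
Lemma matching : exists N C (k : nat -> nat), 0 < C /\ forall n, (N <= n)%N ->
  [/\ 1 <= lam n, `|lam n - lam0 (k n)| <= C / lam n &
    forall x, 0 <= x <= pi -> `|phi x (lam n) - phi0 a al x (lam0 (k n))| <= C / lam n].
Proof.
have [C1 [l0 [C0 l01 hC]]] := phi_asymptotics al0 a0 api hq hphi.
have [c c0 hc] := chi_nondegenerate al0 a0 api.
have [H H0 hH] := chi'_Lipschitz a al.
have [L L0 hL] := phi0_Lipschitz al0 a0.
pose La := Num.max l0 (Num.max (16 * H * C1 / c ^+ 2) (4 * C1 / c)).
have [N hN] := lam_infty al0 hq hphi lam_ge0 lamS eigP La.
pose C2 := 4 * C1 / c; have C20 : 0 < C2 by rewrite divr_gt0 ?mulr_gt0.
pose C := C2 + (C1 + L * C2).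
have C00 : 0 < C.
  by apply: addr_gt0 => //; apply: addr_gt0 => //; apply: mulr_gt0.
suff hk n : exists k, (N <= n)%N -> [/\ 1 <= lam n, `|lam n - lam0 k| <= C / lam n &
    forall x, 0 <= x <= pi -> `|phi x (lam n) - phi0 a al x (lam0 k)| <= C / lam n].
  by have [k hk'] := choice hk; exists N, C, k.
have [Nn|nN] := leqP N n; last by exists 0.
have := hN n Nn; rewrite !ge_max => /and3P[h1 h2 h3].
have l1 : 1 <= lam n by exact: le_trans h1.
have lp : 0 < lam n by exact: lt_le_trans l1.
have hpi : 0 <= (pi : R) <= pi by rewrite pi0 lexx.
have gl : `|phi0 a al pi (lam n)| <= C1 / lam n.
  by have [_] := hC (lam n) pi h1 hpi; rewrite (ef_pi al0 hq hphi eigP) sub0r normrN.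
have [||l' hl' rl'] := near_root c0 H0 (chi_derive al0 api) hc hH (l := lam n).
- apply: le_trans gl _; rewrite ler_pdivrMr // mulrAC ler_pdivlMr ?mulr_gt0 // [leRHS]mulrC.
  by rewrite -ler_pdivrMr ?exprn_gt0 // [C1 * _]mulrC.
- apply: le_trans gl _; rewrite ler_pdivrMr //.
  move: h3; rewrite ler_pdivrMr // => h3; rewrite mulrAC [c * _]mulrC.
  by have := ltW C0; move: h3; move: (lam n * c) => X; lra.
have hl2 : `|lam n - l'| <= C2 / lam n.
  rewrite distrC; apply: le_trans hl' _; rewrite /C2.
  rewrite (_ : 4 * C1 / c / lam n = 4 * (C1 / lam n) / c); last by rewrite -!mulrA; congr (_ * (_ * _)); rewrite mulrC.
  by rewrite ler_pM2r ?invr_gt0 // ler_pM2l.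
have l'0 : 0 <= l'.
  have : C2 / lam n <= 1 by rewrite ler_pdivrMr // mul1r.
  by move: hl2; rewrite ler_norml => /andP[_]; lra.
have [k e] := root_lam0 l'0 rl'; exists k => _; split => // [|x xp].
  rewrite -e; apply: le_trans hl2 _; rewrite ler_wpM2r ?invr_ge0 ?(ltW lp) // lerDl.
  by apply: addr_ge0; [exact: ltW|exact: mulr_ge0 (ltW L0) (ltW C20)].
rewrite -e; apply: le_trans (ler_distD (phi0 a al x (lam n)) _ _) _.
have [_ g1] := hC (lam n) x h1 xp; have g2 := hL x (lam n) l' xp.
have g3 : L * `|lam n - l'| <= L * (C2 / lam n) by rewrite ler_pM2l.
rewrite /C mulrDl mulrDl -[L * C2 / _]mulrA.
have : 0 <= C2 / lam n by rewrite divr_ge0 // ltW.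
lra.
Qed.

(** Each term is below [1 / i - 1 / (i + 1)], and these telescope. *)
Lemma tail_inv_sqr D n : (0 < D)%N -> \sum_(D <= i < n) (i.+1%:R ^+ 2)^-1 <= (D%:R : R)^-1.
Proof.
move=> D0; have [nD|Dn] := leqP n D; first by rewrite big_geq // invr_ge0.
suff : \sum_(D <= i < n) (i.+1%:R ^+ 2)^-1 <= (D%:R : R)^-1 - n%:R^-1.
  by move/le_trans; apply; rewrite gerBl invr_ge0.
rewrite -opprB -(telescope_sumr (fun i => (i%:R : R)^-1)) ?(ltnW Dn) // -sumrN !big_nat.
apply: ler_sum => i /andP[Di _]; rewrite opprB.
have i0 : (0 : R) < i%:R by rewrite ltr0n (leq_trans D0).
have i1 : (0 : R) < i.+1%:R by rewrite ltr0n.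
rewrite -(ler_pM2l i0) -(ler_pM2l (exprn_gt0 2 i1)); move: i1; rewrite -natr1 => i1.
have -> : (i%:R + 1) ^+ 2 * (i%:R * ((i%:R + 1) ^+ 2)^-1) = i%:R :> R by field; rewrite gt_eqF.
have -> : (i%:R + 1) ^+ 2 * (i%:R * (i%:R^-1 - (i%:R + 1)^-1)) = i%:R + 1 :> R by field; rewrite !gt_eqF.
by rewrite lerDl.
Qed.

Let alpha_ge : exists2 c, 0 < c & forall n, c <= alpha n.
Proof. exact (norming_ge al0 a0 api hq hphi lam_ge0 lamS eigP). Qed.

Lemma alpha0_ge : exists2 c, 0 < c & forall n, c <= alpha0 n.
Proof. exact (norming_ge al0 a0 api L2_zero phi0_spec lam0_ge0 lam0S eigP0). Qed.

(** A strictly increasing [k] grows at least like [n], and the root gaps transfer this linear growth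
    to [lam]. *)
Lemma matching_increasing : exists N C c (k : nat -> nat), [/\ 0 < C, 0 < c & forall n, (N <= n)%N ->
  [/\ (k n < k n.+1)%N, c * n.+1%:R <= lam n, `|lam n - lam0 (k n)| <= C / lam n &
    forall x, 0 <= x <= pi -> `|phi x (lam n) - phi0 a al x (lam0 (k n))| <= C / lam n]].
Proof.
have [N [C [k [C0 hk]]]] := matching.
have [d d0 hd] := lam0_gap; have [c0 c00 hc0] := alpha_ge.
have al1 : 0 < 1 + al ^+ 2 by rewrite ltr_pwDl // sqr_ge0.
pose W := (1 + al ^+ 2) * pi * (2 * C) ^+ 2.
have W0 : 0 < W by rewrite !mulr_gt0 ?pi_gt0 // exprn_gt0 // mulr_gt0.
pose La := Num.max (W / c0) (4 * C / d).
have [N1 hN1] := lam_infty al0 hq hphi lam_ge0 lamS eigP La.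
pose N2 := maxn N N1.
have kS n : (N2 <= n)%N -> (k n < k n.+1)%N.
  move=> Nn; have [l1 ln xn] := hk n (leq_trans (leq_maxl _ _) Nn).
  have [l1' ln' xn'] := hk n.+1 (leqW (leq_trans (leq_maxl _ _) Nn)).
  have := hN1 n (leq_trans (leq_maxr _ _) Nn); rewrite ge_max => /andP[h1 h2].
  have lp : 0 < lam n by exact: lt_le_trans l1.
  have CS : C / lam n.+1 <= C / lam n.
    have lt := lamS n; have lp' := lt_trans lp lt.
    by rewrite ler_pM2l // lef_pV2 ?posrE //; exact: ltW.
  (* A decrease of [k] contradicts the root gap. A repeated value would put two orthogonal
     eigenfunctions close to the same unperturbed one, while their norms are bounded below. *)
  case: (ltngtP (k n) (k n.+1)) => // [klt|keq].
    have := hd _ _ (ltnW klt); have : d <= d * (k n - k n.+1)%:R.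
      by rewrite ler_peMr ?(ltW d0) // ler1n subn_gt0.
    have : 2 * (C / lam n) < d.
      rewrite mulrA ltr_pdivrMr // [ltRHS]mulrC -ltr_pdivrMr //.
      by apply: lt_le_trans h2; rewrite ltr_pM2r ?invr_gt0 // ltr_pM2r // ltr_nat.
    move: ln ln'; rewrite !ler_norml => /andP[u1 _] /andP[_ u2].
    by have := lamS n; lra.
  have hl : ip (fun x => ef n x - ef n.+1 x) (fun x => ef n x - ef n.+1 x) <= W / lam n ^+ 2.
    rewrite /W -mulrA -expr_div_n; apply: ip_sup; first exact: L2B.
    move=> x xp; rewrite /eigenfun; have := xn x xp; have := xn' x xp; rewrite -keq.
    have -> : 2 * C / lam n = C / lam n + C / lam n by rewrite -mulrA mulrDl !mul1r.
    move: (phi0 _ _ _ _) => p; rewrite distrC => g1 g2.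
    apply: le_trans (ler_distD p _ _) _; rewrite lerD //; exact: le_trans CS.
  move: hl; rewrite ipBl ?ipBr //; try exact: L2B.
  rewrite (ef_orth al0 hq hphi lam_ge0 lamS eigP (m := n) (n := n.+1)) ?neq_ltn ?ltnSn //.
  rewrite ipC (ef_orth al0 hq hphi lam_ge0 lamS eigP (m := n) (n := n.+1)) ?neq_ltn ?ltnSn //.
  rewrite subr0 sub0r opprK => hl.
  have := hc0 n; have := hc0 n.+1; rewrite /norming => g1 g2.
  have : W / lam n ^+ 2 <= c0.
    rewrite ler_pdivrMr ?exprn_gt0 // mulrC -ler_pdivrMr //; apply: le_trans h1 _.
    by rewrite expr2 ler_peMr // ltW.
  by move: hl; lra.
have kge j : (j <= k (N2 + j)%N)%N.
  elim: j => // j IH; rewrite addnS; apply: leq_ltn_trans IH _; exact/kS/leq_addr.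
pose N3 := (Num.truncn ((d * N2%:R + C + d / 2) / (d / 2))).+1.
have d2 : 0 < d / 2 by rewrite divr_gt0.
exists (maxn N2 N3), C, (d / 2), k; split => // n; rewrite geq_max => /andP[Nn N3n].
have [l1 ln xn] := hk n (leq_trans (leq_maxl _ _) Nn).
split => //; first exact: kS.
have lp : 0 < lam n by exact: lt_le_trans l1.
have Cl : C / lam n <= C by rewrite ler_pdivrMr // ler_peMr // ltW.
have kn : (n - N2 <= k n)%N by have := kge (n - N2)%N; rewrite subnKC.
have := hd 0 (k n) (leq0n _); rewrite subn0 => h1.
have h2 : d * (n%:R - N2%:R) <= d * (k n)%:R by rewrite ler_pM2l // -natrB // ler_nat.
have h3 : d * N2%:R + C + d / 2 <= d / 2 * n%:R.
  by rewrite [leRHS]mulrC -ler_pdivrMr //; apply: le_trans (ltW (truncnS_gt _)) _; rewrite ler_nat.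
move: ln; rewrite ler_norml => /andP[u1 _].
have := lam0_ge0 0%N; rewrite -[n.+1%:R]natr1 mulrDr mulr1.
move: h1 h2 h3 u1 Cl; rewrite mulrBr [d / 2 * n%:R]mulrAC.
move: (d * (k n)%:R) (d * n%:R) (d * N2%:R) (C / lam n) (lam0 _) (lam0 0%N) (lam n) => X1 X2 X3 X4 X5 X6 X7.
lra.
Qed.

Lemma nat_gt (x : R) : exists N, forall n, (N <= n)%N -> x < n%:R.
Proof.
exists (Num.truncn x).+1 => n Nn; apply: lt_le_trans (truncnS_gt _) _; by rewrite ler_nat.
Qed.

(** Only an eventual shift between the two numberings is left to exclude. [no_shift] is applied in
    both directions, once with each family as the complete one. *)
Lemma aligned : exists N C c, [/\ 0 < C, 0 < c & forall n, (N <= n)%N ->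
  [/\ c * n.+1%:R <= lam n, `|lam n - lam0 n| <= C / n.+1%:R &
    forall x, 0 <= x <= pi -> `|phi x (lam n) - phi0 a al x (lam0 n)| <= C / n.+1%:R]].
Proof.
have [N [C [c [k [C0 c0 hk]]]]] := matching_increasing.
have Cn n : (N <= n)%N -> C / lam n <= (C / c) / n.+1%:R.
  move=> /hk[_ h _ _]; have n0 : (0 : R) < n.+1%:R by rewrite ltr0n.
  have cn : 0 < c * n.+1%:R by rewrite mulr_gt0.
  by rewrite -mulrA -invfM ler_pM2l // lef_pV2 ?posrE // (lt_le_trans cn).
suff [N' hN'] : exists N', forall n, (N' <= n)%N -> k n = n.
  exists (maxn N N'), (C / c), c; split => // [|n]; first by rewrite divr_gt0.
  rewrite geq_max => /andP[Nn /hN' kn]; have [_ h1 h2 h3] := hk n Nn; rewrite kn in h2 h3.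
  split => // [|x /h3 h]; [exact: le_trans h2 (Cn n Nn)|exact: le_trans h (Cn n Nn)].
have [ca ca0 hca] := alpha_ge; have [cb cb0 hcb] := alpha0_ge.
have al1 : 0 < 1 + al ^+ 2 by rewrite ltr_pwDl // sqr_ge0.
pose B := (1 + al ^+ 2) * pi * (C / c) ^+ 2.
have B0 : 0 < B.
  by apply: mulr_gt0; [apply: mulr_gt0 => //; exact: pi_gt0|apply: exprn_gt0; exact: divr_gt0].
have close n : (N <= n)%N -> ip (fun x => ef n x - ef0 (k n) x) (fun x => ef n x - ef0 (k n) x) <= B * (n.+1%:R ^+ 2)^-1.
  move=> Nn; have [_ _ _ h] := hk n Nn.
  rewrite /B -mulrA -exprVn -exprMn; apply: ip_sup; first exact: L2B.
  by move=> x /h /le_trans; apply; exact: Cn.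
have close' n : (N <= n)%N -> ip (fun x => ef0 (k n) x - ef n x) (fun x => ef0 (k n) x - ef n x) <= B * (n.+1%:R ^+ 2)^-1.
  move=> /close; rewrite (_ : ip (fun x => ef n x - ef0 (k n) x) (fun x => ef n x - ef0 (k n) x) =
    ip (fun x => ef0 (k n) x - ef n x) (fun x => ef0 (k n) x - ef n x)) //.
  by rewrite /wip; apply: I_ext => x _; ring.
have [Na hNa] := nat_gt (2 * (B / ca)); have [Nb hNb] := nat_gt (2 * (B / cb)).
have tail D M c1 (u : nat -> R) (v : nat -> R) : (0 < D)%N -> 0 < c1 -> 2 * (B / c1) < D%:R ->
    (forall i, c1 <= v i) -> (forall i, (D <= i)%N -> u i <= B * (i.+1%:R ^+ 2)^-1) ->
    (forall i, (D <= i)%N -> 0 <= u i) ->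
    \sum_(D <= i < M) u i / v i <= 2^-1.
  move=> D0 c10 hD hv hu hu0.
  apply: (@le_trans _ _ (\sum_(D <= i < M) B / c1 * (i.+1%:R ^+ 2)^-1)).
    rewrite !big_nat; apply: ler_sum => i /andP[Di _].
    rewrite mulrAC ler_pM ?hu ?hu0 ?invr_ge0 ?(le_trans (ltW c10) (hv i)) //.
    by rewrite lef_pV2 ?posrE ?(lt_le_trans c10 (hv i)).
  rewrite -mulr_sumr; have DR : (0 : R) < D%:R by rewrite ltr0n.
  apply: le_trans (ler_wpM2l (ltW (divr_gt0 B0 c10)) (tail_inv_sqr M D0)) _.
  by rewrite ler_pdivrMr //; move: hD; lra.
have kmono m n : (N <= m)%N -> (m <= n)%N -> (n - m <= k n - k m)%N /\ (k m <= k n)%N.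
  move=> Nm; elim: n => [|n IH]; first by rewrite leqn0 => /eqP <-; rewrite !subnn.
  rewrite leq_eqVlt => /predU1P[<-|]; first by rewrite !subnn.
  rewrite ltnS => mn; have [h1 h2] := IH mn.
  have [h3 _ _ _] := hk n (leq_trans Nm mn); split; last exact: leq_trans h2 (ltnW h3).
  by rewrite subSn // (leq_ltn_trans h1) // ltn_sub2r // (leq_ltn_trans h2).
pose N1 := maxn N (maxn Na (maxn Nb 1)).
(* If [k n > n], the functions [ef i] with [i >= n] are matched with unperturbed ones beyond index
   [n], which is a shift of [ef0] against the complete family [ef]. *)
have kle n : (N1 <= n)%N -> (k n <= n)%N.
  rewrite !geq_max => /and4P[Nn an bn n0]; rewrite leqNgt; apply/negP => kn.
  apply: (@no_shift R a al al0 ef ef0 alpha n k) => //.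
  - by move=> i j; exact: (ef_orth al0 L2_zero phi0_spec lam0_ge0 lam0S eigP0).
  - by move=> v hv e e_0; exact: (Parseval al0 hq hphi lam_ge0 lamS eigP hv e_0).
  - by move=> i ni; have [_ h] := kmono _ _ Nn ni; exact: leq_trans kn h.
  move=> M; apply: (tail n M ca) => //.
  - exact: hNa.
  - by move=> i ni; apply: close; exact: leq_trans ni.
  - by move=> i _; exact: ip_ge0.
(* The natural number [n - k n] does not increase, because [k] is strictly increasing and below the
   identity; it is constant once it reaches its minimum. *)
have [j hj] : exists j, exists2 n2, (N1 <= n2)%N & forall n, (n2 <= n)%N -> (n - k n)%N = j.
  have ex : exists j, [exists n : 'I_1, true] && `[< exists2 n, (N1 <= n)%N & (n - k n)%N = j >].
    by exists (N1 - k N1)%N; apply/andP; split; [apply/existsP; exists ord0|apply/asboolP; exists N1].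
  have [j /andP[_ /asboolP[n2 Nn2 ej]] jmin] := ex_minnP ex.
  exists j, n2 => // n n2n; apply/eqP; rewrite eqn_leq; apply/andP; split.
    have NN : (N <= n2)%N by apply: leq_trans Nn2; exact: leq_maxl.
    have [h1 h2] := kmono _ _ NN n2n; rewrite -ej.
    by move: (kle n2 Nn2) (kle n (leq_trans Nn2 n2n)) (h1) (h2) (n2n); clear; lia.
  apply: jmin; apply/andP; split; first by apply/existsP; exists ord0.
  by apply/asboolP; exists n => //; exact: leq_trans n2n.
have [n2 Nn2 hn2] := hj.
have [j0|j0] := posnP j.
  by exists n2 => n n2n; move: (hn2 n n2n) (kle n (leq_trans Nn2 n2n)); rewrite j0; clear; lia.
(* With a constant defect [j > 0], [ef0 i] is matched with [ef (i + j)], a shift of [ef] against the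
   complete family [ef0]. *)
exfalso; pose D := n2.
have kD i : (D <= i)%N -> k (i + j)%N = i.
  move=> Di; have h1 : (n2 <= i + j)%N by rewrite (leq_trans Di) // leq_addr.
  by move: (hn2 _ h1) (kle _ (leq_trans Nn2 h1)); clear; lia.
move: (Nn2); rewrite !geq_max => /and4P[Nn an bn n0].
apply: (@no_shift R a al al0 ef0 ef alpha0 D (fun i => i + j)%N) => //.
- by move=> i i'; exact: (ef_orth al0 hq hphi lam_ge0 lamS eigP).
- by move=> v hv e e_0; exact: (Parseval al0 L2_zero phi0_spec lam0_ge0 lam0S eigP0 hv e_0).
- by move=> i Di; rewrite (leq_ltn_trans Di) // -[X in (X < _)%N]addn0 ltn_add2l.
move=> M; apply: (tail D M cb) => //.
- exact: hNb.
- move=> i Di; have h1 : (N <= i + j)%N by rewrite (leq_trans Nn) // (leq_trans Di) // leq_addr.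
  have := close' _ h1; rewrite kD // => /le_trans; apply; rewrite ler_pM2l //.
  by rewrite lef_pV2 ?posrE ?exprn_gt0 ?ltr0n // ler_pXn2r ?nnegrE // ler_nat ltnS leq_addr.
- by move=> i _; exact: ip_ge0.
Qed.

Let nR n : (0 : R) < n.+1%:R. Proof. by rewrite ltr0n. Qed.

(** Sets of values allow one statement for a single sequence and for suprema over [[0, pi]]. *)
Lemma tail_bound_div (u : nat -> set R) : (forall n, exists B, forall y, u n y -> y <= B) ->
  (exists N C, forall n, (N <= n)%N -> forall y, u n y -> y <= C / n.+1%:R) ->
  exists2 C, 0 < C & forall n y, u n y -> y <= C / n.+1%:R.
Proof.
move=> h1 h2; apply: tail_bound => // [n C C' CC h y /h /le_trans -> //|n].
  by rewrite ler_pM2r ?invr_gt0.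
by have [B hB] := h1 n; exists (B * n.+1%:R) => y /hB; rewrite mulfK ?gt_eqF.
Qed.

Lemma lam_close : exists2 C, 0 < C & forall n, `|lam n - lam0 n| <= C / n.+1%:R.
Proof.
have [N [C [c0 [_ _ h]]]] := aligned.
have [||C' C'0 hC'] := @tail_bound_div (fun n => [set `|lam n - lam0 n|]).
- by move=> n; exists `|lam n - lam0 n| => y ->.
- by exists N, C => n /h[_ h1 _] y ->.
by exists C' => // n; exact: hC'.
Qed.

Lemma ef_close : exists2 C, 0 < C & forall n x, 0 <= x <= pi ->
  `|phi x (lam n) - phi0 a al x (lam0 n)| <= C / n.+1%:R.
Proof.
have [N [C [c0 [_ _ h]]]] := aligned.
have [||C' C'0 hC'] := @tail_bound_div (fun n => [set `|phi x (lam n) - phi0 a al x (lam0 n)| | x in `[0, pi]]).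
- move=> n; have [_ [B hB]] := BMB (phi_BM hphi (lam n)) (phi_BM phi0_spec (lam0 n)).
  by exists B => _ [x /= + <-]; rewrite in_itv /=; exact: hB.
- by exists N, C => n /h[_ _ h1] _ [x /= + <-]; rewrite in_itv /=; exact: h1.
by exists C' => // n x xp; apply: hC'; exists x => //=; rewrite in_itv.
Qed.

Lemma lam0_growth : exists2 d, 0 < d & forall n, d * n%:R <= lam0 n.
Proof.
have [d d0 hd] := lam0_gap; exists d => // n.
by have := hd 0%N n (leq0n n); have := lam0_ge0 0%N; rewrite subn0; lra.
Qed.

(** These differences are the Fourier coefficients of the kernel in the unperturbed system; their
    decay will bound the kernel uniformly. *)
Lemma phi_lam0_close : exists2 C, 0 < C & forall n x, 0 <= x <= pi ->
  `|phi x (lam0 n) - phi0 a al x (lam0 n)| <= C / n.+1%:R.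
Proof.
have [C1 [l0 [C10 l01 hC]]] := phi_asymptotics al0 a0 api hq hphi.
have [d d0 hd] := lam0_growth.
have [N hN] := lam_infty al0 L2_zero phi0_spec lam0_ge0 lam0S eigP0 l0.
have [||C' C'0 hC'] := @tail_bound_div (fun n => [set `|phi x (lam0 n) - phi0 a al x (lam0 n)| | x in `[0, pi]]).
- move=> n; have [_ [B hB]] := BMB (phi_BM hphi (lam0 n)) (phi_BM phi0_spec (lam0 n)).
  by exists B => _ [x /= + <-]; rewrite in_itv /=; exact: hB.
- exists (maxn N 1), (2 * C1 / d) => n; rewrite geq_max => /andP[/hN ln n1] _ [x /= + <-].
  rewrite in_itv /= => xp; have [_ /le_trans -> //] := hC (lam0 n) x ln xp.
  have nn : (1 : R) <= n%:R by rewrite ler1n.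
  have lp : 0 < lam0 n by rewrite (lt_le_trans _ ln) // (lt_le_trans ltr01).
  rewrite ler_pdivrMr // mulrAC ler_pdivlMr // mulrAC ler_pdivlMr // -[n.+1%:R]natr1.
  rewrite -mulrA [2 * C1]mulrC -mulrA ler_pM2l //; have := hd n.
  have : d <= d * n%:R by rewrite ler_peMr // ltW.
  by rewrite mulrDl mul1r [n%:R * d]mulrC; lra.
by exists C' => // n x xp; apply: hC'; exists x => //=; rewrite in_itv.
Qed.

Lemma norming_close : exists2 C, 0 < C & forall n, `|(alpha n)^-1 - (alpha0 n)^-1| <= C / n.+1%:R.
Proof.
have [C C0 hC] := ef_close; have [c c0 hc] := alpha_ge; have [c' c'0 hc'] := alpha0_ge.
pose S := C + 4 * (1 + srhoB al).
have S0 : 0 < S by rewrite addr_gt0 // mulr_gt0 // /srhoB !addr_gt0 // invr_gt0.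
pose T := pi * ((1 + al ^+ 2) * S * C).
have al1 : 0 < 1 + al ^+ 2 by rewrite ltr_pwDl // sqr_ge0.
have T0 : 0 <= T by rewrite !mulr_ge0 // ltW.
exists (T / (c * c') + 1) => [|n].
  by rewrite ltr_pwDr // divr_ge0 // mulr_ge0 // ltW.
have close : `|alpha n - alpha0 n| <= T / n.+1%:R.
  have h1 := ip_L1 a al0 (e2 n) (e2 n); have h2 := ip_L1 a al0 (e20 n) (e20 n).
  rewrite /norming /wip -IB //; apply: le_trans (I_abs _) _; first exact: L1B.
  have -> : T / n.+1%:R = I 0 pi (fun=> (1 + al ^+ 2) * S * (C / n.+1%:R)).
    by rewrite I_cst // subr0 /T; ring.
  apply: I_le => [||x xp]; [exact/L1_abs/L1B|exact/BM_L1/BM_cst|].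
  rewrite (_ : _ - _ = w x * ((ef n x + ef0 n x) * (ef n x - ef0 n x))); last by ring.
  rewrite !normrM -mulrA ler_pM // ?(gtr0_norm (rho_gt0 a al0 x)) ?rho_le //.
  have h := hC n x xp; rewrite ler_pM //.
  have := phi0_bound a al0 x (lam0 n); rewrite -/(ef0 n x) => hb.
  have -> : ef n x + ef0 n x = (ef n x - ef0 n x) + 2 * ef0 n x by ring.
  apply: le_trans (ler_normD _ _) _; rewrite /S lerD //.
    by apply: le_trans h _; rewrite ler_pdivrMr // ler_peMr ?ler1n // ltW.
  by rewrite normrM normr_nat; move: hb; lra.
have -> : (alpha n)^-1 - (alpha0 n)^-1 = (alpha0 n - alpha n) * ((alpha n)^-1 * (alpha0 n)^-1).
  by have := ap n; have := ap0 n; move: (alpha n) (alpha0 n) => x y x0 y0; field; rewrite !gt_eqF.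
rewrite normrM distrC; apply: (@le_trans _ _ (T / n.+1%:R * (c * c')^-1)).
  rewrite ler_pM // normrM !ger0_norm ?invr_ge0 ?(ltW (ap n)) ?(ltW (ap0 n)) //.
  by rewrite invfM ler_pM ?invr_ge0 ?(ltW (ap n)) ?(ltW (ap0 n)) // lef_pV2 ?posrE ?ap ?ap0.
by rewrite mulrAC ler_pM2r ?invr_gt0 // lerDl.
Qed.

End Alignment.

(** * The trigonometric series of F0 *)

Section TrigonometricSystem.
Context {R : realType}.
Notation I := (@lintegral_ab R).

(** Comparison with the telescoping sum of [1 / (x ^ 2 - 1/4) = 1 / (x - 1/2) - 1 / (x + 1/2)]. The
    term [j = i] is 0 since the inverse of 0 is 0. *)
Lemma sum_inv_sqr_dist i n :
  \sum_(0 <= j < n) ((i%:R - j%:R) ^+ 2)^-1 <= (6 : R).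
Proof.
(* At [j = i] this primitive jumps from 2 to [-2]; the summand 4 compensates the jump. *)
pose tau j : R := - (j%:R - i%:R - 2^-1)^-1.
have den j : (j <= i)%N \/ (i < j)%N by case: (leqP j i); [left|right].
have dle j : (j <= i)%N -> (j%:R : R) - i%:R <= 0 by move=> ji; rewrite subr_le0 ler_nat.
have dge j : (i < j)%N -> 1 <= (j%:R : R) - i%:R.
  by move=> ij; rewrite lerBrDl natr1 ler_nat.
suff key : \sum_(0 <= j < n) ((i%:R - j%:R) ^+ 2)^-1 <= tau n - tau 0%N + (if (i < n)%N then 4 else 0).
  apply: le_trans key _.
  have t0 : - tau 0%N <= 0.
    by rewrite /tau opprK invr_le0; have := dle 0%N (leq0n i); lra.
  have tn : tau n <= 2.
    rewrite /tau -invrN -[2]invrK; have [h|h] := den n.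
      by rewrite lef_pV2 ?posrE; have := dle n h; lra.
    apply: (@le_trans _ _ 0); last by rewrite invr_ge0.
    by rewrite invr_le0; have := dge n h; lra.
  case: ifP => _; lra.
elim: n => [|n IH]; first by rewrite big_geq // subrr ltn0 addr0.
rewrite big_nat_recr //=; move: IH; set S := \sum_(_ <= _ < _) _ => IH.
have en : (n.+1%:R : R) = n%:R + 1 by rewrite -natr1.
have [ni|ni] := eqVneq n i.
  move: IH; rewrite ni ltnn ltnSn subrr expr0n invr0 !addr0.
  have ti : tau i = 2 by rewrite /tau subrr add0r invrN opprK invrK.
  have tS : tau i.+1 = - 2.
    by rewrite /tau -natr1 [i%:R + 1 - i%:R]addrAC subrr add0r; congr (- _); field.
  by rewrite ti tS; lra.
have step : ((i%:R - n%:R) ^+ 2)^-1 <= tau n.+1 - tau n.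
  rewrite /tau en; set x : R := n%:R - i%:R.
  have -> : (i%:R - n%:R) ^+ 2 = x ^+ 2 by rewrite /x; ring.
  have x1 : 1 <= x ^+ 2.
    have [h|h] := den n; last by have := dge n h; rewrite -/x; nra.
    have : 1 <= (i%:R : R) - n%:R by rewrite lerBrDl natr1 ler_nat ltn_neqAle ni.
    by rewrite /x; nra.
  have -> : - (n%:R + 1 - i%:R - 2^-1)^-1 - - (n%:R - i%:R - 2^-1)^-1 = (x ^+ 2 - 4^-1)^-1.
    rewrite (_ : n%:R + 1 - i%:R - 2^-1 = x + 2^-1); last by rewrite /x; field.
    rewrite -/x; have h1 : x + 2^-1 != 0 by apply/eqP => h; move: x1; rewrite (_ : x = - 2^-1); lra.
    have h2 : x - 2^-1 != 0 by apply/eqP => h; move: x1; rewrite (_ : x = 2^-1); lra.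
    have -> : x ^+ 2 - 4^-1 = (x + 2^-1) * (x - 2^-1) by field.
    have : (x + 2^-1) - (x - 2^-1) = 1 by field.
    move: (x + 2^-1) (x - 2^-1) h1 h2 => u v u0 v0 uv.
    by rewrite -[(u * v)^-1]mul1r -uv; field; rewrite u0 v0.
  by rewrite lef_pV2 ?posrE; lra.
have -> : (i < n.+1)%N = (i < n)%N by rewrite ltnS leq_eqVlt eq_sym (negPf ni).
move: IH step; move: (tau n.+1) (tau n) (tau 0%N) (if _ then _ else _) (_ ^- 2) => x1 x2 x3 x4 x5; lra.
Qed.

Lemma BM_sum b c (F : nat -> R -> R) m n : (forall i, BM b c (F i)) ->
  BM b c (fun x => \sum_(m <= i < n) F i x).
Proof.
move=> hF; have [nm|mn] := leqP n m.
  by apply: BM_ext (BM_cst b c 0) => x _; rewrite big_geq.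
elim: n mn => // n IH; rewrite ltnS leq_eqVlt => /predU1P[<-|mn].
  by apply: BM_ext (hF m) => x _; rewrite big_nat1.
by apply: BM_ext (BMD (IH mn) (hF n)) => x _; rewrite big_nat_recr // ltnW.
Qed.

Variables (e : nat -> R -> R) (Z B : R).
Hypotheses (Z0 : 0 < Z) (hB : 0 <= B) (eB : forall i, BM 0 (2 * Z) (e i)).
Hypothesis diag : forall i, `|I 0 (2 * Z) (fun z => (2 * Z - z) * (e i z * e i z))| <= B.
Hypothesis offdiag : forall i j, i != j ->
  `|I 0 (2 * Z) (fun z => (2 * Z - z) * (e i z * e j z))| <= B * ((i%:R - j%:R) ^+ 2)^-1.

(* Schur test; the weight [2 Z - z] makes the Gram matrix decay quadratically. *)
Lemma trig_Bessel (c : nat -> R) m n : I 0 Z (fun z => (\sum_(m <= i < n) c i * e i z) ^+ 2)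
  <= 7 * B / Z * \sum_(m <= i < n) c i ^+ 2.
Proof.
pose G i j := I 0 (2 * Z) (fun z => (2 * Z - z) * (e i z * e j z)).
have hw : BM 0 (2 * Z) (fun z => 2 * Z - z).
  apply: BMB; first exact: BM_cst.
  split; first exact: measurable_id.
  by exists (2 * Z) => z /andP[z0 zZ]; rewrite ger0_norm.
have hL i j : L1 0 (2 * Z) (fun z => (2 * Z - z) * (e i z * e j z)).
  by apply/BM_L1/BMM => //; exact: BMM.
pose S z := \sum_(m <= i < n) c i * e i z.
have BS : BM 0 (2 * Z) S by apply: BM_sum => i; exact: BMZ.
have Z2 : Z <= 2 * Z by move: Z0; lra.
have main : I 0 (2 * Z) (fun z => (2 * Z - z) * S z ^+ 2) <= 7 * B * \sum_(m <= i < n) c i ^+ 2.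
  have -> : I 0 (2 * Z) (fun z => (2 * Z - z) * S z ^+ 2) =
      \sum_(m <= i < n) \sum_(m <= j < n) c i * c j * G i j.
    pose F i j z := c i * c j * ((2 * Z - z) * (e i z * e j z)).
    have hF i j : L1 0 (2 * Z) (F i j) by exact: L1Z.
    have hF2 i := I_sum m n (hF i).
    have [_ e1] := I_sum m n (fun i => (hF2 i).1).
    transitivity (I 0 (2 * Z) (fun z => \sum_(m <= i < n) \sum_(m <= j < n) F i j z)).
      apply: I_ext => z _; rewrite /S expr2 mulr_suml mulr_sumr; apply: eq_bigr => i _.
      rewrite mulr_sumr mulr_sumr; apply: eq_bigr => j _; rewrite /F; ring.
    rewrite e1; apply: eq_bigr => i _; rewrite (hF2 i).2; apply: eq_bigr => j _.
    by rewrite /F IZ.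
  (* A majorant of the Gram matrix; its rows sum to at most [1 + 6], the origin of the factor 7. *)
  pose s i j := (i == j)%:R + ((i%:R - j%:R) ^+ 2)^-1 : R.
  have s0 i j : 0 <= s i j by rewrite addr_ge0 ?ler0n ?invr_ge0 ?sqr_ge0.
  have hG i j : `|G i j| <= B * s i j.
    rewrite /s; have [<-|ij] := eqVneq i j; first by rewrite subrr expr0n invr0 addr0 mulr1; exact: diag.
    by rewrite add0r; exact: offdiag.
  have ss i : \sum_(m <= j < n) s i j <= 7.
    have s1 : \sum_(m <= j < n) s i j <= \sum_(0 <= j < n) s i j.
      have [nm|mn] := leqP n m; first by rewrite big_geq // sumr_ge0.
      by rewrite [leRHS](@big_cat_nat _ _ _ m) ?(ltnW mn) //= lerDr sumr_ge0.
    apply: le_trans s1 _; rewrite /s big_split /=.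
    have : \sum_(0 <= j < n) (i == j)%:R <= (1 : R).
      have [i_n|n_i] := ltnP i n.
        rewrite (bigD1_seq i) ?mem_index_iota ?iota_uniq //= eqxx big1 ?addr0 // => j.
        by rewrite eq_sym => /negPf ->.
      rewrite big_nat big1 // => j /andP[_ jn].
      by rewrite gtn_eqF // (leq_trans jn).
    by have := sum_inv_sqr_dist i n; lra.
  apply: (@le_trans _ _ (\sum_(m <= i < n) \sum_(m <= j < n) (B / 2 * (c i ^+ 2 * s i j) + B / 2 * (c j ^+ 2 * s j i)))).
    apply: ler_sum => i _; apply: ler_sum => j _.
    have -> : s j i = s i j by rewrite /s eq_sym -sqrrN opprB.
    apply: le_trans (ler_norm _) _; rewrite normrM.
    apply: le_trans (ler_wpM2l (normr_ge0 _) (hG i j)) _.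
    have : 2 * `|c i * c j| <= c i ^+ 2 + c j ^+ 2.
      rewrite normrM -[c i ^+ 2]real_normK ?num_real // -[c j ^+ 2]real_normK ?num_real //.
      by have := sqr_ge0 (`|c i| - `|c j|); rewrite !expr2; lra.
    have Bs : 0 <= B * s i j by rewrite mulr_ge0.
    by move=> h; have := ler_wpM2r Bs h; lra.
  have part : \sum_(m <= i < n) \sum_(m <= j < n) B / 2 * (c i ^+ 2 * s i j) <= B / 2 * 7 * \sum_(m <= i < n) c i ^+ 2.
    rewrite mulr_sumr; apply: ler_sum => i _; rewrite -mulr_sumr -mulr_sumr.
    rewrite -[leRHS]mulrA ler_wpM2l ?divr_ge0 // [leRHS]mulrC; exact (ler_wpM2l (sqr_ge0 _) (ss i)).
  under eq_bigr do rewrite big_split /=.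
  rewrite big_split /= [X in _ + X]exchange_big /=; lra.
(* On [[0, Z]] the weight [2 * Z - z] is at least [Z], so the weighted integral over the doubled
   interval dominates. *)
rewrite mulrAC ler_pdivlMr // mulrC; apply: le_trans main.
rewrite -IZ; last by apply/BM_L1/BMX; apply: BM_sub BS.
apply: (@le_trans _ _ (I 0 Z (fun z => (2 * Z - z) * S z ^+ 2))).
  have h : L1 0 Z (fun z => (2 * Z - z) * S z ^+ 2).
    apply: (L1_sub (lexx 0) Z2); apply/BM_L1/BMM => //; exact: BMX.
  apply: I_le => // [|z /andP[z0 zZ]]; first by apply/L1Z/BM_L1/BMX; apply: BM_sub BS.
  by rewrite ler_wpM2r ?sqr_ge0 //; lra.
apply: I_mono => //; [exact: ltW| |].
  by apply/BM_L1/BMM => //; exact: BMX.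
by move=> z /andP[z0 zZ]; rewrite mulr_ge0 ?sqr_ge0 // subr_ge0.
Qed.

End TrigonometricSystem.

(** * Bessel inequalities for separated cosines and sines *)

Section TrigonometricSeries.
Context {R : realType}.
Notation I := (@lintegral_ab R).
Notation mu := (@lebesgue_measure R).

(** The integral is the Fejer expression [(1 - cos (k * c)) / k ^ 2], obtained from an explicit
    antiderivative. *)
Lemma I_triangle (c k : R) : k != 0 -> 0 <= c ->
  `|I 0 c (fun z => (c - z) * cos (k * z))| <= 2 / k ^+ 2.
Proof.
move=> k0 c0.
have hid : AC 0 c (fun z => c - z) (fun=> -1).
  apply: (@AC_ext _ _ _ (fun z => -1 * z + c) (fun=> -1 * 1)) => [z _|z _|]; [by ring|by ring|].
  apply: AC_C1 => [z|]; last by move=> z; exact: cvg_cst.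
  exact (is_derive_affine (-1) c z (fun x => is_derive_id x 1)).
have hs : AC 0 c (fun z => k^-1 * sin (k * z + 0) + 0 * sin (k * z + 0)) 
    (fun z => k^-1 * (k * cos (k * z + 0)) + 0 * (k * cos (k * z + 0))).
  apply: AC_C1 => [z|]; first by apply: is_derive_lin2; exact: derive_sin_aff.
  move=> z; have := @continuous_lin2 _ _ _ (k^-1 * k) 0 (@cont_cos_aff _ k 0) (@cont_cos_aff _ k 0) z.
  by congr (continuous_at z _); apply/funext => t; ring.
have hc : AC 0 c (fun z => - k^-1 ^+ 2 * cos (k * z + 0) + 0 * cos (k * z + 0))
    (fun z => - k^-1 ^+ 2 * (k * - sin (k * z + 0)) + 0 * (k * - sin (k * z + 0))).
  apply: AC_C1 => [z|]; first by apply: is_derive_lin2; exact: derive_cos_aff.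
  move=> z; have := @continuous_lin2 _ _ _ (k^-1 ^+ 2 * k) 0 (@cont_sin_aff _ k 0) (@cont_sin_aff _ k 0) z.
  by congr (continuous_at z _); apply/funext => t; ring.
have := (AC_D (AC_mul hid hs) hc).2 c; rewrite c0 lexx => /(_ isT).
rewrite (@I_ext _ _ _ _ (fun z => (c - z) * cos (k * z))); last first.
  by move=> z _; rewrite !addr0; field.
set J := I 0 c _; rewrite subrr !mulr0 !addr0 !mul0r sin0 cos0 !addr0 add0r => h.
have -> : J = (1 - cos (k * c)) / k ^+ 2.
  have -> : J = - k^-1 ^+ 2 * cos (k * c) - ((c - 0) * (k^-1 * 0) - k^-1 ^+ 2 * 1).
    by rewrite h; ring.
  by field.
rewrite normrM [`|_^-1|]ger0_norm ?invr_ge0 ?sqr_ge0 //.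
rewrite ler_wpM2r ?invr_ge0 ?sqr_ge0 // ler_norml.
by have := cos_geN1 (k * c); have := cos_le1 (k * c); lra.
Qed.

Variables (l : nat -> R) (d Z : R).
Hypotheses (Z0 : 0 < Z) (d0 : 0 < d) (l_ge0 : forall n, 0 <= l n).
Hypothesis gap : forall m n, (m <= n)%N -> d * (n - m)%:R <= l n - l m.
Let B := 2 / d ^+ 2 + 4 * Z ^+ 2.
Let ZZ : 0 <= 2 * Z. Proof. by rewrite mulr_ge0 // ltW. Qed.
Let B0 : 0 <= B.
Proof. by apply: addr_ge0; [apply: divr_ge0 => //; exact: sqr_ge0|apply: mulr_ge0 => //; exact: sqr_ge0]. Qed.

Lemma l_dist i j : i != j -> [/\ 0 < d * `|i%:R - j%:R|, d * `|i%:R - j%:R| <= `|l i - l j| &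
  d * `|i%:R - j%:R| <= `|l i + l j|].
Proof.
wlog ij : i j / (i < j)%N.
  by move=> H; rewrite neq_ltn => /orP[] h; [|rewrite (distrC i%:R) (distrC (l i)) (addrC (l i))]; apply: H; rewrite // ?neq_ltn h.
move=> _; have h := gap (ltnW ij).
have -> : `|i%:R - j%:R| = (j - i)%:R :> R by rewrite distrC ger0_norm ?natrB ?(ltnW ij) // subr_ge0 ler_nat ltnW.
have p : 0 < d * (j - i)%:R by rewrite mulr_gt0 // ltr0n subn_gt0.
split => //; first by rewrite distrC (le_trans h) // ler_norm.
by apply: le_trans h _; apply: le_trans (ler_norm _); have := l_ge0 i; lra.
Qed.

Lemma triangle_cos i j : i != j ->
  `|I 0 (2 * Z) (fun z => (2 * Z - z) * cos ((l i - l j) * z))| <= 2 / d ^+ 2 * ((i%:R - j%:R) ^+ 2)^-1 /\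
  `|I 0 (2 * Z) (fun z => (2 * Z - z) * cos ((l i + l j) * z))| <= 2 / d ^+ 2 * ((i%:R - j%:R) ^+ 2)^-1.
Proof.
move=> ij; have [p h1 h2] := l_dist ij.
have aux k : d * `|i%:R - j%:R| <= `|k| ->
    `|I 0 (2 * Z) (fun z => (2 * Z - z) * cos (k * z))| <= 2 / d ^+ 2 * ((i%:R - j%:R) ^+ 2)^-1.
  move=> h; have k0 : k != 0 by rewrite -normr_gt0 (lt_le_trans p).
  apply: le_trans (I_triangle k0 ZZ) _.
  rewrite -mulrA -invfM -exprMn ler_pM2l // lef_pV2 ?posrE.
  - rewrite -[leLHS]real_normK ?num_real // -[leRHS]real_normK ?num_real //.
    by rewrite ler_pXn2r ?nnegrE // normrM (gtr0_norm d0).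
  - by rewrite exprn_even_gt0.
  - rewrite exprn_even_gt0 //=; apply/eqP => h0; move: p.
    by rewrite -(gtr0_norm d0) -normrM h0 normr0 ltxx.
by split; exact: aux.
Qed.

Lemma weight_BM : BM 0 (2 * Z) (fun z : R => 2 * Z - z).
Proof.
apply: BMB; first exact: BM_cst.
split; first exact: measurable_id.
by exists (2 * Z) => z /andP[z0 zZ]; rewrite ger0_norm.
Qed.

Lemma trig_diag (e : R -> R) : BM 0 (2 * Z) e -> (forall z, `|e z| <= 1) ->
  `|I 0 (2 * Z) (fun z => (2 * Z - z) * (e z * e z))| <= B.
Proof.
move=> be e1; apply: (@le_trans _ _ (2 * Z * (2 * Z - 0))).
  apply: I_absM => // [|z /andP[z0 zZ]]; first by apply/BM_L1/BMM; [exact: weight_BM|exact: BMM].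
  rewrite normrM -[leRHS]mulr1 ler_pM //; first by rewrite ger0_norm ?subr_ge0 // gerBl.
  by rewrite normrM -[leRHS]mulr1 ler_pM.
by rewrite subr0 /B (_ : 2 * Z * (2 * Z) = 4 * Z ^+ 2) ?lerDr ?divr_ge0 ?sqr_ge0 //; ring.
Qed.

(** The parity of [s] selects the product formula: [s = 0] for two cosines, [s = 1] for two
    sines. *)
Lemma trig_offdiag i j s (F : R -> R) : i != j ->
  (forall z, F z = 2^-1 * (cos ((l i - l j) * z) + (-1) ^+ s * cos ((l i + l j) * z))) ->
  `|I 0 (2 * Z) (fun z => (2 * Z - z) * F z)| <= B * ((i%:R - j%:R) ^+ 2)^-1.
Proof.
move=> ij hF; have [h1 h2] := triangle_cos ij.
have hL k : L1 0 (2 * Z) (fun z => (2 * Z - z) * cos (k * z)).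
  by apply/BM_L1/BMM; [exact: weight_BM|exact: BM_cos].
have -> : I 0 (2 * Z) (fun z => (2 * Z - z) * F z) =
   2^-1 * I 0 (2 * Z) (fun z => (2 * Z - z) * cos ((l i - l j) * z)) +
   2^-1 * (-1) ^+ s * I 0 (2 * Z) (fun z => (2 * Z - z) * cos ((l i + l j) * z)).
  by rewrite -!IZ // -ID; [apply: I_ext => z _; rewrite hF; ring|exact: L1Z|exact: L1Z].
apply: le_trans (ler_normD _ _) _; rewrite !normrM normrX normrN1 expr1n mulr1 normfV normr_nat.
have : 0 <= 4 * Z ^+ 2 * ((i%:R - j%:R) ^+ 2)^-1 by rewrite mulr_ge0 ?invr_ge0 ?sqr_ge0 // mulr_ge0 ?sqr_ge0.
move: h1 h2; rewrite /B mulrDl; lra.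
Qed.

Lemma cos_Bessel (c : nat -> R) m n : I 0 Z (fun z => (\sum_(m <= i < n) c i * cos (l i * z)) ^+ 2)
  <= 7 * B / Z * \sum_(m <= i < n) c i ^+ 2.
Proof.
apply: trig_Bessel => // [i|i|i j ij]; first exact: BM_cos.
  by apply: trig_diag => [|z]; [exact: BM_cos|rewrite ler_norml cos_geN1 cos_le1].
apply: (@trig_offdiag i j 0) => // z; rewrite expr0 mul1r mulrBl mulrDl cosB cosD; by field.
Qed.

Lemma sin_Bessel (c : nat -> R) m n : I 0 Z (fun z => (\sum_(m <= i < n) c i * sin (l i * z)) ^+ 2)
  <= 7 * B / Z * \sum_(m <= i < n) c i ^+ 2.
Proof.
apply: trig_Bessel => // [i|i|i j ij]; first exact: BM_sin.
  by apply: trig_diag => [|z]; [exact: BM_sin|rewrite ler_norml sin_geN1 sin_le1].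
apply: (@trig_offdiag i j 1) => // z; rewrite expr1 mulrBl mulrDl cosB cosD; by field.
Qed.

End TrigonometricSeries.

(** * Series of differences of cosines with nearby frequencies *)

Section SpectralDifference.
Context {R : realType}.
Notation I := (@lintegral_ab R).
Notation mu := (@lebesgue_measure R).

Lemma cos_Taylor (u v : R) : `|cos v - cos u + (v - u) * sin u| <= (v - u) ^+ 2.
Proof.
have key (x y z : R) : `|z - u| <= `|v - u| -> cos v - cos u = - sin z * (v - u) ->
    `|cos v - cos u + (v - u) * sin u| <= (v - u) ^+ 2.
  move=> hz ->; have -> : - sin z * (v - u) + (v - u) * sin u = (v - u) * (sin u - sin z) by ring.
  rewrite normrM -[leRHS]real_normK ?num_real // expr2.
  by rewrite ler_wpM2l //; apply: le_trans (sin_Lipschitz _ _) _; rewrite distrC.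
case: (ltgtP u v) => [uv|vu|->]; last by rewrite !subrr mul0r addr0 normr0 expr0n.
- have [z /andP[uz zv] e] := mean_value (fun x => is_derive_cos x) uv.
  by apply: (key 0 0 z) => //; rewrite !ger0_norm; lra.
- have [z /andP[uz zv] e] := mean_value (fun x => is_derive_cos x) vu.
  apply: (key 0 0 z); first by rewrite !ler0_norm; lra.
  by rewrite -opprB e; ring.
Qed.

Variables (l l' b b' : nat -> R) (C d Z : R).
Hypotheses (Z0 : 0 < Z) (d0 : 0 < d) (C0 : 0 < C) (l_ge0 : forall n, 0 <= l' n).
Hypothesis gap : forall m n, (m <= n)%N -> d * (n - m)%:R <= l' n - l' m.
Hypothesis hl : forall n, `|l n - l' n| <= C / n.+1%:R.
Hypothesis hb : forall n, `|b n - b' n| <= C / n.+1%:R.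
Hypothesis hB : forall n, `|b n| <= C.

(** The summand of [F0] reduced to one variable: the product of [phi0(t, lam_n)] and a cosine splits
    into cosines of sums and differences of the arguments. *)
Definition dterm n z : R := cos (l n * z) * b n - cos (l' n * z) * b' n.
Definition dsum m n z : R := \sum_(m <= i < n) dterm i z.

Let nR n : (0 : R) < n.+1%:R. Proof. by rewrite ltr0n. Qed.
(** The second-order remainder, of size [1 / n ^ 2]. What is left of [dterm] is a cosine series and
    [z] times a sine series, both over the separated frequencies [l'] and with coefficients
    [O(1/n)]. *)
Let rem n z := b n * (cos (l n * z) - cos (l' n * z) + (l n * z - l' n * z) * sin (l' n * z)).

Let dtermE n z : dterm n z = (b n - b' n) * cos (l' n * z) - z * (b n * (l n - l' n) * sin (l' n * z)) + rem n z.
Proof. by rewrite /dterm /rem; ring. Qed.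

Lemma dterm_bound : exists2 K, 0 < K & forall n z, `|z| <= Z -> `|dterm n z| <= K / n.+1%:R.
Proof.
exists (C + C * (C * Z)) => [|n z hz]; first by rewrite addr_gt0 // !mulr_gt0.
have -> : dterm n z = (b n - b' n) * cos (l' n * z) + b n * (cos (l n * z) - cos (l' n * z)).
  by rewrite /dterm; ring.
apply: le_trans (ler_normD _ _) _; rewrite [leRHS]mulrDl !normrM lerD //.
  by rewrite -[leRHS]mulr1 ler_pM // ler_norml cos_geN1 cos_le1.
rewrite -mulrA ler_pM //; apply: le_trans (cos_Lipschitz _ _) _.
by rewrite -mulrBl normrM mulrAC ler_pM.
Qed.

Lemma dsum_BM b1 c1 m n : b1 <= c1 -> BM b1 c1 (dsum m n).
Proof.
move=> bc; apply: BM_sum => i; apply: BMB.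
  by apply: BM_ext (BMZ (b i) (@BM_cos _ b1 c1 (l i))) => z _; rewrite mulrC.
by apply: BM_ext (BMZ (b' i) (@BM_cos _ b1 c1 (l' i))) => z _; rewrite mulrC.
Qed.

Lemma dsum_cat m n p z : (m <= n)%N -> (n <= p)%N -> dsum m p z = dsum m n z + dsum n p z.
Proof. by move=> mn np; rewrite /dsum (@big_cat_nat _ _ _ n). Qed.

Lemma dsum_even m n z : dsum m n (- z) = dsum m n z.
Proof. by apply: eq_bigr => i _; rewrite /dterm !mulrN !cosN. Qed.

Notation sg m n := (\sum_(m <= i < n) (i.+1%:R ^+ 2)^-1 : R).

Lemma sg_ge0 m n : 0 <= sg m n.
Proof. by apply: sumr_ge0 => i _; rewrite invr_ge0 sqr_ge0. Qed.

Lemma sg_le2 m n : sg m n <= 2.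
Proof.
have [nm|mn] := leqP n m; first by rewrite big_geq.
apply: (@le_trans _ _ (sg 0 n)).
  by rewrite [leRHS](@big_cat_nat _ _ _ m) ?(ltnW mn) //= lerDr sg_ge0.
case: n mn => [//|n] _; rewrite big_nat_recl // expr1n invr1.
have -> : \sum_(0 <= i < n) (i.+2%:R ^+ 2)^-1 = \sum_(1 <= i < n.+1) (i.+1%:R ^+ 2)^-1 :> R.
  by rewrite big_add1.
by have := @tail_inv_sqr R 1 n.+1 isT; rewrite invr1; lra.
Qed.

(** The Bessel inequalities bound the two first-order series, and the remainder is summed in
    absolute value. *)
Lemma dsum_L2_bound : exists2 K, 0 < K & forall m n, I 0 Z (fun z => dsum m n z ^+ 2) <= K * sg m n.
Proof.
pose K0 := 7 * (2 / d ^+ 2 + 4 * Z ^+ 2) / Z.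
have K00 : 0 <= K0.
  apply: divr_ge0; last exact: ltW; apply: mulr_ge0 => //; apply: addr_ge0.
    by apply: divr_ge0 => //; exact: sqr_ge0.
  by apply: mulr_ge0 => //; exact: sqr_ge0.
pose K := 3 * (K0 * C ^+ 2) + 3 * (Z ^+ 2 * (K0 * C ^+ 4)) + 6 * (Z * (C ^+ 3 * Z ^+ 2) ^+ 2).
have K1 : 0 <= K.
  have Z1 := ltW Z0; have C1 := ltW C0.
  rewrite /K; clear K; clearbody K0.
  by rewrite !addr_ge0 ?mulr_ge0 ?exprn_ge0 ?mulr_ge0 ?exprn_ge0.
exists (K + 1) => [|m n]; first by rewrite ltr_pwDr.
apply: (@le_trans _ _ (K * sg m n)); last by rewrite ler_wpM2r ?sg_ge0 // lerDl.
pose S1 z := \sum_(m <= i < n) (b i - b' i) * cos (l' i * z).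
pose S2 z := \sum_(m <= i < n) (b i * (l i - l' i)) * sin (l' i * z).
pose r z := \sum_(m <= i < n) rem i z.
have e z : dsum m n z = S1 z - z * S2 z + r z.
  by rewrite /dsum /S1 /S2 /r mulr_sumr -sumrB -big_split; apply: eq_bigr => i _; rewrite dtermE.
have Z1 := ltW Z0.
have B1 : BM 0 Z S1 by apply: BM_sum => i; exact/BMZ/BM_cos.
have B2 : BM 0 Z S2 by apply: BM_sum => i; exact/BMZ/BM_sin.
have hr z : 0 <= z <= Z -> `|r z| <= C ^+ 3 * Z ^+ 2 * sg m n.
  move=> /andP[z0 zZ]; apply: le_trans (ler_norm_sum _ _ _) _; rewrite mulr_sumr; apply: ler_sum => i _.
  have -> : C ^+ 3 * Z ^+ 2 / i.+1%:R ^+ 2 = C * (C / i.+1%:R * Z) ^+ 2 by rewrite -exprVn; ring.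
  rewrite /rem normrM ler_pM //; apply: le_trans (cos_Taylor _ _) _.
  rewrite -mulrBl -[leLHS]real_normK ?num_real // normrM ler_pXn2r ?nnegrE ?mulr_ge0 ?divr_ge0 ?(ltW C0) //.
  by rewrite ler_pM // ger0_norm.
have i1 : I 0 Z (fun z => S1 z ^+ 2) <= K0 * C ^+ 2 * sg m n.
  apply: le_trans (cos_Bessel Z0 d0 l_ge0 gap _ _ _) _; rewrite -/K0 -mulrA ler_wpM2l // mulr_sumr.
  apply: ler_sum => i _; rewrite -exprVn -exprMn -[leLHS]real_normK ?num_real //.
  by rewrite ler_pXn2r ?nnegrE ?divr_ge0 ?(ltW C0).
have i2 : I 0 Z (fun z => S2 z ^+ 2) <= K0 * C ^+ 4 * sg m n.
  apply: le_trans (sin_Bessel Z0 d0 l_ge0 gap _ _ _) _; rewrite -/K0 -mulrA ler_wpM2l // mulr_sumr.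
  apply: ler_sum => i _; rewrite -exprVn (_ : C ^+ 4 = (C * C) ^+ 2); last by ring.
  rewrite -exprMn -[leLHS]real_normK ?num_real // ler_pXn2r ?nnegrE ?mulr_ge0 ?invr_ge0 ?(ltW C0) //.
  by rewrite normrM -mulrA ler_pM.
have c1 : L1 0 Z (fun z => S1 z ^+ 2) by exact/BM_L1/BMX.
have c2 : L1 0 Z (fun z => S2 z ^+ 2) by exact/BM_L1/BMX.
have s0 := sg_ge0 m n; have s2 := sg_le2 m n.
pose W := (C ^+ 3 * Z ^+ 2) ^+ 2 * (2 * sg m n).
apply: (@le_trans _ _ (I 0 Z (fun z => 3 * S1 z ^+ 2 + 3 * Z ^+ 2 * S2 z ^+ 2 + 3 * W))).
  apply: I_le => [||z zz]; first exact/BM_L1/BMX/dsum_BM.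
    by apply: L1D; [apply: L1D; exact: L1Z|exact/BM_L1/BM_cst].
  rewrite e; have h1 : r z ^+ 2 <= W.
    rewrite -[leLHS]real_normK ?num_real //.
    apply: (@le_trans _ _ ((C ^+ 3 * Z ^+ 2 * sg m n) ^+ 2)).
      by rewrite ler_pXn2r ?nnegrE ?(le_trans _ (hr z zz)) // hr.
    by rewrite exprMn ler_wpM2l ?sqr_ge0 // expr2 ler_wpM2r.
  case/andP: zz => z0 zZ.
  have h2 : (z * S2 z) ^+ 2 <= Z ^+ 2 * S2 z ^+ 2.
    by rewrite exprMn ler_wpM2r ?sqr_ge0 // ler_pXn2r ?nnegrE.
  move: h1 h2; move: (S1 z) (z * S2 z) (r z) => x y t h1 h2.
  have := sqr_ge0 (x + y); have := sqr_ge0 (x - t); have := sqr_ge0 (y + t); rewrite -mulrA.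
  by move: h1 h2; rewrite !expr2; lra.
rewrite ID; [|by apply: L1D; exact: L1Z|exact/BM_L1/BM_cst].
rewrite ID; [|exact: L1Z|exact: L1Z].
rewrite I_cst // subr0 (IZ _ c1) (IZ _ c2).
have h3 : 3 * Z ^+ 2 * I 0 Z (fun z => S2 z ^+ 2) <= 3 * Z ^+ 2 * (K0 * C ^+ 4 * sg m n).
  by rewrite ler_wpM2l // mulr_ge0 // sqr_ge0.
have -> : K * sg m n = 3 * (K0 * C ^+ 2 * sg m n) + 3 * Z ^+ 2 * (K0 * C ^+ 4 * sg m n) + 3 * W * Z.
  by rewrite /K /W; ring.
by rewrite lerD2r lerD // ler_pM2l.
Qed.

Lemma cube_split N : exists j, (j ^ 3 <= N < j.+1 ^ 3)%N.
Proof.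
elim: N => [|N [j /andP[h1 h2]]]; first by exists 0%N.
have [h|h] := ltnP N.+1 (j.+1 ^ 3); first by exists j; rewrite (leq_trans h1).
exists j.+1; rewrite h (leq_ltn_trans h2) //.
by rewrite ltn_exp2r.
Qed.

Lemma cube_subseq_cvg (u : nat -> R) (L K : R) : 0 < K -> (fun j => u (j ^ 3)%N) @ \oo --> L ->
  (forall j N, (j ^ 3 <= N < j.+1 ^ 3)%N -> `|u N - u (j ^ 3)%N| <= K / j.+1%:R) ->
  u @ \oo --> L.
Proof.
move=> K0 /cvgrPdist_le h hu; apply/cvgrPdist_le => e e0.
have e2 : 0 < e / 2 by rewrite divr_gt0.
have [J _ hJ] := h _ e2.
have [J2 hJ2] := nat_gt (K / (e / 2)).
pose J3 := maxn J J2.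
exists (J3 ^ 3)%N => // N /= JN; have [j jN] := cube_split N.
have jJ : (J3 <= j)%N.
  have : (J3 ^ 3 < j.+1 ^ 3)%N by case/andP: jN => _; exact: leq_ltn_trans.
  by rewrite ltn_exp2r.
have h1 := hJ j (leq_trans (leq_maxl _ _) jJ).
have h2 := hu j N jN.
have h3 : K / j.+1%:R <= e / 2.
  rewrite ler_pdivrMr // mulrC -ler_pdivrMr // ltW // hJ2 // (leq_trans _ (leqnSn j)) //.
  exact: leq_trans (leq_maxr _ _) jJ.
apply: le_trans (ler_distD (u (j ^ 3)%N) _ _) _; rewrite distrC in h2.
by apply: le_trans (lerD h1 (le_trans h2 h3)) _; rewrite -splitr.
Qed.

(** With [x = j] the defect is [4 * (x ^ 3 + 1) - (x + 1) ^ 3 = 3 * (x + 1) * (x - 1) ^ 2]; the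
    shifted index keeps [j = 0] included. *)
Lemma cube_block j i : (j ^ 3 <= i)%N -> (j.+1%:R ^+ 3 / 4 : R) <= i.+1%:R.
Proof.
move=> ji; apply: (@le_trans _ _ (j%:R ^+ 3 + 1)); last first.
  by rewrite -[i.+1%:R]natr1 lerD2r -natrX ler_nat.
rewrite -[j.+1%:R]natr1; have : (0 : R) <= j%:R by [].
move: (j%:R : R) => x x0; rewrite ler_pdivrMr //.
have h : 0 <= (x + 1) * (x - 1) ^+ 2 by rewrite mulr_ge0 ?sqr_ge0 // addr_ge0.
rewrite -subr_ge0 (_ : _ - _ = 3 * ((x + 1) * (x - 1) ^+ 2)); last by ring.
exact: mulr_ge0.
Qed.

Lemma cube_count j N (f : nat -> R) B : (j ^ 3 <= N <= j.+1 ^ 3)%N -> 0 <= B ->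
  (forall i, (j ^ 3 <= i)%N -> f i <= B) -> \sum_((j ^ 3)%N <= i < N) f i <= 3 * j.+1%:R ^+ 2 * B.
Proof.
move=> /andP[jN Nj] B0' hf; apply: (@le_trans _ _ (\sum_((j ^ 3)%N <= i < N) B)).
  by rewrite !big_nat; apply: ler_sum => i /andP[h _]; exact: hf.
rewrite sumr_const_nat -[X in X <= _]mulr_natl ler_wpM2r //.
apply: (@le_trans _ _ ((j.+1 ^ 3 - j ^ 3)%N%:R)); first by rewrite ler_nat leq_sub2r.
rewrite natrB ?leq_exp2r // !natrX -[j.+1%:R]natr1.
by have : (0 : R) <= j%:R by []; move: (j%:R : R) => x; rewrite !expr2 !exprS; nra.
Qed.

(** A square-summable bound alone does not give pointwise convergence. The blocks between cubes have
    summable L1 norms, and inside a block about [3 * j ^ 2] terms of size [j^-3] cannot move the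
    partial sum by more than [O(1/j)]. *)
Lemma dsum_cvg_ae : {ae mu, forall z, 0 <= z <= Z -> cvgn (fun N => dsum 0 N z)}.
Proof.
have [K K0 hK] := dsum_L2_bound; have [K' K'0 hK'] := dterm_bound.
pose D j z := dsum (j ^ 3)%N (j.+1 ^ 3)%N z.
have Z1 := ltW Z0.
have jj j : (j ^ 3 <= j.+1 ^ 3)%N by rewrite leq_exp2r.
have BD j : BM 0 Z (D j) by exact: dsum_BM.
(* The weighted inequality between the means with weight [w ^ 2] balances the squared norm, of order
   [w^-4], against [w^-2]. *)
have hI j : I 0 Z (fun z => `|D j z|) <= (24 * K + Z) * (j.+1%:R ^+ 2)^-1.
  have w0 := nR j; set w := j.+1%:R in w0 *.
  have w2 : 0 < w ^+ 2 by rewrite exprn_gt0.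
  apply: (@le_trans _ _ (I 0 Z (fun z => 2^-1 * w ^+ 2 * D j z ^+ 2 + (w ^+ 2)^-1))).
    apply: I_le => [||z _]; first exact/L1_abs/BM_L1.
      by apply: L1D; [exact/L1Z/BM_L1/BMX|exact/BM_L1/BM_cst].
    have wi : 0 < w^-1 by rewrite invr_gt0.
    have ww : w * w^-1 = 1 by rewrite mulfV // gt_eqF.
    rewrite -[D j z ^+ 2]real_normK ?num_real // -exprVn; move: (`|D j z|) (normr_ge0 (D j z)) => x x0.
    have := sqr_ge0 (w * x - w^-1); rewrite sqrrB => h.
    have e1 : w * x * w^-1 = x by rewrite mulrAC ww mul1r.
    have := sqr_ge0 w^-1; move: h; rewrite -mulrA e1 exprMn mulr2n.
    move: (w ^+ 2 * x ^+ 2) (w^-1 ^+ 2) => u1 u2; lra.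
  rewrite ID; [|exact/L1Z/BM_L1/BMX|exact/BM_L1/BM_cst].
  rewrite I_cst // subr0 IZ; last exact/BM_L1/BMX.
  rewrite mulrDl lerD //; last by rewrite mulrC.
  have s1 : \sum_((j ^ 3)%N <= i < (j.+1 ^ 3)%N) (i.+1%:R ^+ 2)^-1 <= 3 * w ^+ 2 * ((w ^+ 3 / 4) ^+ 2)^-1.
    apply: cube_count; rewrite ?jj ?leqnn ?invr_ge0 ?sqr_ge0 // => i ji.
    rewrite lef_pV2 ?posrE ?exprn_gt0 // ?divr_gt0 ?exprn_gt0 //.
    by rewrite ler_pXn2r ?nnegrE ?divr_ge0 ?exprn_ge0 ?(ltW w0) // cube_block.
  have h2 := le_trans (hK (j ^ 3)%N (j.+1 ^ 3)%N) (ler_wpM2l (ltW K0) s1).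
  have -> : 24 * K * (w ^+ 2)^-1 = 2^-1 * w ^+ 2 * (K * (3 * w ^+ 2 * ((w ^+ 3 / 4) ^+ 2)^-1)).
    by field; rewrite gt_eqF.
  by rewrite ler_wpM2l // mulr_ge0 // ltW.
have hs n : \sum_(0 <= j < n) I 0 Z (fun z => `|D j z|) <= (24 * K + Z) * 2.
  apply: (@le_trans _ _ (\sum_(0 <= j < n) (24 * K + Z) * (j.+1%:R ^+ 2)^-1)).
    by apply: ler_sum => j _; exact: hI.
  by rewrite -mulr_sumr ler_wpM2l ?sg_le2 // addr_ge0 ?(ltW Z0) // mulr_ge0 // ltW.
have := ae_cvg_series (fun j => BM_L1 (BD j)) hs; apply: ae_mp => z hz zZ; move: (hz zZ) => /cvg_ex[L hL].
apply/cvg_ex; exists L; apply: (@cube_subseq_cvg _ _ (12 * K')) => [|/=|j N jN].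
- by rewrite mulr_gt0.
- rewrite (_ : (fun j => dsum 0 (j ^ 3)%N z) = series (D^~ z)) //; apply/funext => n.
  rewrite /series /=; elim: n => [|n IH]; first by rewrite !big_geq // /dsum big_geq.
  by rewrite big_nat_recr //= -IH /D -dsum_cat.
case/andP: (jN) => h1 h2.
rewrite (dsum_cat z (leq0n _) h1) addrAC subrr add0r.
apply: le_trans (ler_norm_sum _ _ _) _.
have w0 := nR j; set w := j.+1%:R in w0 *.
have -> : 12 * K' / w = 3 * w ^+ 2 * (K' / (w ^+ 3 / 4)) by field; rewrite gt_eqF.
have wp : 0 < w ^+ 3 / 4 by rewrite divr_gt0 // exprn_gt0.
apply: cube_count; first by rewrite h1 ltnW.
  by rewrite divr_ge0 ?ltW.
move=> i ji; have zz : `|z| <= Z by case/andP: zZ => z0 ?; rewrite ger0_norm.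
apply: le_trans (hK' i z zz) _; rewrite ler_pM2l // lef_pV2 ?posrE //; exact: cube_block.
Qed.

Definition dlim z : R := limn (fun N => dsum 0 N z).

Lemma dsum_cvg : {ae mu, forall z, - Z <= z <= Z -> (fun N => dsum 0 N z) @ \oo --> dlim z}.
Proof.
have h1 := dsum_cvg_ae.
have h2 := ae_affine 0 (_ : (-1 : R) != 0) h1; rewrite oppr_eq0 oner_eq0 in h2.
have := ae_and h1 (h2 isT); apply: ae_mp => z [g1 g2] /andP[zl zr].
have [z0|z0] := leP 0 z; first by apply: g1; rewrite z0.
have := g2; rewrite mulN1r addr0 => /(_ _)/cvg_ex[|L hL]; first by rewrite oppr_ge0 (ltW z0) lerNl.
have e : (fun N => dsum 0 N (- z)) = (fun N => dsum 0 N z) by apply/funext => N; rewrite dsum_even.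
by rewrite e in hL; apply/cvg_ex; exists L.
Qed.

Lemma dsum_sym m n : I (- Z) Z (fun z => dsum m n z ^+ 2) = 2 * I 0 Z (fun z => dsum m n z ^+ 2).
Proof.
have Z1 := ltW Z0; have Z2 : - Z <= 0 by rewrite oppr_le0.
have hL b1 c1 : b1 <= c1 -> L1 b1 c1 (fun z => dsum m n z ^+ 2).
  by move=> bc; exact/BM_L1/BMX/dsum_BM.
rewrite (@I_split _ _ 0) //; last exact/hL/(le_trans Z2).
have [] := @I_affineN R (-1) 0 (- Z) 0 (fun z => dsum m n z ^+ 2); rewrite ?oppr_lt0 ?ltr01 //.
  by rewrite mulr0 mulN1r opprK !addr0; exact: hL.
move=> _; rewrite mulr0 mulN1r opprK !addr0 => ->; rewrite opprK mul1r.
rewrite (@I_ext _ _ _ (fun t => dsum m n (-1 * t + 0) ^+ 2) (fun z => dsum m n z ^+ 2)); first by ring.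
by move=> z _; rewrite mulN1r addr0 dsum_even.
Qed.

End SpectralDifference.

(** * The kernel as a Volterra operator *)

Section Glue.
Context {R : realType}.
Notation I := (@lintegral_ab R).
Notation mu := (@lebesgue_measure R).
Implicit Types (b c d : R) (f g h : R -> R).

Lemma itv_split3 b c d : b <= c -> c <= d ->
  `[b, d]%classic = `[b, c[ `|` ([set c] `|` `]c, d]) :> set R.
Proof.
move=> bc cd; apply/seteqP; split => x /=; rewrite !in_itv /=.
  by case: (ltgtP x c) => [xc|cx|->] /andP[h1 h2]; [left; rewrite h1|right; right; rewrite h2|right; left].
case=> [/andP[h1 h2]|[->|/andP[h1 h2]]]; rewrite ?bc ?cd // ?h1 ?h2 ?(ltW (lt_le_trans h2 cd)) //.
by rewrite (le_trans bc (ltW h1)).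
Qed.

(** The value of [h] at [c] is left free: the kernel has its own value at [a], given by neither of
    the one-sided formulas. *)
Lemma Mf_glue b c d f g h : b <= c -> c <= d -> Mf b c f -> Mf c d g ->
  (forall t, b <= t < c -> h t = f t) -> (forall t, c < t <= d -> h t = g t) -> Mf b d h.
Proof.
move=> bc cd mf mg hf hg; rewrite /Mf (itv_split3 bc cd).
apply/measurable_funU => //; first exact: measurableU.
split.
  apply: (@eq_measurable_fun _ _ _ _ _ f) => [t|].
    by rewrite inE /= in_itv /= => /hf.
  by apply: measurable_funS mf => // t /=; rewrite !in_itv /= => /andP[-> /ltW].
apply/measurable_funU => //; split; first exact: measurable_fun_set1.
apply: (@eq_measurable_fun _ _ _ _ _ g) => [t|].
  by rewrite inE /= in_itv /= => /hg.
by apply: measurable_funS mg => // t /=; rewrite !in_itv /= => /andP[/ltW ->].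
Qed.

Lemma L1_glue_ge0 b c d f g h : b <= c -> c <= d -> L1 b c f -> L1 c d g ->
  (forall t, b <= t < c -> h t = f t) -> (forall t, c < t <= d -> h t = g t) ->
  (forall t, 0 <= f t) -> (forall t, 0 <= g t) -> (forall t, 0 <= h t) -> L1 b d h.
Proof.
move=> bc cd Lf Lg hf hg f0 g0 h0.
have mh := Mf_glue bc cd (L1_Mf Lf) (L1_Mf Lg) hf hg.
apply: (ge0_I_fin mh (K := I b c f + I c d g) _ _).1 => //.
rewrite (itv_split3 bc cd) ge0_integral_setU //=; last 4 first.
- exact: measurableU.
- by rewrite -(itv_split3 bc cd); exact/measurable_EFinP.
- by move=> x _; rewrite lee_fin.
- apply/disj_setPLR => t /=; rewrite in_itv /= => /andP[_ tc] [e|]; first by rewrite e ltxx in tc.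
  by rewrite in_itv /= => /andP[/(lt_trans tc)]; rewrite ltxx.
have mh' : measurable_fun ([set c] `|` `]c, d]) (fun x => (h x)%:E).
  apply/measurable_EFinP; apply: measurable_funS mh => //; rewrite [X in _ `<=` X](itv_split3 bc cd).
  by move=> t; right.
rewrite ge0_integral_setU //=; last 2 first.
- by move=> x _; rewrite lee_fin.
- by apply/disj_setPLR => t /= ->; rewrite in_itv /= ltxx.
rewrite integral_set1 //= add0e EFinD; apply: leeD.
  have -> : (\int[mu]_(x in `[b, c[) (h x)%:E = \int[mu]_(x in `[b, c[) (f x)%:E)%E.
    by apply: eq_integral => t; rewrite inE /= in_itv /= => /hf ->.
  rewrite -(I_EFin Lf); apply: ge0_subset_integral => //.
  - by apply/measurable_EFinP; exact: L1_Mf Lf.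
  - by move=> x _; rewrite lee_fin.
  - by move=> t /=; rewrite !in_itv /= => /andP[-> /ltW].
have -> : (\int[mu]_(x in `]c, d]) (h x)%:E = \int[mu]_(x in `]c, d]) (g x)%:E)%E.
  by apply: eq_integral => t; rewrite inE /= in_itv /= => /hg ->.
rewrite -(I_EFin Lg); apply: ge0_subset_integral => //.
- by apply/measurable_EFinP; exact: L1_Mf Lg.
- by move=> x _; rewrite lee_fin.
- by move=> t /=; rewrite !in_itv /= => /andP[/ltW ->].
Qed.

Lemma L2_glue b c d f g h : b <= c -> c <= d -> L2 b c f -> L2 c d g ->
  (forall t, b <= t < c -> h t = f t) -> (forall t, c < t <= d -> h t = g t) -> L2 b d h.
Proof.
move=> bc cd [mf Lf] [mg Lg] hf hg; split; first exact: Mf_glue bc cd mf mg hf hg.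
apply: (L1_glue_ge0 bc cd Lf Lg) => [t ht|t ht|t|t|t]; rewrite ?sqr_ge0 //.
  by rewrite hf.
by rewrite hg.
Qed.

Lemma I_glue b c d f g h : b <= c -> c <= d -> L1 b d h -> Mf b c f -> Mf c d g ->
  (forall t, b <= t < c -> h t = f t) -> (forall t, c < t <= d -> h t = g t) ->
  I b d h = I b c f + I c d g.
Proof.
move=> bc cd Lh mf mg hf hg; rewrite (I_split bc cd Lh); congr (_ + _).
  apply: I_ae => //; first exact: L1_Mf (L1_sub (lexx _) cd Lh).
  by apply: aeW => t /andP[h1 h2]; rewrite hf // h2 ltW.
apply: I_ae => //; first exact: L1_Mf (L1_sub bc (lexx _) Lh).
by apply: aeW => t /andP[h1 h2]; rewrite hg // h1 ltW.
Qed.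

Lemma L2_zero_ext b c d f : b <= c -> c <= d -> L2 b c f -> (forall t, c < t <= d -> f t = 0) -> L2 b d f.
Proof. by move=> bc cd hf f0; apply: L2_glue bc cd hf (BM_L2 (BM_cst c d 0)) _ f0. Qed.

Lemma I_cut b c d f : b <= c -> c <= d -> L1 b d f -> (forall t, c < t <= d -> f t = 0) -> I b d f = I b c f.
Proof.
move=> bc cd hf f0; rewrite (I_glue (f := f) (g := fun=> 0) bc cd hf _ _ _ f0) //.
- by rewrite I_cst // mul0r addr0.
- exact: L1_Mf (L1_sub (lexx _) cd hf).
- exact: (BM_cst _ _ _).1.
Qed.

Lemma ae_exists (b c : R) (P : R -> Prop) : b < c -> {ae mu, forall x, P x} -> exists2 x, b < x < c & P x.
Proof.
move=> bc [N [mN N0 hN]]; apply: contrapT => hn.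
have hs : `]b, c[ `<=` N.
  move=> x /=; rewrite in_itv /= => xbc; apply: hN => /= px; apply: hn; exists x => //.
have := le_measure mu (mem_set (measurable_itv `]b, c[)) (mem_set mN) hs.
have N1 : (mu N <= 0)%E by rewrite N0.
have hm : mu `]b, c[%classic = (c - b)%:E by rewrite lebesgue_measure_itv /= lte_fin bc.
move=> h1; have : ((c - b)%:E <= 0)%E by rewrite -hm; exact: le_trans h1 N1.
by rewrite lee_fin; move: bc; lra.
Qed.

End Glue.

(** * The two terms of the kernel in the weighted space *)

Section Kernel.
Context {R : realType}.
Variables (a al : R).
Hypotheses (al0 : 0 < al) (a0 : 0 < a) (api : a < pi) (pial : pi * al < a * (1 + al)).
Notation I := (@lintegral_ab R).
Notation mu := (@lebesgue_measure R).
Notation w := (rho a al).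
Notation ip := (wip a al).
Notation L2p := (@L2 R 0 pi).
Notation mp := (mu_plus a al).
Notation mm := (mu_minus a al).
Variables (phi A : R -> R -> R).
Hypothesis hA : forall x, 0 <= x <= pi -> measurable_fun `[0, mp x] (A x) /\
  mu.-integrable `[0, mp x] (fun t => (w t * A x t ^+ 2)%:E).
Hypothesis phiA : forall x l, 0 <= x <= pi ->
  phi x l = phi0 a al x l + I 0 (mp x) (fun t => A x t * cos (l * t)).
Hypothesis A0 : forall x t, 0 <= x <= pi -> mp x < t -> A x t = 0.
Implicit Types (s t x l : R).
Let pi0 : 0 <= pi :> R := pi_ge0 R.

Lemma mp_left x : x <= a -> mp x = x.
Proof. by move=> xa; rewrite /mu_plus srhoE // xa; ring. Qed.

Lemma mp_right x : a <= x -> mp x = al * x + a * (1 - al).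
Proof.
rewrite /mu_plus srhoE // => ax; case: ifP => xa; last by ring.
by have -> : x = a; [apply/le_anti; rewrite xa|ring].
Qed.

Lemma mmE x : mm x = 2 * a - mp x.
Proof. by rewrite /mu_minus /mu_plus; ring. Qed.

Lemma mp_lt x y : x < y -> mp x < mp y.
Proof.
move=> xy; have [ya|ay] := leP y a; first by rewrite !mp_left ?(le_trans (ltW xy)).
have al1 : 0 < al * (y - a) by rewrite mulr_gt0 // subr_gt0.
have [xa|ax] := leP x a.
  by rewrite (mp_left xa) (mp_right (ltW ay)); move: al1; rewrite mulrBr mulrBr mulr1 [al * a]mulrC; lra.
by rewrite (mp_right (ltW ay)) (mp_right (ltW ax)) ltrD2r ltr_pM2l.
Qed.

Lemma mp_le x y : x <= y -> mp x <= mp y.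
Proof. by rewrite le_eqVlt => /predU1P[->//|/mp_lt/ltW]. Qed.

Lemma mp_ge0 x : 0 <= x -> 0 <= mp x.
Proof. by move=> x0; rewrite -[leLHS](mp_left (ltW a0)) mp_le. Qed.

Lemma a_le_M : a <= mp pi.
Proof. by rewrite -[leLHS](mp_left (lexx a)) mp_le // ltW. Qed.

(** This is where the condition on [a] and [al] enters: the interval [[a, mp pi]] reflected at [a]
    stays inside [[0, a]]. *)
Lemma M_le_2a : mp pi <= 2 * a.
Proof. by rewrite (mp_right (ltW api)) mulrBr mulr1 mulrC; move: pial; rewrite mulrDr mulr1; lra. Qed.

Lemma A_L2 s c : 0 <= s <= pi -> mp s <= c -> L2 0 c (A s).
Proof.
move=> sp sc; have [mA LA] := hA sp; case/andP: (sp) => s0 spi.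
apply: (L2_zero_ext (mp_ge0 s0) sc); last by move=> t /andP[st _]; exact: A0.
split => //; have bw : BM 0 (mp s) (fun t => (w t)^-1).
  have ai : 0 < al^-1 by rewrite invr_gt0.
  apply: BM_ext (BM_rho a ai 0 (mp s)) => t _.
  by rewrite /rho; case: ifP => _; rewrite ?invr1 // exprVn.
apply: L1_ext (BM_L1M bw LA) => t _; rewrite mulrA mulVf ?mul1r // gt_eqF //; exact: rho_gt0.
Qed.

Definition kernel s t := 2 / (1 + srho a al t) * A s (mp t) +
  (1 - srho a al (2 * a - t)) / (1 + srho a al (2 * a - t)) * A s (2 * a - t).

Let k := (1 - al) / (1 + al).

Lemma kernel_left s t : t < a -> kernel s t = A s t + k * A s (2 * a - t).
Proof.
move=> ta; rewrite /kernel (mp_left (ltW ta)) !srhoE // (ltW ta) leNgt.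
rewrite (_ : a < 2 * a - t) /=; last by lra.
by rewrite (_ : 1 + 1 = 2) // divff ?mul1r // pnatr_eq0.
Qed.

Lemma kernel_right s t : a < t -> kernel s t = 2 / (1 + al) * A s (al * t + a * (1 - al)).
Proof.
move=> ta; rewrite /kernel (mp_right (ltW ta)) !srhoE // leNgt ta /=.
rewrite (_ : 2 * a - t <= a) /=; last by lra.
by rewrite subrr !mul0r addr0.
Qed.

Lemma kernel_supp s t : 0 <= s <= pi -> s < t -> t <= pi -> kernel s t = 0.
Proof.
move=> sp st tp; rewrite /kernel (A0 sp (mp_lt st)) mulr0 add0r.
have [ta|ta] := ltP t a; last first.
  by rewrite !srhoE // (_ : 2 * a - t <= a) /=; [rewrite subrr !mul0r|lra].
rewrite [A s _]A0 ?mulr0 // (mp_left (ltW (lt_trans st ta))); lra.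
Qed.

Let fl s t := A s t + k * A s (-1 * t + 2 * a).
Let fr s t := 2 / (1 + al) * A s (al * t + a * (1 - al)).

Lemma fl_L2 s : 0 <= s <= pi -> L2 0 a (fl s).
Proof.
move=> sp; case/andP: (sp) => s0 spi; have h2 := A_L2 sp (le_trans (mp_le spi) M_le_2a).
have a2 : a <= 2 * a by have := a0; lra.
apply: L2D; first exact: L2_sub h2.
apply: L2Z.
have n1 : (-1 : R) < 0 by rewrite oppr_lt0.
have e1 : -1 * a + 2 * a = a by ring.
have e2 : -1 * 0 + 2 * a = 2 * a by ring.
have hL : L2 (-1 * a + 2 * a) (-1 * 0 + 2 * a) (A s) by rewrite e1 e2; exact: (L2_sub (ltW a0) (lexx _) h2).
split.
  by have [/L1_Mf] := I_affineN n1 (L2_L1 hL).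
by have [] := I_affineN n1 hL.2.
Qed.

Lemma fr_L2 s : 0 <= s <= pi -> L2 a pi (fr s).
Proof.
move=> sp; case/andP: (sp) => s0 spi; have h2 := A_L2 sp (mp_le spi).
apply: L2Z.
have hL : L2 (al * a + a * (1 - al)) (al * pi + a * (1 - al)) (A s).
  rewrite -!mp_right ?(ltW api) // mp_left //; exact: (L2_sub (ltW a0) (lexx _) h2).
split.
  by have [/L1_Mf] := I_affine al0 (L2_L1 hL).
by have [] := I_affine al0 hL.2.
Qed.

Lemma kernel_L2 s : 0 <= s <= pi -> L2p (kernel s).
Proof.
move=> sp; apply: (L2_glue (ltW a0) (ltW api) (fl_L2 sp) (fr_L2 sp)) => t.
  by move=> /andP[_ /kernel_left ->]; rewrite /fl mulN1r [- t + _]addrC.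
by move=> /andP[/kernel_right ->].
Qed.

(** After the affine substitutions both halves are integrals of [A s] against direct and reflected
    cosines. The reflected ones cancel, and the direct ones add up to the given representation. *)
Lemma kernel_repr s l : 0 <= s <= pi ->
  phi s l = phi0 a al s l + ip (kernel s) (fun t => phi0 a al t l).
Proof.
move=> sp; rewrite phiA //; congr (_ + _); case/andP: (sp) => s0 spi.
have h2 := A_L2 sp (le_trans (mp_le spi) M_le_2a).
have aM := a_le_M; have M2 := M_le_2a; have a2 := le_trans aM M2.
have b0 : BM 0 pi (fun t => phi0 a al t l).
  by have [h _] := phi0_AC al0 a0 api l; exact: AC_BM h.
have hker : L1 0 pi (fun t => w t * kernel s t * phi0 a al t l).
  by apply: ip_L1 => //; [exact: kernel_L2|exact: BM_L2].
pose ca u := cos (l * u); have bca b c : BM b c ca by exact: BM_cos.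
pose cb u := cos (- l * u + l * (2 * a)).
have bcb b c : BM b c cb by exact: BM_cos_aff.
have La : L1 0 (2 * a) (fun u => A s u * ca u) by apply: L1_BM; [exact: L2_L1|apply: bca; rewrite mulr_ge0 // ltW].
have Lb : L1 0 (2 * a) (fun u => A s u * cb u) by apply: L1_BM; [exact: L2_L1|apply: bcb; rewrite mulr_ge0 // ltW].
have aa := ltW a0; have ap := ltW api.
rewrite /wip (I_glue (f := fun t => fl s t * phi0 a al t l) (g := fun t => al ^+ 2 * fr s t * phi0 a al t l) aa ap hker); last 4 first.
- exact: MfM (fl_L2 sp).1 (BM_sub (lexx _) ap b0).1.
- apply: MfM (BM_sub aa (lexx _) b0).1; apply: MfZ; exact: (fr_L2 sp).1.
- by move=> t /andP[_ ta]; rewrite kernel_left // /rho ltW // mul1r /fl mulN1r [- t + _]addrC.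
- by move=> t /andP[at_ _]; rewrite kernel_right // /rho leNgt at_.
(* The substitution [u = 2 * a - t] turns the second [A]-term into an integral over [[a, mp pi]]
   against [cos (l * (2 * a - u))]. *)
have eleft : I 0 a (fun t => fl s t * phi0 a al t l) = I 0 a (fun u => A s u * ca u) + k * I a (mp pi) (fun u => A s u * cb u).
  have n1 : (-1 : R) < 0 by rewrite oppr_lt0.
  have e1 : -1 * a + 2 * a = a by ring.
  have e2 : -1 * 0 + 2 * a = 2 * a by ring.
  have hL : L1 (-1 * a + 2 * a) (-1 * 0 + 2 * a) (fun u => A s u * cb u) by rewrite e1 e2; apply: L1_sub Lb.
  have [h1 h3] := I_affineN n1 hL; rewrite e1 e2 opprK mul1r in h3.
  have <- : I a (2 * a) (fun u => A s u * cb u) = I a (mp pi) (fun u => A s u * cb u).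
    apply: I_cut => //; first by apply: L1_sub Lb.
    by move=> t /andP[h _]; rewrite A0 ?mul0r // (le_lt_trans (mp_le spi)).
  rewrite h3 -IZ // -ID; [|by apply: L1_sub La|exact: L1Z].
  apply: I_ext => t /andP[t0 ta]; rewrite (phi0_left al0 l ta).1 /fl /ca /cb mulrDl -mulrA.
  by congr (_ + _ * (_ * cos _)); ring.
(* The weight [al ^ 2], the factor [2 / (1 + al)] and the Jacobian [1 / al] combine to 1 in front of
   the direct wave and to [- k] in front of the reflected one. *)
have eright : I a pi (fun t => al ^+ 2 * fr s t * phi0 a al t l) =
    I a (mp pi) (fun u => A s u * ca u) - k * I a (mp pi) (fun u => A s u * cb u).
  have e1 : al * a + a * (1 - al) = a by ring.
  have Lc : L1 a (mp pi) (fun u => A s u * ca u - k * (A s u * cb u)).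
    by apply: L1B; [exact: L1_sub La|apply/L1Z; exact: L1_sub Lb].
  have Lc' : L1 (al * a + a * (1 - al)) (al * pi + a * (1 - al)) (fun u => A s u * ca u - k * (A s u * cb u)).
    by rewrite e1 -mp_right.
  have [h1 h3] := I_affine al0 Lc'.
  rewrite e1 -mp_right // in h3.
  rewrite -IZ; last exact: L1_sub Lb.
  rewrite -IB; [|exact: L1_sub La|apply/L1Z; exact: L1_sub Lb].
  rewrite h3 -IZ //; apply: I_ext => t /andP[at_ tp].
  rewrite (phi0_right al0 l at_).1 /right0 /fr /ca /cb /k.
  have -> : l * (al * t + a * (1 - al)) = l * al * t + l * (a * (1 - al)) by ring.
  have -> : - l * (al * t + a * (1 - al)) + l * (2 * a) = - (l * al) * t + l * (a * (1 + al)) by ring.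
  by field; rewrite !gt_eqF // addr_gt0.
rewrite eleft eright; have := @I_split R 0 a (mp pi) _ aa aM (L1_sub (lexx _) M2 La).
move: (I a _ (fun u => A s u * cb u)) (I a _ _) (I 0 a _) => x1 x2 x3 e.
rewrite (_ : x3 + k * x1 + (x2 - k * x1) = x3 + x2); last by ring.
rewrite -e; by rewrite (@I_cut R 0 (mp s)) ?mp_ge0 ?mp_le //; [exact: L1_sub La|move=> t /andP[h _]; rewrite A0 ?mul0r].
Qed.

End Kernel.

Section ConvergenceForms.
Context {R : realType}.
Notation I := (@lintegral_ab R).

Lemma sqr_cvg (u : nat -> R) (L : R) :
  (forall e, 0 < e -> exists N, forall n, (N <= n)%N -> (u n - L) ^+ 2 <= e) -> u @ \oo --> L.
Proof.
move=> h; apply/cvgrPdist_le => e e0.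
have [N hN] := h (e ^+ 2) (exprn_gt0 2 e0); exists N => // n /= /hN.
rewrite -[(u n - L) ^+ 2]real_normK ?num_real // ler_pXn2r ?nnegrE ?(ltW e0) //.
by rewrite distrC.
Qed.

Lemma cvg_le_bound (u : nat -> R) (L B : R) : u @ \oo --> L -> (forall n, u n <= B) -> L <= B.
Proof.
move=> cu hu; rewrite -(cvg_lim (@Rhausdorff R) cu); apply: limr_le; first by apply/cvg_ex; exists L.
by apply: nearW.
Qed.

Lemma sqr_cvg_inv (u : nat -> R) (L C : R) :
  (forall n, (0 < n)%N -> (u n - L) ^+ 2 <= C / n%:R) -> u @ \oo --> L.
Proof.
move=> h; apply: sqr_cvg => e e0; have [N hN] := nat_gt (C / e).
exists (maxn N 1) => n; rewrite geq_max => /andP[/hN h1 n1]; apply: le_trans (h n n1) _.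
by rewrite ler_pdivrMr ?ltr0n // mulrC -ler_pdivrMr // ltW.
Qed.

Variables (q : R -> R) (a al : R).
Hypotheses (al0 : 0 < al) (hq : L2 0 pi q).
Variables (phi phi1 : R -> R -> R) (lam : nat -> R).
Hypothesis hphi : forall l, is_sol q a al (l ^+ 2) (fun x => phi x l) (fun x => phi1 x l) /\
  phi 0 l = 1 /\ phi1 0 l = 0.
Hypothesis lam_ge0 : forall n, 0 <= lam n.
Hypothesis lamS : forall n, lam n < lam n.+1.
Hypothesis eigP : forall nu, is_eigenvalue q a al nu <-> exists n, nu = lam n ^+ 2.
Notation ip := (wip a al).
Notation L2p := (@L2 R 0 pi).
Notation ef := (eigenfun phi lam).
Notation alpha := (norming a al phi lam).

Lemma Parseval_cvg v u : L2p v -> L2p u ->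
  (fun n => \sum_(0 <= i < n) ip v (ef i) * ip u (ef i) / alpha i) @ \oo --> ip v u.
Proof.
move=> hv hu; apply: sqr_cvg => e e0.
have u0 := ip_ge0 a al0 u; have u1 : 0 < ip u u + 1 by rewrite ltr_pwDr.
have [N hN] := Parseval al0 hq hphi lam_ge0 lamS eigP hv (divr_gt0 e0 u1).
exists N => n Nn; rewrite -sqrrN opprB; apply: le_trans (hN n u Nn hu) _.
by rewrite mulrAC ler_pdivrMr // ler_wpM2l ?(ltW e0) // lerDl.
Qed.

Lemma expansion_cvg f f1 g x : Dom q a al f f1 g -> 0 <= x <= pi ->
  (fun n => \sum_(0 <= i < n) ip f (ef i) / alpha i * phi x (lam i)) @ \oo --> f x.
Proof.
move=> hf xp; apply/cvgrPdist_le => e e0.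
have [N hN] := expansion al0 hq hphi lam_ge0 lamS eigP hf e0.
by exists N => // n /= Nn; exact: hN.
Qed.

End ConvergenceForms.

(** * The Volterra operator, handled through the unperturbed expansion *)

Section Kappa.
Context {R : realType}.
Variables (q : R -> R) (a al : R).
Hypotheses (al0 : 0 < al) (a0 : 0 < a) (api : a < pi) (pial : pi * al < a * (1 + al)) (hq : L2 0 pi q).
Variables (phi phi1 A : R -> R -> R) (lam0 : nat -> R).
Hypothesis hphi : forall l, is_sol q a al (l ^+ 2) (fun x => phi x l) (fun x => phi1 x l) /\
  phi 0 l = 1 /\ phi1 0 l = 0.
Notation I := (@lintegral_ab R).
Notation mu := (@lebesgue_measure R).
Notation w := (rho a al).
Notation ip := (wip a al).
Notation L2p := (@L2 R 0 pi).
Notation mp := (mu_plus a al).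
Hypothesis hA : forall x, 0 <= x <= pi -> measurable_fun `[0, mp x] (A x) /\
  mu.-integrable `[0, mp x] (fun t => (w t * A x t ^+ 2)%:E).
Hypothesis phiA : forall x l, 0 <= x <= pi ->
  phi x l = phi0 a al x l + I 0 (mp x) (fun t => A x t * cos (l * t)).
Hypothesis A0 : forall x t, 0 <= x <= pi -> mp x < t -> A x t = 0.
Hypothesis lam0_ge0 : forall n, 0 <= lam0 n.
Hypothesis lam0S : forall n, lam0 n < lam0 n.+1.
Hypothesis eigP0 : forall nu, is_eigenvalue (fun _ => 0) a al nu <-> exists n, nu = lam0 n ^+ 2.
Notation ef0 := (eigenfun (phi0 a al) lam0).
Notation alpha0 := (norming a al (phi0 a al) lam0).
Notation K := (kernel a al A).
Notation ps := (phi0_spec al0 a0 api).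
Notation z2 := (@L2_zero R).
Let pi0 : 0 <= pi :> R := pi_ge0 R.

Let ap0 n : 0 < alpha0 n.
Proof. exact (alpha_gt0 al0 z2 ps eigP0 n). Qed.
Let e20 n : L2p (ef0 n).
Proof. exact (ef_L2 lam0 ps n). Qed.
Let K2 s : 0 <= s <= pi -> L2p (K s).
Proof. by move=> sp; exact (kernel_L2 al0 a0 api pial hA A0 sp). Qed.

Lemma kernel_coef s l : 0 <= s <= pi ->
  ip (K s) (fun t => phi0 a al t l) = phi s l - phi0 a al s l.
Proof.
by move=> sp; rewrite (kernel_repr al0 a0 api pial hA phiA A0 l sp) addrAC subrr add0r.
Qed.

(** The hypotheses on [A] give no uniformity in [s]. It comes from Parseval's identity: the
    coefficients [phi - phi0] at [lam0 i] are [O(1/i)] uniformly in [s]. *)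
Lemma kernel_bound : exists2 C, 0 < C & forall s, 0 <= s <= pi -> ip (K s) (K s) <= C.
Proof.
have [C C0 hC] := phi_lam0_close al0 a0 api hq hphi lam0_ge0 lam0S eigP0.
have [c c0 hc] := alpha0_ge al0 a0 api lam0_ge0 lam0S eigP0.
pose B := C ^+ 2 / c; have B0 : 0 < B by rewrite divr_gt0 // exprn_gt0.
exists (B * 2) => [|s sp]; first by rewrite mulr_gt0.
have cv := Parseval_cvg al0 z2 ps lam0_ge0 lam0S eigP0 (K2 sp) (K2 sp).
apply: (cvg_le_bound cv) => n.
apply: (@le_trans _ _ (B * \sum_(0 <= i < n) (i.+1%:R ^+ 2)^-1)); last first.
  by rewrite ler_wpM2l ?(ltW B0) //; exact: sg_le2.
rewrite mulr_sumr; apply: ler_sum => i _; rewrite kernel_coef //.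
have := hC i s sp; move: (phi s _ - _) => y hy.
have y2 : y ^+ 2 <= C ^+ 2 / i.+1%:R ^+ 2.
  rewrite -expr_div_n -[leLHS]real_normK ?num_real // ler_pXn2r ?nnegrE //.
  by rewrite divr_ge0 // ltW.
rewrite /B [leRHS]mulrAC -expr2; apply: ler_pM => //; [exact: sqr_ge0|by rewrite invr_ge0 ltW|].
by rewrite lef_pV2 ?posrE.
Qed.

Definition kappa h s := ip (K s) h.

Lemma kappa_sqr : exists2 C, 0 < C & forall h s, L2p h -> 0 <= s <= pi -> kappa h s ^+ 2 <= C * ip h h.
Proof.
have [C C0 hC] := kernel_bound; exists C => // h s hh sp.
apply: le_trans (ip_CS a al0 (K2 sp) hh) _; rewrite ler_wpM2r ?hC //; exact: ip_ge0.
Qed.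

Lemma kappaB h g s : L2p h -> L2p g -> 0 <= s <= pi -> kappa (fun t => h t - g t) s = kappa h s - kappa g s.
Proof. by move=> hh hg sp; rewrite /kappa ipBr //; exact: K2. Qed.

Lemma kappa_fsum c N s : 0 <= s <= pi ->
  kappa (fsum (phi0 a al) lam0 c 0 N) s = \sum_(0 <= i < N) c i * (phi s (lam0 i) - phi0 a al s (lam0 i)).
Proof.
move=> sp; rewrite /kappa ipC (@ip_fsum R _ a al al0 _ _ lam0 ps c 0 N (K s) (K2 sp)).
by apply: eq_bigr => i _; rewrite ipC kernel_coef.
Qed.

(** Measurability in [s] is not among the assumptions on [A]. It holds because [kappa h] is the
    pointwise limit of its values on partial expansions of [h], which are explicit combinations of
    [phi - phi0]. *)
Lemma kappa_BM h : L2p h -> BM 0 pi (kappa h).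
Proof.
move=> hh; have [C C0 hC] := kappa_sqr; split.
  pose v N s := \sum_(0 <= i < N) coef a al (phi0 a al) lam0 h i * (phi s (lam0 i) - phi0 a al s (lam0 i)).
  have mv N : Mf 0 pi (v N).
    apply: (BM_sum 0 N (F := fun i s => coef a al (phi0 a al) lam0 h i * (phi s (lam0 i) - phi0 a al s (lam0 i))) _).1.
    by move=> i; apply/BMZ/BMB; [exact: (phi_BM hphi)|exact: (phi_BM ps)].
  apply: Mf_ext (limn_Mf mv) => s sp; apply: cvg_lim => //.
  apply: sqr_cvg => e e0; have [N hN] := complete al0 z2 ps lam0_ge0 lam0S eigP0 hh (divr_gt0 e0 C0).
  exists N => n Nn; have f2 := fsum_L2 lam0 ps (coef a al (phi0 a al) lam0 h) 0 n.
  rewrite /v -(kappa_fsum _ _ sp) -sqrrN opprB -kappaB //.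
  apply: le_trans (hC _ _ (L2B hh f2) sp) _.
  by rewrite mulrC -ler_pdivlMr //; exact: hN.
exists (C * ip h h + 1) => s sp; have h1 := hC h s hh sp.
move: h1; rewrite -[_ ^+ 2]real_normK ?num_real //; have := normr_ge0 (kappa h s).
move: (`|_|) (C * _) => x y; nra.
Qed.

Lemma kappa_supp h s : 0 <= s <= pi -> (forall t, 0 <= t <= s -> h t = 0) -> kappa h s = 0.
Proof.
move=> sp h0; rewrite /kappa /wip (@I_ext _ _ _ _ (fun=> 0)); first by rewrite I_cst // mul0r.
move=> t /andP[t0 tp]; have [ts|st] := leP t s; first by rewrite h0 ?mulr0 // t0.
by rewrite (kernel_supp al0 A0 sp st tp) mulr0 mul0r.
Qed.

Lemma ip_sup_bound f u B : L2p f -> L2p u -> 0 <= B -> (forall s, 0 <= s <= pi -> u s ^+ 2 <= B) ->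
  ip f u ^+ 2 <= ip f f * ((1 + al ^+ 2) * pi * B).
Proof.
move=> hf hu B0 hB; apply: le_trans (ip_CS a al0 hf hu) _; rewrite ler_wpM2l ?ip_ge0 //.
have := @ip_sup R a al al0 u (Num.sqrt B) hu; rewrite sqr_sqrtr //; apply => s sp.
by rewrite -sqrtr_sqr ler_wsqrtr ?hB.
Qed.

Notation cf f i := (ip f (fun s => phi s (lam0 i) - phi0 a al s (lam0 i))).

(** Expanding [h] in the unperturbed system replaces an interchange of integrals: the numbers
    [cf f i] are the coefficients of the transpose of [kappa] applied to [f]. *)
Lemma kappa_dual f h : L2p f -> L2p h ->
  (fun N => \sum_(0 <= i < N) cf f i * ip h (ef0 i) / alpha0 i) @ \oo --> ip f (kappa h).
Proof.
move=> hf hh; have [C C0 hC] := kappa_sqr.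
apply: sqr_cvg => e e0.
pose D := ip f f * ((1 + al ^+ 2) * pi * C) + 1.
have D0 : 0 < D.
  by rewrite ltr_pwDr // mulr_ge0 ?ip_ge0 // mulr_ge0 ?(ltW C0) // mulr_ge0 // addr_ge0 ?sqr_ge0.
have [N hN] := complete al0 z2 ps lam0_ge0 lam0S eigP0 hh (divr_gt0 e0 D0).
exists N => n /hN; set hn := fsum _ _ _ _ _ => hr.
have f2 : L2p hn by exact (fsum_L2 lam0 ps (coef a al (phi0 a al) lam0 h) 0 n).
have -> : \sum_(0 <= i < n) cf f i * ip h (ef0 i) / alpha0 i = ip f (kappa hn).
  have dL i : L2p (fun s => phi s (lam0 i) - phi0 a al s (lam0 i)).
    by apply: L2B; [exact: (phi_L2 hphi)|exact: (phi_L2 ps)].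
  rewrite ipC (@ip_ext _ a al _ _ (fun s => \sum_(0 <= i < n) coef a al (phi0 a al) lam0 h i * (phi s (lam0 i) - phi0 a al s (lam0 i))) f); last 2 first.
  - by move=> s sp; rewrite kappa_fsum.
  - by [].
  rewrite ip_suml //; last by move=> i; exact: L2Z.
  by apply: eq_bigr => i _; rewrite ipZl // ipC /coef; ring.
rewrite -sqrrN opprB -ipBr //; try exact/BM_L2/kappa_BM.
set r := ip _ _ in hr.
have r0 : 0 <= r by exact: ip_ge0.
have h3 := @ip_sup_bound f (fun s => kappa h s - kappa hn s) (C * r) hf
  (L2B (BM_L2 (kappa_BM hh)) (BM_L2 (kappa_BM f2))) (mulr_ge0 (ltW C0) r0).
apply: le_trans (h3 _) _.
  by move=> s sp; rewrite -kappaB //; apply: hC => //; exact: L2B.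
rewrite [_ * _ * (C * r)]mulrA mulrA; apply: (@le_trans _ _ (D * r)).
  by rewrite ler_wpM2r // /D lerDl.
by rewrite mulrC -ler_pdivlMr.
Qed.

End Kappa.

(** * Convergence of F0 *)

Section SeriesF0.
Context {R : realType}.
Variables (a al : R).
Hypotheses (al0 : 0 < al) (a0 : 0 < a) (api : a < pi).
Notation I := (@lintegral_ab R).
Notation mu := (@lebesgue_measure R).
Notation mp := (mu_plus a al).
Notation mm := (mu_minus a al).
Variables (lam lam0 b b' : nat -> R) (C d : R).
Hypotheses (d0 : 0 < d) (C0 : 0 < C) (lam0_ge0 : forall n, 0 <= lam0 n).
Hypothesis gap : forall m n, (m <= n)%N -> d * (n - m)%:R <= lam0 n - lam0 m.
Hypothesis hl : forall n, `|lam n - lam0 n| <= C / n.+1%:R.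
Hypothesis hb : forall n, `|b n - b' n| <= C / n.+1%:R.
Hypothesis hB : forall n, `|b n| <= C.
Let pi0 : 0 <= pi :> R := pi_ge0 R.
(** Large enough for all arguments [y + mu] and [y - mu] with both numbers bounded by [muB]. *)
Let Z : R := 2 * muB a al.
Notation ds := (dsum lam lam0 b b').
Notation dl := (dlim lam lam0 b b').

Let muB0 : 0 < muB a al.
Proof. by rewrite /muB addr_gt0 // mulr_gt0 ?pi_gt0 // addr_gt0. Qed.
Let Z0 : 0 < Z. Proof. by rewrite mulr_gt0. Qed.
Let ZZ : - Z <= Z. Proof. by rewrite ge0_cp // ltW. Qed.

Lemma dsum_aff_BM u v k e m n : u <= v -> BM u v (fun t => ds m n (k * t + e)).
Proof.
move=> uv; apply: BM_sum => i; rewrite /dterm; apply: BMB.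
  apply: BM_ext (BMZ (b i) (@BM_cos_aff _ u v (lam i * k) (lam i * e))) => z _.
  by rewrite mulrDr mulrA mulrC.
apply: BM_ext (BMZ (b' i) (@BM_cos_aff _ u v (lam0 i * k) (lam0 i * e))) => z _.
by rewrite mulrDr mulrA mulrC.
Qed.

Definition dnorm m n := I (- Z) Z (fun z => ds m n z ^+ 2).

Lemma dnorm_bound : exists2 K, 0 < K & forall N n, (0 < N)%N -> dnorm N n <= K / N%:R.
Proof.
have [K K0 hK] := dsum_L2_bound Z0 d0 C0 lam0_ge0 gap hl hb hB.
exists (2 * K) => [|N n N0]; first by rewrite mulr_gt0.
rewrite /dnorm (dsum_sym _ _ _ _ Z0) -[leRHS]mulrA ler_wpM2l //; apply: le_trans (hK N n) _.
by rewrite ler_wpM2l ?(ltW K0) // tail_inv_sqr.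
Qed.

Lemma I_sub_le (u v u' v' : R) f : u <= u' -> u' <= v' -> v' <= v -> L1 u v f ->
  (forall x, u <= x <= v -> 0 <= f x) -> I u' v' f <= I u v f.
Proof.
move=> uu uv vv hf f0; rewrite (I_split uu (le_trans uv vv) hf).
apply: (@le_trans _ _ (I u' v f)).
  apply: I_mono => //; first exact: L1_sub hf.
  by move=> x /andP[h1 h2]; apply: f0; rewrite (le_trans uu).
by rewrite lerDr; apply: I_ge0 => x /andP[h1 h2]; apply: f0; rewrite h1 (le_trans h2) // (le_trans uv).
Qed.

(** The partial sums are even, which reduces a negative slope to a positive one. *)
Lemma shift_bound u v k e m n : u <= v -> k != 0 -> (forall t, u <= t <= v -> `|k * t + e| <= Z) ->
  I u v (fun t => ds m n (k * t + e) ^+ 2) <= `|k|^-1 * dnorm m n.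
Proof.
wlog k0 : k e / 0 < k.
  move=> H uv k0 h; have [kp|kn|k00] := ltgtP 0 k; [exact: H| |by rewrite -k00 eqxx in k0].
  have := H (- k) (- e); rewrite oppr_gt0 oppr_eq0 normrN => /(_ kn uv k0) H'.
  rewrite (@I_ext _ _ _ _ (fun t => ds m n (- k * t + - e) ^+ 2)); last first.
    by move=> t _; rewrite mulNr -opprD dsum_even.
  by apply: H' => t /h; rewrite mulNr -opprD normrN.
move=> uv _ h; have kuv : k * u + e <= k * v + e by rewrite lerD2r ler_pM2l.
have LZ : L1 (- Z) Z (fun z => ds m n z ^+ 2) by exact/BM_L1/BMX/dsum_BM.
have hu : `|k * u + e| <= Z by apply: h; rewrite lexx.
have hv : `|k * v + e| <= Z by apply: h; rewrite lexx andbT.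
move: hu hv; rewrite !ler_norml => /andP[u1 u2] /andP[v1 v2].
have Lk := L1_sub u1 v2 LZ.
have [_ e1] := I_affine k0 Lk.
rewrite (gtr0_norm k0) -(ler_pM2l k0) -e1 mulrA mulfV ?gt_eqF // mul1r.
by apply: I_sub_le => // x _; exact: sqr_ge0.
Qed.

Lemma dsum_cvg_aff k e : k != 0 -> {ae mu, forall t, `|k * t + e| <= Z -> (fun N => ds 0 N (k * t + e)) @ \oo --> dl (k * t + e)}.
Proof.
move=> k0; have := ae_affine e k0 (dsum_cvg Z0 d0 C0 lam0_ge0 gap hl hb hB).
by apply: ae_mp => t h; rewrite ler_norml; exact: h.
Qed.

Section PiecewiseAffine.
Variables (g : R -> R) (k1 e1 k2 e2 : R).
Hypotheses (g1 : forall t, t <= a -> g t = k1 * t + e1) (g2 : forall t, a <= t -> g t = k2 * t + e2).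
Hypotheses (nk1 : `|k1| = 1) (nk2 : `|k2| = al) (gZ : forall t, 0 <= t <= pi -> `|g t| <= Z).

Let k10 : k1 != 0. Proof. by rewrite -normr_gt0 nk1. Qed.
Let k20 : k2 != 0. Proof. by rewrite -normr_gt0 nk2. Qed.

Lemma piecewise_L2 m n : L2 0 pi (fun t => ds m n (g t)).
Proof.
apply: (L2_glue (ltW a0) (ltW api) (BM_L2 (dsum_aff_BM k1 e1 m n (ltW a0))) (BM_L2 (dsum_aff_BM k2 e2 m n (ltW api)))) => t.
  by move=> /andP[_ /ltW/g1 ->].
by move=> /andP[/ltW/g2 -> _].
Qed.

(** The slopes have modulus 1 before [a] and [al] after it; the inverse Jacobians add up to
    [srhoB]. *)
Lemma piecewise_bound m n : I 0 pi (fun t => ds m n (g t) ^+ 2) <= srhoB al * dnorm m n.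
Proof.
rewrite (I_split (ltW a0) (ltW api) (piecewise_L2 m n).2) /srhoB mulrDl; apply: lerD.
  rewrite (@I_ext _ _ _ _ (fun t => ds m n (k1 * t + e1) ^+ 2)) => [|t /andP[_ /g1 ->] //].
  rewrite -[1]invr1 -nk1; apply: shift_bound => // [|t /andP[t0 ta]]; first exact: ltW.
  by rewrite -g1 // gZ // t0 (le_trans ta) // ltW.
rewrite (@I_ext _ _ _ _ (fun t => ds m n (k2 * t + e2) ^+ 2)) => [|t /andP[/g2 -> _] //].
rewrite -nk2; apply: shift_bound => // [|t /andP[ta tp]]; first exact: ltW.
by rewrite -g2 // gZ // tp (le_trans _ ta) // ltW.
Qed.

Lemma piecewise_cvg : {ae mu, forall t, 0 <= t <= pi -> (fun N => ds 0 N (g t)) @ \oo --> dl (g t)}.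
Proof.
have := ae_and (dsum_cvg_aff e1 k10) (dsum_cvg_aff e2 k20); apply: ae_mp => t [h1 h2] tp.
have := gZ tp; have [/g1 ->|/ltW/g2 ->] := leP t a; [exact: h1|exact: h2].
Qed.

End PiecewiseAffine.

Definition F0_sum m n xi t := \sum_(m <= i < n)
  (phi0 a al t (lam i) * cos (lam i * xi) * b i - phi0 a al t (lam0 i) * cos (lam0 i * xi) * b' i).

Let P t := 2^-1 * (1 + (srho a al t)^-1).
Let Q t := 2^-1 * (1 - (srho a al t)^-1).

(** Product-to-sum formulas reduce the series in two variables to the one-variable series at four
    arguments. *)
Lemma F0_sum_dsum m n xi t : F0_sum m n xi t =
  P t / 2 * (ds m n (xi + mp t) + ds m n (xi - mp t)) + Q t / 2 * (ds m n (xi + mm t) + ds m n (xi - mm t)).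
Proof.
rewrite /F0_sum /dsum -!big_split /= !mulr_sumr -big_split /=; apply: eq_bigr => i _.
have cD l u v : cos (l * (u + v)) = cos (l * u) * cos (l * v) - sin (l * u) * sin (l * v) :> R.
  by rewrite mulrDr cosD.
rewrite /phi0 /dterm -/(P t) -/(Q t); move: (mp t) (mm t) (P t) (Q t) => u v p r.
by rewrite !cD !mulrN !cosN !sinN; field.
Qed.

Let S := 1 + srhoB al.

Lemma F0_sum_sqr m n xi t : F0_sum m n xi t ^+ 2 <= S ^+ 2 * (ds m n (xi + mp t) ^+ 2 + ds m n (xi - mp t) ^+ 2
  + ds m n (xi + mm t) ^+ 2 + ds m n (xi - mm t) ^+ 2).
Proof.
rewrite F0_sum_dsum; have [] := phi0_coef_bound a al0 t; rewrite -/(P t) -/(Q t) -/S.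
move: (P t) (Q t) (ds _ _ _) (ds _ _ (xi - mp t)) (ds _ _ (xi + mm t)) (ds _ _ (xi - mm t)) => p r x1 x2 x3 x4 hp hr.
have S0 : 0 <= S by apply: le_trans hp.
have p2 : p ^+ 2 <= S ^+ 2 by rewrite -[leLHS]real_normK ?num_real // ler_pXn2r ?nnegrE.
have r2 : r ^+ 2 <= S ^+ 2 by rewrite -[leLHS]real_normK ?num_real // ler_pXn2r ?nnegrE.
have h1 : (p / 2 * (x1 + x2) + r / 2 * (x3 + x4)) ^+ 2 <= p ^+ 2 * (x1 ^+ 2 + x2 ^+ 2) + r ^+ 2 * (x3 ^+ 2 + x4 ^+ 2).
  have := sqr_ge0 (p * (x1 - x2)); have := sqr_ge0 (r * (x3 - x4)).
  have := sqr_ge0 (p * (x1 + x2) - r * (x3 + x4)); rewrite -subr_ge0 => k1 k2 k3.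
  rewrite -subr_ge0 (_ : _ - _ = 2^-1 * ((p * (x1 - x2)) ^+ 2 + (r * (x3 - x4)) ^+ 2) +
    4^-1 * (p * (x1 + x2) - r * (x3 + x4)) ^+ 2); last by field.
  by move: k1; rewrite subr_ge0 => k1; rewrite addr_ge0 // mulr_ge0 // ?addr_ge0 ?sqr_ge0.
apply: le_trans h1 _; rewrite -[x1 ^+ 2 + _ + _ + _]addrA [leRHS]mulrDr.
by rewrite lerD // ler_wpM2r // addr_ge0 // sqr_ge0.
Qed.

Lemma phi0_BM u l : 0 <= u -> u <= pi -> BM 0 u (fun t => phi0 a al t l).
Proof. by move=> u0 up; have [h _] := phi0_AC al0 a0 api l; apply: BM_sub (AC_BM pi0 h). Qed.

Lemma F0_sum_BM_xi m n t u v : u <= v -> BM u v (fun xi => F0_sum m n xi t).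
Proof.
move=> uv; apply: BM_sum => i; apply: BMB.
  by apply: BM_ext (BMZ (phi0 a al t (lam i) * b i) (@BM_cos _ u v (lam i))) => z _; rewrite mulrAC.
by apply: BM_ext (BMZ (phi0 a al t (lam0 i) * b' i) (@BM_cos _ u v (lam0 i))) => z _; rewrite mulrAC.
Qed.

Lemma F0_sum_BM_t m n y : BM 0 pi (fun t => F0_sum m n y t).
Proof.
apply: BM_sum => i; apply: BMB.
  by apply: BM_ext (BMZ (cos (lam i * y) * b i) (phi0_BM (lam i) pi0 (lexx _))) => z _; ring.
by apply: BM_ext (BMZ (cos (lam0 i * y) * b' i) (phi0_BM (lam0 i) pi0 (lexx _))) => z _; ring.
Qed.

Lemma F0_sum_bound_xi m n t u : 0 <= t <= pi -> 0 <= u -> u <= muB a al ->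
  I 0 u (fun xi => F0_sum m n xi t ^+ 2) <= 4 * S ^+ 2 * dnorm m n.
Proof.
move=> tp u0 uB; have [mp1 mm1] := mu_bound al0 a0 tp.
have sh e : `|e| <= muB a al -> I 0 u (fun xi => ds m n (1 * xi + e) ^+ 2) <= dnorm m n.
  move=> he; rewrite -[leRHS]mul1r -[X in X * _]invr1 -{2}[1]normr1; apply: shift_bound => // xi /andP[x0 xu].
  by rewrite mul1r (le_trans (ler_normD _ _)) // /Z mulrDl mul1r lerD // ger0_norm // (le_trans xu).
have L e : L1 0 u (fun xi => ds m n (1 * xi + e) ^+ 2) by apply/BM_L1/BMX; exact: dsum_aff_BM.
have e1 := sh (mp t) mp1; have e2 := sh (- mp t); rewrite normrN in e2; have {}e2 := e2 mp1.
have e3 := sh (mm t) mm1; have e4 := sh (- mm t); rewrite normrN in e4; have {}e4 := e4 mm1.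
apply: (@le_trans _ _ (I 0 u (fun xi => S ^+ 2 * (ds m n (1 * xi + mp t) ^+ 2 + ds m n (1 * xi + - mp t) ^+ 2
  + ds m n (1 * xi + mm t) ^+ 2 + ds m n (1 * xi + - mm t) ^+ 2)))).
  apply: I_le => [||xi _]; first by apply/BM_L1/BMX/F0_sum_BM_xi.
    by apply: L1Z; apply: L1D => //; apply: L1D => //; exact: L1D.
  by rewrite mul1r; exact: F0_sum_sqr.
rewrite IZ; last by apply: L1D => //; apply: L1D => //; exact: L1D.
rewrite !ID //; try by [apply: L1D => //; exact: L1D|exact: L1D].
rewrite (_ : 4 * S ^+ 2 * dnorm m n = S ^+ 2 * (4 * dnorm m n)); last by ring.
rewrite ler_wpM2l ?sqr_ge0 //; move: e1 e2 e3 e4; lra.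
Qed.

(** The four arguments as functions of [t]. Each is affine on both sides of [a], so null sets and
    integrals can be pulled back. *)
Let affs (y : R) (g : R -> R) := `|y| <= muB a al /\
  ((g = fun t => y + mp t) \/ (g = fun t => y - mp t) \/ (g = fun t => y + mm t) \/ (g = fun t => y - mm t)).

Let affs_spec y g : affs y g -> exists k1 e1 k2 e2, [/\ forall t, t <= a -> g t = k1 * t + e1,
  forall t, a <= t -> g t = k2 * t + e2, `|k1| = 1, `|k2| = al & forall t, 0 <= t <= pi -> `|g t| <= Z].
Proof.
move=> [hy h]; have nal := gtr0_norm al0.
have gZ t : 0 <= t <= pi -> `|g t| <= Z.
  move=> tp; have [mp1 mm1] := mu_bound al0 a0 tp; rewrite /Z mulrDl mul1r.
  case: h => [->|[->|[->|->]]]; (apply: le_trans (ler_normD _ _) _; rewrite ?normrN; exact: lerD).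
case: h => [e|[e|[e|e]]]; rewrite e in gZ *.
- exists 1, y, al, (y + a * (1 - al)); split => // [t ta|t ta|]; rewrite ?normr1 //.
    by rewrite mp_left //; ring.
  by rewrite mp_right //; ring.
- exists (-1), y, (- al), (y - a * (1 - al)); split => // [t ta|t ta||]; rewrite ?normrN ?normr1 //.
    by rewrite mp_left //; ring.
  by rewrite mp_right //; ring.
- exists (-1), (y + 2 * a), (- al), (y + 2 * a - a * (1 - al)); split => // [t ta|t ta||]; rewrite ?normrN ?normr1 //.
    by rewrite mmE mp_left //; ring.
  by rewrite mmE mp_right //; ring.
- exists 1, (y - 2 * a), al, (y - 2 * a + a * (1 - al)); split => // [t ta|t ta|]; rewrite ?normr1 //.
    by rewrite mmE mp_left //; ring.
  by rewrite mmE mp_right //; ring.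
Qed.

Let affs_L1 y g m n : affs y g -> L1 0 pi (fun t => ds m n (g t) ^+ 2).
Proof. by move=> /affs_spec[k1 [e1 [k2 [e2 [h1 h2 h3 h4 h5]]]]]; exact: (piecewise_L2 h1 h2 m n).2. Qed.

Let affs_bound y g m n : affs y g -> I 0 pi (fun t => ds m n (g t) ^+ 2) <= srhoB al * dnorm m n.
Proof. by move=> /affs_spec[k1 [e1 [k2 [e2 [h1 h2 h3 h4 h5]]]]]; exact: (piecewise_bound h1 h2 h3 h4 h5). Qed.

Let affs_cvg y g : affs y g -> {ae mu, forall t, 0 <= t <= pi -> (fun N => ds 0 N (g t)) @ \oo --> dl (g t)}.
Proof. by move=> /affs_spec[k1 [e1 [k2 [e2 [h1 h2 h3 h4 h5]]]]]; exact: (piecewise_cvg h1 h2 h3 h4 h5). Qed.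

Lemma F0_sum_bound_t m n y : `|y| <= muB a al ->
  I 0 pi (fun t => F0_sum m n y t ^+ 2) <= 4 * S ^+ 2 * (srhoB al * dnorm m n).
Proof.
move=> hy.
have a1 : affs y (fun t => y + mp t) by split => //; left.
have a2 : affs y (fun t => y - mp t) by split => //; right; left.
have a3 : affs y (fun t => y + mm t) by split => //; right; right; left.
have a4 : affs y (fun t => y - mm t) by split => //; right; right; right.
have l1 := affs_L1 m n a1; have l2 := affs_L1 m n a2; have l3 := affs_L1 m n a3; have l4 := affs_L1 m n a4.
have e1 := affs_bound m n a1; have e2 := affs_bound m n a2.
have e3 := affs_bound m n a3; have e4 := affs_bound m n a4.
apply: (@le_trans _ _ (I 0 pi (fun t => S ^+ 2 * (ds m n (y + mp t) ^+ 2 + ds m n (y - mp t) ^+ 2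
  + ds m n (y + mm t) ^+ 2 + ds m n (y - mm t) ^+ 2)))).
  apply: I_le => [||t _]; first by apply/BM_L1/BMX/F0_sum_BM_t.
    by apply: L1Z; apply: L1D => //; apply: L1D => //; exact: L1D.
  exact: F0_sum_sqr.
rewrite IZ; last by apply: L1D => //; apply: L1D => //; exact: L1D.
rewrite !ID //; try by [apply: L1D => //; exact: L1D|exact: L1D].
rewrite (_ : 4 * S ^+ 2 * _ = S ^+ 2 * (4 * (srhoB al * dnorm m n))); last by ring.
rewrite ler_wpM2l ?sqr_ge0 //; move: e1 e2 e3 e4; lra.
Qed.

Definition F0 y t := limn (fun N => F0_sum 0 N y t).

Let F0_sum_cvg y t : (fun N => ds 0 N (y + mp t)) @ \oo --> dl (y + mp t) ->
  (fun N => ds 0 N (y - mp t)) @ \oo --> dl (y - mp t) ->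
  (fun N => ds 0 N (y + mm t)) @ \oo --> dl (y + mm t) ->
  (fun N => ds 0 N (y - mm t)) @ \oo --> dl (y - mm t) ->
  (fun N => F0_sum 0 N y t) @ \oo --> F0 y t.
Proof.
move=> h1 h2 h3 h4.
have h : (fun N => F0_sum 0 N y t) @ \oo --> P t / 2 * (dl (y + mp t) + dl (y - mp t)) + Q t / 2 * (dl (y + mm t) + dl (y - mm t)).
  rewrite (_ : (fun N => F0_sum 0 N y t) = fun N => P t / 2 * (ds 0 N (y + mp t) + ds 0 N (y - mp t))
    + Q t / 2 * (ds 0 N (y + mm t) + ds 0 N (y - mm t))); last by apply/funext => N; rewrite F0_sum_dsum.
  by apply: cvgD; apply: cvgM; try exact: cvg_cst; exact: cvgD.
by rewrite /F0 (cvg_lim (@Rhausdorff R) h).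
Qed.

Lemma F0_cvg_t y : `|y| <= muB a al -> {ae mu, forall t, 0 <= t <= pi -> (fun N => F0_sum 0 N y t) @ \oo --> F0 y t}.
Proof.
move=> hy.
have a1 : affs y (fun t => y + mp t) by split => //; left.
have a2 : affs y (fun t => y - mp t) by split => //; right; left.
have a3 : affs y (fun t => y + mm t) by split => //; right; right; left.
have a4 : affs y (fun t => y - mm t) by split => //; right; right; right.
have := ae_and (ae_and (affs_cvg a1) (affs_cvg a2)) (ae_and (affs_cvg a3) (affs_cvg a4)).
by apply: ae_mp => t [[h1 h2] [h3 h4]] tp; apply: F0_sum_cvg; [exact: h1|exact: h2|exact: h3|exact: h4].
Qed.

Lemma F0_cvg_xi t u : 0 <= t <= pi -> u <= muB a al ->
  {ae mu, forall xi, 0 <= xi <= u -> (fun N => F0_sum 0 N xi t) @ \oo --> F0 xi t}.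
Proof.
move=> tp uB; have [mp1 mm1] := mu_bound al0 a0 tp.
have n1 := oner_neq0 R.
have := ae_and (ae_and (dsum_cvg_aff (mp t) n1) (dsum_cvg_aff (- mp t) n1))
  (ae_and (dsum_cvg_aff (mm t) n1) (dsum_cvg_aff (- mm t) n1)).
apply: ae_mp => xi; rewrite !mul1r => -[[h1 h2] [h3 h4]] /andP[x0 xu].
have hz e : `|e| <= muB a al -> `|xi + e| <= Z.
  by move=> he; rewrite (le_trans (ler_normD _ _)) // /Z mulrDl mul1r lerD // ger0_norm // (le_trans xu).
by apply: F0_sum_cvg; [apply: h1|apply: h2|apply: h3|apply: h4]; apply: hz; rewrite ?normrN.
Qed.

Lemma F0_sum_cat m n k y t : (m <= n)%N -> (n <= k)%N -> F0_sum m k y t = F0_sum m n y t + F0_sum n k y t.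
Proof. by move=> mn nk; rewrite /F0_sum (@big_cat_nat _ _ _ n). Qed.

(** Fatou's lemma in the upper summation limit turns the bounds on blocks into a rate, uniform in
    [t]. *)
Lemma F0_L2 : exists2 K, 0 < K & forall t u N, 0 <= t <= pi -> 0 <= u -> u <= muB a al -> (0 < N)%N ->
  L2 0 u (fun xi => F0 xi t - F0_sum 0 N xi t) /\ I 0 u (fun xi => (F0 xi t - F0_sum 0 N xi t) ^+ 2) <= K / N%:R.
Proof.
have [K K0 hK] := dnorm_bound; exists (4 * S ^+ 2 * K + 1) => [|t u N tp u0 uB N0].
  by rewrite ltr_pwDr // mulr_ge0 ?(ltW K0) // mulr_ge0 // sqr_ge0.
apply: (@fatou_L2 _ _ _ (fun n xi => F0_sum 0 n xi t - F0_sum 0 N xi t) _ _ N) => [n|||n Nn].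
- by apply/BM_L2/BMB; exact: F0_sum_BM_xi.
- by apply: MfB; [apply: limn_Mf => n|]; exact: (F0_sum_BM_xi _ _ _ u0).1.
- by apply: ae_mp (F0_cvg_xi tp uB) => xi h xu; apply: cvgB; [exact: h|exact: cvg_cst].
rewrite (@I_ext _ _ _ _ (fun xi => F0_sum N n xi t ^+ 2)); last first.
  by move=> xi _; rewrite (F0_sum_cat _ _ (leq0n _) Nn) addrAC subrr add0r.
apply: le_trans (F0_sum_bound_xi N n tp u0 uB) _.
rewrite [leRHS]mulrDl; apply: (@le_trans _ _ (4 * S ^+ 2 * (K / N%:R))).
  by rewrite ler_wpM2l ?hK // mulr_ge0 // sqr_ge0.
by rewrite mulrA lerDl mul1r invr_ge0.
Qed.

Section KernelIntegral.
Variables (f : R -> R) (u : R).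
Hypotheses (u0 : 0 <= u) (uB : u <= muB a al) (f2 : L2 0 u f).

(** Pointwise convergence would not suffice under the integral; the L2 rate in [xi] and the
    Cauchy-Schwarz inequality do. *)
Lemma I_F0_cvg t : 0 <= t <= pi ->
  (fun N => I 0 u (fun xi => f xi * F0_sum 0 N xi t)) @ \oo --> I 0 u (fun xi => f xi * F0 xi t).
Proof.
move=> tp; have [K K0 hK] := F0_L2.
apply: (@sqr_cvg_inv _ _ _ (I 0 u (fun xi => f xi ^+ 2) * K)) => N N0.
have [g2 gK] := hK t u N tp u0 uB N0.
have T2 : L2 0 u (fun xi => F0_sum 0 N xi t) by exact/BM_L2/F0_sum_BM_xi.
have F2 : L2 0 u (fun xi => F0 xi t).
  by apply: L2_ext (L2D g2 T2) => xi _; rewrite subrK.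
rewrite -sqrrN opprB -IB; [|exact: L2M|exact: L2M].
rewrite (@I_ext _ _ _ _ (fun xi => f xi * (F0 xi t - F0_sum 0 N xi t))); last by move=> xi _; rewrite mulrBr.
apply: le_trans (CauchySchwarz1 f2 g2) _; rewrite -mulrA ler_wpM2l //.
by apply: I_ge0 => xi _; exact: sqr_ge0.
Qed.

Lemma I_F0_sum_bound t m n : 0 <= t <= pi ->
  I 0 u (fun xi => f xi * F0_sum m n xi t) ^+ 2 <= I 0 u (fun xi => f xi ^+ 2) * (4 * S ^+ 2 * dnorm m n).
Proof.
move=> tp; have T2 : L2 0 u (fun xi => F0_sum m n xi t) by exact/BM_L2/F0_sum_BM_xi.
apply: le_trans (CauchySchwarz1 f2 T2) _; rewrite ler_wpM2l ?F0_sum_bound_xi //.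
by apply: I_ge0 => xi _; exact: sqr_ge0.
Qed.

Lemma I_F0_sumE t m n : I 0 u (fun xi => f xi * F0_sum m n xi t) = \sum_(m <= i < n)
  (phi0 a al t (lam i) * I 0 u (fun xi => f xi * cos (lam i * xi)) * b i
   - phi0 a al t (lam0 i) * I 0 u (fun xi => f xi * cos (lam0 i * xi)) * b' i).
Proof.
have Lc l : L1 0 u (fun xi => f xi * cos (l * xi)).
  by apply: L1_BM; [exact: L2_L1|exact: BM_cos].
pose F i xi := phi0 a al t (lam i) * b i * (f xi * cos (lam i * xi)) - phi0 a al t (lam0 i) * b' i * (f xi * cos (lam0 i * xi)).
have hF i : L1 0 u (F i) by apply: L1B; exact: L1Z.
rewrite (@I_ext _ _ _ _ (fun xi => \sum_(m <= i < n) F i xi)); last first.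
  by move=> xi _; rewrite /F0_sum mulr_sumr; apply: eq_bigr => i _; rewrite /F; ring.
rewrite (I_sum m n hF).2; apply: eq_bigr => i _; rewrite /F IB; [|exact: L1Z|exact: L1Z].
by rewrite !IZ //; ring.
Qed.

End KernelIntegral.

End SeriesF0.

(** * The main equation *)

Section DualSeries.
Context {R : realType}.
Variables (q : R -> R) (a al : R).
Hypotheses (al0 : 0 < al) (a0 : 0 < a) (api : a < pi) (pial : pi * al < a * (1 + al)) (hq : L2 0 pi q).
Variables (phi phi1 A : R -> R -> R) (lam0 : nat -> R).
Hypothesis hphi : forall l, is_sol q a al (l ^+ 2) (fun x => phi x l) (fun x => phi1 x l) /\
  phi 0 l = 1 /\ phi1 0 l = 0.
Notation I := (@lintegral_ab R).
Notation mu := (@lebesgue_measure R).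
Notation w := (rho a al).
Notation ip := (wip a al).
Notation L2p := (@L2 R 0 pi).
Notation mp := (mu_plus a al).
Hypothesis hA : forall x, 0 <= x <= pi -> measurable_fun `[0, mp x] (A x) /\
  mu.-integrable `[0, mp x] (fun t => (w t * A x t ^+ 2)%:E).
Hypothesis phiA : forall x l, 0 <= x <= pi ->
  phi x l = phi0 a al x l + I 0 (mp x) (fun t => A x t * cos (l * t)).
Hypothesis A0 : forall x t, 0 <= x <= pi -> mp x < t -> A x t = 0.
Hypothesis lam0_ge0 : forall n, 0 <= lam0 n.
Hypothesis lam0S : forall n, lam0 n < lam0 n.+1.
Hypothesis eigP0 : forall nu, is_eigenvalue (fun _ => 0) a al nu <-> exists n, nu = lam0 n ^+ 2.
Notation ef0 := (eigenfun (phi0 a al) lam0).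
Notation alpha0 := (norming a al (phi0 a al) lam0).
Notation ka := (kappa a al A).
Notation ps := (phi0_spec al0 a0 api).
Notation z2 := (@L2_zero R).
Notation cf f i := (ip f (fun s => phi s (lam0 i) - phi0 a al s (lam0 i))).
Let pi0 : 0 <= pi :> R := pi_ge0 R.

Let ap0 n : 0 < alpha0 n.
Proof. exact (alpha_gt0 al0 z2 ps eigP0 n). Qed.
Let e20 n : L2p (ef0 n).
Proof. exact (ef_L2 lam0 ps n). Qed.

Lemma cvg_le_tail (u : nat -> R) (L B : R) N : u @ \oo --> L ->
  (forall n, (N <= n)%N -> u n <= B) -> L <= B.
Proof.
move=> cu hu; rewrite -(cvg_lim (@Rhausdorff R) cu); apply: limr_le; first by apply/cvg_ex; exists L.
by exists N.
Qed.

Lemma AC_Lipschitz b c (f f' : R -> R) : AC b c f f' -> BM b c f' ->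
  exists2 L, 0 < L & forall x y, b <= y -> y <= x -> x <= c -> `|f x - f y| <= L * (x - y).
Proof.
move=> h [mf [M hM]]; exists (`|M| + 1) => [|x y by_ yx xc]; first by rewrite ltr_pwDr.
have hs := AC_sub by_ xc h; rewrite (hs.2 x) ?yx ?lexx // addrAC subrr add0r.
apply: I_absM => //; first exact: hs.1.
move=> z /andP[yz zx]; apply: (@le_trans _ _ M); first by apply: hM; rewrite (le_trans by_ yz) (le_trans zx xc).
by rewrite (le_trans (ler_norm _)) // lerDl.
Qed.

(** Here [psi(., l)] need not be an eigenfunction: the boundary terms at [pi] vanish because [f] and
    its derivative do. *)
Lemma Dom_solution_coef (q' : R -> R) (psi psi1 : R -> R -> R) f f1 g l :
  (forall l, is_sol q' a al (l ^+ 2) (fun x => psi x l) (fun x => psi1 x l) /\ psi 0 l = 1 /\ psi1 0 l = 0) ->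
  L2p q' -> Dom q' a al f f1 g -> f1 pi = 0 ->
  l ^+ 2 * ip f (fun s => psi s l) = ip g (fun s => psi s l).
Proof.
move=> hpsi hq' [hE f10 fpi g2] f1pi; have hEl := phi_Equation hpsi l.
have p2 : L2p (fun s => psi s l) by exact (phi_L2 hpsi l).
have [f2 _] := Equation_L2 hE.
have := Lagrange al0 hE hEl g2 (L2Z (l ^+ 2) p2).
have [_ [_ ->]] := hpsi l; rewrite f10 fpi f1pi !mul0r mulr0 !subr0 => /eqP; rewrite subr_eq0 => /eqP ->.
by rewrite ipZr.
Qed.

(** Applying each operator once to [f] gains a factor [l ^ -2] in both inner products, and [lam0 n]
    grows linearly. *)
Lemma cf_decay f f1 fd x : x <= pi -> 0 < x -> test_fun 0 x f f1 fd ->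
  exists2 C, 0 < C & forall n, `|cf f n| <= C / n.+1%:R ^+ 2.
Proof.
move=> xp x0 hf.
have D1 := test_Dom a al0 hq (lexx 0) xp (ltW x0) hf.
have D2 := test_Dom a al0 z2 (lexx 0) xp (ltW x0) hf.
have f1pi : f1 pi = 0 by case: hf => e' e'0 [_ _ h3]; have [] := h3 pi; first by lra.
have f2 := Dom_L2 D1.
set g := (fun y => _) in D1; pose g0 y := (0 * f y - fd y) / w y.
have g2 : L2p g by case: D1. have g02 : L2p g0 by case: D2.
have [C1 [l0 [C10 l01 hC]]] := phi_asymptotics al0 a0 api hq hphi.
have [d d0 hd] := lam0_growth al0 a0 api lam0_ge0 lam0S eigP0.
have [N hN] := lam_infty al0 z2 ps lam0_ge0 lam0S eigP0 l0.
pose B1 := ip g g * ((1 + al ^+ 2) * pi * C1 ^+ 2).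
pose B2 := ip g0 g0 * ((1 + al ^+ 2) * pi * (2 * (1 + srhoB al)) ^+ 2).
pose B := B1 + B2 + 1.
have al1 : 0 <= 1 + al ^+ 2 by rewrite addr_ge0 ?sqr_ge0.
have B10 : 0 <= B1 by apply: mulr_ge0; [exact: ip_ge0|apply: mulr_ge0; [exact: mulr_ge0|exact: sqr_ge0]].
have B20 : 0 <= B2 by apply: mulr_ge0; [exact: ip_ge0|apply: mulr_ge0; [exact: mulr_ge0|exact: sqr_ge0]].
have sq_le y b : 0 <= b -> y ^+ 2 <= b -> `|y| <= b + 1 :> R.
  move=> b0 h; rewrite -[y ^+ 2]real_normK ?num_real // in h; have := normr_ge0 y; nra.
have bphi l : l0 <= l -> `|l ^+ 2 * ip f (fun s => phi s l)| <= B1 + 1.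
  move=> ll; rewrite (Dom_solution_coef l hphi hq D1 f1pi); apply: sq_le => //.
  apply: ip_sup_bound => //; [exact (phi_L2 hphi l)|exact: sqr_ge0|].
  move=> s sp; have [h _] := hC l s ll sp; rewrite -[leLHS]real_normK ?num_real //.
  by rewrite ler_pXn2r ?nnegrE // ltW.
have bphi0 l : `|l ^+ 2 * ip f (fun s => phi0 a al s l)| <= B2 + 1.
  rewrite (Dom_solution_coef l ps z2 D2 f1pi); apply: sq_le => //.
  apply: ip_sup_bound => //; [exact (phi_L2 ps l)|exact: sqr_ge0|].
  move=> s sp; have h := phi0_bound a al0 s l; rewrite -[leLHS]real_normK ?num_real //.
  by rewrite ler_pXn2r ?nnegrE // (le_trans _ h).
apply: tail_bound => [n C C' CC h|n|].
- by apply: le_trans h _; rewrite ler_wpM2r // invr_ge0 sqr_ge0.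
- by exists (`|cf f n| * n.+1%:R ^+ 2); rewrite mulfK // expf_eq0 /= pnatr_eq0.
exists (maxn N 1), ((B1 + 1 + (B2 + 1)) * 4 / d ^+ 2) => n; rewrite geq_max => /andP[/hN ln n1].
have h1 := bphi _ ln; have h2 := bphi0 (lam0 n).
have lp : 0 < lam0 n by apply: lt_le_trans ln; apply: lt_le_trans l01.
have l2 : 0 < lam0 n ^+ 2 by rewrite exprn_gt0.
have h3 : lam0 n ^+ 2 * `|cf f n| <= B1 + 1 + (B2 + 1).
  rewrite -[lam0 n ^+ 2]gtr0_norm // -normrM ipBr //; try by [exact (phi_L2 hphi _)|exact (phi_L2 ps _)].
  by rewrite mulrBr; apply: le_trans (ler_normB _ _) _; exact: lerD.
have nn : (0 : R) < n.+1%:R by rewrite ltr0n.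
have h4 : d ^+ 2 * n.+1%:R ^+ 2 <= 4 * lam0 n ^+ 2.
  have h5 : d * n.+1%:R <= 2 * lam0 n.
    have := hd n; rewrite -[n.+1%:R]natr1 mulrDr mulr1; have : d <= d * n%:R by rewrite ler_peMr ?(ltW d0) // ler1n.
    lra.
  rewrite -exprMn (_ : 4 = 2 ^+ 2 :> R) -?exprMn; last by rewrite -natrX.
  by rewrite ler_pXn2r ?nnegrE ?mulr_ge0 ?(ltW d0) ?(ltW lp).
rewrite ler_pdivlMr ?exprn_gt0 // ler_pdivlMr ?exprn_gt0 //.
have h5 := ler_wpM2l (normr_ge0 (cf f n)) h4.
rewrite -mulrA [_ * d ^+ 2]mulrC; apply: le_trans h5 _.
by rewrite mulrCA mulrC ler_pM2r // mulrC.
Qed.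

(* The functional [f -> sum_n cf f n / alpha0 n * phi0 x (lam0 n)] is the value at [x] of the
   transpose of the Volterra operator [kappa] applied to [f]; it vanishes beyond the support of [f]. *)
Lemma dual_series_cvg0 f f1 fd x : 0 < x -> x <= pi -> test_fun 0 x f f1 fd ->
  (fun N => \sum_(0 <= i < N) cf f i / alpha0 i * phi0 a al x (lam0 i)) @ \oo --> (0 : R).
Proof.
move=> x0 xp hf; have [C C0 hC] := cf_decay xp x0 hf.
have D1 := test_Dom a al0 hq (lexx 0) xp (ltW x0) hf; have f2 := Dom_L2 D1.
have [c c0 hc] := alpha0_ge al0 a0 api lam0_ge0 lam0S eigP0.
pose S := 2 * (1 + srhoB al).
have S0 : 0 < S by rewrite /S /srhoB mulr_gt0 // !addr_gt0 // invr_gt0.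
pose D := C / c * S; have D0 : 0 < D by rewrite /D mulr_gt0 // divr_gt0.
pose u i y := cf f i / alpha0 i * phi0 a al y (lam0 i).
have hu i y : `|u i y| <= D * (i.+1%:R ^+ 2)^-1.
  rewrite /u normrM normrM [`|_^-1|]gtr0_norm ?invr_gt0 //.
  have -> : D * (i.+1%:R ^+ 2)^-1 = C / i.+1%:R ^+ 2 * c^-1 * S by rewrite /D; ring.
  rewrite ler_pM //; [by rewrite mulr_ge0 // invr_ge0 ltW| |exact: phi0_bound].
  by rewrite ler_pM // ?invr_ge0 ?(ltW (ap0 i)) // lef_pV2 ?posrE.
clearbody D; pose G N y := \sum_(0 <= i < N) u i y.
have GD M N y : (N <= M)%N -> `|G M y - G N y| <= D * \sum_(N <= i < M) (i.+1%:R ^+ 2)^-1.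
  move=> NM; rewrite /G (@big_cat_nat _ _ _ N) //= addrAC subrr add0r mulr_sumr.
  by apply: le_trans (ler_norm_sum _ _ _) _; apply: ler_sum => i _; exact: hu.
have GD' M N y : (0 < N)%N -> (N <= M)%N -> `|G M y - G N y| <= D / N%:R.
  by move=> N0 NM; apply: le_trans (GD M N y NM) _; rewrite ler_pM2l //; exact: tail_inv_sqr.
have Gcv y : cvgn (fun N => G N y).
  have h : cvgn (series (fun i => `|u i y|)).
    apply: nondecreasing_is_cvgn; first by apply: nondecreasing_series => n _ _.
    exists (D * 2) => _ [n _ <-]; rewrite /series /=.
    apply: (@le_trans _ _ (D * \sum_(0 <= i < n) (i.+1%:R ^+ 2)^-1)).
      by rewrite mulr_sumr; apply: ler_sum => i _; exact: hu.
    by rewrite ler_pM2l //; exact: sg_le2.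
  exact: (@normed_cvg R R^o (fun i => u i y) h).
pose g y := limn (fun N => G N y).
have Gg y : (fun N => G N y) @ \oo --> g y by exact: Gcv.
have gG N y : (0 < N)%N -> `|g y - G N y| <= D / N%:R.
  move=> N0; apply: (@cvg_le_tail (fun M => `|G M y - G N y|) _ _ N) => [|M NM]; last exact: GD'.
  by apply: cvg_norm; apply: cvgB; [exact: Gg|exact: cvg_cst].
have BG N : BM 0 pi (G N) by apply: BM_sum => i; apply: BMZ; exact (phi_BM ps (lam0 i)).
have Bg : BM 0 pi g.
  split; first by apply: limn_Mf => N; exact: (BG N).1.
  have [_ [M hM]] := BG 1%N; exists (D / 1 + M) => y yp.
  have -> : g y = (g y - G 1%N y) + G 1%N y by rewrite subrK.
  by apply: le_trans (ler_normD _ _) _; rewrite lerD // ?hM // (gG 1%N).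
have [e e0 [_ _ hfe]] := hf.
(* The function [f] vanishes beyond [x - e], hence already before [x'] when [x'] is positive; this
   leaves an interval to the left of [x] for the argument. *)
pose x' := Num.max 0 (x - e / 2).
have x'0 : 0 <= x' by rewrite le_max lexx.
have x'x : x' < x by rewrite gt_max x0 /=; lra.
have x'e : x - e / 2 <= x' by rewrite le_max lexx orbT.
have x'p : x' < pi by exact: lt_le_trans xp.
(* For [h] supported beyond [x'] the pairing of [g] with [h] is [ip f (kappa h)]. It is zero:
   [kappa h] vanishes up to [x'], and [f] vanishes after it. *)
have gz : {ae mu, forall y, x' < y < pi -> g y = 0}.
  apply: (@ip_zero_of_test R _ a al al0 z2 _ _ _ x'0 (lexx _) x'p (BM_L2 Bg)) => h h1 hd hh.
  have h2 : L2p h by exact (Dom_L2 (test_Dom a al0 hq x'0 (lexx _) (ltW x'p) hh)).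
  have [e' e'0 [_ hhe _]] := hh.
  have lim1 := kappa_dual al0 a0 api pial hq hphi hA phiA A0 lam0_ge0 lam0S eigP0 f2 h2.
  have z0 : ip f (ka h) = 0.
    rewrite /wip (@I_ext _ _ _ _ (fun=> 0)); first by rewrite I_cst // mul0r.
    move=> s sp; have [sx|sx] := leP s x'.
      rewrite (kappa_supp al0 A0 sp) ?mulr0 // => t /andP[_ ts].
      by have [] := hhe t; first by lra.
    have [|-> _] := hfe s; first by move: e0 sx x'e; move: (x') => X; lra.
    by rewrite mulr0 mul0r.
  rewrite z0 in lim1.
  have eG N : ip (G N) h = \sum_(0 <= i < N) cf f i * ip h (ef0 i) / alpha0 i.
    rewrite /G ip_suml //; last by move=> i; apply: L2Z; exact: e20.
    apply: eq_bigr => i _; rewrite /u ipZl //; last exact: e20.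
    have -> : ip (fun s => phi0 a al s (lam0 i)) h = ip h (ef0 i) by rewrite ipC.
    by rewrite mulrAC.
  have lim2 : (fun N => ip (G N) h) @ \oo --> ip g h.
    apply: (@sqr_cvg_inv _ _ _ (ip h h * ((1 + al ^+ 2) * pi * D ^+ 2))) => N N0.
    rewrite -sqrrN opprB -ipBl //; try exact: BM_L2.
    rewrite ipC; apply: (@le_trans _ _ (ip h h * ((1 + al ^+ 2) * pi * (D / N%:R) ^+ 2))).
      apply: ip_sup_bound => //; [by apply: L2B; exact: BM_L2|exact: sqr_ge0|].
      move=> s _; have h5 := gG N s N0; rewrite -[leLHS]real_normK ?num_real //.
      by rewrite ler_pXn2r ?nnegrE // (le_trans _ h5).
    have nN : (1 : R) <= N%:R by rewrite ler1n.
    have np : (0 : R) < N%:R by rewrite ltr0n.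
    rewrite -!mulrA ler_wpM2l ?ip_ge0 // ler_wpM2l ?addr_ge0 ?sqr_ge0 // ler_wpM2l //.
    have DN : 0 <= D / N%:R by rewrite divr_ge0 // ltW.
    by rewrite expr2; apply: ler_wpM2r => //; rewrite ler_pdivrMr // ler_peMr // ltW.
  rewrite (_ : (fun N => ip (G N) h) = (fun N => \sum_(0 <= i < N) cf f i * ip h (ef0 i) / alpha0 i)) in lim2.
    exact: (cvg_unique (@Rhausdorff R) lim2 lim1).
  by apply/funext => N; exact: eG.
(* Vanishing almost everywhere is upgraded to the point [x] itself: one partial sum is uniformly
   close to [g] and Lipschitz, and [g] is zero at some point arbitrarily near [x]. *)
suff gx0 : g x = 0 by have := Gg x; rewrite gx0.
apply: contrapT => /eqP gx.
have eta0 : 0 < `|g x| by rewrite normr_gt0.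
have [N0 hN0] := nat_gt (D / (`|g x| / 4)).
pose N := maxn N0 1.
have N1 : (0 < N)%N by rewrite leq_max orbT.
have DN : D / N%:R <= `|g x| / 4.
  rewrite ler_pdivrMr ?ltr0n // mulrC -ler_pdivrMr ?divr_gt0 // ltW // hN0 // leq_maxl //.
have [L L0 hL] : exists2 L, 0 < L & forall z y, 0 <= y -> y <= z -> z <= pi -> `|G N z - G N y| <= L * (z - y).
  pose G' y := \sum_(0 <= i < N) cf f i / alpha0 i * phi0' a al y (lam0 i).
  apply: (@AC_Lipschitz 0 pi (G N) G').
    by apply: AC_sum => i; apply: AC_Z; have [] := phi0_AC al0 a0 api (lam0 i).
  by apply: BM_sum => i; apply: BMZ; have [_ h2] := phi0_AC al0 a0 api (lam0 i); exact: AC_BM h2.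
pose y0 := Num.max x' (x - `|g x| / (4 * L)).
have L4 : 0 < 4 * L by rewrite mulr_gt0.
have y0x : y0 < x by rewrite gt_max x'x /= ltrBlDr ltrDl divr_gt0.
have [y /andP[yl yx] hy] := ae_exists y0x gz.
have yx' : x' < y by apply: le_lt_trans yl; rewrite le_max lexx.
have gy : g y = 0 by apply: hy; rewrite yx' (lt_le_trans yx).
have k1 := hL x y (le_trans x'0 (ltW yx')) (ltW yx) xp.
have k2 : L * (x - y) <= `|g x| / 4.
  have : x - `|g x| / (4 * L) <= y by apply: ltW; apply: le_lt_trans yl; rewrite le_max lexx orbT.
  rewrite lerBlDr -lerBlDl => h; have := ler_wpM2l (ltW L0) h.
  by rewrite (_ : L * (`|g x| / (4 * L)) = `|g x| / 4) //; field; rewrite gt_eqF.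
have k3 := gG N x N1; have k4 := gG N y N1; rewrite gy sub0r normrN in k4.
have : `|g x| <= `|g x - G N x| + (`|G N x - G N y| + `|G N y|).
  rewrite -{1}(subrK (G N x) (g x)); apply: le_trans (ler_normD _ _) _; rewrite lerD2l.
  by rewrite -{1}(subrK (G N y) (G N x)); exact: ler_normD.
by move: k1 k2 k3 k4 DN eta0; move: (`|g x|) (`|g x - _|) `|G N x - _| `|G N y| (L * _) (D / _) => *; lra.
Qed.

End DualSeries.

(** * The defect of the equation and its vanishing *)

Section MainEquation.
Context {R : realType}.
Variables (q : R -> R) (a al : R).
Hypotheses (al0 : 0 < al) (a0 : 0 < a) (api : a < pi) (pial : pi * al < a * (1 + al)) (hq : L2 0 pi q).
Variables (phi phi1 A : R -> R -> R) (lam lam0 : nat -> R).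
Hypothesis hphi : forall l, is_sol q a al (l ^+ 2) (fun x => phi x l) (fun x => phi1 x l) /\
  phi 0 l = 1 /\ phi1 0 l = 0.
Notation I := (@lintegral_ab R).
Notation mu := (@lebesgue_measure R).
Notation w := (rho a al).
Notation ip := (wip a al).
Notation L2p := (@L2 R 0 pi).
Notation mp := (mu_plus a al).
Notation mm := (mu_minus a al).
Hypothesis hA : forall x, 0 <= x <= pi -> measurable_fun `[0, mp x] (A x) /\
  mu.-integrable `[0, mp x] (fun t => (w t * A x t ^+ 2)%:E).
Hypothesis phiA : forall x l, 0 <= x <= pi ->
  phi x l = phi0 a al x l + I 0 (mp x) (fun t => A x t * cos (l * t)).
Hypothesis A0 : forall x t, 0 <= x <= pi -> mp x < t -> A x t = 0.
Hypothesis lam_ge0 : forall n, 0 <= lam n.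
Hypothesis lamS : forall n, lam n < lam n.+1.
Hypothesis eigP : forall nu, is_eigenvalue q a al nu <-> exists n, nu = lam n ^+ 2.
Hypothesis lam0_ge0 : forall n, 0 <= lam0 n.
Hypothesis lam0S : forall n, lam0 n < lam0 n.+1.
Hypothesis eigP0 : forall nu, is_eigenvalue (fun _ => 0) a al nu <-> exists n, nu = lam0 n ^+ 2.
Notation ef := (eigenfun phi lam).
Notation ef0 := (eigenfun (phi0 a al) lam0).
Notation alpha := (norming a al phi lam).
Notation alpha0 := (norming a al (phi0 a al) lam0).
Notation K := (kernel a al A).
Notation ka := (kappa a al A).
Notation ps := (phi0_spec al0 a0 api).
Notation z2 := (@L2_zero R).
Notation cf f i := (ip f (fun s => phi s (lam0 i) - phi0 a al s (lam0 i))).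
Let b n := (alpha n)^-1.
Let b' n := (alpha0 n)^-1.
Notation TT := (F0_sum a al lam lam0 b b').
Notation FF := (F0 a al lam lam0 b b').
Notation dn := (dnorm a al lam lam0 b b').
Let pi0 : 0 <= pi :> R := pi_ge0 R.

Let ap n : 0 < alpha n.
Proof. exact (alpha_gt0 al0 hq hphi eigP n). Qed.
Let ap0 n : 0 < alpha0 n.
Proof. exact (alpha_gt0 al0 z2 ps eigP0 n). Qed.
Let K2 s : 0 <= s <= pi -> L2p (K s).
Proof. by move=> sp; exact (kernel_L2 al0 a0 api pial hA A0 sp). Qed.

Lemma spectral_constants : exists C d, [/\ 0 < C, 0 < d,
  forall m n, (m <= n)%N -> d * (n - m)%:R <= lam0 n - lam0 m,
  forall n, `|lam n - lam0 n| <= C / n.+1%:R &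
  (forall n, `|b n - b' n| <= C / n.+1%:R) /\ (forall n, `|b n| <= C)].
Proof.
have [C1 C10 h1] := lam_close al0 a0 api hq hphi lam_ge0 lamS eigP lam0_ge0 lam0S eigP0.
have [C2 C20 h2] := norming_close al0 a0 api hq hphi lam_ge0 lamS eigP lam0_ge0 lam0S eigP0.
have [c c0 hc] := norming_ge al0 a0 api hq hphi lam_ge0 lamS eigP.
have [d d0 hd] := lam0_gap al0 a0 api lam0S eigP0.
have ci : 0 < c^-1 by rewrite invr_gt0.
have nR n : (0 : R) < n.+1%:R by rewrite ltr0n.
exists (C1 + C2 + c^-1), d; split => //; [by rewrite !addr_gt0| |split].
- move=> n; apply: le_trans (h1 n) _; rewrite ler_pM2r ?invr_gt0 //; lra.
- move=> n; apply: le_trans (h2 n) _; rewrite ler_pM2r ?invr_gt0 //; lra.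
move=> n; rewrite gtr0_norm ?invr_gt0 //; apply: (@le_trans _ _ c^-1).
  by rewrite lef_pV2 ?posrE.
by rewrite lerDr addr_ge0 ?ltW.
Qed.

Variable x : R.
Hypotheses (x0 : 0 < x) (xp : x <= pi).
Let xpi : 0 <= x <= pi. Proof. by rewrite ltW. Qed.
Let mpx0 : 0 <= mp x. Proof. exact (mp_ge0 al0 a0 (ltW x0)). Qed.
Let A2 : L2 0 (mp x) (A x). Proof. exact (A_L2 al0 a0 hA A0 xpi (lexx _)). Qed.
Let mpxB : `|mp x| <= muB a al. Proof. by have [] := mu_bound al0 a0 xpi. Qed.
Let mmxB : `|mm x| <= muB a al. Proof. by have [] := mu_bound al0 a0 xpi. Qed.
Let mpxB' : mp x <= muB a al. Proof. exact: le_trans (ler_norm _) mpxB. Qed.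
Let Px := 2^-1 * (1 + (srho a al x)^-1).
Let Qx := 2^-1 * (1 - (srho a al x)^-1).

Let block m n t := \sum_(m <= i < n)
  (phi x (lam i) * phi0 a al t (lam i) * b i - phi x (lam0 i) * phi0 a al t (lam0 i) * b' i).

(** The representation of [phi] at [x], inserted into a finite sum, produces the [F]-terms and the
    integral term together. *)
Lemma block_split m n t : block m n t = Px * TT m n (mp x) t + Qx * TT m n (mm x) t + I 0 (mp x) (fun xi => A x xi * TT m n xi t).
Proof.
rewrite (I_F0_sumE a al lam lam0 b b' A2) /F0_sum !mulr_sumr -!big_split /=; apply: eq_bigr => i _.
rewrite !(phiA _ xpi) /(phi0 a al x) -/Px -/Qx.
by ring.
Qed.

Lemma block_BM m n : BM 0 pi (block m n).
Proof.
apply: BM_sum => i; apply: BMB.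
  by apply: BM_ext (BMZ (phi x (lam i) * b i) (phi0_BM al0 a0 api (lam i) pi0 (lexx _))) => t _; rewrite mulrAC.
by apply: BM_ext (BMZ (phi x (lam0 i) * b' i) (phi0_BM al0 a0 api (lam0 i) pi0 (lexx _))) => t _; rewrite mulrAC.
Qed.

Lemma block_cat N n t : (N <= n)%N -> block 0 n t - block 0 N t = block N n t.
Proof. by move=> Nn; rewrite /block (@big_cat_nat _ _ _ N 0 n) //= addrAC subrr add0r. Qed.

Lemma block_bound : exists2 C, 0 < C & forall N n, (0 < N)%N -> I 0 pi (fun t => block N n t ^+ 2) <= C / N%:R.
Proof.
have [C [d [C0 d0 hd hl [hb hB]]]] := spectral_constants.
have [D D0 hD] := dnorm_bound al0 a0 d0 C0 lam0_ge0 hd hl hb hB.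
pose s2 := 4 * (1 + srhoB al) ^+ 2 * srhoB al.
pose iA := I 0 (mp x) (fun xi => A x xi ^+ 2) * (4 * (1 + srhoB al) ^+ 2).
have iA0 : 0 <= iA.
  by apply: mulr_ge0; [apply: I_ge0 => t _; exact: sqr_ge0|apply: mulr_ge0 => //; exact: sqr_ge0].
have s20 : 0 <= s2.
  by rewrite mulr_ge0 //; [apply: mulr_ge0 => //; exact: sqr_ge0|rewrite /srhoB addr_ge0 // invr_ge0 ltW].
pose E := 3 * Px ^+ 2 * s2 + 3 * Qx ^+ 2 * s2 + 3 * (pi * iA).
have E0 : 0 <= E.
  have hp : 0 <= Px ^+ 2 by exact: sqr_ge0. have hr : 0 <= Qx ^+ 2 by exact: sqr_ge0.
  by rewrite /E; apply: addr_ge0; [apply: addr_ge0; apply: mulr_ge0 => //; exact: mulr_ge0|apply: mulr_ge0 => //; exact: mulr_ge0].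
exists (E * D + 1) => [|N n N0]; first by rewrite ltr_pwDr // mulr_ge0 // ltW.
have nN : (0 : R) < N%:R by rewrite ltr0n.
apply: (@le_trans _ _ (E * dn N n)); last first.
  apply: le_trans (ler_wpM2l E0 (hD N n N0)) _.
  by rewrite mulrA ler_pM2r ?invr_gt0 // lerDl.
have bp := F0_sum_BM_t al0 a0 api lam lam0 b b' N n (mp x).
have bm := F0_sum_BM_t al0 a0 api lam lam0 b b' N n (mm x).
have d1 := F0_sum_bound_t al0 a0 api lam lam0 b b' N n mpxB.
have d2 := F0_sum_bound_t al0 a0 api lam lam0 b b' N n mmxB.
rewrite mulrA -/s2 in d1; rewrite mulrA -/s2 in d2.
have L1' : L1 0 pi (fun t => TT N n (mp x) t ^+ 2) by exact/BM_L1/BMX.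
have L2' : L1 0 pi (fun t => TT N n (mm x) t ^+ 2) by exact/BM_L1/BMX.
apply: (@le_trans _ _ (I 0 pi (fun t => 3 * Px ^+ 2 * TT N n (mp x) t ^+ 2 + 3 * Qx ^+ 2 * TT N n (mm x) t ^+ 2 + 3 * (iA * dn N n)))).
  apply: I_le => [||t tp]; first by apply/BM_L1/BMX/block_BM.
    by apply: L1D; [apply: L1D; exact: L1Z|exact/BM_L1/BM_cst].
  have h3 := I_F0_sum_bound al0 a0 lam lam0 b b' mpx0 mpxB' A2 N n tp; rewrite mulrA -/iA in h3.
  rewrite block_split; move: h3; move: (TT _ _ _ _) (TT _ _ (mm x) _) (I 0 (mp x) _) (iA * _) => y1 y2 y3 y4 h3.
  have := sqr_ge0 (Px * y1 - Qx * y2); have := sqr_ge0 (Px * y1 - y3); have := sqr_ge0 (Qx * y2 - y3).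
  have -> : (Px * y1 + Qx * y2 + y3) ^+ 2 = 3 * Px ^+ 2 * y1 ^+ 2 + 3 * Qx ^+ 2 * y2 ^+ 2 + 3 * y3 ^+ 2
     - (Px * y1 - Qx * y2) ^+ 2 - (Px * y1 - y3) ^+ 2 - (Qx * y2 - y3) ^+ 2 by ring.
  move: h3; move: (_ - _) => *; lra.
rewrite ID; [|by apply: L1D; exact: L1Z|exact/BM_L1/BM_cst].
rewrite ID; [|exact: L1Z|exact: L1Z].
rewrite I_cst // subr0 (IZ _ L1') (IZ _ L2').
have h1 : 3 * Px ^+ 2 * I 0 pi (fun t => TT N n (mp x) t ^+ 2) <= 3 * Px ^+ 2 * (s2 * dn N n).
  by apply: ler_wpM2l => //; apply: mulr_ge0 => //; exact: sqr_ge0.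
have h2 : 3 * Qx ^+ 2 * I 0 pi (fun t => TT N n (mm x) t ^+ 2) <= 3 * Qx ^+ 2 * (s2 * dn N n).
  by apply: ler_wpM2l => //; apply: mulr_ge0 => //; exact: sqr_ge0.
have -> : E * dn N n = 3 * Px ^+ 2 * (s2 * dn N n) + 3 * Qx ^+ 2 * (s2 * dn N n) + 3 * (iA * dn N n) * pi.
  by rewrite /E; ring.
by rewrite lerD2r lerD.
Qed.

Let defect_sum N t := K x t + block 0 N t.
Definition defect t := limn (fun N => defect_sum N t).
Notation Rx := defect.

Lemma defect_sum_cvg : {ae mu, forall t, 0 <= t <= pi -> (fun N => defect_sum N t) @ \oo -->
  K x t + (Px * FF (mp x) t + Qx * FF (mm x) t) + I 0 (mp x) (fun xi => A x xi * FF xi t)}.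
Proof.
have [C [d [C0 d0 hd hl [hb hB]]]] := spectral_constants.
have h1 := F0_cvg_t al0 a0 d0 C0 lam0_ge0 hd hl hb hB mpxB.
have h2 := F0_cvg_t al0 a0 d0 C0 lam0_ge0 hd hl hb hB mmxB.
apply: ae_mp (ae_and h1 h2) => t [g1 g2] tp.
rewrite (_ : (fun N => defect_sum N t) = fun N => K x t + (Px * TT 0 N (mp x) t + Qx * TT 0 N (mm x) t) +
   I 0 (mp x) (fun xi => A x xi * TT 0 N xi t)); last first.
  by apply/funext => N; rewrite /defect_sum block_split addrA.
apply: cvgD; last by exact (I_F0_cvg al0 a0 d0 C0 lam0_ge0 hd hl hb hB mpx0 mpxB' A2 tp).
apply: cvgD; first exact: cvg_cst.
by apply: cvgD; apply: cvgM; try exact: cvg_cst; [exact: g1|exact: g2].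
Qed.

Lemma defect_sum_L2 N : L2p (defect_sum N).
Proof. by apply: L2D; [exact: K2|exact/BM_L2/block_BM]. Qed.

(** The squared rate [1 / N] lets [ip f] and the Volterra operator pass to the limit in the test
    identity. *)
Lemma defect_tail : exists2 C, 0 < C & forall N, (0 < N)%N ->
  L2p (fun t => Rx t - defect_sum N t) /\ ip (fun t => Rx t - defect_sum N t) (fun t => Rx t - defect_sum N t) <= C / N%:R.
Proof.
have [C C0 hC] := block_bound.
have al1 : 0 < 1 + al ^+ 2 by rewrite ltr_pwDl // sqr_ge0.
exists ((1 + al ^+ 2) * C) => [|N N0]; first by rewrite mulr_gt0.
suff [g2 gC] : L2p (fun t => Rx t - defect_sum N t) /\ I 0 pi (fun t => (Rx t - defect_sum N t) ^+ 2) <= C / N%:R.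
  split => //; apply: le_trans (ip_le_I a al0 g2) _; by rewrite -mulrA ler_wpM2l // ltW.
apply: (@fatou_L2 _ _ _ (fun n t => defect_sum n t - defect_sum N t) _ _ N) => [n|||n Nn].
- by apply: L2B; exact: defect_sum_L2.
- by apply: MfB; [apply: limn_Mf => n|]; exact: (defect_sum_L2 _).1.
- apply: ae_mp defect_sum_cvg => t h tp; apply: cvgB; last exact: cvg_cst.
  by rewrite /defect (cvg_lim (@Rhausdorff R) (h tp)); exact: h.
rewrite (@I_ext _ _ _ _ (fun t => block N n t ^+ 2)); first exact: hC.
by move=> t _; rewrite -block_cat // /defect_sum; congr (_ ^+ 2); ring.
Qed.

Lemma L2_defect : L2p Rx.
Proof.
have [C C0 hC] := defect_tail; have [h _] := hC 1%N isT.
by apply: L2_ext (L2D h (defect_sum_L2 1%N)) => t _; rewrite subrK.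
Qed.

Notation kBM h2 := (kappa_BM al0 a0 api pial hq hphi hA phiA A0 lam0_ge0 lam0S eigP0 h2).

Lemma defect_sum_kappa N s : 0 <= s <= pi -> defect_sum N s + ka (defect_sum N) s = K x s + ka (K x) s +
  \sum_(0 <= i < N) (phi x (lam i) * phi s (lam i) * b i - phi x (lam0 i) * phi s (lam0 i) * b' i).
Proof.
move=> sp; have p2 l : L2p (fun t => phi0 a al t l) by exact/BM_L2/(phi0_BM al0 a0 api l pi0 (lexx _)).
have -> : ka (defect_sum N) s = ka (K x) s + ka (block 0 N) s.
  by rewrite /kappa ipDr //; [exact: K2|exact/BM_L2/block_BM|exact: K2].
have -> : ka (block 0 N) s = \sum_(0 <= i < N) (phi x (lam i) * (phi s (lam i) - phi0 a al s (lam i)) * b i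
    - phi x (lam0 i) * (phi s (lam0 i) - phi0 a al s (lam0 i)) * b' i).
  pose F i t := phi x (lam i) * b i * phi0 a al t (lam i) - phi x (lam0 i) * b' i * phi0 a al t (lam0 i).
  rewrite /kappa ipC (@ip_ext _ a al _ _ (fun t => \sum_(0 <= i < N) F i t) (K s)) //; last first.
    by move=> t _; apply: eq_bigr => i _; rewrite /F mulrAC; congr (_ - _); rewrite mulrAC.
  rewrite ip_suml //; [|by move=> i; apply: L2B; exact: L2Z|exact: K2].
  apply: eq_bigr => i _; rewrite /F ipBl ?ipZl //; try exact: K2; try exact: L2Z.
  by rewrite !(ipC _ _ _ (K s)) !(kernel_coef al0 a0 api pial hA phiA A0) //; ring.
rewrite /defect_sum addrACA; congr (_ + _); rewrite -big_split /=; apply: eq_bigr => i _; ring.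
Qed.

Lemma defect_test f f1 fd : test_fun 0 x f f1 fd -> ip (fun s => Rx s + ka Rx s) f = 0.
Proof.
move=> hf.
have D1 := test_Dom a al0 hq (lexx 0) xp (ltW x0) hf.
have D2 := test_Dom a al0 z2 (lexx 0) xp (ltW x0) hf.
have f2 := Dom_L2 D1; have fx : f x = 0.
  by case: hf => e e0 [_ _ h]; have [] := h x; first by lra.
have [CK CK0 hCK] := kappa_sqr al0 a0 api pial hq hphi hA phiA A0 lam0_ge0 lam0S eigP0.
have [CR CR0 hCR] := defect_tail.
have al1 : 0 <= 1 + al ^+ 2 by rewrite addr_ge0 ?sqr_ge0.
have bL h : L2p h -> L2p (ka h) by move=> h2; exact: BM_L2 (kBM h2).
have lim1 : (fun N => ip f (defect_sum N)) @ \oo --> ip f Rx.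
  apply: (@sqr_cvg_inv _ _ _ (ip f f * CR)) => N N0; have [g2 gC] := hCR N N0.
  rewrite -sqrrN opprB -ipBr //; [|exact: L2_defect|exact: defect_sum_L2].
  by apply: le_trans (ip_CS a al0 f2 g2) _; rewrite -mulrA ler_wpM2l ?ip_ge0.
have lim2 : (fun N => ip f (ka (defect_sum N))) @ \oo --> ip f (ka Rx).
  apply: (@sqr_cvg_inv _ _ _ (ip f f * ((1 + al ^+ 2) * pi * (CK * CR)))) => N N0; have [g2 gC] := hCR N N0.
  have r2 := L2_defect; have n2 := defect_sum_L2 N.
  rewrite -sqrrN opprB -ipBr //; [|exact: bL|exact: bL].
  apply: (@le_trans _ _ (ip f f * ((1 + al ^+ 2) * pi * (CK * (CR / N%:R))))).
    apply: ip_sup_bound => //; [by apply: L2B; exact: bL|by rewrite mulr_ge0 ?divr_ge0 // ltW|].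
    move=> s sp; rewrite -(kappaB al0 a0 api pial hA A0 r2 n2 sp).
    by apply: le_trans (hCK _ _ g2 sp) _; rewrite ler_pM2l.
  by rewrite !mulrA.
(* In the unperturbed sum both [phi(x, lam0 i)] and [ip f (phi(., lam0 i))] split into an
   unperturbed part and a correction. The four products are [u1], [u2], [u4] and [u5]; the perturbed
   sum is [u3]. *)
pose u1 N := \sum_(0 <= i < N) ip f (ef0 i) * ip (K x) (ef0 i) / alpha0 i.
pose u2 N := \sum_(0 <= i < N) cf f i * ip (K x) (ef0 i) / alpha0 i.
pose u3 N := \sum_(0 <= i < N) ip f (ef i) / alpha i * phi x (lam i).
pose u4 N := \sum_(0 <= i < N) ip f (ef0 i) / alpha0 i * phi0 a al x (lam0 i).
pose u5 N := \sum_(0 <= i < N) cf f i / alpha0 i * phi0 a al x (lam0 i).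
have kx2 := K2 xpi.
have l1 : u1 @ \oo --> ip f (K x) by exact (Parseval_cvg al0 z2 ps lam0_ge0 lam0S eigP0 f2 kx2).
have l2 : u2 @ \oo --> ip f (ka (K x)).
  exact (kappa_dual al0 a0 api pial hq hphi hA phiA A0 lam0_ge0 lam0S eigP0 f2 kx2).
have l3 : u3 @ \oo --> (0 : R) by rewrite -fx; exact (expansion_cvg al0 hq hphi lam_ge0 lamS eigP D1 xpi).
have l4 : u4 @ \oo --> (0 : R) by rewrite -fx; exact (expansion_cvg al0 z2 ps lam0_ge0 lam0S eigP0 D2 xpi).
have l5 : u5 @ \oo --> (0 : R).
  exact (dual_series_cvg0 al0 a0 api pial hq hphi hA phiA A0 lam0_ge0 lam0S eigP0 x0 xp hf).
have p2 l : L2p (fun t => phi t l) by exact (phi_L2 hphi l).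
have q2 l : L2p (fun t => phi0 a al t l) by exact/BM_L2/(phi0_BM al0 a0 api l pi0 (lexx _)).
have eqN N : ip f (defect_sum N) + ip f (ka (defect_sum N)) = ip f (K x) + ip f (ka (K x)) + u3 N - (u1 N + u2 N + (u4 N + u5 N)).
  have n2 := defect_sum_L2 N; rewrite -ipDr //; last exact: bL.
  pose F i t := phi x (lam i) * b i * phi t (lam i) - phi x (lam0 i) * b' i * phi t (lam0 i).
  have F2 i : L2p (F i) by apply: L2B; exact: L2Z.
  have -> : ip f (fun t => defect_sum N t + ka (defect_sum N) t) = ip f (fun t => K x t + ka (K x) t + \sum_(0 <= i < N) F i t).
    rewrite ![ip f _]ipC; apply: ip_ext => // t tp; rewrite defect_sum_kappa //; congr (_ + _).
    by apply: eq_bigr => i _; rewrite /F mulrAC; congr (_ - _); rewrite mulrAC.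
  rewrite ipDr //; [|by apply: L2D => //; exact: bL|exact: L2_sum].
  rewrite ipDr //; last exact: bL.
  rewrite -[RHS]addrA; congr (_ + _).
  rewrite ipC ip_suml // -!big_split -sumrB /=; apply: eq_bigr => i _.
  rewrite /F ipBl ?ipZl //; try exact: L2Z.
  rewrite ipBr // !(kernel_coef al0 a0 api pial hA phiA A0) // -/(b i) -/(b' i).
  rewrite !(ipC _ _ (fun t => phi t _) f) /eigenfun.
  by ring.
have lim3 : (fun N => ip f (defect_sum N) + ip f (ka (defect_sum N))) @ \oo --> (0 : R).
  rewrite (_ : (fun N => _) = fun N => ip f (K x) + ip f (ka (K x)) + u3 N - (u1 N + u2 N + (u4 N + u5 N))); last first.
    by apply/funext => N; exact: eqN.
  rewrite [X in _ --> X](_ : _ = ip f (K x) + ip f (ka (K x)) + 0 - (ip f (K x) + ip f (ka (K x)) + (0 + 0))); last by ring.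
  apply: cvgB; first by apply: cvgD => //; exact: cvg_cst.
  by apply: cvgD; apply: cvgD.
have lim4 : (fun N => ip f (defect_sum N) + ip f (ka (defect_sum N))) @ \oo --> ip f Rx + ip f (ka Rx) by exact (cvgD lim1 lim2).
rewrite ipC ipDr //; [|exact: L2_defect|exact/bL/L2_defect].
exact: (cvg_unique (@Rhausdorff R) lim4 lim3).
Qed.

(** The uniform kernel bound combined with triangularity: only the values of [h] on [[0, s]]
    contribute, as Gronwall's inequality requires. *)
Lemma kappa_local : exists2 C, 0 < C & forall h s, L2p h -> 0 <= s <= pi ->
  ka h s ^+ 2 <= C * I 0 s (fun t => h t ^+ 2).
Proof.
have [C C0 hC] := kernel_bound al0 a0 api pial hq hphi hA phiA A0 lam0_ge0 lam0S eigP0.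
have al1 : 0 < 1 + al ^+ 2 by rewrite ltr_pwDl // sqr_ge0.
exists (C * (1 + al ^+ 2)) => [|h s h2 sp]; first by rewrite mulr_gt0.
case/andP: (sp) => s0 spi; have k2 := K2 sp.
have Lwk := ip_L1 a al0 k2 h2; have Lkk := ip_L1 a al0 k2 k2.
have k2s : L2 0 s (K s) by exact: L2_sub k2. have h2s : L2 0 s h by exact: L2_sub h2.
have -> : ka h s = I 0 s (fun t => w t * K s t * h t).
  rewrite /kappa /wip (I_cut s0 spi Lwk) // => t /andP[st tp].
  by rewrite (kernel_supp al0 A0 sp st tp) mulr0 mul0r.
have hw : BM 0 s w by exact: BM_rho.
apply: le_trans (CauchySchwarz hw (fun t _ => ltW (rho_gt0 a al0 t)) k2s h2s) _.
have i0 : 0 <= I 0 s (fun t => h t ^+ 2) by apply: I_ge0 => t _; exact: sqr_ge0.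
rewrite -mulrA; apply: ler_pM.
- by apply: I_ge0 => t _; rewrite mulr_ge0 ?sqr_ge0 // ltW // rho_gt0.
- by apply: I_ge0 => t _; rewrite mulr_ge0 ?sqr_ge0 // ltW // rho_gt0.
- apply: le_trans (hC s sp); rewrite /wip (@I_ext _ _ _ _ (fun t => w t * K s t * K s t)); last first.
    by move=> t _; rewrite -mulrA -expr2.
  by apply: I_mono => // t _; rewrite -mulrA -expr2 mulr_ge0 ?sqr_ge0 // ltW // rho_gt0.
rewrite -IZ; last exact: h2s.2.
apply: I_le => [||t _]; [apply: BM_L1M => //; exact: h2s.2|apply: L1Z; exact: h2s.2|].
by rewrite ler_wpM2r ?sqr_ge0 // rho_le.
Qed.

Lemma defect_ae0 : {ae mu, forall s, 0 < s < x -> Rx s = 0}.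
Proof.
have r2 := L2_defect; have kb := kBM r2.
have V2 : L2p (fun s => Rx s + ka Rx s) by apply: L2D => //; exact: BM_L2.
have hV := @ip_zero_of_test R _ a al al0 z2 0 x _ (lexx 0) xp x0 V2 defect_test.
have hR : {ae mu, forall s, 0 < s < x -> Rx s = - ka Rx s}.
  by apply: ae_mp hV => s h sx; apply/eqP; rewrite -addr_eq0; apply/eqP; exact: h.
have [C C0 hC] := kappa_local.
(* Gronwall's inequality is applied to the image under [kappa], which is bounded at every point,
   because the defect itself is only square integrable. The two squares agree almost everywhere on
   [(0, x)]. *)
pose v s := ka Rx s ^+ 2.
have v_le s : 0 <= s <= x -> v s <= 0 + C * I 0 s v.
  move=> /andP[s0 sx]; rewrite add0r; apply: le_trans (hC _ _ r2 _) _; first by rewrite s0 (le_trans sx).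
  rewrite ler_pM2l // le_eqVlt; apply/orP; left; apply/eqP; apply: I_ae.
  - exact: MfX (L2_sub (lexx _) (le_trans sx xp) r2).1.
  - exact: MfX (BM_sub (lexx _) (le_trans sx xp) kb).1.
  by apply: ae_mp hR => t h /andP[t0 ts]; rewrite h ?t0 ?(lt_le_trans ts) // sqrrN.
have bv : BM 0 x v by apply: BMX; exact: BM_sub kb.
have v0 s : 0 <= s <= x -> v s <= 0.
  by move=> sx; have := Gronwall (ltW C0) (lexx 0) bv v_le sx; rewrite mulr0 mul0r.
apply: ae_mp hR => s h sx; rewrite (h sx).
have : v s <= 0 by apply: v0; case/andP: sx => ? ?; rewrite !ltW.
rewrite /v => h0; have : ka Rx s ^+ 2 == 0 by rewrite eq_le h0 sqr_ge0.
by rewrite expf_eq0 /= => /eqP ->; rewrite oppr0.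
Qed.

Lemma main_equation : {ae mu, forall t, 0 < t < x ->
  K x t + (Px * FF (mp x) t + Qx * FF (mm x) t) + I 0 (mp x) (fun xi => A x xi * FF xi t) = 0}.
Proof.
apply: ae_mp (ae_and defect_ae0 defect_sum_cvg) => t [h1 h2] tx; case/andP: (tx) => t0 tx'.
have tp : 0 <= t <= pi by rewrite (ltW t0) (le_trans (ltW tx')).
exact: etrans (esym (cvg_lim (@Rhausdorff R) (h2 tp))) (h1 tx).
Qed.

End MainEquation.

Theorem theorem1 (R : realType) (q : R -> R) (a al : R)
    (phi A : R -> R -> R) (lam lam0 : nat -> R) :
  measurable_fun `[0, pi] q ->
  (@lebesgue_measure R).-integrable `[0, pi] (fun x => (q x ^+ 2)%:E) ->
  0 < a < pi -> 0 < al -> pi * al < a * (1 + al) ->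
  (* phi(., l) solves the equation with l^2, phi(0,l) = 1, phi'(0,l) = 0 *)
  (exists phi1 : R -> R -> R, forall l : R,
     is_sol q a al (l ^+ 2) (fun x => phi x l) (fun x => phi1 x l) /\
     phi 0 l = 1 /\ phi1 0 l = 0) ->
  (* A(x,.) is the kernel of the transformation-operator representation *)
  (forall x : R, 0 <= x <= pi ->
     measurable_fun `[0, mu_plus a al x] (A x) /\
     (@lebesgue_measure R).-integrable `[0, mu_plus a al x]
        (fun t => (rho a al t * A x t ^+ 2)%:E)) ->
  (forall x l : R, 0 <= x <= pi ->
     phi x l = phi0 a al x l + lintegral_ab 0 (mu_plus a al x) (fun t => A x t * cos (l * t))) ->
  (* convention: A(x,t) = 0 for t > mu^+(x) *)
  (forall x t : R, 0 <= x <= pi -> mu_plus a al x < t -> A x t = 0) ->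
  (* eigenvalues lam_n^2, lam_n >= 0, increasing *)
  (forall n, 0 <= lam n) -> (forall n, lam n < lam n.+1) ->
  (forall mu : R, is_eigenvalue q a al mu <-> exists n, mu = lam n ^+ 2) ->
  (* eigenvalues of the unperturbed problem (q = 0) *)
  (forall n, 0 <= lam0 n) -> (forall n, lam0 n < lam0 n.+1) ->
  (forall mu : R, is_eigenvalue (fun _ => 0) a al mu <-> exists n, mu = lam0 n ^+ 2) ->
  let alpha (n : nat) : R := lintegral_ab 0 pi (fun x => rho a al x * phi x (lam n) ^+ 2) in
  let alpha0 (n : nat) : R := lintegral_ab 0 pi (fun x => rho a al x * phi0 a al x (lam0 n) ^+ 2) in
  let F0 (x t : R) : R := limn (fun N => \sum_(0 <= n < N)
      (phi0 a al t (lam n) * cos (lam n * x) / alpha n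
       - phi0 a al t (lam0 n) * cos (lam0 n * x) / alpha0 n)) in
  let F (x t : R) : R := 2^-1 * (1 + (srho a al x)^-1) * F0 (mu_plus a al x) t
             + 2^-1 * (1 - (srho a al x)^-1) * F0 (mu_minus a al x) t in
  forall x : R, 0 <= x <= pi ->
    \forall t \ae (@lebesgue_measure R), 0 < t < x ->
      2 / (1 + srho a al t) * A x (mu_plus a al t)
      + (1 - srho a al (2 * a - t)) / (1 + srho a al (2 * a - t)) * A x (2 * a - t)
      + F x t
      + lintegral_ab 0 (mu_plus a al x) (fun xi => A x xi * F0 xi t) = 0.
Proof.
move=> mq iq /andP[a0 api] al0 pial [phi1 hphi] hA phiA A0 lam_ge0 lamS eigP lam0_ge0 lam0S eigP0
  alpha alpha0 F0' F x /andP[x_ge0 xp].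
have hq : L2 0 pi q by split.
case: (ltgtP 0 x) x_ge0 => // [x0|<-] _; last first.
  by apply: aeW => t /andP[/lt_trans h /h]; rewrite ltxx.
(* The norming constants are written with a square in the statement and as inner products elsewhere;
   quotients become products with their inverses. *)
have F0E : F0' = F0 a al lam lam0 (fun n => (norming a al phi lam n)^-1) (fun n => (norming a al (phi0 a al) lam0 n)^-1).
  have normE (f : R -> R -> R) l n : lintegral_ab 0 pi (fun s => rho a al s * f s (l n) ^+ 2) = norming a al f l n.
    by apply: I_ext => s _; rewrite expr2 mulrA.
  apply/funext => y; apply/funext => t; rewrite /F0' /F0 /F0_sum; congr (limn _); apply/funext => N.
  by apply: eq_bigr => n _; rewrite -(normE phi) -(normE (phi0 a al)).
have := main_equation al0 a0 api pial hq hphi hA phiA A0 lam_ge0 lamS eigP lam0_ge0 lam0S eigP0 x0 xp.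
by apply: ae_mp => t h tx; rewrite /F F0E; exact: h.
Qed.
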